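(* Let $$P=\frac12\operatorname{Tr}(Q\nabla_x^2)+\langle Bx,\nabla_x\rangle,\quad x\in\mathbb{R}^n,$$ be a hypoelliptic Ornstein-Uhlenbeck operator which admits the invariant measure $d\mu(x)=\rho(x)dx$. Then the global solution $v(t)=e^{tP}v_0$ to the Cauchy problem $\partial_tv=Pv$, $v|_{t=0}=v_0\in L^2_\mu$, satisfies: there exists $C>0$ such that for all $x_0\in\mathbb{R}^n$, $\xi_0\in\mathbb{R}^n$, $v_0\in L^2_\mu$, $$\forall\,0<t\le1,\quad\|\langle\xi_0,D_x\rangle e^{tP}v_0\|_{L^2_\mu}\le C|\xi_0|\,t^{-(2k_{\xi_0}+1)/2}\|v_0\|_{L^2_\mu},$$ $$\forall\,0<t\le1,\quad\|\langle x_0,x\rangle e^{tP}v_0\|_{L^2_\mu}\le C|x_0|\,t^{-(2\tilde k_{x_0}+1)/2}\|v_0\|_{L^2_\mu},$$ $$\forall\,t\ge1,\quad\|\langle\xi_0,D_x\rangle e^{tP}v_0\|_{L^2_\mu}\le C|\xi_0|\,\|v_0\|_{L^2_\mu},$$ $$\forall\,t\ge1,\quad\|\langle x_0,x\rangle e^{tP}v_0\|_{L^2_\mu}\le C|x_0|\,\|v_0\|_{L^2_\mu},$$ where $0\le k_{\xi_0}\le k_0$ is the frequency index of $\xi_0$ with respect to $P$ and $0\le\tilde k_{x_0}\le k_0$ is the space index of $x_0$ with respect to $P$.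
   Context: $n\ge1$; $Q=(q_{i,j})$ and $B=(b_{i,j})$ are real $n\times n$ matrices, $Q$ symmetric positive semidefinite, and $P=\frac12\sum_{i,j}q_{i,j}\partial^2_{x_i,x_j}+\sum_{i,j}b_{i,j}x_j\partial_{x_i}$. Hypoellipticity of $P$ is equivalent to the Kalman rank condition $\operatorname{Rank}[Q^{1/2},BQ^{1/2},\dots,B^{n-1}Q^{1/2}]=n$ (columns written consecutively; $Q^{1/2}$ is the symmetric positive semidefinite square root). For such $P$, existence of an invariant probability measure $\mu$ for the associated Markov semigroup is equivalent to $\sigma(B)\subset\{z\in\mathbb{C}:\operatorname{Re}z<0\}$; it is then unique and $d\mu=\rho\,dx$ with $$\rho(x)=\frac{1}{(2\pi)^{n/2}\sqrt{\det Q_\infty}}e^{-\frac12\langle Q_\infty^{-1}x,x\rangle},\qquad Q_\infty=\int_0^{+\infty}e^{sB}Qe^{sB^T}ds.$$ $L^2_\mu=L^2(\mathbb{R}^n,d\mu)$; $P$ acts on $L^2_\mu$ with domain $D(P)=\{u\in L^2_\mu:Pu\in L^2_\mu\}$ and generates the semigroup $(e^{tP})_{t\ge0}$. $D_x=i^{-1}\nabla_x$; $\langle\xi_0,D_x\rangle=\sum_j(\xi_0)_jD_{x_j}$; $|\cdot|$ is the Euclidean norm. $0\le k_0\le n-1$ is the smallest integer with $\operatorname{Rank}[Q^{1/2},BQ^{1/2},\dots,B^{k_0}Q^{1/2}]=n$. For $0\le k\le k_0$, as real subspaces of $\mathbb{R}^n$, $$\mathcal V_k=\sum_{j=0}^k\operatorname{Ran}(B^jQ^{1/2}),\qquad\tilde{\mathcal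 V}_k=\sum_{j=0}^k\operatorname{Ran}\big((B^T)^jQ_\infty^{-1}Q^{1/2}\big).$$ Both families increase with $k$ and equal $\mathbb{R}^n$ for $k=k_0$. The frequency index $k_{\xi_0}$ of $\xi_0\in\mathbb{R}^n$ is the smallest $0\le k\le k_0$ with $\xi_0\in\mathcal V_k$; the space index $\tilde k_{x_0}$ of $x_0\in\mathbb{R}^n$ is the smallest $0\le k\le k_0$ with $x_0\in\tilde{\mathcal V}_k$. *)

(* Defs.v *)
From HB Require Import structures.
From mathcomp Require Import all_boot all_order all_algebra complex.
From mathcomp Require Import all_classical all_reals all_analysis.

Set Implicit Arguments.
Unset Strict Implicit.
Unset Printing Implicit Defensive.
Import Order.TTheory GRing.Theory Num.Theory.
Import numFieldNormedType.Exports.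
Local Open Scope classical_set_scope.
Local Open Scope ring_scope.

Lemma product_sigma_finite d1 d2 (T1 : measurableType d1)
    (T2 : measurableType d2) (R : realType)
    (m1 : {sigma_finite_measure set T1 -> \bar R})
    (m2 : {sigma_finite_measure set T2 -> \bar R}) :
  sigma_finite setT (m1 \x m2)%E.
Proof.
have /sigma_finiteP[F [TF ndF Foo]] := sigma_finiteT m1.
have /sigma_finiteP[G [TG ndG Goo]] := sigma_finiteT m2.
exists (fun n => F n `*` G n).
  rewrite -setXTT TF TG predeqE => -[x y]; split.
    move=> [/= [n _ Fnx] [k _ Gky]]; exists (maxn n k) => //; split.
    - by move: x Fnx; exact/subsetPset/ndF/leq_maxl.
    - by move: y Gky; exact/subsetPset/ndG/leq_maxr.
  by move=> [n _ []/= ? ?]; split; exists n.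
move=> k; have [? ?] := Foo k; have [? ?] := Goo k.
split; first exact: measurableX.
by rewrite product_measure1E// lte_mul_pinfty// ge0_fin_numE.
Qed.

Section Lebesgue_measure_Rn.
Context {R : realType}.

(* The Borel sigma-algebra of R^n, as the sigma-algebra generated by the
   coordinates. *)
Definition Rn_measurable n : set (set 'cV[R]_n) :=
  g_sigma_preimage (fun (i : 'I_n) (x : 'cV[R]_n) => x i 0).

Let Rn_measurable0 n : @Rn_measurable n set0.
Proof. exact: sigma_algebra0. Qed.

Let Rn_measurableC n (A : set 'cV[R]_n) :
  Rn_measurable A -> Rn_measurable (~` A).
Proof. exact: sigma_algebraC. Qed.

Let Rn_measurable_bigcup n (F : (set 'cV[R]_n)^nat) :
  (forall i, Rn_measurable (F i)) -> Rn_measurable (\bigcup_i F i).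
Proof. exact: sigma_algebra_bigcup. Qed.

HB.instance Definition _ n := @isMeasurable.Build default_measure_display
  'cV[R]_n (@Rn_measurable n) (@Rn_measurable0 n) (@Rn_measurableC n)
  (@Rn_measurable_bigcup n).

Lemma measurable_coord n (i : 'I_n) :
  measurable_fun setT (fun x : 'cV[R]_n => x i 0).
Proof.
move=> _ Y mY; rewrite setTI; apply: sub_sigma_algebra => /=.
rewrite -bigcup_seq/=; exists i => /=; first by rewrite mem_index_enum.
by exists Y => //; rewrite setTI.
Qed.

Lemma measurable_fun_coordP d (T : measurableType d) n (f : T -> 'cV[R]_n) :
  (forall i, measurable_fun setT (fun t => f t i 0)) -> measurable_fun setT f.
Proof.
move=> mf _ A mA; rewrite setTI.
have : image_set_system setT f measurable A.
  move: A mA; apply: smallest_sub.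
    by apply: sigma_algebra_image; exact: sigma_algebra_measurable.
  rewrite -bigcup_seq/= => _ [i _] [B mB <-].
  by rewrite /image_set_system/= !setTI; have := mf i measurableT B mB; rewrite setTI.
by rewrite /image_set_system/= setTI.
Qed.

Definition Rn_cons n (p : R * 'cV[R]_n) : 'cV[R]_n.+1 :=
  col_mx (const_mx p.1 : 'cV_1) p.2.

Definition Rn_uncons n (x : 'cV[R]_n.+1) : R * 'cV[R]_n :=
  (x ord0 0, dsubmx (x : 'cV[R]_(1 + n))).

Lemma Rn_consK n : cancel (@Rn_cons n) (@Rn_uncons n).
Proof.
move=> [a v]; rewrite /Rn_uncons /Rn_cons/= col_mxKd; congr pair.
by rewrite mxE; case: splitP => // j _; rewrite mxE.
Qed.

Lemma measurable_Rn_cons n : measurable_fun setT (@Rn_cons n).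
Proof.
apply: measurable_fun_coordP => i; rewrite /Rn_cons.
under eq_fun do rewrite mxE; case: splitP => j _.
  under eq_fun do rewrite mxE.
  exact: measurable_fst.
apply: (@measurableT_comp _ _ _ _ _ _ (fun x : 'cV_n => x j 0) _ snd) => //.
exact: measurable_coord.
Qed.

Lemma measurable_Rn_uncons n : measurable_fun setT (@Rn_uncons n).
Proof.
apply/measurable_fun_pairP; split; first exact: measurable_coord.
apply: measurable_fun_coordP => i; rewrite /comp/=.
under eq_fun do rewrite mxE.
exact: measurable_coord.
Qed.

Section pushforward_cons.
Variables (n : nat) (m : {sigma_finite_measure set 'cV[R]_n -> \bar R}).

Definition prepend_measure : set 'cV[R]_n.+1 -> \bar R :=
  pushforward (lebesgue_measure \x m)%E (@Rn_cons n).

Let prepend0 : prepend_measure set0 = 0%E.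
Proof. by rewrite /prepend_measure /pushforward preimage_set0 measure0. Qed.

Let prepend_ge0 A : (0 <= prepend_measure A)%E.
Proof. by rewrite /prepend_measure /pushforward. Qed.

Let prepend_semi_sigma_additive : semi_sigma_additive prepend_measure.
Proof.
exact: (@measure_semi_sigma_additive _ _ _
  (measure_function_pushforward__canonical__measure_function_Measure
    (lebesgue_measure \x m)%E (@measurable_Rn_cons n))).
Qed.

HB.instance Definition _ := isMeasure.Build _ _ _ prepend_measure
  prepend0 prepend_ge0 prepend_semi_sigma_additive.

Let prepend_sigma_finite : sigma_finite setT prepend_measure.
Proof.
have [F TF Foo] := product_sigma_finite (@lebesgue_measure R) m.
exists (fun i => (@Rn_uncons n) @^-1` F i).
  by rewrite -preimage_bigcup -TF preimage_setT.
move=> i; have [mF Fioo] := Foo i; split.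
  by rewrite -[X in measurable X]setTI; exact: measurable_Rn_uncons.
rewrite /prepend_measure /pushforward -comp_preimage.
by rewrite (_ : _ \o _ = id) ?preimage_id//; apply/funext => p; exact: Rn_consK.
Qed.

HB.instance Definition _ := Measure_isSigmaFinite.Build _ _ _ prepend_measure
  prepend_sigma_finite.

End pushforward_cons.

Fixpoint lebesgue_Rn n : {sigma_finite_measure set 'cV[R]_n -> \bar R} :=
  match n with
  | 0 => dirac (0 : 'cV[R]_0)
  | n'.+1 => prepend_measure (lebesgue_Rn n')
  end.

End Lebesgue_measure_Rn.

Section Functions_on_Rn.
Context {R : realType} {n : nat}.
Local Open Scope complex_scope.
Local Notation Rn := 'cV[R]_n.
Local Notation C := R[i].
Local Notation leb := (@lebesgue_Rn R n).

Definition dot (x y : Rn) : R := \sum_i x i 0 * y i 0.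

(* The Euclidean norm; the norm `|x| of the library is the sup norm. *)
Definition enorm (x : Rn) : R := Num.sqrt (dot x x).

Definition pderiv (i : 'I_n) (f : Rn -> C) : Rn -> C := fun x =>
  'D_(delta_mx i 0) (fun y => complex.Re (f y)) x +i*
  'D_(delta_mx i 0) (fun y => complex.Im (f y)) x.

Definition pderivs (s : seq 'I_n) (f : Rn -> C) : Rn -> C := foldr pderiv f s.

(* C^oo on the open set U. *)
Definition smooth_on (U : set Rn) (f : Rn -> C) := forall s x, U x ->
  [/\ {for x, continuous (fun y => complex.Re (pderivs s f y))},
      {for x, continuous (fun y => complex.Im (pderivs s f y))} &
      forall i,
        derivable (fun y => complex.Re (pderivs s f y)) x (delta_mx i 0) /\
        derivable (fun y => complex.Im (pderivs s f y)) x (delta_mx i 0)].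

Definition supported_in (K : set Rn) (phi : Rn -> C) :=
  forall x, ~ K x -> phi x = 0.

Definition test_fun (U : set Rn) (phi : Rn -> C) :=
  smooth_on setT phi /\
  exists K : set Rn, [/\ compact K, K `<=` U & supported_in K phi].

(* Candidate distributions are arbitrary functionals, of which only the values
   on test functions matter; is_distribution singles out the elements of
   D'(U), and eq_distr is their equality. *)
Definition functional := (Rn -> C) -> C.

Definition is_distribution (U : set Rn) (u : functional) :=
  (forall (a : C) phi psi, test_fun U phi -> test_fun U psi ->
    u (fun x => a * phi x + psi x) = a * u phi + u psi) /\
  forall K : set Rn, compact K -> K `<=` U ->
    exists (c : R) (N : nat), forall phi (M : R),
      test_fun U phi -> supported_in K phi ->
      (forall s x, (size s <= N)%N -> Normc.normc (pderivs s phi x) <= M) ->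
      Normc.normc (u phi) <= c * M.

Definition eq_distr (U : set Rn) (u v : functional) :=
  forall phi, test_fun U phi -> u phi = v phi.

Definition of_fun (f : Rn -> C) : functional := fun phi =>
  \int[leb]_x complex.Re (f x * phi x) +i* \int[leb]_x complex.Im (f x * phi x).

Definition ddiff (i : 'I_n) (u : functional) : functional :=
  fun phi => - u (pderiv i phi).

Definition dmul (a : Rn -> C) (u : functional) : functional :=
  fun phi => u (fun x => a x * phi x).

(* P = 1/2 sum_ij q_ij d_i d_j + sum_ij b_ij x_j d_i *)
Definition OU_operator (Q B : 'M[R]_n) (u : functional) : functional :=
  fun phi =>
    2^-1 * (\sum_i \sum_j (Q i j)%:C * ddiff i (ddiff j u) phi) +
    \sum_i \sum_j (B i j)%:C * dmul (fun x => (x j 0)%:C) (ddiff i u) phi.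

(* <xi, D_x> with D_x = i^-1 grad *)
Definition dir_D (xi : Rn) (u : functional) : functional :=
  fun phi => \sum_j (xi j 0)%:C * (('i)^-1 * ddiff j u phi).

Definition hypoelliptic (P : functional -> functional) :=
  forall U : set Rn, open U -> forall u, is_distribution U u ->
    (exists2 f, smooth_on U f & eq_distr U (P u) (of_fun f)) ->
    exists2 g, smooth_on U g & eq_distr U u (of_fun g).

Section L2.
Variable mu : {measure set Rn -> \bar R}.

Definition L2norm (f : Rn -> C) : \bar R :=
  Lnorm mu 2%:E (fun x => (Normc.normc (f x))%:E).

Definition L2 (f : Rn -> C) :=
  [/\ measurable_fun setT (fun x => complex.Re (f x)),
      measurable_fun setT (fun x => complex.Im (f x)) &
      (L2norm f < +oo)%E].

(* The L^2 norm of a distribution on R^n: +oo unless it is given by a function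
   in L^2, whose norm does not depend on the representative. *)
Definition distr_L2norm (u : functional) : \bar R :=
  ereal_inf [set L2norm w | w in [set w | L2 w /\ eq_distr setT u (of_fun w)]].

(* Strongly continuous semigroups on L^2. Operators act on functions, which
   stand for their classes modulo almost everywhere equality. *)
Record C0_semigroup (T : R -> (Rn -> C) -> (Rn -> C)) : Prop := {
  semigroup_L2 : forall t f, 0 <= t -> L2 f -> L2 (T t f) ;
  semigroup_ae : forall t f g, 0 <= t -> L2 f -> L2 g ->
    {ae mu, forall x, f x = g x} -> {ae mu, forall x, T t f x = T t g x} ;
  semigroup_linear : forall t (a : C) f g, 0 <= t -> L2 f -> L2 g ->
    {ae mu, forall x, T t (fun y => a * f y + g y) x = a * T t f x + T t g x} ;
  semigroup_bounded : forall t, 0 <= t ->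
    exists M : R, forall f, L2 f -> (L2norm (T t f) <= M%:E * L2norm f)%E ;
  semigroup0 : forall f, L2 f -> {ae mu, forall x, T 0 f x = f x} ;
  semigroupD : forall s t f, 0 <= s -> 0 <= t -> L2 f ->
    {ae mu, forall x, T (s + t) f x = T s (T t f) x} ;
  semigroup_continuous : forall f, L2 f ->
    (fun t => L2norm (fun x => T t f x - f x)) @ 0^'+ --> 0%E }.

(* The graph of the infinitesimal generator of T. *)
Definition generator_graph (T : R -> (Rn -> C) -> (Rn -> C)) (u f : Rn -> C) :=
  [/\ L2 u, L2 f &
    (fun h => L2norm (fun x => (h^-1)%:C * (T h u x - u x) - f x)) @ 0^'+
      --> 0%E].

(* T t = e^{tP}, where P has domain {u in L^2 | P u in L^2}. *)
Definition semigroup_generated_by (P : functional -> functional)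
    (T : R -> (Rn -> C) -> (Rn -> C)) :=
  C0_semigroup T /\
  forall u f, generator_graph T u f <->
    [/\ L2 u, L2 f & eq_distr setT (P (of_fun u)) (of_fun f)].

End L2.
End Functions_on_Rn.

Section Ornstein_Uhlenbeck.
Context {R : realType} {n : nat}.
Local Notation Rn := 'cV[R]_n.
Implicit Types (Q B S : 'M[R]_n).

Definition psd Q := Q^T = Q /\ forall x : Rn, 0 <= dot (Q *m x) x.

Definition is_psd_sqrt Q S := psd S /\ S *m S = Q.

Definition expmx (A : 'M[R]_n) : 'M[R]_n :=
  lim (series (fun k => k`!%:R^-1 *: A ^+ k) @ \oo).

(* Entrywise integral of e^{sB} Q e^{sB^T} over s in I. *)
Definition covariance_on Q B (I : set R) : 'M[R]_n :=
  \matrix_(i, j) \int[lebesgue_measure]_(s in I)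
    (expmx (s *: B) *m Q *m expmx (s *: B^T)) i j.

Definition Q_at Q B (t : R) := covariance_on Q B `[0, t].
Definition Q_infty Q B := covariance_on Q B `[0, +oo[.

Definition gauss_density (S : 'M[R]_n) (x : Rn) : R :=
  ((2 * pi) `^ (n%:R / 2) * Num.sqrt (\det S))^-1 *
  expR (- (2^-1 * dot (invmx S *m x) x)).

(* Kolmogorov's formula for the Markov semigroup of a hypoelliptic
   Ornstein-Uhlenbeck operator (Q_at t is then invertible for t > 0). *)
Definition markov_semigroup Q B (t : R) (g : Rn -> R) : Rn -> R := fun x =>
  \int[@lebesgue_Rn R n]_y
    (gauss_density (Q_at Q B t) y * g (expmx (t *: B) *m x - y)).

Definition invariant_measure Q B (mu : {measure set Rn -> \bar R}) :=
  forall (t : R) (g : Rn -> R), 0 < t -> continuous g ->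
    (exists M : R, forall x, `|g x| <= M) ->
    \int[mu]_x markov_semigroup Q B t g x = \int[mu]_x g x.

(* In the definitions below S stands for Q^{1/2}. Ranges of matrices are row
   spaces of their transposes. An index that does not exist gets a value
   beyond the range searched. *)
Definition kalman_index S B : nat :=
  find (fun k => \rank (\mxrow_(j < k.+1) (B ^+ j *m S)) == n) (iota 0 n).

Definition freq_space S B (k : nat) : 'M[R]_n :=
  (\sum_(j < k.+1) (B ^+ j *m S)^T)%MS.

Definition space_space Q S B (k : nat) : 'M[R]_n :=
  (\sum_(j < k.+1) (B^T ^+ j *m invmx (Q_infty Q B) *m S)^T)%MS.

Definition freq_index S B (xi : Rn) : nat :=
  find (fun k => (xi^T <= freq_space S B k)%MS)
    (iota 0 (kalman_index S B).+1).

Definition space_index Q S B (x : Rn) : nat :=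
  find (fun k => (x^T <= space_space Q S B k)%MS)
    (iota 0 (kalman_index S B).+1).

End Ornstein_Uhlenbeck.

(* Main.v *)
Require Import Defs.
From mathcomp Require Import all_boot all_order all_algebra complex.
From mathcomp Require Import all_classical all_reals all_analysis.
From mathcomp Require Import measurable_realfun ring lra.

Set Implicit Arguments.
Unset Strict Implicit.
Unset Printing Implicit Defensive.
Import Order.TTheory GRing.Theory Num.Theory.
Import numFieldNormedType.Exports.
Local Open Scope classical_set_scope.
Local Open Scope ring_scope.

(* The invariant measure is the Gaussian measure with covariance G = Q_infty,
   so G is positive definite and satisfies the Lyapunov equation
   B G + G B^T = - Q.  On the waves e_eta(x) = e^{i <eta, x>} the semigroup is
   explicit: e^{tP} e_eta = exp (- (p(0) - p(t)) / 2) e_{z(t)} with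
   z(t) = e^{t B^T} eta and p(t) = <G z(t), z(t)>, because the right-hand side
   solves the Cauchy problem.  Gaussian Gram matrices of waves are kernels
   exp <G eta, eta'>, and the Schur product theorem turns the finite-dimensional
   inequality <xi, z(t)>^2 <= M^2 (p(0) - p(t)) for all eta into
   |<xi, D_x> e^{tP} v| <= M |v| for every trigonometric polynomial v; these are
   dense in L^2.  Since p' = - |S z|^2, the finite-dimensional inequality is a
   quantitative observability estimate: a Taylor expansion of z at t and an
   inversion of a Vandermonde matrix bound t^(2j+1) |S (B^T)^j z(t)|^2 by
   p(0) - p(t), up to terms absorbed thanks to the Kalman condition, so that
   M = C t^(-(2k+1)/2) is admissible when xi lies in V_k.  Finally, Gaussian
   integration by parts bounds |<x0, x> v| by |v| and |<G x0, D_x> v|, and G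
   maps the space filtration onto the frequency filtration. *)

(** * Matrix exponentials *)

(** The semigroup is given only through its generator, whose domain is maximal: a function of L^2
    belongs to it as soon as its distributional image under P is in L^2. Waves thus lie in the
    domain, and computing e^{tP} e_eta becomes a uniqueness question. Propagating the errors
    requires operator bounds uniform on [0, t], whereas the axioms bound each operator separately; a
    gliding hump closes this gap. Write c_r for the kernel <G z(r), z'(r)> and l for <xi, z(t)>. The
    main estimate is the chain of kernel inequalities l l' e^{c_t} <= M^2 (c_0 - c_t) e^{c_t} <= M^2
    (e^{c_0} - e^{c_t}) <= M^2 e^{c_0}. The damping of a wave compensates the change of its Gaussian
    weight, so that the same coefficients occur at times 0 and t. The properties of G come from the
    density: total mass one makes G invertible, integration by parts makes <G y, y> a second moment,
    positivity then forces the integral defining G to converge, and convergence removes the boundary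
    term at infinity in the Lyapunov equation. *)

Section derivatives.
Context {R : realType}.

(** Entrywise, so that product and chain rules reduce to scalar ones and no norm on matrices
    enters. *)
Definition mderiv (m p : nat) (M : R -> 'M[R]_(m, p)) (s : R)
    (dM : 'M[R]_(m, p)) :=
  forall i j, is_derive s (1 : R) (fun r => M r i j) (dM i j).

Lemma mderiv_eq m p (M : R -> 'M[R]_(m, p)) s D1 D2 :
  mderiv M s D1 -> D1 = D2 -> mderiv M s D2.
Proof. by move=> + <-. Qed.

Lemma is_derive_cst0 (V W : normedModType R) (a : W) (x v : V) :
  is_derive x v (fun=> a) (0 : W).
Proof. exact: is_derive_cst. Qed.

Lemma mderiv_cst m p (M : 'M[R]_(m, p)) s : mderiv (fun=> M) s 0.
Proof. by move=> i j; rewrite mxE; exact: is_derive_cst0. Qed.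

Lemma mderivD m p (M N : R -> 'M[R]_(m, p)) s dM dN :
  mderiv M s dM -> mderiv N s dN -> mderiv (fun r => M r + N r) s (dM + dN).
Proof.
move=> HM HN i j; rewrite mxE.
rewrite (_ : (fun r => _) = (fun r => M r i j) + (fun r => N r i j)).
  exact: is_deriveD.
by apply/funext => r; rewrite mxE.
Qed.

Lemma mderivM m p q (M : R -> 'M[R]_(m, p)) (N : R -> 'M[R]_(p, q)) s dM dN :
  mderiv M s dM -> mderiv N s dN ->
  mderiv (fun r => M r *m N r) s (dM *m N s + M s *m dN).
Proof.
move=> HM HN i j.
rewrite (_ : (fun r => _) =
    \sum_(k < p) ((fun r => M r i k) * (fun r => N r k j))); last first.
  by apply/funext => r; rewrite mxE fct_sumE.
apply: is_derive_eq; first by apply: is_derive_sum => k; apply: is_deriveM.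
rewrite !mxE -big_split/=; apply: eq_bigr => k _.
by rewrite /= addrC /GRing.scale/= [N s k j * _]mulrC.
Qed.

Lemma mderivT m p (M : R -> 'M[R]_(m, p)) s dM :
  mderiv M s dM -> mderiv (fun r => (M r)^T) s dM^T.
Proof.
move=> HM i j; rewrite mxE.
by rewrite (_ : (fun r => _) = (fun r => M r j i)) //; apply/funext => r; rewrite mxE.
Qed.

Lemma mderiv_comp m p (M : R -> 'M[R]_(m, p)) (f : R -> R) s df dM :
  mderiv M (f s) dM -> is_derive s 1 f df ->
  mderiv (fun r => M (f r)) s (df *: dM).
Proof.
move=> HM Hf i j; rewrite mxE.
have := is_derive1_comp (f := fun r => M r i j) (g := f).
by move=> H; have := H _ _ _ (HM i j) Hf; rewrite mulrC.
Qed.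

Lemma ler_derive_le (f df : R -> R) (a b : R) : a <= b ->
  (forall x, a <= x <= b -> is_derive x 1 f (df x)) ->
  (forall x, a <= x <= b -> df x <= 0) -> f b <= f a.
Proof.
move=> ab Hf Hd.
have Hc : {within `[a, b], continuous f}.
  apply: derivable_within_continuous => x; rewrite in_itv/= => xab.
  by have := Hf x xab => -[].
have [x|c cab E] := MVT_segment (df := df) ab _ Hc.
  by rewrite in_itv/= => /andP[/ltW ax /ltW xb]; apply: Hf; rewrite ax.
rewrite -subr_le0 E mulr_le0_ge0 ?subr_ge0//.
by apply: Hd; move: cab; rewrite in_itv.
Qed.

Lemma is_derive0_cst (f : R -> R) (a b : R) :
  (forall x : R, is_derive x (1 : R) f (0 : R)) -> f b = f a.
Proof. by move=> Hf; exact: is_derive_0_is_cst. Qed.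

Lemma mderiv0_cst m p (M : R -> 'M[R]_(m, p)) a b :
  (forall s, mderiv M s 0) -> M a = M b.
Proof.
move=> HM; apply/matrixP => i j.
apply: (@is_derive0_cst (fun r => M r i j)) => x.
by have := HM x i j; rewrite mxE.
Qed.

End derivatives.

Section expmx.
Context {R : realType} {n : nat}.
Implicit Types (A B : 'M[R]_n) (s t : R).

(** This norm bounds the entries of all powers and also, in [norm_mulmx_le], the action on vectors
    in the sup norm. *)
Definition mxsum A : R := \sum_i \sum_j `|A i j|.

Lemma mxsum_ge0 A : 0 <= mxsum A.
Proof. by apply: sumr_ge0 => i _; apply: sumr_ge0 => j _. Qed.

Lemma expr_mx_le B k i j : `|(B ^+ k) i j| <= mxsum B ^+ k.
Proof.
elim: k i j => [|k IH] i j.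
  by rewrite !expr0 !mxE; case: eqP; rewrite ?normr1 ?normr0.
rewrite exprS mxE (le_trans (ler_norm_sum _ _ _))// exprS.
apply: (@le_trans _ _ (\sum_k0 `|B i k0| * mxsum B ^+ k)).
  by apply: ler_sum => l _; rewrite normrM ler_wpM2l.
rewrite -mulr_suml ler_wpM2r ?exprn_ge0 ?mxsum_ge0//.
rewrite /mxsum [leRHS](bigD1 i)//= lerDl; apply: sumr_ge0 => a _.
exact: sumr_ge0.
Qed.

(** The coefficients of the scalar power series of one entry of the exponential, which makes
    termwise differentiation of [pseries] available. *)
Definition exp_entry B i j k : R := (k`!%:R)^-1 * (B ^+ k) i j.

Lemma is_cvg_exp_entry B i j s : cvgn (pseries (exp_entry B i j) s).
Proof.
apply: normed_cvg.
apply: (@series_le_cvg _ _ (exp_coeff (mxsum B * `|s|))) => //=.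
- by move=> k; rewrite exp_coeffE mulr_ge0 ?exprn_ge0 ?mulr_ge0 ?mxsum_ge0.
- move=> k; rewrite exp_coeffE /exp_entry normrM normrX normrM exprMn mulrA.
  rewrite ler_wpM2r ?exprn_ge0// ler_pM ?expr_mx_le//.
  by rewrite ger0_norm// invr_ge0.
- exact: is_cvg_series_exp_coeff.
Qed.

Lemma exp_entry_diffs B i j :
  pseries_diffs (exp_entry B i j) =
  fun k => \sum_l B i l * exp_entry B l j k.
Proof.
apply/funext => k; rewrite /pseries_diffs /exp_entry factS natrM invfM.
rewrite mulrA mulrA divff ?mul1r ?pnatr_eq0//.
rewrite exprS mxE mulr_sumr; apply: eq_bigr => l _.
by rewrite mulrCA.
Qed.

Lemma expr_scalemx s B k : (s *: B) ^+ k = s ^+ k *: B ^+ k.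
Proof.
elim: k => [|k IH]; first by rewrite !expr0 scale1r.
by rewrite !exprS IH /GRing.mul/= -scalemxAl -scalemxAr scalerA.
Qed.

(** There are finitely many entries, so the limit of matrices can be computed entry by entry. *)
Lemma expmxE B s i j :
  expmx (s *: B) i j = limn (pseries (exp_entry B i j) s).
Proof.
pose L := (\matrix_(i, j) limn (pseries (exp_entry B i j) s)) : 'M[R]_n.
rewrite /expmx; suff -> : lim (series (fun k => k`!%:R^-1 *: (s *: B) ^+ k) @ \oo) = L.
  by rewrite mxE.
apply/cvg_lim; first exact: norm_hausdorff.
apply/cvg_mx_entourageP => E entE.
suff : \forall N \near \oo, forall i j, (L i j,
    series (fun k => k`!%:R^-1 *: (s *: B) ^+ k) N i j) \in E by [].
near=> N => i' j'.
rewrite (_ : series (fun k => k`!%:R^-1 *: (s *: B) ^+ k) N i' j' = pseries (exp_entry B i' j')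
    s N); last first.
  rewrite /series /pseries/= summxE; apply: eq_bigr => k _.
  by rewrite /exp_entry mxE -mulrA expr_scalemx mxE [_ * s ^+ _]mulrC.
rewrite mxE inE /=.
suff : forall ij : 'I_n * 'I_n, E (limn (pseries (exp_entry B ij.1 ij.2) s), pseries (exp_entry
    B ij.1 ij.2) s N) by move=> /(_ (i', j')).
near: N.
have : forall ij : 'I_n * 'I_n, \forall N \near \oo, E (limn (pseries (exp_entry B ij.1 ij.2)
    s), pseries (exp_entry B ij.1 ij.2) s N).
  move=> ij; have := @is_cvg_exp_entry B ij.1 ij.2 s.
  by move/cvg_entourageP; apply.
exact: filter_forall.
Unshelve. all: by end_near. Qed.

Lemma cvgn_sum (I : finType) (u : I -> R^nat) (l : I -> R) :
  (forall i, u i @ \oo --> l i) ->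
  (fun N => \sum_i u i N) @ \oo --> \sum_i l i.
Proof.
move=> ul; elim: (index_enum I) => [|i r IH].
  by under eq_fun do rewrite big_nil; rewrite big_nil; exact: cvg_cst.
under eq_fun do rewrite big_cons; rewrite big_cons.
by apply: cvgD.
Qed.

(** Termwise differentiation: by [exp_entry_diffs], differentiating the series of an entry gives a
    combination, with coefficients in a row of [B], of the series of the entries of the same
    column. *)
Lemma mderiv_expmx B s : mderiv (fun t => expmx (t *: B)) s (B *m expmx (s *: B)).
Proof.
move=> i j.
rewrite (_ : (fun t => _) = (fun t => limn (pseries (exp_entry B i j) t))); last first.
  by apply/funext => t; exact: expmxE.
have cdiff i' j' K : cvgn (pseries (pseries_diffs (exp_entry B i' j')) K) /\
    limn (pseries (pseries_diffs (exp_entry B i' j')) K) =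
    \sum_l B i' l * limn (pseries (exp_entry B l j') K).
  suff : pseries (pseries_diffs (exp_entry B i' j')) K @ \oo -->
      \sum_l B i' l * limn (pseries (exp_entry B l j') K).
    by move=> H; split; [apply/cvg_ex; eexists; exact: H| exact/cvg_lim].
  rewrite (_ : pseries _ K = fun N => \sum_l B i' l * pseries (exp_entry B l j') K N).
    by apply: cvgn_sum => l; apply: cvgMr; exact: is_cvg_exp_entry.
  apply/funext => N; rewrite exp_entry_diffs /pseries /series /=.
  under [RHS]eq_bigr do rewrite mulr_sumr.
  rewrite exchange_big/=; apply: eq_bigr => k _.
  by rewrite mulr_suml; apply: eq_bigr => l _; rewrite mulrA.
(* Differentiating a power series at [s] asks for convergence of the series differentiated twice, at
   a radius larger than the modulus of [s]. *)
have cdiff2 K : cvgn (pseries (pseries_diffs (pseries_diffs (exp_entry B i j))) K).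
  rewrite exp_entry_diffs.
  rewrite (_ : pseries_diffs _ = fun k => \sum_l B i l * pseries_diffs (exp_entry B l j) k);
      last first.
    apply/funext => k; rewrite /pseries_diffs mulr_sumr; apply: eq_bigr => l _.
    by rewrite mulrCA.
  rewrite (_ : pseries _ K = fun N => \sum_l B i l * pseries (pseries_diffs (exp_entry B l j)) K N).
    apply/cvg_ex; exists (\sum_l B i l * limn (pseries (pseries_diffs (exp_entry B l j)) K)).
    by apply: cvgn_sum => l; apply: cvgMr; exact: (cdiff _ _ _).1.
  apply/funext => N; rewrite /pseries /series /=.
  under [RHS]eq_bigr do rewrite mulr_sumr.
  rewrite exchange_big/=; apply: eq_bigr => k _.
  by rewrite mulr_suml; apply: eq_bigr => l _; rewrite mulrA.
apply: is_derive_eq.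
  apply: (@pseries_snd_diffs _ _ (`|s| + 1)).
  - exact: is_cvg_exp_entry.
  - exact: (cdiff _ _ _).1.
  - exact: cdiff2.
  - by rewrite [ltRHS]ger0_norm ?addr_ge0// ltrDl.
rewrite (cdiff _ _ _).2 mxE; apply: eq_bigr => l _.
by rewrite expmxE.
Qed.

Lemma expmx0 B : expmx (0 *: B) = 1%:M.
Proof.
apply/matrixP => i j; rewrite expmxE.
apply/cvg_lim => //; rewrite -(cvg_shiftS _) /=.
rewrite (_ : (fun _ => _) = cst (1%:M i j)); first exact: cvg_cst.
apply/funext => N; rewrite /pseries /series/= big_nat_recl//= big1 ?addr0.
  by rewrite /exp_entry fact0 invr1 mul1r !expr0 mulr1.
by move=> k _; rewrite exprS mul0r mulr0.
Qed.

Lemma trmx_exp A k : (A ^+ k)^T = A^T ^+ k.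
Proof.
elim: k => [|k IH]; first by rewrite !expr0 trmx1.
by rewrite exprS exprSr -IH trmx_mul.
Qed.

Lemma expmx_tr B s : (expmx (s *: B))^T = expmx (s *: B^T).
Proof.
apply/matrixP => i j; rewrite mxE !expmxE; congr (limn (pseries _ _)).
by apply/funext => k; rewrite /exp_entry -trmx_exp mxE.
Qed.

(** Both products sum the differentiated series: its k-th coefficient is B^(k+1) / k!, from which a
    factor [B] splits off on either side. *)
Lemma expmx_comm B s : B *m expmx (s *: B) = expmx (s *: B) *m B.
Proof.
apply/matrixP => i j; rewrite !mxE.
under eq_bigr do rewrite expmxE; under [RHS]eq_bigr do rewrite expmxE.
transitivity (limn (pseries (pseries_diffs (exp_entry B i j)) s)).
  apply/esym/cvg_lim => //.
  rewrite (_ : pseries _ s = fun N => \sum_l B i l * pseries (exp_entry B l j) s N).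
    by apply: cvgn_sum => l; apply: cvgMr; exact: is_cvg_exp_entry.
  apply/funext => N; rewrite exp_entry_diffs /pseries /series /=.
  under [RHS]eq_bigr do rewrite mulr_sumr.
  rewrite exchange_big/=; apply: eq_bigr => k _.
  by rewrite mulr_suml; apply: eq_bigr => l _; rewrite mulrA.
apply/cvg_lim => //.
rewrite (_ : pseries _ s = fun N => \sum_l pseries (exp_entry B i l) s N * B l j).
  by apply: cvgn_sum => l; apply: cvgMl; exact: is_cvg_exp_entry.
apply/funext => N; rewrite /pseries /series /=.
under [RHS]eq_bigr do rewrite mulr_suml.
rewrite exchange_big/=; apply: eq_bigr => k _.
rewrite /pseries_diffs /exp_entry factS natrM invfM mulrA mulrA divff ?mul1r ?pnatr_eq0//.
rewrite exprSr mxE mulr_sumr mulr_suml; apply: eq_bigr => l _.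
by rewrite -!mulrA; congr (_ * (_ * _)); rewrite mulrC.
Qed.

(** The product has zero derivative in [u], because [B] commutes with its exponential, and it is the
    identity at 0. *)
Lemma expmxK B u : expmx (u *: B) *m expmx (- u *: B) = 1%:M.
Proof.
rewrite -[RHS](_ : expmx (0 *: B) *m expmx (- 0 *: B) = _); last first.
  by rewrite oppr0 expmx0 mul1mx.
apply: (@mderiv0_cst _ _ _ (fun u => expmx (u *: B) *m expmx (- u *: B))) => r.
apply: mderiv_eq.
  apply: mderivM; first exact: mderiv_expmx.
  apply: (@mderiv_comp _ _ _ (fun r => expmx (r *: B)) (fun r => - r)).
  exact: mderiv_expmx.
by rewrite scaleN1r mulmxN expmx_comm mulmxA subrr.
Qed.

Lemma expmxD B s t : expmx ((s + t) *: B) = expmx (s *: B) *m expmx (t *: B).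
Proof.
have H : expmx (- s *: B) *m expmx ((s + t) *: B) =
    expmx (- 0 *: B) *m expmx ((0 + t) *: B).
  apply: (@mderiv0_cst _ _ _ (fun u => expmx (- u *: B) *m expmx ((u + t) *: B))) => r.
  apply: mderiv_eq.
    apply: mderivM.
      apply: (@mderiv_comp _ _ _ (fun r => expmx (r *: B)) (fun r => - r)).
      exact: mderiv_expmx.
    apply: (@mderiv_comp _ _ _ (fun r => expmx (r *: B)) (fun r => r + t)).
    exact: mderiv_expmx.
  by rewrite addr0 scale1r scaleN1r mulNmx expmx_comm mulmxA addNr.
rewrite oppr0 expmx0 mul1mx add0r in H.
by rewrite -H mulmxA expmxK mul1mx.
Qed.

End expmx.

(** * Inner product and sup norm on R^n *)

Section dot.
Context {R : realType} {n : nat}.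
Implicit Types (x y z : 'cV[R]_n) (A : 'M[R]_n).

Lemma dotE x y : dot x y = (x^T *m y) 0 0.
Proof. by rewrite mxE; apply: eq_bigr => i _; rewrite mxE. Qed.

Lemma dotC x y : dot x y = dot y x.
Proof. by apply: eq_bigr => i _; rewrite mulrC. Qed.

Lemma dotDl x y z : dot (x + y) z = dot x z + dot y z.
Proof. by rewrite -big_split; apply: eq_bigr => i _; rewrite mxE mulrDl. Qed.

Lemma dotDr x y z : dot z (x + y) = dot z x + dot z y.
Proof. by rewrite !(dotC z) dotDl. Qed.

Lemma dotZl a x y : dot (a *: x) y = a * dot x y.
Proof. by rewrite mulr_sumr; apply: eq_bigr => i _; rewrite mxE mulrA. Qed.

Lemma dotZr a x y : dot y (a *: x) = a * dot y x.
Proof. by rewrite !(dotC y) dotZl. Qed.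

Lemma dotNl x y : dot (- x) y = - dot x y.
Proof. by rewrite -scaleN1r dotZl mulN1r. Qed.

Lemma dotNr x y : dot x (- y) = - dot x y.
Proof. by rewrite dotC dotNl dotC. Qed.

Lemma dotBl x y z : dot (x - y) z = dot x z - dot y z.
Proof. by rewrite dotDl dotNl. Qed.

Lemma dotBr x y z : dot z (x - y) = dot z x - dot z y.
Proof. by rewrite dotDr dotNr. Qed.

Lemma dot0l x : dot 0 x = 0.
Proof. by rewrite -(scale0r x) dotZl mul0r. Qed.

Lemma dot0r x : dot x 0 = 0.
Proof. by rewrite dotC dot0l. Qed.

Lemma dot_mulmxl A x y : dot (A *m x) y = dot x (A^T *m y).
Proof. by rewrite !dotE trmx_mul mulmxA. Qed.

Lemma dot_mulmxr A x y : dot x (A *m y) = dot (A^T *m x) y.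
Proof. by rewrite dot_mulmxl trmxK. Qed.

Lemma dot_ge0 x : 0 <= dot x x.
Proof. by apply: sumr_ge0 => i _; rewrite -expr2 sqr_ge0. Qed.

Lemma dot_eq0 x : dot x x = 0 -> x = 0.
Proof.
move=> /eqP; rewrite psumr_eq0 => [|i _]; last by rewrite -expr2 sqr_ge0.
move=> /allP H; apply/colP => i; rewrite mxE.
have := H i; rewrite mem_index_enum => /(_ isT).
by rewrite /= mulf_eq0 orbb => /eqP.
Qed.

Lemma dot_cs x y : dot x y ^+ 2 <= dot x x * dot y y.
Proof.
have [y0|yn0] := eqVneq (dot y y) 0.
  by rewrite (dot_eq0 y0) !dot0r expr0n mulr0.
have yy : 0 < dot y y by rewrite lt_def yn0 dot_ge0.
have := dot_ge0 (dot y y *: x - dot x y *: y).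
rewrite dotBl !dotBr !dotZl !dotZr (dotC y x) => H.
have {}H : 0 <= dot y y * (dot x x * dot y y - dot x y ^+ 2).
  by apply: le_trans H _; rewrite le_eqVlt; apply/orP; left; apply/eqP; ring.
by move: H; rewrite pmulr_rge0// subr_ge0.
Qed.

Lemma coord_le_norm x i : `|x i 0| <= `|x|.
Proof.
rewrite /Num.norm/= mx_normrE.
exact: (@le_bigmax _ _ _ _ (fun ij : 'I_n * 'I_1 => `|x ij.1 ij.2|) (i, 0)).
Qed.

Lemma norm_le_coord x (c : R) : 0 <= c -> (forall i, `|x i 0| <= c) -> `|x| <= c.
Proof.
move=> c0 H; rewrite /Num.norm/= mx_normrE; apply/bigmax_leP; split => //.
by move=> [i j] _ /=; rewrite (ord1 j).
Qed.

Lemma norm_mulmx_le A x : `|A *m x| <= mxsum A * `|x|.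
Proof.
apply: norm_le_coord; first by rewrite mulr_ge0// mxsum_ge0.
move=> i; rewrite mxE (le_trans (ler_norm_sum _ _ _))//.
rewrite /mxsum mulr_suml [leRHS](bigD1 i)//= -[leLHS]addr0; apply: lerD.
  rewrite mulr_suml; apply: ler_sum => j _.
  by rewrite normrM ler_wpM2l// coord_le_norm.
by apply: sumr_ge0 => k _; rewrite mulr_ge0// sumr_ge0.
Qed.

Lemma dot_le_norm x y : `|dot x y| <= n%:R * (`|x| * `|y|).
Proof.
rewrite (le_trans (ler_norm_sum _ _ _))//.
rewrite (_ : n%:R * _ = \sum_(i < n) (`|x| * `|y|)); last first.
  by rewrite sumr_const card_ord mulr_natl.
apply: ler_sum => i _.
by rewrite normrM ler_pM ?coord_le_norm.
Qed.

Lemma sqr_norm_le_dot x : `|x| ^+ 2 <= dot x x.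
Proof.
suff : `|x| <= Num.sqrt (dot x x).
  by move=> H; rewrite -[leRHS]sqr_sqrtr ?dot_ge0// lerXn2r ?nnegrE ?sqrtr_ge0.
apply: norm_le_coord; first exact: sqrtr_ge0.
move=> i; rewrite -sqrtr_sqr ler_wsqrtr// /dot (bigD1 i)//= expr2 lerDl.
by apply: sumr_ge0 => j _; rewrite -expr2 sqr_ge0.
Qed.

Lemma is_derive_dot (u v : R -> 'cV[R]_n) (s : R) du dv :
  mderiv u s du -> mderiv v s dv ->
  is_derive s (1 : R) (fun r => dot (u r) (v r)) (dot du (v s) + dot (u s) dv).
Proof.
move=> Hu Hv; have := mderivM (mderivT Hu) Hv => /(_ 0 0).
rewrite mxE -!dotE (_ : (fun r => _) = (fun r => dot (u r) (v r)))//.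
by apply/funext => r; rewrite dotE.
Qed.

Lemma mderiv_mulmxl (A : 'M[R]_n) (u : R -> 'cV[R]_n) s du :
  mderiv u s du -> mderiv (fun r => A *m u r) s (A *m du).
Proof.
move=> Hu; apply: mderiv_eq; first by apply: mderivM Hu; exact: mderiv_cst.
by rewrite mul0mx add0r.
Qed.

End dot.

(** * Taylor remainder of the matrix exponential *)

Section expmx_taylor.
Context {R : realType} {n : nat}.
Implicit Types (A B : 'M[R]_n) (s t : R).

Definition exp_trunc A s m : 'M[R]_n := \sum_(k < m) (k`!%:R^-1 * s ^+ k) *: A ^+ k.

Lemma exp_truncE A s m i j : exp_trunc A s m i j = pseries (exp_entry A i j) s m.
Proof.
rewrite /exp_trunc summxE /pseries /series/= big_mkord; apply: eq_bigr => k _.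
by rewrite /exp_entry mxE mulrAC.
Qed.

Lemma exp_trunc_cvg A s i j :
  (fun m => exp_trunc A s m i j) @ \oo --> expmx (s *: A) i j.
Proof.
rewrite expmxE (_ : (fun m => _) = pseries (exp_entry A i j) s).
  exact: is_cvg_exp_entry.
by apply/funext => m; rewrite exp_truncE.
Qed.

(** When |s| <= 1, each term of degree k >= m carries |s|^k <= |s|^m; the rest is a tail of the
    series of exp (mxsum A). *)
Lemma exp_taylor A s m i j : `|s| <= 1 ->
  `|(expmx (s *: A) - exp_trunc A s m) i j| <= `|s| ^+ m * expR (mxsum A).
Proof.
move=> s1; rewrite !mxE.
have Hc : (fun N => `|exp_trunc A s N i j - exp_trunc A s m i j|) @ \oo -->
    `|expmx (s *: A) i j - exp_trunc A s m i j|.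
  by apply: cvg_norm; apply: cvgB; [exact: exp_trunc_cvg | exact: cvg_cst].
rewrite -(cvg_lim _ Hc)//; apply: limr_le; first by apply/cvg_ex; eexists; exact: Hc.
near=> N.
have mN : (m <= N)%N by near: N; exact: nbhs_infty_ge.
rewrite !exp_truncE /pseries /series/= sub_series_geq//.
rewrite (le_trans (ler_norm_sum _ _ _))//.
apply: (@le_trans _ _ (`|s| ^+ m * \sum_(m <= k < N) exp_coeff (mxsum A) k)).
  rewrite mulr_sumr big_nat_cond [leRHS]big_nat_cond; apply: ler_sum => k.
  rewrite andbT => /andP[mk _].
  rewrite exp_coeffE /exp_entry !normrM normrX mulrC ler_pM//.
  - by rewrite -(subnK mk) exprD ler_piMl ?exprn_ge0// exprn_ile1.
  - by rewrite ler_pM// ?expr_mx_le// ger0_norm// invr_ge0.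
rewrite ler_wpM2l ?exprn_ge0//.
apply: (@le_trans _ _ (series (exp_coeff (mxsum A)) N)).
  rewrite /series/= [leRHS](big_cat_nat (n := m))//= lerDr sumr_ge0// => k _.
  by rewrite exp_coeffE mulr_ge0// ?exprn_ge0// mxsum_ge0.
apply: nondecreasing_cvgn_le; last exact: is_cvg_series_exp_coeff.
apply/nondecreasing_seqP => k; rewrite /series/= big_nat_recr//= lerDl.
by rewrite exp_coeffE mulr_ge0// ?exprn_ge0// mxsum_ge0.
Unshelve. all: by end_near. Qed.

End expmx_taylor.

(** * Kalman condition and observability *)

Section kalman.
Context {R : realType} {n : nat}.
Implicit Types (S B : 'M[R]_n) (x : 'cV[R]_n).

(** The characteristic polynomial expresses each power of order at least [n] through lower ones;
    strong induction on the exponent follows. *)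
Lemma Cayley_Hamilton_vanish S B x : (0 < n)%N ->
  (forall j, (j < n)%N -> S *m (B ^+ j *m x) = 0) ->
  forall j, S *m (B ^+ j *m x) = 0.
Proof.
case: n S B x => // m S B x _ H j.
elim/ltn_ind: j => j IH.
have [|mj] := ltnP j m.+1; first exact: H.
have CH := Cayley_Hamilton B.
have mon := char_poly_monic B.
have sz := size_char_poly B.
have E : B ^+ m.+1 = - \sum_(i < m.+1) (char_poly B)`_i *: B ^+ i.
  apply/eqP; rewrite -addr_eq0; apply/eqP; rewrite -[RHS]CH.
  rewrite -[char_poly B in RHS]coefK poly_def linear_sum/= sz [RHS]big_ord_recr/=.
  rewrite [RHS]addrC; congr (_ + _).
    move/monicP: mon; rewrite lead_coefE sz/= => ->.
    by rewrite scale1r rmorphXn/= horner_mx_X.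
  by apply: eq_bigr => i _; rewrite linearZ/= rmorphXn/= horner_mx_X.
rewrite -(subnK mj) exprD E mulrN mulr_sumr.
rewrite mulNmx mulmxN mulmx_suml mulmx_sumr big1 ?oppr0// => i _.
rewrite -scalerAr -exprD -scalemxAl -scalemxAr IH ?scaler0//.
by rewrite -[ltnRHS](subnK mj) ltn_add2l.
Qed.

(** The truncated exponentials are polynomials in [B], and the vanishing passes to their limit. *)
Lemma observable_unitmx_exp S B x :
  (forall j, S *m (B ^+ j *m x) = 0) ->
  forall s, S *m (expmx (s *: B) *m x) = 0.
Proof.
move=> H s; apply/colP => i; rewrite mxE [RHS]mxE.
have Hc : (fun m => (S *m (exp_trunc B s m *m x)) i 0) @ \oo -->
    \sum_j S i j * (expmx (s *: B) *m x) j 0.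
  under eq_fun do rewrite mxE.
  apply: cvgn_sum => j; apply: cvgMr; rewrite mxE; under eq_fun do rewrite mxE.
  by apply: cvgn_sum => k; apply: cvgMl; exact: exp_trunc_cvg.
rewrite -(cvg_lim _ Hc)//; apply/cvg_lim => //.
rewrite (_ : (fun _ => _) = cst 0); first exact: cvg_cst.
apply/funext => m; rewrite /exp_trunc mulmx_suml mulmx_sumr big1 ?mxE//= => k _.
by rewrite -scalemxAl -scalemxAr H scaler0.
Qed.

(** For symmetric [S] this is the Kalman condition of order [k] in dual form: only 0 is orthogonal
    to the columns of all [B ^+ j *m S] with [j] at most [k]. *)
Definition injective_up_to S B k :=
  forall x, (forall j, (j <= k)%N -> S *m (B^T ^+ j *m x) = 0) -> x = 0.

Lemma mxrow_mul0P S B k (v : 'rV[R]_n) : S^T = S ->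
  (v *m (\mxrow_(j < k.+1) (B ^+ j *m S)) == 0) =
  [forall j : 'I_k.+1, S *m (B^T ^+ j *m v^T) == 0].
Proof.
move=> ST; rewrite mul_mxrow.
have E j : S *m (B^T ^+ j *m v^T) = (v *m (B ^+ j *m S))^T.
  by rewrite !trmx_mul ST trmx_exp mulmxA.
apply/eqP/forallP => [H j|H].
  rewrite E; apply/eqP; have := congr1 (fun M => submxrow M j) H.
  by rewrite mxrowK => ->; apply/matrixP => a b; rewrite !mxE.
rewrite -[RHS](_ : \mxrow_(j < k.+1) (0 : 'rV_n) = 0); last first.
  by apply/matrixP => a b; rewrite !mxE.
apply: eq_mxrow => j.
by have := H j; rewrite E => /eqP/(congr1 trmx); rewrite trmxK => ->; rewrite trmx0.
Qed.

Lemma kalman_rankP S B k : S^T = S ->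
  reflect (injective_up_to S B k) (\rank (\mxrow_(j < k.+1) (B ^+ j *m S)) == n).
Proof.
move=> ST; rewrite -/(row_free _) -kermx_eq0; apply: (iffP eqP) => H.
  move=> x Hx.
  have : x^T *m (\mxrow_(j < k.+1) (B ^+ j *m S)) = 0.
    by apply/eqP; rewrite mxrow_mul0P//; apply/forallP => j; rewrite trmxK Hx// -ltnS.
  move=> /sub_kermxP; rewrite H submx0 => /eqP /(congr1 trmx).
  by rewrite trmxK trmx0.
apply/eqP/rowV0P => v /sub_kermxP /eqP; rewrite mxrow_mul0P// => /forallP Hv.
have /(congr1 trmx) : v^T = 0.
  by apply: H => j jk; have := Hv (inord j); rewrite inordK// => /eqP.
by rewrite trmxK trmx0.
Qed.

(** Observability along the whole flow is what positivity of [Q_infty] yields. Cayley-Hamilton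
    reduces it to powers below [n], so the search defining [kalman_index] succeeds and does not
    return its out-of-range value. *)
Lemma kalman_indexP S B : (0 < n)%N -> S^T = S ->
  (forall x, (forall s, S *m (expmx (s *: B^T) *m x) = 0) -> x = 0) ->
  injective_up_to S B (kalman_index S B).
Proof.
move=> n0 ST H; apply/kalman_rankP => //.
have has_k : has (fun k => \rank (\mxrow_(j < k.+1) (B ^+ j *m S)) == n) (iota 0 n).
  apply/hasP; exists n.-1; first by rewrite mem_iota/= add0n prednK.
  apply/kalman_rankP => // x Hx; apply: H; apply: observable_unitmx_exp.
  by apply: Cayley_Hamilton_vanish => // j jn; apply: Hx; rewrite -ltnS prednK.
have lt : (kalman_index S B < n)%N by move: has_k; rewrite has_find size_iota.
by have := nth_find 0%N has_k; rewrite nth_iota// add0n.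
Qed.

(** Each column of the cokernel is orthogonal to all the generators, hence zero by injectivity. *)
Lemma freq_space_full S B k : S^T = S -> injective_up_to S B k ->
  row_full (freq_space S B k).
Proof.
move=> ST H; rewrite -cokermx_eq0; apply/eqP/matrixP => i j.
suff /colP/(_ i) : col j (cokermx (freq_space S B k)) = 0 by rewrite !mxE.
apply: H => l lk.
have : ((B ^+ (inord l : 'I_k.+1) *m S)^T <= freq_space S B k)%MS.
  exact: (sumsmx_sup (inord l)).
rewrite inordK ?ltnS// submxE => /eqP E.
have -> : S *m (B^T ^+ l *m col j (cokermx (freq_space S B k))) =
    col j ((B ^+ l *m S)^T *m cokermx (freq_space S B k)).
  by rewrite trmx_mul ST trmx_exp !colE !mulmxA.
by rewrite E; apply/colP => a; rewrite !mxE.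
Qed.

Lemma freq_space_mono S B k l : (k <= l)%N ->
  (freq_space S B k <= freq_space S B l)%MS.
Proof.
move=> kl; apply/sumsmx_subP => i _.
by apply: (sumsmx_sup (widen_ord (_ : k.+1 <= l.+1)%N i)).
Qed.

Lemma freq_indexP S B xi : (0 < n)%N -> row_full (freq_space S B (kalman_index S B)) ->
  (freq_index S B xi <= kalman_index S B)%N /\
  (xi^T <= freq_space S B (freq_index S B xi))%MS.
Proof.
move=> n0 full; rewrite /freq_index; set P := (fun k => _).
have has_k : has P (iota 0 (kalman_index S B).+1).
  apply/hasP; exists (kalman_index S B); first by rewrite mem_iota/= add0n ltnSn.
  by rewrite /P submx_full.
have lt : (find P (iota 0 (kalman_index S B).+1) < (kalman_index S B).+1)%N.
  by move: has_k; rewrite has_find size_iota.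
split; first by rewrite -ltnS.
by have := nth_find 0%N has_k; rewrite nth_iota// add0n.
Qed.

Lemma space_indexP Q S B x : (0 < n)%N -> row_full (space_space Q S B (kalman_index S B)) ->
  (space_index Q S B x <= kalman_index S B)%N /\
  (x^T <= space_space Q S B (space_index Q S B x))%MS.
Proof.
move=> n0 full; rewrite /space_index; set P := (fun k => _).
have has_k : has P (iota 0 (kalman_index S B).+1).
  apply/hasP; exists (kalman_index S B); first by rewrite mem_iota/= add0n ltnSn.
  by rewrite /P submx_full.
have lt : (find P (iota 0 (kalman_index S B).+1) < (kalman_index S B).+1)%N.
  by move: has_k; rewrite has_find size_iota.
split; first by rewrite -ltnS.
by have := nth_find 0%N has_k; rewrite nth_iota// add0n.
Qed.

Lemma freq_space_mul S B k : S^T = S ->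
  (freq_space S B k *m B^T <= freq_space S B k.+1)%MS.
Proof.
move=> ST; rewrite /freq_space sumsmxMr; apply/sumsmx_subP => i _.
apply: (sumsmx_sup (lift ord0 i)) => //.
by rewrite lift0 -trmx_mul mulmxA exprS.
Qed.

Lemma space_space_mul Q S B k : (Q_infty Q B)^T = Q_infty Q B ->
  (space_space Q S B k *m B <= space_space Q S B k.+1)%MS.
Proof.
move=> GT; rewrite /space_space sumsmxMr; apply/sumsmx_subP => i _.
apply: (sumsmx_sup (lift ord0 i)) => //.
by rewrite lift0 -[X in _ *m X]trmxK -trmx_mul !mulmxA exprS.
Qed.

Lemma space_space_mono Q S B k l : (k <= l)%N ->
  (space_space Q S B k <= space_space Q S B l)%MS.
Proof.
move=> kl; apply/sumsmx_subP => i _.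
by apply: (sumsmx_sup (widen_ord (_ : k.+1 <= l.+1)%N i)).
Qed.

(** The Lyapunov equation exchanges B G and - G B^T up to a term ending in [S], which lies in every
    space of the filtration. Induction on the exponent thus turns S G^-1 B^j G into an element of
    the frequency space of order j, and symmetrically for the inverse. *)
Lemma space_freq Q S B k : S^T = S -> let G := Q_infty Q B in
  G \in unitmx -> G^T = G -> B *m G + G *m B^T = - (S *m S) ->
  (space_space Q S B k *m G <= freq_space S B k)%MS /\
  (freq_space S B k *m invmx G <= space_space Q S B k)%MS.
Proof.
move=> ST G uG GT lyap.
have iGT : (invmx G)^T = invmx G by rewrite trmx_inv GT.
have AE j : (B ^+ j *m S)^T = S *m B^T ^+ j by rewrite trmx_mul ST trmx_exp.
have CE j : (B^T ^+ j *m invmx G *m S)^T = S *m invmx G *m B ^+ j.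
  by rewrite !trmx_mul ST iGT trmx_exp trmxK mulmxA.
have BG : B *m G = - (G *m B^T) - S *m S by apply: (addIr (G *m B^T)); rewrite lyap addrAC addNr
    add0r.
(* The Lyapunov equation conjugated by the inverse of [G], needed for the second inclusion. *)
have GB : B^T *m invmx G = - (invmx G *m B) - invmx G *m (S *m S) *m invmx G.
  have : invmx G *m (B *m G) *m invmx G = invmx G *m (- (G *m B^T) - S *m S) *m invmx G.
    by rewrite BG.
  rewrite mulmxA mulmxK// mulmxBr mulmxN mulKmx// mulmxBl mulNmx => ->.
  by rewrite opprB addrAC subrr add0r opprK.
have S_sub l : (S <= freq_space S B l)%MS.
  by apply: (sumsmx_sup ord0) => //; rewrite expr0 mul1mx ST.
have SG_sub l : (S *m invmx G <= space_space Q S B l)%MS.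
  by apply: (sumsmx_sup ord0) => //; rewrite CE expr0 mulmx1.
split; rewrite sumsmxMr; apply/sumsmx_subP => -[j /= jk] _.
  apply: (submx_trans _ (freq_space_mono S B (jk : j <= k)%N)).
  rewrite CE; elim: j {jk} => [|j IH]; first by rewrite expr0 mulmx1 mulmxKV.
  rewrite exprSr -[_ * B]/(_ *m B) -!mulmxA BG mulmxBr !mulmxBr mulmxN !mulmxN.
  rewrite addmx_sub// eqmx_opp.
    rewrite !mulmxA; apply: submx_trans (freq_space_mul B j ST).
    by rewrite submxMr// -mulmxA.
  by rewrite !mulmxA; apply: (submx_trans (submxMl _ _)).
apply: (submx_trans _ (space_space_mono Q S B (jk : j <= k)%N)).
rewrite AE; elim: j {jk} => [|j IH]; first by rewrite expr0 mulmx1.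
rewrite exprSr -[_ * B^T]/(_ *m B^T) -!mulmxA GB !mulmxBr !mulmxN.
rewrite addmx_sub// eqmx_opp.
  rewrite !mulmxA; apply: submx_trans (space_space_mul _ _ GT).
  by rewrite submxMr// -mulmxA.
by rewrite !mulmxA -[_ *m S *m invmx G]mulmxA; apply: (submx_trans (submxMl _ _)).
Qed.

End kalman.

(** * Quantitative observability along the adjoint flow *)

Section lyapunov.
Context {R : realType} {n : nat}.
Variables (S B G : 'M[R]_n).
Hypotheses (ST : S^T = S) (GT : G^T = G).
Hypothesis lyap : B *m G + G *m B^T = - (S *m S).
Hypothesis obs : forall x : 'cV[R]_n,
  (forall s, S *m (expmx (s *: B^T) *m x) = 0) -> x = 0.
Implicit Types (x y xi eta : 'cV[R]_n) (s t r : R).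

Local Notation z := (fun eta s => expmx (s *: B^T) *m eta).
Local Notation p := (fun eta s => dot (G *m z eta s) (z eta s)).

Lemma mderiv_orbit eta s : mderiv (z eta) s (B^T *m z eta s).
Proof.
apply: mderiv_eq; first by apply: mderivM; [exact: mderiv_expmx | exact: mderiv_cst].
by rewrite mulmx0 addr0 mulmxA.
Qed.

Lemma lyapunov_dot x : dot (G *m (B^T *m x)) x + dot (G *m x) (B^T *m x) =
  - dot (S *m x) (S *m x).
Proof.
rewrite [X in _ + X]dot_mulmxr trmxK -dotDl !mulmxA -mulmxDl [X in X *m _]addrC lyap.
by rewrite mulNmx dotNl -mulmxA -{1}ST -dot_mulmxr.
Qed.

Lemma is_derive_energy eta s :
  is_derive s (1 : R) (p eta) (- dot (S *m z eta s) (S *m z eta s)).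
Proof.
rewrite -lyapunov_dot; apply: is_derive_dot.
  by apply: mderiv_mulmxl; exact: mderiv_orbit.
exact: mderiv_orbit.
Qed.

Lemma energy_le eta s t : s <= t -> p eta t <= p eta s.
Proof.
move=> st; apply: (ler_derive_le (df := fun s => - dot (S *m z eta s) (S *m z eta s))) => //.
  by move=> x _; exact: is_derive_energy.
by move=> x _; rewrite oppr_le0 dot_ge0.
Qed.

(** A vector killed by B^T is a fixed point of the flow, and the Lyapunov identity makes its image
    under [S] vanish, so it is unobservable. Invertibility of B^T then provides explicit primitives
    of the flow and avoids vector-valued integrals. *)
Lemma drift_inj x : B^T *m x = 0 -> x = 0.
Proof.
move=> Bx; apply: obs => s.
have E0 : expmx (s *: B^T) *m x = x.
  have := @mderiv0_cst _ _ _ (z x) s 0.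
  rewrite /= expmx0 mul1mx; apply => r.
  by apply: mderiv_eq; [exact: mderiv_orbit | rewrite mulmxA expmx_comm -mulmxA Bx mulmx0].
rewrite E0; apply: dot_eq0; apply/eqP; rewrite -oppr_eq0; apply/eqP.
by rewrite -lyapunov_dot Bx mulmx0 dot0l dot0r addr0.
Qed.

Lemma drift_unitmx : B^T \in unitmx.
Proof.
rewrite -unitmx_tr -row_free_unit -kermx_eq0; apply/rowV0P => v /sub_kermxP.
rewrite trmxK => vB.
have /(congr1 trmx) : v^T = 0.
  by apply: drift_inj; rewrite -trmx_mul vB trmx0.
by rewrite trmxK trmx0.
Qed.

(* [S (zeta' - e^{-r B^T} zeta')] with [B^T zeta' = zeta] is the integral of
   [S e^{-u B^T} zeta] over [u] in [0, r]; the bound is Cauchy-Schwarz, obtained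
   by optimizing [2 <w, Y>  <= r |w|^2 + energy loss] over constant vectors [w]. *)
Lemma integrated_observation_le eta zeta' Y t r : 0 <= r <= t ->
  B^T *m zeta' = z eta t ->
  Y = S *m (zeta' - expmx (- r *: B^T) *m zeta') ->
  dot Y Y <= r * (p eta 0 - p eta t).
Proof.
move=> /andP[r0 rt] Bz EY.
have key (w : 'cV[R]_n) : 2 * dot w Y <= dot w w * r + (p eta (t - r) - p eta t).
  rewrite -subr_le0.
  pose f u := 2 * dot w (S *m (zeta' - expmx (- u *: B^T) *m zeta')) -
    (dot w w * u + (p eta (t - u) - p eta t)).
  have -> : 0 = f 0.
    rewrite /f oppr0 expmx0 mul1mx subrr mulmx0 dot0r !mulr0 addr0 subrr.
    by rewrite addr0 subr0.
  rewrite EY -[leLHS]/(f r).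
  pose df u := 2 * dot w (S *m z eta (t - u)) -
    (dot w w + dot (S *m z eta (t - u)) (S *m z eta (t - u))).
  apply: (ler_derive_le (df := df)) => // [u _|u _]; last first.
    have := dot_ge0 (w - S *m z eta (t - u)).
    rewrite dotBl !dotBr [dot (S *m _) w]dotC /df => H.
    rewrite -oppr_ge0; apply: le_trans H _; rewrite le_eqVlt; apply/orP; left.
    by apply/eqP; ring.
  have D1 : mderiv (fun u => S *m (zeta' - expmx (- u *: B^T) *m zeta')) u
      (S *m z eta (t - u)).
    apply: mderiv_mulmxl; apply: mderiv_eq.
      apply: mderivD; first exact: mderiv_cst.
      have -> : (fun r0 => - (expmx (- r0 *: B^T) *m zeta')) =
          (fun r0 => expmx (- r0 *: B^T) *m (- zeta')).
        by apply/funext => r1; rewrite mulmxN.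
      apply: (@mderiv_comp _ _ _ (z (- zeta')) (fun r => - r)).
      exact: mderiv_orbit.
    rewrite add0r scaleN1r mulmxN mulmxN opprK mulmxA expmx_comm -mulmxA Bz.
    by rewrite mulmxA -expmxD addrC.
  have D2 : is_derive u (1 : R) (fun u => dot w (S *m (zeta' - expmx (- u *: B^T) *m zeta')))
      (dot w (S *m z eta (t - u))).
    apply: is_derive_eq; first by apply: is_derive_dot D1; exact: mderiv_cst.
    by rewrite dot0l add0r.
  have D3 : is_derive u (1 : R) (fun u => p eta (t - u))
      (dot (S *m z eta (t - u)) (S *m z eta (t - u))).
    have D4 : is_derive u (1 : R) (fun u => t - u) (-1 : R).
      apply: (is_derive_eq (is_deriveB (is_derive_cst0 t u 1) (is_derive_id u 1))).
      by rewrite sub0r.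
    apply: is_derive_eq.
      have H := is_derive1_comp (f := p eta) (g := fun u => t - u).
      exact: (H _ _ _ (is_derive_energy eta (t - u)) D4).
    by rewrite mulrN mulr1 opprK.
  apply: (is_derive_eq (is_deriveB (is_deriveZ 2 D2)
    (is_deriveD (is_deriveZ (dot w w) (is_derive_id u 1))
      (is_deriveB D3 (is_derive_cst0 (p eta t) u 1))))).
  by rewrite /df /GRing.scale/= mulr1 subr0.
have ppos : p eta (t - r) - p eta t <= p eta 0 - p eta t.
  by rewrite lerD2r energy_le// subr_ge0.
have [r00|rn0] := eqVneq r 0.
  by rewrite EY r00 oppr0 expmx0 mul1mx subrr mulmx0 dot0r mul0r.
have rp : 0 < r by rewrite lt_def rn0.
(* This vector maximises 2 <w, Y> - r |w|^2. *)
have := key (r^-1 *: Y); rewrite !dotZl !dotZr => H.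
have {}H : dot Y Y * r^-1 <= p eta 0 - p eta t.
  apply: le_trans ppos.
  move: H; rewrite -lerBlDl; apply: le_trans; rewrite le_eqVlt; apply/orP; left; apply/eqP.
  by field.
by rewrite mulrC -ler_pdivrMr.
Qed.

(** The rows of [lam] recover the coefficients of a polynomial of degree at most [K] from its values
    at the distinct nodes 0, ..., K. *)
Lemma vandermonde_dual (K : nat) : exists lam : 'M[R]_K.+1,
  forall m m' : 'I_K.+1, \sum_(l < K.+1) lam m l * l%:R ^+ m' = (m == m')%:R.
Proof.
pose V : 'M[R]_K.+1 := Vandermonde K.+1 (\row_l l%:R).
have uV : V \in unitmx.
  rewrite unitmxE det_Vandermonde unitfE; apply/prodf_neq0 => i _.
  apply/prodf_neq0 => j ij; rewrite !mxE subr_eq0 eqr_nat.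
  by rewrite gt_eqF.
exists (invmx V^T) => m m'.
have uVT : V^T \in unitmx by rewrite unitmx_tr.
transitivity ((invmx V^T *m V^T) m m'); last by rewrite mulVmx// mxE.
by rewrite [RHS]mxE; apply: eq_bigr => l _; rewrite 3![in RHS]mxE.
Qed.

(* The coefficients of the Taylor expansion in [l] of [S e^{- (l t / K) B^T} zeta'],
   [l = 0, ..., K], are recovered through the dual Vandermonde matrix. *)
Lemma observation_step (K : nat) : exists2 c : R, 0 < c & forall eta t, 0 < t <= 1 ->
  forall j, (j < K)%N ->
  t ^+ j.+1 * `|S *m (B^T ^+ j *m z eta t)| <=
  c * (Num.sqrt (t * (p eta 0 - p eta t)) + t ^+ K.+1 * `|z eta t|).
Proof.
have [lam Hlam] := vandermonde_dual K.
pose L : R := \sum_i \sum_j `|lam i j|.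
have L0 : 0 <= L by apply: sumr_ge0 => i _; apply: sumr_ge0.
pose E := expR (mxsum B^T) * (n%:R * n%:R) * mxsum S * mxsum (invmx B^T).
have E0 : 0 <= E by rewrite !mulr_ge0 ?expR_ge0 ?mxsum_ge0.
(* The first factor dominates K^(j+1) (j+1)! for every j < K, which makes the constant independent
   of [j]. *)
pose c := (K.+1`!%:R * (K.+1%:R ^+ K.+1)) * (L * (E + 1)).
exists (c + 1).
  by rewrite ltr_wpDl// !mulr_ge0 ?exprn_ge0 ?addr_ge0.
move=> eta t /andP[t0 t1] j jK.
set zeta := z eta t; pose zeta' := invmx B^T *m zeta.
have Bz : B^T *m zeta' = zeta by rewrite mulKVmx// drift_unitmx.
set d := p eta 0 - p eta t.
have d0 : 0 <= d by rewrite subr_ge0 energy_le// ltW.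
(* The scaling places the nodes 0, ..., K inside [0, t], where the energy loss is controlled. *)
pose r (l : nat) : R := t * l%:R / K%:R.
have K0 : (0 < K)%N by exact: leq_ltn_trans jK.
have K0' : K%:R != 0 :> R by rewrite pnatr_eq0 -lt0n.
have rb (l : 'I_K.+1) : 0 <= r l <= t.
  rewrite /r divr_ge0 ?mulr_ge0 ?(ltW t0)//= ler_pdivrMr ?ltr0n//.
  by rewrite ler_pM2l// ler_nat -ltnS.
pose Y l := S *m (zeta' - expmx (- r l *: B^T) *m zeta').
have Yle (l : 'I_K.+1) : `|Y l| <= Num.sqrt (t * d).
  rewrite -(ger0_norm (normr_ge0 (Y l))) -sqrtr_sqr ler_wsqrtr//.
  apply: le_trans (sqr_norm_le_dot _) _.
  apply: le_trans (integrated_observation_le (rb l) Bz erefl) _.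
  by rewrite ler_wpM2r//; case/andP: (rb l).
pose Rem l := (expmx (- r l *: B^T) - exp_trunc B^T (- r l) K.+1) *m zeta'.
have Remle (l : 'I_K.+1) : `|S *m Rem l| <= E * (t ^+ K.+1 * `|zeta|).
  have /andP[rl0 rlt] := rb l.
  apply: le_trans (norm_mulmx_le _ _) _.
  apply: (@le_trans _ _ (mxsum S * ((n%:R * n%:R * (t ^+ K.+1 * expR (mxsum B^T))) *
     (mxsum (invmx B^T) * `|zeta|)))).
    rewrite ler_wpM2l ?mxsum_ge0//; apply: le_trans (norm_mulmx_le _ _) _.
    apply: ler_pM; rewrite ?mxsum_ge0//; last exact: norm_mulmx_le.
    rewrite -mulrA /mxsum.
    rewrite (_ : n%:R * _ = \sum_(i < n) \sum_(j < n) (t ^+ K.+1 * expR (mxsum B^T))); last first.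
      by rewrite !sumr_const !card_ord !mulr_natl.
    apply: ler_sum => a _; apply: ler_sum => b _.
    apply: le_trans (exp_taylor _ _ _ _ _) _; rewrite normrN ger0_norm//.
      exact: le_trans t1.
    by rewrite ler_wpM2r ?expR_ge0// lerXn2r// nnegrE ltW.
  by rewrite /E le_eqVlt; apply/orP; left; apply/eqP; ring.
(* The expansion starts from [zeta'], a preimage of [zeta] under B^T: the power j of B^T applied to
   [zeta] is the coefficient of order j + 1. This is the origin of the shift of indices. *)
have scal (m : 'I_K) : \sum_l lam (inord j.+1) l * ((- r l) ^+ m.+1 / m.+1`!%:R) =
    (-1) ^+ m.+1 * (t / K%:R) ^+ m.+1 / m.+1`!%:R * (j == m)%:R.
  have mK : (m.+1 < K.+1)%N by rewrite ltnS.
  have := Hlam (inord j.+1) (inord m.+1); rewrite inordK//.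
  have -> : (inord j.+1 == inord m.+1 :> 'I_K.+1) = (j == m).
    by rewrite -(inj_eq val_inj)/= !inordK.
  move=> <-.
  rewrite mulr_sumr; apply: eq_bigr => l _.
  have -> : - r l = -1 * (t / K%:R) * l%:R by rewrite /r mulN1r mulrAC mulNr.
  by rewrite 2!exprMn mulrA [RHS]mulrCA mulrA [RHS]mulrC !mulrA; ring.
have comb : (t / K%:R) ^+ j.+1 / j.+1`!%:R *: (S *m (B^T ^+ j *m zeta)) =
   (- 1) ^+ j.+1 *: - \sum_(l < K.+1) lam (inord j.+1) l *: (Y l + S *m Rem l).
  (* The constant term of the truncated exponential cancels [zeta'], so only the orders 1, ..., K
     remain. *)
  have YE l : Y l + S *m Rem l =
      - \sum_(m < K) ((- r l) ^+ m.+1 / m.+1`!%:R) *: (S *m (B^T ^+ m *m zeta)).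
    rewrite -mulmxDr /Rem mulmxBl addrA subrK.
    rewrite /exp_trunc big_ord_recl/= fact0 expr0 invr1 mulr1 scale1r expr0.
    rewrite mulmxDl mul1mx opprD addrA subrr add0r.
    rewrite mulmx_suml mulmxN mulmx_sumr; congr (- _); apply: eq_bigr => m _.
    rewrite /bump/= add1n -scalemxAl -scalemxAr mulrC; congr (_ *: (S *m _)).
    by rewrite exprSr -[_ * B^T]/(_ *m B^T) -mulmxA Bz.
  under eq_bigr do rewrite YE scalerN scaler_sumr.
  rewrite sumrN opprK exchange_big/=.
  rewrite (bigD1 (Ordinal jK))//= [X in _ + X]big1 => [|m mj]; last first.
    under eq_bigr do rewrite scalerA.
    rewrite -scaler_suml scal (_ : (j == m) = false) ?mulr0 ?scale0r//.
    by apply/eqP => jm; move: mj; rewrite -(inj_eq val_inj)/= jm eqxx.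
  rewrite addr0; under eq_bigr do rewrite scalerA.
  rewrite -scaler_suml; have := scal (Ordinal jK); rewrite /= eqxx mulr1 => ->.
  by rewrite scalerA !mulrA -exprD -signr_odd addnn odd_double mul1r.
have n1b : (t / K%:R) ^+ j.+1 / j.+1`!%:R * `|S *m (B^T ^+ j *m zeta)| <=
    L * (Num.sqrt (t * d) + E * (t ^+ K.+1 * `|zeta|)).
  have -> : (t / K%:R) ^+ j.+1 / j.+1`!%:R * `|S *m (B^T ^+ j *m zeta)| =
      `|(t / K%:R) ^+ j.+1 / j.+1`!%:R *: (S *m (B^T ^+ j *m zeta))|.
    by rewrite normrZ ger0_norm// divr_ge0// exprn_ge0// divr_ge0// ltW.
  rewrite comb normrZ normrX normrN1 expr1n mul1r normrN.
  rewrite (le_trans (ler_norm_sum _ _ _))//.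
  apply: (@le_trans _ _ (\sum_l `|lam (inord j.+1) l| *
      (Num.sqrt (t * d) + E * (t ^+ K.+1 * `|zeta|)))).
    apply: ler_sum => l _; rewrite normrZ ler_wpM2l//.
    by rewrite (le_trans (ler_normD _ _))// lerD.
  rewrite -mulr_suml ler_wpM2r//.
    by rewrite addr_ge0 ?sqrtr_ge0// mulr_ge0// mulr_ge0// exprn_ge0// ltW.
  rewrite /L [leRHS](bigD1 (inord j.+1))//= lerDl; apply: sumr_ge0 => i _.
  exact: sumr_ge0.
set X := _ * `|_|.
have -> : X = (K%:R ^+ j.+1 * j.+1`!%:R) *
    ((t / K%:R) ^+ j.+1 / j.+1`!%:R * `|S *m (B^T ^+ j *m zeta)|).
  have j0 : j.+1`!%:R != 0 :> R by rewrite pnatr_eq0 -lt0n fact_gt0.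
  rewrite expr_div_n mulrA mulrACA [K%:R ^+ _ * _]mulrCA divff ?expf_neq0// mulr1.
  by rewrite divff// mulr1.
set sq := Num.sqrt _ in n1b *; set X2 := _ * `|zeta| in n1b *.
have sq0 : 0 <= sq by exact: sqrtr_ge0.
have X20 : 0 <= X2 by rewrite mulr_ge0// exprn_ge0// ltW.
apply: (@le_trans _ _ ((K.+1`!%:R * (K.+1%:R ^+ K.+1)) * (L * (sq + E * X2)))).
  apply: ler_pM => //.
  - by rewrite !mulr_ge0// ?invr_ge0// exprn_ge0// divr_ge0// ltW.
  - rewrite mulrC ler_pM ?exprn_ge0//; first by rewrite ler_nat leq_fact// ltnW.
    rewrite -!natrX ler_nat; apply: (@leq_trans (K.+1 ^ j.+1)).
      by rewrite leq_exp2r.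
    by rewrite leq_pexp2l// ltnW.
have M0 : 0 <= (K.+1)`!%:R * K.+1%:R ^+ K.+1 :> R by rewrite mulr_ge0// exprn_ge0.
apply: (@le_trans _ _ (c * (sq + X2))).
  rewrite mulrA (_ : c * _ = (K.+1)`!%:R * K.+1%:R ^+ K.+1 * L * ((E + 1) * (sq + X2))).
    apply: ler_wpM2l; first by rewrite mulr_ge0.
    have EX : 0 <= E * sq by rewrite mulr_ge0.
    rewrite -subr_ge0 (_ : _ - _ = E * sq + X2); last by ring.
    by rewrite addr_ge0.
  by rewrite /c; ring.
by rewrite ler_wpM2r ?addr_ge0// lerDl.
Qed.

(** The Kalman condition bounds |z| by the observed quantities, so the Taylor error of
    [observation_step] is a small multiple of the left-hand sides when t is small, and is absorbed.
    Larger times are reduced to a small one by restarting the orbit. *)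
Lemma observation_le (K : nat) : (0 < K)%N -> injective_up_to S B K.-1 ->
  exists2 c : R, 0 < c & forall eta t, 0 < t <= 1 ->
  forall j, (j < K)%N ->
  t ^+ j.*2.+1 * `|S *m (B^T ^+ j *m z eta t)| ^+ 2 <= c * (p eta 0 - p eta t).
Proof.
move=> K0 inj.
have [c1 c1_gt0 step] := observation_step K.
have [c2 c2_gt0 injle] : exists2 c2 : R, 0 < c2 & forall x : 'cV[R]_n,
    `|x| <= c2 * \sum_(j < K) `|S *m (B^T ^+ j *m x)|.
  (* A discrete observability Gramian; injectivity of the observations makes it invertible. *)
  pose M := \sum_(j < K) (B^T ^+ j)^T *m (S *m S) *m B^T ^+ j.
  have uM : M \in unitmx.
    rewrite -row_free_unit -kermx_eq0; apply/rowV0P => v /sub_kermxP vM.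
    have /(congr1 trmx) : v^T = 0.
      apply: inj => j jK; apply: dot_eq0.
      have : \sum_(j < K) dot (S *m (B^T ^+ j *m v^T)) (S *m (B^T ^+ j *m v^T)) = 0.
        transitivity ((v *m M *m v^T) 0 0); last by rewrite vM mul0mx mxE.
        rewrite mulmx_sumr mulmx_suml summxE; apply: eq_bigr => i _.
        by rewrite dotE !trmx_mul trmxK ST !mulmxA.
      move=> /eqP; rewrite psumr_eq0 => [/allP H|i _]; last exact: dot_ge0.
      have jK' : (j < K)%N by rewrite -(prednK K0) ltnS.
      by have := H (Ordinal jK'); rewrite mem_index_enum => /(_ isT)/eqP.
    by rewrite trmxK trmx0.
  pose m := \sum_(j < K) mxsum (invmx M) * (mxsum (B^T ^+ j)^T * mxsum S).
  have m0 : 0 <= m by apply: sumr_ge0 => j _; rewrite !mulr_ge0 ?mxsum_ge0.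
  exists (m + 1); first by rewrite ltr_wpDl.
  move=> x; rewrite -[X in `|X| <= _](mulKmx uM) (le_trans (norm_mulmx_le _ _))//.
  rewrite mulmx_suml mulr_sumr.
  apply: (@le_trans _ _ (\sum_(j < K) m * `|S *m (B^T ^+ j *m x)|)).
    rewrite -!mulr_sumr.
    apply: (@le_trans _ _ (mxsum (invmx M) * \sum_(i < K) (mxsum (B^T ^+ i)^T * mxsum S) * `|S
        *m (B^T ^+ i *m x)|)).
      rewrite ler_wpM2l ?mxsum_ge0//.
      rewrite (le_trans (ler_norm_sum _ _ _))//; apply: ler_sum => i _.
      rewrite -!mulmxA (le_trans (norm_mulmx_le _ _))// -mulrA ler_wpM2l ?mxsum_ge0//.
      exact: norm_mulmx_le.
    rewrite !mulr_sumr; apply: ler_sum => i _; rewrite mulrA ler_wpM2r//.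
    rewrite /m (bigD1 i)//= lerDl; apply: sumr_ge0 => j _.
    by rewrite !mulr_ge0 ?mxsum_ge0.
  by apply: ler_sum => j _; rewrite ler_wpM2r// lerDl.
(* With these weights the Taylor error t^(K+1) |z| is at most c2 t times t N: since j <= K - 1 and t
   <= 1, each weight is at least t^(K-1). *)
pose N eta t : R := \sum_(j < K) t ^+ j * `|S *m (B^T ^+ j *m z eta t)|.
pose c3 := K%:R * c1.
have c3_gt0 : 0 < c3 by rewrite mulr_gt0// ltr0n.
have Nle eta t : 0 < t <= 1 ->
    t * N eta t <= c3 * Num.sqrt (t * (p eta 0 - p eta t)) + c3 * c2 * t * (t * N eta t).
  move=> /andP[t0 t1].
  have zle : t ^+ K.+1 * `|z eta t| <= c2 * t * (t * N eta t).
    have -> : c2 * t * (t * N eta t) = t ^+ 2 * (c2 * N eta t) by ring.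
    rewrite (_ : K.+1 = (2 + K.-1)%N); last by rewrite add2n prednK.
    rewrite exprD -mulrA ler_wpM2l ?exprn_ge0 ?(ltW t0)//.
    apply: le_trans (_ : t ^+ K.-1 * (c2 * \sum_(j < K) `|S *m (B^T ^+ j *m z eta t)|) <= _).
      by rewrite ler_wpM2l ?exprn_ge0 ?(ltW t0).
    rewrite mulrCA ler_wpM2l ?(ltW c2_gt0)// /N mulr_sumr; apply: ler_sum => j _.
    rewrite ler_wpM2r// -[X in t ^+ X](subnK (_ : j <= K.-1)%N).
      by rewrite exprD ler_piMl ?exprn_ge0 ?(ltW t0)// exprn_ile1// ltW.
    by rewrite -ltnS prednK.
  apply: (@le_trans _ _ (\sum_(j < K) c1 * (Num.sqrt (t * (p eta 0 - p eta t)) + t ^+ K.+1 * `|z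
      eta t|))).
    rewrite /N mulr_sumr; apply: ler_sum => j _.
    by rewrite mulrA -exprS; apply: step; rewrite ?t0.
  rewrite sumr_const card_ord -[leLHS]mulr_natl mulrA -/c3 mulrDr lerD2l.
  have -> : c3 * c2 * t * (t * N eta t) = c3 * (c2 * t * (t * N eta t)) by ring.
  by rewrite ler_wpM2l ?(ltW c3_gt0).
move: (c3) c3_gt0 Nle => {}c3 {}c3_gt0 {}Nle.
(* Chosen to make the absorbed coefficient c3 c2 t at most 1/2 on (0, t0]. *)
pose t0 : R := (1 + 2 * c3 * c2)^-1.
have den : 1 < 1 + 2 * c3 * c2 by rewrite ltrDl !mulr_gt0.
have t0_gt0 : 0 < t0 by rewrite invr_gt0 (lt_trans _ den).
have t0_lt1 : t0 <= 1 by rewrite invf_le1 ?(lt_trans _ den)// ltW.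
have N_ge0 eta t : 0 < t -> 0 <= N eta t.
  by move=> t_gt0; apply: sumr_ge0 => j _; rewrite mulr_ge0// exprn_ge0// ltW.
have small eta t : 0 < t <= t0 ->
    t * N eta t <= 2 * c3 * Num.sqrt (t * (p eta 0 - p eta t)).
  move=> /andP[t_gt0 tt0].
  have := Nle eta t; rewrite t_gt0 (le_trans tt0 t0_lt1) => /(_ isT).
  have : c3 * c2 * t <= 2^-1.
    apply: (@le_trans _ _ (c3 * c2 * t0)); first by rewrite ler_wpM2l// mulr_ge0 ?ltW.
    rewrite /t0 ler_pdivrMr ?(lt_trans _ den)// mulrDr mulr1.
    have : 0 < c3 * c2 by rewrite mulr_gt0.
    lra.
  have : 0 <= t * N eta t by rewrite mulr_ge0 ?N_ge0// ltW.
  set a := t * N _ _; set b := c3 * c2 * t; set e := Num.sqrt _; move=> a0 b2 H.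
  have : b * a <= 2^-1 * a by rewrite ler_wpM2r.
  lra.
have small2 eta t j : 0 < t <= t0 -> (j < K)%N ->
    t ^+ j.*2.+1 * `|S *m (B^T ^+ j *m z eta t)| ^+ 2 <=
    (2 * c3) ^+ 2 * (p eta 0 - p eta t).
  move=> tt jK; have /andP[t_gt0 tt0] := tt.
  have dge : 0 <= p eta 0 - p eta t by rewrite subr_ge0 energy_le// ltW.
  have H : t ^+ j.+1 * `|S *m (B^T ^+ j *m z eta t)| <= 2 * c3 * Num.sqrt (t * (p eta 0 - p eta t)).
    apply: le_trans (small _ _ tt); rewrite exprS -mulrA ler_wpM2l ?(ltW t_gt0)//.
    rewrite /N (bigD1 (Ordinal jK))//= lerDl; apply: sumr_ge0 => i _.
    by rewrite mulr_ge0// exprn_ge0// ltW.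
  have {}H : (t ^+ j.+1 * `|S *m (B^T ^+ j *m z eta t)|) ^+ 2 <=
     (2 * c3 * Num.sqrt (t * (p eta 0 - p eta t))) ^+ 2.
    rewrite lerXn2r// nnegrE ?mulr_ge0 ?exprn_ge0 ?sqrtr_ge0 ?(ltW t_gt0)//.
    exact: ltW.
  rewrite !exprMn sqr_sqrtr in H; last by rewrite mulr_ge0// ltW.
  (* Squaring produces t^(2j+2) on the left and a factor t on the right; cancelling one t leaves the
     odd exponent 2j + 1. *)
  rewrite -(ler_pM2l t_gt0) mulrA -exprS.
  rewrite -exprM muln2 doubleS in H; apply: le_trans H _.
  by rewrite exprMn le_eqVlt; apply/orP; left; apply/eqP; ring.
exists ((2 * c3) ^+ 2 / t0 ^+ K.*2.+1).
  by rewrite divr_gt0 ?exprn_gt0 ?mulr_gt0.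
move=> eta t /andP[t_gt0 t1] j jK.
have dge : 0 <= p eta 0 - p eta t by rewrite subr_ge0 energy_le// ltW.
have c3s : 0 <= (2 * c3) ^+ 2 by exact: sqr_ge0.
have [tt0|tt0] := leP t t0.
  apply: le_trans (small2 eta t j _ jK) _; first by rewrite t_gt0.
  rewrite ler_wpM2r// ler_pdivlMr ?exprn_gt0// ler_piMr// exprn_ile1// ltW//.
(* For t in (t0, 1] only the last stretch of length t0 is used; the energy lost there is at most the
   energy lost since time 0. *)
pose eta1 := z eta (t - t0).
have E1 : z eta1 t0 = z eta t by rewrite /eta1 mulmxA -expmxD addrC subrK.
have E2 : z eta1 0 = z eta (t - t0) by rewrite expmx0 mul1mx.
have := small2 eta1 t0 j; rewrite t0_gt0 lexx => /(_ isT jK).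
rewrite E1 E2 => H.
rewrite mulrAC ler_pdivlMr ?exprn_gt0// mulrC.
apply: (@le_trans _ _ (t0 ^+ j.*2.+1 * `|S *m (B^T ^+ j *m z eta t)| ^+ 2)).
  apply: ler_pM; rewrite ?mulr_ge0 ?exprn_ge0 ?(ltW t0_gt0) ?(ltW t_gt0)//.
    rewrite -[X in t0 ^+ X](subnK (_ : j.*2.+1 <= K.*2.+1)%N).
      by rewrite exprD ler_piMl ?exprn_ge0 ?(ltW t0_gt0)// exprn_ile1// ltW.
    by rewrite ltnS leq_double ltnW.
  by rewrite ler_piMl ?exprn_ge0// exprn_ile1// ltW.
by apply: le_trans H _; rewrite ler_wpM2l// lerD2r energy_le// subr_ge0 ltW.
Qed.

(** A pseudo-inverse decomposes every [xi] of the frequency space linearly along the generators, so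
    <xi, x> is a sum of pairings with the observations of [x], with a constant uniform in [xi]. *)
Lemma freq_space_le k : exists2 c : R, 0 < c & forall xi x,
  (xi^T <= freq_space S B k)%MS ->
  `|dot xi x| <= c * enorm xi * \sum_(j < k.+1) `|S *m (B^T ^+ j *m x)|.
Proof.
have [U_ HU] := sub_sumsmxP (submx_refl (freq_space S B k)).
pose W j : 'M[R]_n := (pinvmx (freq_space S B k) *m U_ j)^T.
pose c := \sum_(j < k.+1) n%:R * mxsum (W j).
have c0 : 0 <= c by apply: sumr_ge0 => j _; rewrite mulr_ge0 ?mxsum_ge0.
exists (c + 1); first by rewrite ltr_wpDl.
move=> xi x Hxi.
have Exi : dot xi x = \sum_(j < k.+1) dot (W j *m xi) (S *m (B^T ^+ j *m x)).
  rewrite dotE -(mulmxKpV Hxi) {2}HU !mulmx_sumr mulmx_suml summxE.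
  apply: eq_bigr => j _; rewrite dotE /W [in RHS]trmx_mul trmxK trmx_mul ST trmx_exp.
  by rewrite !mulmxA.
have xile : `|xi| <= enorm xi.
  rewrite -(ger0_norm (normr_ge0 xi)) -sqrtr_sqr /enorm ler_wsqrtr//.
  exact: sqr_norm_le_dot.
rewrite Exi (le_trans (ler_norm_sum _ _ _))// mulr_sumr; apply: ler_sum => j _.
apply: le_trans (dot_le_norm _ _) _; rewrite mulrA ler_wpM2r//.
apply: (@le_trans _ _ (n%:R * mxsum (W j) * `|xi|)).
  by rewrite -mulrA ler_wpM2l// norm_mulmx_le.
apply: ler_pM => //; first by rewrite mulr_ge0 ?mxsum_ge0.
apply: (@le_trans _ _ c); last by rewrite lerDl.
rewrite /c (bigD1 j)//= lerDl; apply: sumr_ge0 => i _.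
by rewrite mulr_ge0 ?mxsum_ge0.
Qed.

(** The observations of order j <= k cost t^-(2j+1) <= t^-(2k+1) for t <= 1, which gives the rate
    attached to the frequency index. *)
Lemma smoothing_le k0 : injective_up_to S B k0 ->
  exists2 c : R, 0 < c & forall k xi eta t, (k <= k0)%N ->
  (xi^T <= freq_space S B k)%MS -> 0 < t ->
  dot xi (z eta t) ^+ 2 <=
  c * dot xi xi * (if t <= 1 then t ^- k.*2.+1 else 1) * (p eta 0 - p eta t).
Proof.
move=> inj.
have [c1 c1_gt0 obs1] := @observation_le k0.+1 isT inj.
(* The constant of [freq_space_le] depends on [k]; adding the finitely many constants makes it
   uniform up to [k0]. *)
have [c2 c2_gt0 H2] : exists2 c : R, 0 < c & forall k, (k <= k0)%N -> forall xi x,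
  (xi^T <= freq_space S B k)%MS ->
  `|dot xi x| <= c * enorm xi * \sum_(j < k.+1) `|S *m (B^T ^+ j *m x)|.
  elim: (k0) => [|k [c c0 IH]].
    have [c c0 Hc] := freq_space_le 0; exists c => // k.
    by rewrite leqn0 => /eqP ->.
  have [c' c'0 Hc'] := freq_space_le k.+1; exists (c + c').
    by rewrite addr_gt0.
  move=> l; rewrite leq_eqVlt ltnS => /predU1P[-> xi x Hxi|lk xi x Hxi].
    apply: le_trans (Hc' _ _ Hxi) _; rewrite ler_wpM2r//; first exact: sumr_ge0.
    by rewrite ler_wpM2r ?sqrtr_ge0// lerDr ltW.
  apply: le_trans (IH _ lk _ _ Hxi) _; rewrite ler_wpM2r//; first exact: sumr_ge0.
  by rewrite ler_wpM2r ?sqrtr_ge0// lerDl ltW.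
pose c := c2 ^+ 2 * k0.+1%:R ^+ 2 * c1.
have c0 : 0 < c by rewrite !mulr_gt0 ?exprn_gt0 ?ltr0n.
have small k xi eta t : (k <= k0)%N -> (xi^T <= freq_space S B k)%MS ->
    0 < t <= 1 -> t ^+ k.*2.+1 * dot xi (z eta t) ^+ 2 <=
    c * dot xi xi * (p eta 0 - p eta t).
  move=> kk0 Hxi t01; have /andP[t0 t1] := t01.
  set d := p eta 0 - p eta t.
  have d0 : 0 <= d by rewrite subr_ge0 energy_le// ltW.
  pose s := Num.sqrt (t ^+ k.*2.+1).
  have tk0 : 0 <= t ^+ k.*2.+1 by rewrite exprn_ge0// ltW.
  have sj j : (j <= k)%N -> s * `|S *m (B^T ^+ j *m z eta t)| <= Num.sqrt (c1 * d).
    move=> jk; rewrite -[X in s * X]ger0_norm// -sqrtr_sqr -sqrtrM// ler_wsqrtr//.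
    apply: le_trans (obs1 _ _ t01 j _); last by rewrite ltnS (leq_trans jk).
    rewrite ler_wpM2r ?exprn_ge0//.
    rewrite -[X in t ^+ X <= _](subnK (_ : j.*2.+1 <= k.*2.+1)%N).
      by rewrite exprD ler_piMl ?exprn_ge0 ?(ltW t0)// exprn_ile1// ltW.
    by rewrite ltnS leq_double.
  have H : s * `|dot xi (z eta t)| <= c2 * enorm xi * (k0.+1%:R * Num.sqrt (c1 * d)).
    apply: (@le_trans _ _ (s * (c2 * enorm xi * \sum_(j < k.+1) `|S *m (B^T ^+ j *m z eta t)|))).
      by rewrite ler_wpM2l ?sqrtr_ge0// H2.
    rewrite mulrCA ler_wpM2l ?mulr_ge0 ?sqrtr_ge0 ?(ltW c2_gt0)// mulr_sumr.
    apply: (@le_trans _ _ (\sum_(j < k.+1) Num.sqrt (c1 * d))).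
      by apply: ler_sum => j _; apply: sj; rewrite -ltnS.
    by rewrite sumr_const card_ord -[leLHS]mulr_natl ler_wpM2r ?sqrtr_ge0// ler_nat.
  have {}H : (s * `|dot xi (z eta t)|) ^+ 2 <= (c2 * enorm xi * (k0.+1%:R * Num.sqrt (c1 * d)))
      ^+ 2.
    rewrite lerXn2r// nnegrE ?mulr_ge0 ?sqrtr_ge0//; exact: ltW.
  rewrite !exprMn !sqr_sqrtr ?dot_ge0// in H; last by rewrite mulr_ge0// ltW.
  rewrite real_normK ?num_real// in H; apply: le_trans H _.
  by rewrite /c le_eqVlt; apply/orP; left; apply/eqP; ring.
exists c => // k xi eta t kk0 Hxi t0; case: ifPn => [t1|].
  have := small k xi eta t kk0 Hxi; rewrite t0 t1 => /(_ isT) H.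
  by rewrite mulrAC ler_pdivlMr ?exprn_gt0// mulrC.
rewrite -ltNge => t1; rewrite mulr1.
(* For t > 1 the estimate at time 1 is applied to the orbit restarted at t - 1, and the energy at t
   - 1 is at most the initial one. *)
pose eta1 := z eta (t - 1).
have E1 : z eta1 1 = z eta t by rewrite /eta1 mulmxA -expmxD addrC subrK.
have E2 : z eta1 0 = z eta (t - 1) by rewrite expmx0 mul1mx.
have := small k xi eta1 1 kk0 Hxi; rewrite ltr01 lexx => /(_ isT).
rewrite E1 E2 expr1n mul1r => H; apply: le_trans H _.
apply: ler_wpM2l; first by rewrite mulr_ge0 ?dot_ge0// ltW.
by rewrite lerD2r energy_le// subr_ge0 ltW.
Qed.

End lyapunov.

(** * Integration by parts in R^n *)

Section continuous_measurable.
Context {R : realType}.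

Lemma coord_ball n (x y : 'cV[R]_n) (e : R) : 0 < e ->
  (forall i, `|x i 0 - y i 0| < e) -> ball x e y.
Proof. by move=> e0 H; split => // i j; rewrite (ord1 j); exact: H. Qed.

Definition box n (x : 'cV[R]_n) (e : R) : set 'cV[R]_n :=
  [set y | forall i, `|x i 0 - y i 0| < e].

Lemma measurable_box n (x : 'cV[R]_n) e : measurable (box x e).
Proof.
have -> : box x e = \bigcap_(i in [set: 'I_n]) ((fun y : 'cV[R]_n => y i 0) @^-1` ball (x i 0) e).
  by apply/seteqP; split => y H i; [move=> _; exact: H | exact: (H i I)].
apply: fin_bigcap_measurable; first exact: finite_finset.
move=> i _; rewrite -[X in measurable X]setTI; apply: measurable_coord => //.
exact: measurable_ball.
Qed.

(** The sigma-algebra is generated by coordinates, not by open sets. Second countability links the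
    two: an open set is a union of rational boxes, enumerated here by [unpickle]. *)
Lemma open_Rn_measurable n (U : set 'cV[R]_n) : open U -> measurable U.
Proof.
move=> oU.
pose F (m : nat) : set 'cV[R]_n :=
  if @unpickle ('cV[rat]_n * nat)%type m is Some (q, k)
  then if `[< box (map_mx ratr q) (k.+1%:R^-1) `<=` U >]
       then box (map_mx ratr q) (k.+1%:R^-1) else set0
  else set0.
have -> : U = \bigcup_m F m.
  apply/seteqP; split => [x Ux|x [m _]]; last first.
    rewrite /F; case: (unpickle m) => [[q k]|//].
    by case: ifPn => // /asboolP; apply.
  have := oU x Ux => /nbhs_ballP[e /= e0 xU].
  (* A box of radius 1/(k+1) around a rational point that is 1/(k+1)-close to [x] stays within
     2/(k+1) of [x]. *)
  have [k ke] : exists k : nat, 2 * k.+1%:R^-1 < e.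
    have [k _ ke] := near_infty_natSinv_lt (PosNum (divr_gt0 e0 (ltr0n R 2))).
    exists k; have := ke k (leqnn k).
    by rewrite /= ltr_pdivlMr// mulrC.
  have k0 : 0 < k.+1%:R^-1 :> R by rewrite invr_gt0.
  have [q Hq] : exists q : 'cV[rat]_n, forall i, `|ratr (q i 0) - x i 0| < k.+1%:R^-1.
    have Hex i : exists r : rat, `|ratr r - x i 0| < k.+1%:R^-1.
      have : x i 0 - k.+1%:R^-1 < x i 0 + k.+1%:R^-1 by rewrite ltrD2l gt0_cp.
      move=> /rat_in_itvoo[r]; rewrite in_itv/= => /andP[r1 r2]; exists r.
      by rewrite ltr_norml ltrBrDl r1/= ltrBlDl.
    exists (\col_i projT1 (cid (Hex i))) => i; rewrite mxE.
    exact: projT2 (cid (Hex i)).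
  exists (pickle (q, k)) => //; rewrite /F pickleK.
  case: ifPn => [_|/asboolPn]; first by move=> i /=; rewrite mxE; exact: Hq.
  case; move=> y By; apply: xU; apply: coord_ball => // i.
  apply: (@lt_trans _ _ (2 * k.+1%:R^-1)) => //.
  rewrite mulrDl !mul1r -(subrK (ratr (q i 0)) (x i 0)) -addrA.
  apply: le_lt_trans (ler_normD _ _) _; apply: ltrD.
    by rewrite distrC; exact: Hq.
  by have := By i; rewrite mxE.
apply: bigcupT_measurable => m; rewrite /F.
case: (unpickle m) => [[q k]|]; last exact: measurable0.
by case: ifPn => _; [exact: measurable_box|exact: measurable0].
Qed.

Lemma continuous_Rn_measurable n (f : 'cV[R]_n -> R) :
  continuous f -> measurable_fun setT f.
Proof.
move=> cf; apply: (measurability (@RGenOInfty.G R)).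
  by rewrite /measurable/= /measurableR RGenOInfty.measurableE.
move=> _ [_ [x ->] <-]; rewrite setTI; apply: open_Rn_measurable.
by move/continuousP : cf; apply; rewrite set_itvE; exact: open_gt.
Qed.

End continuous_measurable.

Section lebesgue_cube.
Context {R : realType}.

Definition cube n (M : R) : set 'cV[R]_n := [set x | forall i, `|x i 0| <= M].

Lemma measurable_cube n M : measurable (@cube n M).
Proof.
have -> : @cube n M = \bigcap_(i in [set: 'I_n]) ((fun y : 'cV[R]_n => y i 0) @^-1` `[- M,
    M]%classic).
  apply/seteqP; split => y H i.
    by move=> _; rewrite /= in_itv/= -ler_norml; exact: H.
  by have := H i I; rewrite /= in_itv/= -ler_norml.
apply: fin_bigcap_measurable; first exact: finite_finset.
by move=> i _; rewrite -[X in measurable X]setTI; apply: measurable_coord.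
Qed.

Lemma Rn_consE0 n a (v : 'cV[R]_n) : Rn_cons (a, v) ord0 0 = a.
Proof. by rewrite -[LHS]/((Rn_uncons (Rn_cons (a, v))).1) Rn_consK. Qed.

Lemma Rn_consES n a (v : 'cV[R]_n) i : Rn_cons (a, v) (lift ord0 i) 0 = v i 0.
Proof.
have -> : lift ord0 i = rshift 1 (i : 'I_n) :> 'I_(1 + n) by apply/val_inj.
exact: (col_mxEd (const_mx a : 'M[R]_(1, 1)) v i 0).
Qed.

Lemma lebesgue_cube_lty n (M : R) : (@lebesgue_Rn R n (@cube n M) < +oo)%E.
Proof.
elim: n => [|n IH] /=; first by rewrite diracE ltry.
rewrite /prepend_measure /pushforward.
have -> : @Rn_cons R n @^-1` @cube n.+1 M = `[- M, M]%classic `*` @cube n M.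
  apply/seteqP; split => -[a v] /=.
    move=> H; split; first by rewrite /= in_itv/= -ler_norml; have := H ord0; rewrite Rn_consE0.
    by move=> i; have := H (lift ord0 i); rewrite Rn_consES.
  move=> [/=]; rewrite in_itv/= -ler_norml => aM vM i.
  case: (unliftP ord0 i) => [j ->|->]; first by rewrite Rn_consES; exact: vM.
  by rewrite Rn_consE0.
rewrite product_measure1E//; last exact: measurable_cube.
rewrite /= lebesgue_measure_itv/=; case: ifPn => MM; last by rewrite mul0e ltry.
by rewrite lte_mul_pinfty// -EFinD lee_fin subr_ge0 ltW// -lte_fin.
Qed.

(** Lebesgue measure in dimension n + 1 is a pushforward of a product; the formula for nonnegative
    functions is extended by splitting into positive and negative parts. *)
Lemma integrable_lebesgue_cons n (f : 'cV[R]_n.+1 -> \bar R) :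
  (@lebesgue_Rn R n.+1).-integrable setT f ->
  (lebesgue_measure \x @lebesgue_Rn R n)%E.-integrable setT (f \o @Rn_cons R n) /\
  (\int[@lebesgue_Rn R n.+1]_x f x =
   \int[(lebesgue_measure \x @lebesgue_Rn R n)%E]_z f (Rn_cons z))%E.
Proof.
move=> /integrableP[mf foo].
have mc := @measurable_Rn_cons R n.
have eqm g : (forall x, 0 <= g x)%E -> measurable_fun setT g ->
    (\int[@lebesgue_Rn R n.+1]_x g x =
   \int[(lebesgue_measure \x @lebesgue_Rn R n)%E]_z g (Rn_cons z))%E.
  move=> g0 mg.
  rewrite [LHS](_ : _ = (\int[pushforward (lebesgue_measure \x @lebesgue_Rn R n) (@Rn_cons R
      n)]_x g x)%E)//.
  by rewrite ge0_integral_pushforward.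
have I : (lebesgue_measure \x @lebesgue_Rn R n)%E.-integrable setT (f \o @Rn_cons R n).
  apply/integrableP; split; first exact: measurableT_comp.
  by rewrite -(eqm (fun x => `|f x|)%E)//; exact: measurableT_comp.
split => //.
rewrite integralE [RHS]integralE eqm//; last exact: measurable_funepos.
rewrite eqm//; last exact: measurable_funeneg.
congr (_ - _)%E; apply: eq_integral => z _.
  by rewrite -[LHS]/((f^\+ \o @Rn_cons R n)%E z) -funepos_comp.
by rewrite -[LHS]/((f^\- \o @Rn_cons R n)%E z) -funeneg_comp.
Qed.

End lebesgue_cube.

(** * Partial derivatives and functions with bounded support *)

Section directional_derivative.
Context {R : realType}.

(** A directional derivative only sees the restriction to a line. This transfers derivatives between
    spaces of different dimension, in particular when a coordinate is split off. *)
Lemma is_derive_line (V1 V2 W : normedModType R) (x v : V1) (y w : V2)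
    (f : V1 -> W) (g : V2 -> W) d :
  (forall h : R, f (h *: v + x) = g (h *: w + y)) ->
  is_derive x v f d -> is_derive y w g d.
Proof.
move=> fg [fd df].
have E : (fun h => h^-1 *: ((f \o shift x) (h *: v) - f x)) =
    (fun h => h^-1 *: ((g \o shift y) (h *: w) - g y)).
  apply/funext => h; congr (_ *: _); congr (_ - _); first exact: fg.
  by have := fg 0; rewrite !scale0r !add0r.
split; first by rewrite /derivable -E.
by rewrite -df /derive E.
Qed.

Lemma is_derive_comp_R (V : normedModType R) (x v : V) (f : V -> R) (phi : R -> R) d p :
  is_derive (f x) (1 : R) phi p -> is_derive x v f d ->
  is_derive x v (fun y => phi (f y)) (p * d).
Proof.
move=> Hphi Hf.
have H1 : is_derive (0 : R) (1 : R) (fun h => f (h *: v + x)) d.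
  apply: is_derive_line Hf => h.
  by rewrite /= addr0 /GRing.scale/= mulr1.
have H2 := is_derive1_comp (f := phi) (g := fun h => f (h *: v + x)).
have {}H2 : is_derive (0 : R) (1 : R) (phi \o (fun h => f (h *: v + x))) (p * d).
  by apply: H2 => //; rewrite scale0r add0r.
apply: is_derive_line H2 => h.
by rewrite /= addr0 /GRing.scale/= mulr1.
Qed.

Context {n : nat}.
Local Notation Rn := 'cV[R]_n.

Definition c1 (i : 'I_n) (f df : Rn -> R) :=
  [/\ continuous f, continuous df &
      forall x, is_derive x (delta_mx i 0 : Rn) f (df x)].

(** Support in a cube rather than in a ball: slices of cubes are cubes, as Fubini requires. *)
Definition bounded_supp (f : Rn -> R) :=
  exists M : R, forall x, ~ cube M x -> f x = 0.

Lemma c1_eq i f df g dg : c1 i f df -> f =1 g -> df =1 dg -> c1 i g dg.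
Proof. by move=> ? /funext <- /funext <-. Qed.

Lemma c1_cst i (a : R) : c1 i (fun=> a) (fun=> 0).
Proof. by split; [exact: cst_continuous|exact: cst_continuous|move=> x; exact: is_derive_cst0]. Qed.

Lemma c1D i f df g dg : c1 i f df -> c1 i g dg ->
  c1 i (fun x => f x + g x) (fun x => df x + dg x).
Proof.
move=> [cf cdf Df] [cg cdg Dg]; split.
- by move=> x; exact: (continuousD (cf x) (cg x)).
- by move=> x; exact: (continuousD (cdf x) (cdg x)).
- by move=> x; exact: is_deriveD.
Qed.

Lemma c1M i f df g dg : c1 i f df -> c1 i g dg ->
  c1 i (fun x => f x * g x) (fun x => f x * dg x + df x * g x).
Proof.
move=> [cf cdf Df] [cg cdg Dg]; split.
- by move=> x; exact: (continuousM (cf x) (cg x)).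
- move=> x.
  exact: (continuousD (continuousM (cf x) (cdg x)) (continuousM (cdf x) (cg x))).
- move=> x; apply: (is_derive_eq (is_deriveM (Df x) (Dg x))).
  by rewrite /GRing.scale/= [_ * df x]mulrC.
Qed.

Lemma c1_comp i f df (phi dphi : R -> R) : c1 i f df ->
  continuous phi -> continuous dphi ->
  (forall x : R, is_derive x (1 : R) phi (dphi x)) ->
  c1 i (fun x => phi (f x)) (fun x => dphi (f x) * df x).
Proof.
move=> [cf cdf Df] cphi cdphi Dphi; split.
- by move=> x; apply: (@continuous_comp _ _ _ f phi); [exact: cf|exact: cphi].
- move=> x; apply: (@continuousM _ _ (fun x => dphi (f x))); last exact: cdf.
  by apply: (@continuous_comp _ _ _ f dphi); [exact: cf|exact: cdphi].
- by move=> x; exact: is_derive_comp_R.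
Qed.

Lemma c1_coord i (j : 'I_n) : c1 i (fun x => x j 0) (fun=> (i == j)%:R).
Proof.
split; [exact: coord_continuous|exact: cst_continuous|move=> x].
have H : is_derive (x j 0) (1 : R) (fun h : R => x j 0 + (h - x j 0) * (i == j)%:R) (i == j)%:R.
  rewrite (_ : (fun h : R => _) = cst (x j 0 - x j 0 * (i == j)%:R) + ((i == j)%:R \*o id)).
    apply: is_derive_eq.
    by rewrite add0r /GRing.scale/= mulr1.
  by apply/funext => h; rewrite /= !fctE /=; ring.
apply: is_derive_line H => h; rewrite !mxE /= /GRing.scale/= mulr1.
by rewrite addrK addrC eq_sym andbT.
Qed.

Lemma c1_sum i (I : finType) (f df : I -> Rn -> R) :
  (forall j, c1 i (f j) (df j)) ->
  c1 i (fun x => \sum_j f j x) (fun x => \sum_j df j x).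
Proof.
move=> H; elim: (index_enum I) => [|j r IH].
  by apply: c1_eq (c1_cst i 0) _ _ => x; rewrite big_nil.
by apply: c1_eq (c1D (H j) IH) _ _ => x; rewrite big_cons.
Qed.

Lemma c1Z i (a : R) f df : c1 i f df -> c1 i (fun x => a * f x) (fun x => a * df x).
Proof.
by move=> H; apply: c1_eq (c1M (c1_cst i a) H) _ _ => x //; rewrite mul0r addr0.
Qed.

Lemma c1_dot i (y : Rn) : c1 i (fun x => dot y x) (fun=> y i 0).
Proof.
apply: c1_eq (c1_sum (fun j => c1Z (y j 0) (c1_coord i j))) _ _ => x //.
rewrite (bigD1 i)//= eqxx mulr1 big1 ?addr0// => j ji.
by rewrite eq_sym (negbTE ji) mulr0.
Qed.

Lemma c1_measurable i f df : c1 i f df -> measurable_fun setT f /\ measurable_fun setT df.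
Proof. by move=> [cf cdf _]; split; exact: continuous_Rn_measurable. Qed.

(** Outside a cube one coordinate strictly exceeds the bound and still does so after a small
    displacement, so the difference quotients vanish. *)
Lemma bounded_supp_deriv i f df : c1 i f df -> bounded_supp f -> bounded_supp df.
Proof.
move=> [cf cdf Df] [M fM]; exists M => x xM.
have [j xj] : exists j, M < `|x j 0|.
  by apply/not_existsP => H; apply: xM => j; rewrite leNgt; apply/negP; exact: H.
suff : (fun h : R => h^-1 *: ((f \o shift x) (h *: delta_mx i 0) - f x)) @ 0^' --> (0 : R).
  by move=> H; have [_ <-] := Df x; exact/cvg_lim.
apply: cvg_near_cst; near=> h.
rewrite (fM x xM) subr0 /= fM ?scaler0// => H.
have := H j; rewrite !mxE leNgt => /negP; apply.
rewrite addrC; apply: lt_le_trans (lerB_normD _ _); rewrite ltrBrDr -ltrBrDl.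
rewrite normrM; apply: (@le_lt_trans _ _ `|h|).
  by rewrite ler_piMr//; case: (_ && _); rewrite ?normr1 ?normr0.
near: h; apply: dnbhs0_lt; by rewrite subr_gt0.
Unshelve. all: by end_near. Qed.

Lemma continuous_cube_bounded (f : Rn -> R) (M : R) : continuous f ->
  exists C : R, forall x : Rn, cube M x -> `|f x| <= C.
Proof.
move=> cf.
have cT : continuous (fun v : 'rV[R]_n => v^T).
  move=> v s /= /nbhs_ballP[e e0 es]; apply/nbhs_ballP; exists e => //= w [_ vw].
  by apply: es; split => // i j; rewrite !mxE; exact: vw.
have cK : compact [set v : 'rV[R]_n | cube M v^T].
  apply: bounded_closed_compact.
    exists `|M|; split; first exact: num_real.
    move=> y My v vM /=.
    rewrite /Num.norm/= mx_normrE; apply/bigmax_leP; split.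
      by rewrite (le_trans _ (ltW My)).
    move=> [i j] _ /=; rewrite (ord1 i); have := vM j; rewrite mxE => H.
    by rewrite (le_trans H)// (le_trans (ler_norm M))// ltW.
  rewrite (_ : [set v : 'rV[R]_n | cube M v^T] =
      \bigcap_(i in [set: 'I_n]) [set v : 'rV[R]_n | `|v 0 i| <= M]).
    apply: closed_bigI => i _.
    apply: (@closed_comp _ _ (fun v : 'rV[R]_n => `|v 0 i|) [set r | r <= M]).
      move=> v _; apply: (@continuous_comp _ _ _ (fun v : 'rV[R]_n => v 0 i)).
        exact: coord_continuous.
      exact: norm_continuous.
    exact: closed_le.
  apply/seteqP; split => v H i; first by move=> _; have := H i; rewrite mxE.
  by have := H i I; rewrite mxE.
have : compact ((fun v => f v^T) @` [set v : 'rV[R]_n | cube M v^T]).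
  apply: continuous_compact => //; apply: continuous_subspaceT => v.
  by apply: continuous_comp; [exact: cT|exact: cf].
move=> /compact_bounded[C [_ HC]]; exists (C + 1) => x xM.
by apply: (HC (C + 1)); [rewrite ltrDl|exists x^T => /=; rewrite ?trmxK].
Qed.

Lemma bounded_supp_bounded (f : Rn -> R) : continuous f -> bounded_supp f ->
  exists C : R, forall x, `|f x| <= C.
Proof.
move=> cf [M fM]; have [C HC] := continuous_cube_bounded M cf.
exists (Num.max C 0) => x; have [xM|xM] := pselect (cube M x).
  by rewrite le_max HC.
by rewrite (fM x xM) normr0 le_max lexx orbT.
Qed.

Lemma bounded_supp_integrable (f : Rn -> R) : continuous f -> bounded_supp f ->
  (@lebesgue_Rn R n).-integrable setT (EFin \o f).
Proof.
move=> cf sf; have [C HC] := bounded_supp_bounded cf sf.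
have [M fM] := sf.
have I : (@lebesgue_Rn R n).-integrable (cube M) (EFin \o f).
  apply: measurable_bounded_integrable; first exact: measurable_cube.
  - exact: lebesgue_cube_lty.
  - by apply: measurable_funS (continuous_Rn_measurable cf).
  - exists C; split; first exact: num_real.
    by move=> y Cy x _; exact: le_trans (HC x) (ltW Cy).
have := (integrable_mkcond (EFin \o f) (measurable_cube M)).1 I.
apply: eq_integrable => // x _; rewrite /= patchE; case: ifPn => //.
by move/negP; rewrite inE => /fM /= ->.
Qed.

End directional_derivative.

Section integration_by_parts.
Context {R : realType}.

Lemma bounded_suppD n (f g : 'cV[R]_n -> R) : bounded_supp f -> bounded_supp g ->
  bounded_supp (fun x => f x + g x).
Proof.
move=> [M fM] [N gN]; exists (Num.max M N) => x xMN; rewrite fM ?gN ?addr0//.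
  by move=> xN; apply: xMN => i; rewrite le_max xN orbT.
by move=> xM; apply: xMN => i; rewrite le_max xM.
Qed.

Lemma bounded_suppMl n (f g : 'cV[R]_n -> R) : bounded_supp f ->
  bounded_supp (fun x => f x * g x).
Proof. by move=> [M fM]; exists M => x /fM ->; rewrite mul0r. Qed.

Lemma bounded_suppMr n (f g : 'cV[R]_n -> R) : bounded_supp g ->
  bounded_supp (fun x => f x * g x).
Proof. by move=> [M fM]; exists M => x /fM ->; rewrite mulr0. Qed.

Lemma integral_deriv_R (f df : R -> R) (M : R) : continuous df ->
  (forall x : R, is_derive x (1 : R) f (df x)) ->
  (forall x, M < `|x| -> f x = 0) ->
  (\int[lebesgue_measure]_x (df x)%:E = 0)%E.
Proof.
move=> cdf Df f0.
(* Strictly beyond [M], so that [f] vanishes at both ends of [-N, N]. *)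
pose N : R := `|M| + 1.
have N0 : 0 < N by rewrite ltr_wpDl.
have MN : M < N by rewrite (le_lt_trans (ler_norm M))// ltrDl.
have df0 x : M < `|x| -> df x = 0.
  move=> Mx; have [_ <-] := Df x; apply/cvg_lim => //.
  apply: cvg_near_cst; near=> h.
  rewrite (f0 _ Mx) subr0 /= f0 ?scaler0// addrC.
  apply: lt_le_trans (lerB_normD _ _); rewrite ltrBrDr -ltrBrDl.
  rewrite /GRing.scale/= mulr1; near: h; apply: dnbhs0_lt; by rewrite subr_gt0.
transitivity (\int[lebesgue_measure]_(x in `[(- N)%R, N]%classic) (df x)%:E)%E.
  rewrite [RHS]integral_mkcond/=; apply: eq_integral => x _.
  rewrite patchE; case: ifPn => // /negP; rewrite inE/= in_itv/= -ler_norml.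
  by move=> /negP; rewrite -ltNge => /(lt_trans MN) /df0 ->.
have cf : continuous f.
  move=> x; apply: differentiable_continuous; apply/derivable1_diffP.
  by have [] := Df x.
rewrite (@continuous_FTC2 _ df f).
- by rewrite !f0 ?normrN ?gtr0_norm// subee.
- by rewrite gt0_cp.
- exact: continuous_subspaceT.
- split.
  + by move=> x _; have [] := Df x.
  + by apply: cvg_at_right_filter; exact: cf.
  + by apply: cvg_at_left_filter; exact: cf.
- by move=> x _; rewrite derive1E; have [_] := Df x.
Unshelve. all: by end_near. Qed.

Lemma continuous_Rn_consl n (v : 'cV[R]_n) : continuous (fun a : R => Rn_cons (a, v)).
Proof.
move=> a s /= /nbhs_ballP[e e0 es].
apply/nbhs_ballP; exists e => // b ab; apply: es.
apply: coord_ball => // i; case: (unliftP ord0 i) => [j ->|->].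
  by rewrite !Rn_consES subrr normr0.
by rewrite !Rn_consE0.
Qed.

Lemma continuous_Rn_consr n (a : R) : continuous (fun v : 'cV[R]_n => Rn_cons (a, v)).
Proof.
move=> v s /= /nbhs_ballP[e e0 es].
apply/nbhs_ballP; exists e => // w [_ vw]; apply: es.
apply: coord_ball => // i; case: (unliftP ord0 i) => [j ->|->].
  by rewrite !Rn_consES; exact: vw.
by rewrite !Rn_consE0 subrr normr0.
Qed.

Lemma cons_scale_delta0 n (h a : R) (v : 'cV[R]_n) :
  h *: delta_mx ord0 0 + Rn_cons (a, v) = Rn_cons (h *: 1 + a, v).
Proof.
apply/colP => i; rewrite [LHS]mxE [X in X + _]mxE [X in _ * X + _]mxE.
case: (unliftP ord0 i) => [j ->|->]; first by rewrite !Rn_consES /= mulr0 add0r.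
by rewrite !Rn_consE0 eqxx.
Qed.

Lemma cons_scale_deltaS n (h a : R) (v : 'cV[R]_n) (i : 'I_n) :
  h *: delta_mx (lift ord0 i) 0 + Rn_cons (a, v) = Rn_cons (a, h *: delta_mx i 0 + v).
Proof.
apply/colP => k; rewrite [LHS]mxE [X in X + _]mxE [X in _ * X + _]mxE.
case: (unliftP ord0 k) => [j ->|->].
  by rewrite !Rn_consES !mxE (inj_eq lift_inj).
by rewrite !Rn_consE0 /= mulr0 add0r.
Qed.

(** Induction on the dimension with Fubini: if [i] is the first coordinate, the inner integral is
    taken in that coordinate and vanishes by the one-dimensional case; otherwise the first
    coordinate is frozen and the induction hypothesis applies. *)
Lemma integral_deriv_Rn n (i : 'I_n) (f df : 'cV[R]_n -> R) :
  c1 i f df -> bounded_supp f ->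
  (\int[@lebesgue_Rn R n]_x (df x)%:E = 0)%E.
Proof.
elim: n i f df => [[]//|n IH] i f df Hf sf.
have [cf cdf Df] := Hf.
have sdf := bounded_supp_deriv Hf sf.
have [If ->] := integrable_lebesgue_cons (bounded_supp_integrable cdf sdf).
have [M fM] := sf.
case: (unliftP ord0 i) => [j ij|i0]; last first.
  rewrite -(@integral21_prod_meas1 _ _ _ _ _ lebesgue_measure (@lebesgue_Rn R n) (fun z => (df
      (Rn_cons z))%:E))//.
  apply: integral0_eq => v _; rewrite /fubini_G.
  apply: (@integral_deriv_R (fun a => f (Rn_cons (a, v))) _ M).
  - move=> a; apply: (@continuous_comp _ _ _ (fun a => Rn_cons (a, v)) df); last exact: cdf.
    exact: continuous_Rn_consl.
  - move=> a; have := Df (Rn_cons (a, v)); rewrite i0; apply: is_derive_line => h.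
    by rewrite cons_scale_delta0.
  - move=> a Ma; apply: fM => H; have := H ord0; rewrite Rn_consE0.
    by rewrite leNgt Ma.
rewrite -(@integral12_prod_meas1 _ _ _ _ _ lebesgue_measure (@lebesgue_Rn R n) (fun z => (df
    (Rn_cons z))%:E))//.
apply: integral0_eq => a _; rewrite /fubini_F.
have cc := @continuous_Rn_consr n a.
apply: (IH j (fun v => f (Rn_cons (a, v)))).
  split.
  - by move=> v; apply: (@continuous_comp _ _ _ (fun v => Rn_cons (a, v)) f); [exact: cc|exact: cf].
  - by move=> v; apply: (@continuous_comp _ _ _ (fun v => Rn_cons (a, v)) df); [exact: cc|exact:
      cdf].
  - move=> v; have := Df (Rn_cons (a, v)); rewrite ij; apply: is_derive_line => h.
    by rewrite cons_scale_deltaS.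
exists M => v vM; apply: fM => H; apply: vM => k.
by have := H (lift ord0 k); rewrite Rn_consES.
Qed.

End integration_by_parts.

(** * Integrable real functions and dominated convergence *)

Section real_integrals.
Context d {T : measurableType d} {R : realType} (mu : {measure set T -> \bar R}).
Implicit Types f g : T -> R.

Local Notation integrableR f := (mu.-integrable setT (EFin \o f)).

Lemma integrableR_dom f g : measurable_fun setT f ->
  (forall x, `|f x| <= g x) -> integrableR g -> integrableR f.
Proof.
move=> mf fg ig; apply: le_integrable ig => //; first exact/measurable_EFinP.
by move=> x _; rewrite lee_fin (le_trans (fg x))// ler_norm.
Qed.

Lemma integrableRD f g : integrableR f -> integrableR g ->
  integrableR (fun x => f x + g x).
Proof. by move=> hf hg; apply: eq_integrable (integrableD _ hf hg). Qed.

Lemma integrableRZ a f : integrableR f -> integrableR (fun x => a * f x).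
Proof. by move=> hf; apply: eq_integrable (integrableZl _ a hf). Qed.

Lemma integrableRB f g : integrableR f -> integrableR g ->
  integrableR (fun x => f x - g x).
Proof.
move=> hf hg; apply: eq_integrable (integrableRD hf (integrableRZ (-1) hg)) => //.
by move=> x _; rewrite /= mulN1r.
Qed.

Lemma integrableR_norm f : integrableR f -> integrableR (fun x => `|f x|).
Proof. exact: integrable_norm. Qed.

Lemma integrableR_measurable f : integrableR f -> measurable_fun setT f.
Proof. by move=> hf; apply/measurable_EFinP; exact: measurable_int hf. Qed.

Lemma integrableR_sum (I : Type) (r : seq I) (f : I -> T -> R) :
  (forall i, integrableR (f i)) -> integrableR (fun x => \sum_(i <- r) f i x).
Proof.
move=> H; elim: r => [|i r IH].
  by apply: eq_integrable (integrable0 mu setT) => // x _; rewrite /= big_nil.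
by apply: eq_integrable (integrableRD (H i) IH) => // x _; rewrite /= big_cons.
Qed.

Lemma RintegralR_sum (I : Type) (r : seq I) (f : I -> T -> R) :
  (forall i, integrableR (f i)) ->
  \int[mu]_x (\sum_(i <- r) f i x) = \sum_(i <- r) \int[mu]_x f i x.
Proof.
move=> H; elim: r => [|i r IH].
  rewrite big_nil; under eq_Rintegral do rewrite big_nil.
  by rewrite /Rintegral integral0.
under eq_Rintegral do rewrite big_cons.
by rewrite RintegralD// ?IH ?big_cons//; exact: integrableR_sum.
Qed.

Lemma EFin_RintegralT f : integrableR f ->
  (\int[mu]_x (f x)%:E)%E = (\int[mu]_x f x)%:E.
Proof. by move=> hf; rewrite /Rintegral fineK//; exact: integrable_fin_num. Qed.

Lemma Rintegral_cvg_dom (f_ : nat -> T -> R) f g :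
  (forall k, measurable_fun setT (f_ k)) ->
  (forall x, f_ ^~ x @ \oo --> f x) ->
  (forall k x, `|f_ k x| <= g x) -> integrableR g ->
  integrableR f /\ (fun k => \int[mu]_x f_ k x) @ \oo --> \int[mu]_x f x.
Proof.
move=> mf ff fg ig.
have mff : measurable_fun setT f.
  by apply: (measurable_fun_cvg (fun k => mf k)) => x _; exact: ff.
have If : integrableR f.
  apply: integrableR_dom ig => // x.
  have H : (fun k => `|f_ k x|) @ \oo --> `|f x| by apply: cvg_norm; exact: ff.
  rewrite -(cvg_lim _ H)//; apply: limr_le; first by apply/cvg_ex; eexists; exact: H.
  by apply: nearW => k; exact: fg.
split => //.
have A1 k : measurable_fun setT (EFin \o f_ k) by exact/measurable_EFinP.
have A2 : measurable_fun setT (EFin \o f) by exact/measurable_EFinP.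
have A3 : {ae mu, forall x, [set: T] x -> (EFin \o f_ k) x @[k --> \oo] --> (EFin \o f) x}.
  by apply: aeW => x _; apply: cvg_EFin; [exact: nearW|exact: ff].
have A4 : {ae mu, forall x k, [set: T] x -> (`|(EFin \o f_ k) x| <= (EFin \o g) x)%E}.
  by apply: aeW => x k _; rewrite /= lee_fin.
have [_ _ H] := dominated_convergence measurableT A1 A2 A3 ig A4.
apply: fine_cvg; rewrite fineK//; exact: integrable_fin_num.
Qed.

Lemma ge0_integrableR_bounded f (c : R) : measurable_fun setT f ->
  (forall x, 0 <= f x) -> (\int[mu]_x (f x)%:E <= c%:E)%E -> integrableR f.
Proof.
move=> mf f0 fc; apply/integrableP; split; first exact/measurable_EFinP.
apply: le_lt_trans (ltry c); under eq_integral do rewrite /= ger0_norm//.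
exact: fc.
Qed.

End real_integrals.

Section density.
Context d {T : measurableType d} {R : realType}.
Variables (mu : probability T R) (nu : {sigma_finite_measure set T -> \bar R}).
Variable rho : T -> R.
Hypotheses (mrho : measurable_fun setT rho) (rho_ge0 : forall x, 0 <= rho x).
Hypothesis density : forall A, measurable A ->
  mu A = (\int[nu]_(x in A) (rho x)%:E)%E.

Lemma density_dominates : mu `<< nu.
Proof.
apply/null_content_dominatesP => A mA nuA; rewrite density//.
by apply: null_set_integral => //; apply/measurable_EFinP/measurable_funTS.
Qed.

(** The density is known on sets only. It agrees almost everywhere with the Radon-Nikodym
    derivative, because both have the same integrals over measurable sets, and the change of
    variables for the latter covers functions. *)
Lemma integral_density (f : T -> R) : mu.-integrable setT (EFin \o f) ->
  (\int[mu]_x (f x)%:E = \int[nu]_x (f x * rho x)%:E)%E.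
Proof.
move=> If.
rewrite -(Radon_Nikodym_change_of_variables density_dominates)//.
have mf := measurable_int mu If.
have IRN : nu.-integrable setT (Radon_Nikodym (charge_of_finite_measure mu) nu).
  by apply: Radon_Nikodym_integrable; exact: density_dominates.
apply: ae_eq_integral => //.
- apply: emeasurable_funM => //; exact: measurable_int IRN.
- by apply/measurable_EFinP/measurable_funM => //; exact/measurable_EFinP.
- under [X in ae_eq _ _ _ X]eq_fun do rewrite EFinM.
  apply: ae_eqe_mul2l => /=.
  apply: integral_ae_eq => //.
  + by apply/measurable_EFinP.
  + move=> E _ mE; rewrite -density// -[RHS]/(charge_of_finite_measure mu E).
    by apply/esym; apply: Radon_Nikodym_integral => //; exact: density_dominates.
Qed.

End density.

Section calculus_bounds.
Context {R : realType}.

(** A global quadratic remainder survives integration, which replaces a theorem on differentiation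
    under the integral sign. *)
Lemma is_derive_sqr_bound (f : R -> R) (t d K : R) :
  (forall h, `|f (t + h) - f t - h * d| <= K * h ^+ 2) -> is_derive t (1 : R) f d.
Proof.
move=> H.
suff C : (fun h : R => h^-1 *: ((f \o shift t) (h *: (1 : R)) - f t)) @ 0^' --> d.
  by split; [apply/cvg_ex; exists d | exact/cvg_lim].
apply/cvgrPdist_le => e e0; near=> h.
have h0 : h != 0 by near: h; exact: nbhs_dnbhs_neq.
rewrite /= /GRing.scale/= mulr1 [h + t]addrC -normrN opprB.
have -> : h^-1 * (f (t + h) - f t) - d = h^-1 * (f (t + h) - f t - h * d).
  by field.
rewrite normrM normfV ler_pdivrMl ?normr_gt0//.
apply: le_trans (H h) _; rewrite -real_normK ?num_real// expr2 mulrA.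
rewrite [leRHS]mulrC ler_wpM2r//.
apply: (@le_trans _ _ ((`|K| + 1) * `|h|)).
  by rewrite ler_wpM2r// (le_trans (ler_norm K))// lerDl.
rewrite -ler_pdivlMl ?ltr_wpDl//; near: h; apply: dnbhs0_le.
by rewrite mulr_gt0 ?invr_gt0 ?ltr_wpDl.
Unshelve. all: by end_near. Qed.

Lemma sin_le_norm (b : R) : `|sin b| <= `|b|.
Proof.
wlog b0 : b / 0 <= b.
  move=> H; have [/H//|b0] := leP 0 b.
  by rewrite -normrN -sinN -(normrN b); apply: H; rewrite oppr_ge0 ltW.
have D x : x \in `]0, b[%R -> is_derive x 1 sin (cos x) by move=> _; exact: is_derive_sin.
have C : {within `[0, b], continuous sin}.
  by apply: continuous_subspaceT; exact: continuous_sin.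
have [c _ E] := MVT_segment b0 D C.
move: E; rewrite sin0 !subr0 => ->.
by rewrite normrM ler_piMl// ler_norml cos_geN1 cos_le1.
Qed.

Lemma cos_MVT (b : R) : 0 <= b -> exists2 c, 0 <= c <= b & cos b - 1 = - sin c * b.
Proof.
move=> b0.
have D x : x \in `]0, b[%R -> is_derive x 1 cos (- sin x) by move=> _; exact: is_derive_cos.
have C : {within `[0, b], continuous cos}.
  by apply: continuous_subspaceT; exact: continuous_cos.
have [c cI E] := MVT_segment b0 D C.
by exists c; [move: cI; rewrite in_itv|rewrite -cos0 E subr0].
Qed.

Lemma cos_linear (b : R) : `|cos b - 1| <= `|b|.
Proof.
wlog b0 : b / 0 <= b.
  move=> H; have [/H//|b0] := leP 0 b.
  by rewrite -cosN -(normrN b); apply: H; rewrite oppr_ge0 ltW.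
have [c _ ->] := cos_MVT b0.
by rewrite normrM normrN ler_piMl// ler_norml sin_geN1 sin_le1.
Qed.

Lemma cos_quadratic (b : R) : `|cos b - 1| <= b ^+ 2.
Proof.
wlog b0 : b / 0 <= b.
  move=> H; have [/H//|b0] := leP 0 b.
  by rewrite -cosN -sqrrN; apply: H; rewrite oppr_ge0 ltW.
have [c /andP[c0 cb] ->] := cos_MVT b0.
rewrite normrM normrN expr2 (ger0_norm b0) ler_wpM2r//.
by apply: le_trans (sin_le_norm c) _; rewrite ger0_norm.
Qed.

Lemma sin_quadratic (b : R) : `|sin b - b| <= b ^+ 2.
Proof.
wlog b0 : b / 0 <= b.
  move=> H; have [b0|b0] := leP 0 b; first exact: H.
  have := H (- b); rewrite oppr_ge0 ltW// => /(_ isT).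
  by rewrite sinN -opprD normrN sqrrN.
have D x : x \in `]0, b[%R -> is_derive x 1 sin (cos x) by move=> _; exact: is_derive_sin.
have C : {within `[0, b], continuous sin}.
  by apply: continuous_subspaceT; exact: continuous_sin.
have [c cI E] := MVT_segment b0 D C.
move: E; rewrite sin0 !subr0 => ->; move: cI; rewrite in_itv/= => /andP[c0 cb].
rewrite -{2}[b]mul1r -mulrBl normrM expr2 (ger0_norm b0) ler_wpM2r//.
by apply: le_trans (cos_linear c) _; rewrite ger0_norm.
Qed.

Lemma cos_taylor (a b : R) : `|cos (a + b) - cos a + b * sin a| <= 2 * b ^+ 2.
Proof.
have -> : cos (a + b) - cos a + b * sin a = cos a * (cos b - 1) - sin a * (sin b - b).
  by rewrite cosD; ring.
apply: le_trans (ler_normB _ _) _; rewrite !normrM mulrDl mul1r; apply: lerD.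
  apply: le_trans (cos_quadratic b); rewrite ler_piMl//.
  by rewrite ler_norml cos_geN1 cos_le1.
apply: le_trans (sin_quadratic b); rewrite ler_piMl//.
by rewrite ler_norml sin_geN1 sin_le1.
Qed.

Lemma sin_taylor (a b : R) : `|sin (a + b) - sin a - b * cos a| <= 2 * b ^+ 2.
Proof.
rewrite sinD (_ : _ - _ = sin a * (cos b - 1) + cos a * (sin b - b)); last by ring.
apply: le_trans (ler_normD _ _) _; rewrite !normrM mulrDl mul1r; apply: lerD.
  apply: le_trans (cos_quadratic b); rewrite ler_piMl//.
  by rewrite ler_norml sin_geN1 sin_le1.
apply: le_trans (sin_quadratic b); rewrite ler_piMl//.
by rewrite ler_norml cos_geN1 cos_le1.
Qed.

(** The integrating factor exp (q t^2 / 2) turns the solution into a constant. *)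
Lemma gauss_ode (f : R -> R) (q : R) :
  (forall t : R, is_derive t (1 : R) f (- (t * q * f t))) ->
  f 1 = f 0 * expR (- (2^-1 * q)).
Proof.
move=> Hf.
pose u (t : R) := f t * expR (2^-1 * q * (t * t)).
have : u 1 = u 0.
  apply: is_derive0_cst => t.
  have Dt : is_derive t (1 : R) (fun t : R => 2^-1 * q * (t * t)) (q * t).
    apply: (is_derive_eq (is_deriveZ (2^-1 * q) (is_deriveM (is_derive_id t 1) (is_derive_id t
        1)))).
    by rewrite /GRing.scale/= !mulr1; field.
  have De := is_derive1_comp (f := expR) (g := fun t : R => 2^-1 * q * (t * t)).
  have {}De := De _ _ _ (is_derive_expR (2^-1 * q * (t * t))) Dt.
  apply: (is_derive_eq (is_deriveM (Hf t) De)).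
  by rewrite /GRing.scale/=; ring.
rewrite /u !mulr1 mulr0 mulr0 expR0 mulr1 => <-.
by rewrite -mulrA -expRD subrr expR0 mulr1.
Qed.

End calculus_bounds.

Section fatou_bound.
Context d {T : measurableType d} {R : realType} (mu : {measure set T -> \bar R}).

Lemma fatou_bound (f_ : nat -> T -> R) (f : T -> R) (K : \bar R) :
  (forall k, measurable_fun setT (f_ k)) -> (forall k x, 0 <= f_ k x) ->
  (forall x, f_ ^~ x @ \oo --> f x) ->
  (forall k, (\int[mu]_x (f_ k x)%:E <= K)%E) ->
  (\int[mu]_x (f x)%:E <= K)%E.
Proof.
move=> mf f0 ff fK.
have := @fatou _ _ _ mu setT measurableT (fun k => EFin \o f_ k).
have A1 k : measurable_fun setT (EFin \o f_ k) by exact/measurable_EFinP.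
move=> /(_ A1) /(_ (fun k x _ => f0 k x)) H.
apply: le_trans.
  apply: le_trans H; rewrite le_eqVlt; apply/orP; left; apply/eqP.
  apply: eq_integral => x _.
  have cx : (fun k => (f_ k x)%:E) @ \oo --> (f x)%:E.
    by apply: cvg_EFin; [exact: nearW|exact: ff].
  rewrite is_cvg_limn_einfE; first exact/esym/cvg_lim.
  by apply/cvg_ex; exists (f x)%:E.
rewrite limn_einf_lim; apply: lime_le; first exact: is_cvg_einfs.
apply: nearW => k; apply: le_trans (fK k).
by apply: ereal_inf_lbound; exists k => //=.
Qed.

End fatou_bound.

(** * Gaussian measures *)

Section gaussian.
Context {R : realType} {n : nat}.
Local Notation Rn := 'cV[R]_n.
Local Notation leb := (@lebesgue_Rn R n).
Variables (G : 'M[R]_n) (mu : probability Rn R).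
Hypothesis GT : G^T = G.
Hypothesis density : forall A, measurable A ->
  mu A = (\int[leb]_(x in A) (gauss_density G x)%:E)%E.
Local Notation A := (invmx G).
Local Notation rho := (gauss_density G).
Local Notation integrableR f := (mu.-integrable setT (EFin \o f)).
Implicit Types (f g : Rn -> R) (x y : Rn).

(* If [\det G <= 0], the square root in the density is [0], and so is its inverse. *)
Lemma gauss_det_gt0 : 0 < \det G.
Proof.
rewrite ltNge; apply/negP => det0.
have : (1 : \bar R)%E = 0%E; last by move/eqP; rewrite onee_eq0.
rewrite -[LHS](@probability_setT _ _ _ mu) density//.
apply: integral0_eq => x _; rewrite /gauss_density (ler0_sqrtr det0).
by rewrite mulr0 invr0 mul0r.
Qed.

Lemma gauss_unitmx : G \in unitmx.
Proof. by rewrite unitmxE unitfE gt_eqF// gauss_det_gt0. Qed.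

Lemma invmx_sym : A^T = A.
Proof. by rewrite trmx_inv GT. Qed.

Let cst_rho : R := ((2 * pi) `^ (n%:R / 2) * Num.sqrt (\det G))^-1.

Lemma gauss_density_gt0 x : 0 < rho x.
Proof.
rewrite /gauss_density mulr_gt0 ?expR_gt0// invr_gt0 mulr_gt0 ?sqrtr_gt0 ?gauss_det_gt0//.
by rewrite powR_gt0// mulr_gt0// pi_gt0.
Qed.

Lemma c1_quadratic (M : 'M[R]_n) i : M^T = M ->
  c1 i (fun x => dot (M *m x) x) (fun x => 2 * (M *m x) i 0).
Proof.
move=> MT.
have H j : c1 i (fun x => (M *m x) j 0) (fun=> M j i).
  apply: c1_eq (c1_dot i (row j M)^T) _ _ => x; last by rewrite !mxE.
  by rewrite mxE; apply: eq_bigr => k _; rewrite !mxE.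
apply: c1_eq (c1_sum (fun j => c1M (H j) (c1_coord i j))) _ _ => x //.
rewrite big_split/= (bigD1 i)//= eqxx mulr1 [X in _ + X + _]big1 ?addr0 => [|j ji].
  rewrite mulrDl mul1r; congr (_ + _); rewrite mxE; apply: eq_bigr => j _.
  by rewrite -[in LHS]MT mxE.
by rewrite eq_sym (negbTE ji) mulr0.
Qed.

Lemma c1_gauss_density i : c1 i rho (fun x => - (A *m x) i 0 * rho x).
Proof.
have H : c1 i (fun x => - (2^-1 * dot (A *m x) x)) (fun x => - (A *m x) i 0).
  apply: c1_eq (c1Z (- 2^-1) (c1_quadratic i invmx_sym)) _ _ => x.
    by rewrite mulNr.
  by rewrite mulrA mulNr mulVf// mulN1r.
apply: c1_eq (c1Z cst_rho (c1_comp H _ _ (@is_derive_expR R))) _ _ => //.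
- exact: continuous_expR.
- exact: continuous_expR.
- by move=> x; rewrite /gauss_density -/cst_rho mulrA mulrC.
Qed.

Lemma c1_continuous f (df : 'I_n -> Rn -> R) :
  (forall i, c1 i f (df i)) -> continuous f.
Proof.
move=> H; case: (pickP (fun _ : 'I_n => true)) => [i _|no]; first by have [] := H i.
rewrite (_ : f = cst (f 0)); first exact: cst_continuous.
by apply/funext => x; congr f; apply/colP => i; have := no i.
Qed.

Lemma gauss_density_continuous : continuous rho.
Proof. exact: c1_continuous c1_gauss_density. Qed.

Lemma integral_gauss f : integrableR f ->
  (\int[mu]_x (f x)%:E = \int[leb]_x (f x * rho x)%:E)%E.
Proof.
apply: integral_density => //.
exact: continuous_Rn_measurable gauss_density_continuous.
Qed.

Lemma bounded_integrable f (c : R) : measurable_fun setT f ->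
  (forall x, `|f x| <= c) -> integrableR f.
Proof.
move=> mf fc; apply: integrableR_dom fc _ => //.
by apply: finite_measure_integrable_cst.
Qed.

Lemma supp_integrable f : continuous f -> bounded_supp f -> integrableR f.
Proof.
move=> cf sf; have [c Hc] := bounded_supp_bounded cf sf.
exact: bounded_integrable (continuous_Rn_measurable cf) Hc.
Qed.

Lemma continuous_mulmx_coord (M : 'M[R]_n) i : continuous (fun x : Rn => (M *m x) i 0).
Proof.
have [] := c1_dot i (row i M)^T; rewrite (_ : (fun x => dot _ x) = (fun x : Rn => (M *m x) i 0))//.
apply/funext => x; rewrite [RHS]mxE; apply: eq_bigr => k _; by rewrite !mxE.
Qed.

(** The derivative of [f] times the density integrates to zero, and the density contributes the
    factor - (A x)_i. *)
Lemma gauss_ibp_supp i f df : c1 i f df -> bounded_supp f ->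
  \int[mu]_x df x = \int[mu]_x (f x * (A *m x) i 0).
Proof.
move=> Hf sf; have [cf cdf _] := Hf.
have sdf := bounded_supp_deriv Hf sf.
have cfA : continuous (fun x => f x * (A *m x) i 0).
  by move=> x; apply: (@continuousM _ _ f); [exact: cf|exact: continuous_mulmx_coord].
have sfA := bounded_suppMl (fun x => (A *m x) i 0) sf.
have cr := gauss_density_continuous.
apply: EFin_inj; rewrite -EFin_RintegralT; last exact: supp_integrable.
rewrite -EFin_RintegralT; last exact: supp_integrable.
rewrite !integral_gauss; [|exact: supp_integrable..].
have I1 : leb.-integrable setT (EFin \o (fun x => df x * rho x)).
  apply: bounded_supp_integrable; last exact: bounded_suppMl.
  by move=> x; exact: (continuousM (cdf x) (cr x)).
have I2 : leb.-integrable setT (EFin \o (fun x => f x * (A *m x) i 0 * rho x)).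
  apply: bounded_supp_integrable; last exact: bounded_suppMl.
  by move=> x; exact: (continuousM (cfA x) (cr x)).
rewrite (EFin_RintegralT I1) (EFin_RintegralT I2); congr EFin.
apply/eqP; rewrite -subr_eq0 -RintegralB//; apply/eqP.
rewrite /Rintegral -[RHS]/(fine 0).
rewrite -[in RHS](integral_deriv_Rn (c1M Hf (c1_gauss_density i)) (bounded_suppMl _ sf)).
by congr fine; apply: eq_integral => x _; congr (_%:E); ring.
Qed.

(** The square of the positive part of 1 - |x|^2 / (N+1)^2, since s + |s| is twice the positive part
    of s. Squaring makes it C^1. *)
Definition cutoff (N : nat) x : R :=
  let s := 1 - dot x x / N.+1%:R ^+ 2 in (s + `|s|) ^+ 2 / 4.
Definition dcutoff (N : nat) (i : 'I_n) x : R :=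
  let s := 1 - dot x x / N.+1%:R ^+ 2 in (s + `|s|) * (- 2 * x i 0 / N.+1%:R ^+ 2).

Lemma is_derive_posX2 (r : R) :
  is_derive r (1 : R) (fun s : R => (s + `|s|) ^+ 2 / 4) (r + `|r|).
Proof.
apply: (@is_derive_sqr_bound _ _ _ _ 1) => h; rewrite mul1r.
rewrite ler_norml; have [u0|u0] := leP 0 (r + h); have [r0|r0] := leP 0 r.
- by rewrite ger0_norm// ger0_norm//; apply/andP; split; nra.
- by rewrite ger0_norm// ltr0_norm//; apply/andP; split; nra.
- by rewrite ltr0_norm// ger0_norm//; apply/andP; split; nra.
- by rewrite ltr0_norm// ltr0_norm//; apply/andP; split; nra.
Qed.

Lemma continuous_addr_norm : continuous (fun s : R => s + `|s|).
Proof.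
move=> r; apply: (@continuousD _ _ _ id); first exact: cvg_id.
exact: norm_continuous.
Qed.

Lemma continuous_posX2 : continuous (fun s : R => (s + `|s|) ^+ 2 / 4).
Proof.
move=> r; apply: differentiable_continuous; apply/derivable1_diffP.
by have [] := is_derive_posX2 r.
Qed.

Lemma c1_cutoff N i : c1 i (cutoff N) (dcutoff N i).
Proof.
have H : c1 i (fun x => 1 - dot x x / N.+1%:R ^+ 2) (fun x => - 2 * x i 0 / N.+1%:R ^+ 2).
  apply: c1_eq (c1D (c1_cst i 1) (c1Z (- (N.+1%:R ^- 2)) (c1_quadratic i (trmx1 _ _)))) _ _ => x.
    by rewrite mul1mx mulNr mulrC.
  by rewrite mul1mx add0r; ring.
exact: (c1_comp H continuous_posX2 continuous_addr_norm is_derive_posX2).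
Qed.

Lemma cutoff_ge0 N x : 0 <= cutoff N x.
Proof. by rewrite /cutoff divr_ge0// sqr_ge0. Qed.

Let cutoff_arg_le1 N x : 1 - dot x x / N.+1%:R ^+ 2 <= 1.
Proof. by rewrite gerBl divr_ge0 ?dot_ge0// exprn_ge0. Qed.

Lemma cutoff_le1 N x : cutoff N x <= 1.
Proof.
rewrite /cutoff; have := cutoff_arg_le1 N x; set s := (1 - _) => s1.
have [s0|s0] := leP 0 s; first by rewrite ger0_norm//; nra.
by rewrite ltr0_norm// subrr expr0n mul0r.
Qed.

Lemma cutoff_supp N : bounded_supp (cutoff N).
Proof.
exists N.+1%:R => x xN.
have [j xj] : exists j, N.+1%:R < `|x j 0|.
  by apply/not_existsP => H; apply: xN => j; rewrite leNgt; apply/negP; exact: H.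
rewrite /cutoff/= ler0_norm ?subrr ?expr0n ?mul0r//.
rewrite subr_le0 ler_pdivlMr ?exprn_gt0// mul1r.
rewrite /dot (bigD1 j)//= -expr2 -[leLHS]addr0 lerD//; last first.
  by apply: sumr_ge0 => k _; rewrite -expr2 sqr_ge0.
by rewrite -[leRHS]real_normK ?num_real// lerXn2r ?nnegrE// ltW.
Qed.

Lemma cutoff_cvg x : cutoff ^~ x @ \oo --> (1 : R).
Proof.
have -> : (1 : R) = (1 + `|1|) ^+ 2 / 4 by rewrite normr1; lra.
apply: (@cvg_comp _ _ _ (fun N => 1 - dot x x / N.+1%:R ^+ 2)
  (fun s : R => (s + `|s|) ^+ 2 / 4) _ (nbhs (1 : R))); last exact: continuous_posX2.
suff : (fun N => 1 - dot x x / N.+1%:R ^+ 2) @ \oo --> (1 : R) by [].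
rewrite -[X in _ --> X]subr0; apply: cvgB; first exact: cvg_cst.
rewrite -(mulr0 (dot x x)); apply: cvgMr.
rewrite (_ : (fun N => _) = (fun N => N.+1%:R^-1 * N.+1%:R^-1)); last first.
  by apply/funext => N; rewrite expr2 invfM.
by rewrite -(mulr0 0); apply: cvgM; exact: cvg_harmonic.
Qed.

Lemma dcutoff_sumE N y x : \sum_i y i 0 * dcutoff N i x =
  ((1 - dot x x / N.+1%:R ^+ 2) + `|1 - dot x x / N.+1%:R ^+ 2|) *
  (- 2 * dot y x / N.+1%:R ^+ 2).
Proof.
rewrite [dot y x]/dot mulr_sumr mulr_suml mulr_sumr; apply: eq_bigr => i _.
by rewrite /dcutoff/=; ring.
Qed.

Lemma abs_dot_le y x : `|dot y x| <= enorm y * enorm x.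
Proof.
rewrite -sqrtr_sqr /enorm -sqrtrM ?dot_ge0// ler_wsqrtr//; exact: dot_cs.
Qed.

(** The weight [c] serves two purposes: c = 1 shows that the gradient of the cutoff tends to 0, and
    c = |<z, x>| shows that its product with a linear form remains bounded. Both rest on |x| <= N +
    1 where the gradient does not vanish. *)
Lemma dcutoff_le2 N y x (c K : R) : 0 <= c -> 0 <= K ->
  (enorm x <= N.+1%:R -> c * enorm x <= K) ->
  c * `|\sum_i y i 0 * dcutoff N i x| <= 4 * enorm y * K / N.+1%:R ^+ 2.
Proof.
move=> c0 K0 Hc; rewrite dcutoff_sumE.
have := cutoff_arg_le1 N x; set s := (1 - _ / _) => s1.
have N0 : 0 < N.+1%:R ^+ 2 :> R by rewrite exprn_gt0.
have ey : 0 <= enorm y by exact: sqrtr_ge0.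
have [s0|s0] := leP 0 s; last first.
  rewrite (ltr0_norm s0) (subrr s) mul0r normr0 mulr0 divr_ge0 ?(ltW N0)//.
  by rewrite mulr_ge0// mulr_ge0.
have xN : enorm x <= N.+1%:R.
  rewrite -[leRHS]ger0_norm// -sqrtr_sqr ler_wsqrtr//.
  by move: s0; rewrite /s subr_ge0 ler_pdivrMr// mul1r.
have {}Hc := Hc xN.
rewrite (ger0_norm s0) normrM (ger0_norm (addr_ge0 s0 s0)).
rewrite !normrM normrN normr_nat normfV (ger0_norm (ltW N0)).
rewrite !mulrA ler_wpM2r ?invr_ge0 ?(ltW N0)//.
have := abs_dot_le y x; have := normr_ge0 (dot y x) => d0 dle.
have H1 : c * `|dot y x| <= enorm y * K.
  apply: (@le_trans _ _ (c * (enorm y * enorm x))); first by rewrite ler_wpM2l.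
  by rewrite mulrCA ler_wpM2l.
have H2 : 0 <= c * `|dot y x| by rewrite mulr_ge0.
rewrite (_ : c * _ * _ * _ = 2 * (s + s) * (c * `|dot y x|)); last by ring.
rewrite -[4 * _ * K]mulrA; apply: ler_pM => //; first by rewrite mulr_ge0// (addr_ge0 s0 s0).
by move: s1; lra.
Qed.

Lemma dcutoff_le N y x : `|\sum_i y i 0 * dcutoff N i x| <= 4 * enorm y / N.+1%:R.
Proof.
have := @dcutoff_le2 N y x 1 N.+1%:R ler01 (ler0n _ _).
rewrite !mul1r => /(_ id) H; apply: le_trans H _.
by rewrite le_eqVlt; apply/orP; left; apply/eqP; field.
Qed.

Lemma dot_dcutoff_le N y z x :
  `|dot z x * \sum_i y i 0 * dcutoff N i x| <= 4 * enorm y * enorm z.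
Proof.
rewrite normrM.
have N0 : 0 <= N.+1%:R ^+ 2 :> R by rewrite exprn_ge0.
have := @dcutoff_le2 N y x `|dot z x| (enorm z * N.+1%:R ^+ 2) (normr_ge0 _).
have -> : 0 <= enorm z * N.+1%:R ^+ 2 by rewrite mulr_ge0// sqrtr_ge0.
move=> /(_ isT) H; apply: le_trans (H _) _ => [xN|]; last first.
  by rewrite le_eqVlt; apply/orP; left; apply/eqP; field.
apply: (@le_trans _ _ (enorm z * enorm x * enorm x)).
  by rewrite ler_wpM2r ?sqrtr_ge0// abs_dot_le.
rewrite -mulrA ler_wpM2l ?sqrtr_ge0// expr2.
by apply: ler_pM; rewrite ?sqrtr_ge0.
Qed.

Lemma dcutoff_cvg y x : (fun N => \sum_i y i 0 * dcutoff N i x) @ \oo --> (0 : R).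
Proof.
apply/cvgr0Pnorm_le => e e0.
have H : (fun N => 4 * enorm y * N.+1%:R^-1) @ \oo --> (0 : R).
  by rewrite -(mulr0 (4 * enorm y)); apply: cvgMr; exact: cvg_harmonic.
move/cvgr0Pnorm_le : H => /(_ _ e0); apply: filterS => N HN.
by apply: le_trans (dcutoff_le _ _ _) (le_trans (ler_norm _) HN).
Qed.

Definition c1all f (df : 'I_n -> Rn -> R) := forall i, c1 i f (df i).

(** Differentiating in the direction [G *m y] cancels the inverse of [G] in the density and leaves
    multiplication by <y, x>. *)
Lemma gauss_ibp_dir f df y : c1all f df -> bounded_supp f ->
  \int[mu]_x (\sum_i (G *m y) i 0 * df i x) = \int[mu]_x (f x * dot y x).
Proof.
move=> Hf sf.
have I1 i : integrableR (df i).
  by have [_ c _] := Hf i; apply: supp_integrable => //; exact: bounded_supp_deriv (Hf i) sf.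
have cA i : continuous (fun x => f x * (A *m x) i 0).
  by have [c _ _] := Hf i; move=> x; apply: (@continuousM _ _ f); [exact: c|exact:
      continuous_mulmx_coord].
have I2 i : integrableR (fun x => f x * (A *m x) i 0).
  by apply: supp_integrable; [exact: cA|exact: bounded_suppMl].
rewrite RintegralR_sum => [|i]; last exact: integrableRZ.
transitivity (\int[mu]_x (\sum_i (G *m y) i 0 * (f x * (A *m x) i 0))).
  rewrite RintegralR_sum => [|i]; last exact: integrableRZ.
  by apply: eq_bigr => i _; rewrite !RintegralZl// (gauss_ibp_supp (Hf i) sf).
apply: eq_Rintegral => x _.
have -> : dot y x = dot (G *m y) (A *m x).
  by rewrite dot_mulmxl GT mulmxA mulmxV ?mul1mx// gauss_unitmx.
by rewrite /dot mulr_sumr; apply: eq_bigr => i _; ring.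
Qed.

Lemma c1all_cutoff f df N : c1all f df ->
  c1all (fun x => f x * cutoff N x) (fun i x => f x * dcutoff N i x + df i x * cutoff N x).
Proof. by move=> Hf i; exact: c1M (Hf i) (c1_cutoff N i). Qed.

Lemma dot_continuous y : continuous (fun x => dot y x).
Proof. by apply: (@c1_continuous _ (fun i => fun=> y i 0)) => i; exact: c1_dot. Qed.

Lemma dot_measurable y : measurable_fun setT (fun x => dot y x).
Proof. exact: continuous_Rn_measurable (@dot_continuous y). Qed.

Lemma cutoff_continuous N : continuous (cutoff N).
Proof. by apply: (@c1_continuous _ (dcutoff N)) => i; exact: c1_cutoff. Qed.

Lemma cutoff_measurable N : measurable_fun setT (cutoff N).
Proof. exact: continuous_Rn_measurable (@cutoff_continuous N). Qed.

Lemma c1all_dot y : c1all (fun x => dot y x) (fun i => fun=> y i 0).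
Proof. by move=> i; exact: c1_dot. Qed.

Lemma le_RintegralT f g : integrableR f -> integrableR g ->
  (forall x, f x <= g x) -> \int[mu]_x f x <= \int[mu]_x g x.
Proof. by move=> If Ig fg; apply: le_Rintegral. Qed.

Lemma Rintegral_cstT (c : R) : \int[mu]_x c = c.
Proof.
transitivity (c * fine (mu setT)); first exact: Rintegral_cst.
by rewrite (@probability_setT _ _ _ mu) mulr1.
Qed.

Lemma cst_integrable (c : R) : integrableR (fun=> c).
Proof. exact: finite_measure_integrable_cst. Qed.

(** Integrability must precede any computation of the moment. Integration by parts bounds the
    truncated moments by a constant independent of the cutoff, and Fatou removes the truncation. *)
Lemma second_moment_bound y : integrableR (fun x => dot y x ^+ 2).
Proof.
pose K := 4 * enorm (G *m y) * enorm y + `|dot (G *m y) y|.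
apply: (@ge0_integrableR_bounded _ _ _ _ _ K).
- by apply: measurable_funX; exact: dot_measurable.
- by move=> x; exact: sqr_ge0.
apply: (@fatou_bound _ _ _ mu (fun N x => dot y x ^+ 2 * cutoff N x)).
- move=> N; apply: measurable_funM; last exact: cutoff_measurable.
  by apply: measurable_funX; exact: dot_measurable.
- by move=> N x; rewrite mulr_ge0 ?sqr_ge0 ?cutoff_ge0.
- move=> x; rewrite -[X in _ --> X]mulr1; apply: cvgMr; exact: cutoff_cvg.
move=> N.
have Hf := c1all_cutoff N (c1all_dot y).
have sf : bounded_supp (fun x => dot y x * cutoff N x) by apply: bounded_suppMr; exact: cutoff_supp.
have If : integrableR (fun x => dot y x ^+ 2 * cutoff N x).
  apply: supp_integrable; last by apply: bounded_suppMr; exact: cutoff_supp.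
  move=> x; apply: (@continuousM _ _ (fun x => dot y x ^+ 2) (cutoff N)); last exact:
      cutoff_continuous.
  apply: (@continuous_comp _ _ _ (fun x => dot y x) (fun r : R => r ^+ 2)); first exact:
      dot_continuous.
  exact: exprn_continuous.
rewrite EFin_RintegralT// lee_fin.
have -> : \int[mu]_x (dot y x ^+ 2 * cutoff N x) =
    \int[mu]_x (dot y x * cutoff N x * dot y x).
  by apply: eq_Rintegral => x _; ring.
rewrite -(gauss_ibp_dir y Hf sf) -(Rintegral_cstT K).
apply: le_RintegralT; [|exact: cst_integrable|].
  apply: integrableR_sum => i; apply: integrableRZ.
  have [_ c _] := Hf i; apply: supp_integrable => //; exact: bounded_supp_deriv (Hf i) sf.
move=> x; under eq_bigr do rewrite mulrDr.
rewrite big_split/= lerD//.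
  rewrite (_ : \sum_i _ = dot y x * \sum_i (G *m y) i 0 * dcutoff N i x).
    by rewrite (le_trans (ler_norm _))// dot_dcutoff_le.
  by rewrite mulr_sumr; apply: eq_bigr => i _; ring.
under eq_bigr do rewrite mulrA.
rewrite -mulr_suml -/(dot (G *m y) y) (le_trans (ler_norm _))// normrM.
by rewrite ler_piMr// ger0_norm ?cutoff_ge0 ?cutoff_le1.
Qed.

Lemma dot_integrable y : integrableR (fun x => dot y x).
Proof.
apply: (@integrableR_dom _ _ _ mu _ (fun x => 1 + dot y x ^+ 2)).
- exact: dot_measurable.
- move=> x; rewrite ler_norml; have := sqr_ge0 (dot y x - 1); have := sqr_ge0 (dot y x + 1).
  by set a := dot y x; rewrite !expr2 => *; apply/andP; split; nra.
- by apply: integrableRD; [exact: cst_integrable|exact: second_moment_bound].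
Qed.

(** The cutoff reduces to bounded support; its gradient is bounded and tends to 0 pointwise, so
    dominated convergence applies on both sides. *)
Lemma gauss_ibp f df y : c1all f df -> integrableR f ->
  integrableR (fun x => \sum_i (G *m y) i 0 * df i x) ->
  integrableR (fun x => f x * dot y x) ->
  \int[mu]_x (\sum_i (G *m y) i 0 * df i x) = \int[mu]_x (f x * dot y x).
Proof.
move=> Hf If IDf Ify.
have mf := integrableR_measurable If.
have mDf := integrableR_measurable IDf.
pose F N x := f x * (\sum_i (G *m y) i 0 * dcutoff N i x) +
  (\sum_i (G *m y) i 0 * df i x) * cutoff N x.
have mdc N : measurable_fun setT (fun x => \sum_i (G *m y) i 0 * dcutoff N i x).
  apply: measurable_sum => i; apply: measurable_funM => //.
  exact: (c1_measurable (c1_cutoff N i)).2.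
have EN N : \int[mu]_x F N x = \int[mu]_x (f x * cutoff N x * dot y x).
  rewrite -(gauss_ibp_dir y (c1all_cutoff N Hf)); last first.
    by apply: bounded_suppMr; exact: cutoff_supp.
  apply: eq_Rintegral => x _; rewrite /F mulr_sumr mulr_suml -big_split/=.
  by apply: eq_bigr => i _; ring.
have [_ H1] : integrableR (fun x => \sum_i (G *m y) i 0 * df i x) /\
    (fun N => \int[mu]_x F N x) @ \oo --> \int[mu]_x (\sum_i (G *m y) i 0 * df i x).
  apply: (@Rintegral_cvg_dom _ _ _ mu F _
    (fun x => 4 * enorm (G *m y) * `|f x| + `|\sum_i (G *m y) i 0 * df i x|)).
  - move=> N; apply: measurable_funD; apply: measurable_funM => //.
    exact: cutoff_measurable.
  - move=> x; rewrite -[X in _ --> X]add0r; apply: cvgD.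
      have := cvgM (cvg_cst (f x)) (@dcutoff_cvg (G *m y) x).
      by rewrite mulr0; apply.
    rewrite -[X in _ --> X]mulr1; apply: cvgMr; exact: cutoff_cvg.
  - move=> N x; rewrite (le_trans (ler_normD _ _))// lerD// normrM.
      rewrite mulrC ler_wpM2r// (le_trans (dcutoff_le _ _ _))//.
      rewrite ler_pdivrMr// ler_peMr ?ler1n// mulr_ge0// sqrtr_ge0//.
    by rewrite ler_piMr// ger0_norm ?cutoff_ge0 ?cutoff_le1.
  - by apply: integrableRD; [apply: integrableRZ|]; exact: integrable_norm.
have [_ H2] : integrableR (fun x => f x * dot y x) /\
    (fun N => \int[mu]_x (f x * cutoff N x * dot y x)) @ \oo --> \int[mu]_x (f x * dot y x).
  apply: (@Rintegral_cvg_dom _ _ _ mu (fun N x => f x * cutoff N x * dot y x) _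
    (fun x => `|f x * dot y x|)).
  - move=> N; apply: measurable_funM; last exact: dot_measurable.
    by apply: measurable_funM => //; exact: cutoff_measurable.
  - move=> x; apply: cvgMl; rewrite -[X in _ --> X]mulr1; apply: cvgMr.
    exact: cutoff_cvg.
  - move=> N x; rewrite mulrAC normrM ler_piMr//.
    by rewrite ger0_norm ?cutoff_ge0 ?cutoff_le1.
  - exact: integrable_norm.
move: H1; under eq_fun do rewrite EN; move=> H1.
by rewrite -(cvg_lim _ H1)// -(cvg_lim _ H2).
Qed.

Lemma second_moment y : \int[mu]_x (dot y x ^+ 2) = dot (G *m y) y.
Proof.
rewrite -[RHS]Rintegral_cstT.
under eq_Rintegral do rewrite expr2.
by rewrite -(gauss_ibp (c1all_dot y))//;
  [exact: dot_integrable|exact: cst_integrable|exact: second_moment_bound].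
Qed.

Lemma gauss_psd y : 0 <= dot (G *m y) y.
Proof. by rewrite -second_moment; apply: Rintegral_ge0 => x _; exact: sqr_ge0. Qed.

(** If <G y, y> = 0, moving [y] slightly against G y would make the form negative unless G y = 0,
    which invertibility forbids. *)
Lemma gauss_posdef y : y != 0 -> 0 < dot (G *m y) y.
Proof.
move=> y0; rewrite lt_def gauss_psd andbT; apply: contra_neq y0 => Gy0.
suff : G *m y = 0 by move=> E; rewrite -(mulKmx gauss_unitmx y) E mulmx0.
apply: dot_eq0; set w := G *m y; apply/eqP; rewrite eq_le dot_ge0 andbT leNgt.
apply/negP => a0.
have c0 := gauss_psd w; set c := dot (G *m w) w in c0.
(* Along y - s w the form is - 2 s |w|^2 + c s^2, which is negative for this step; the added 1
   avoids dividing by zero. *)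
pose s := dot w w / (c + 1).
have := gauss_psd (y - s *: w).
rewrite mulmxBr -scalemxAr dotBl !dotBr !dotZl !dotZr Gy0 -/w -/c.
rewrite [dot (G *m w) y]dot_mulmxl GT -/w => H.
have s0 : 0 < s by rewrite divr_gt0// ltr_wpDl.
have E : s * (c + 1) = dot w w by rewrite /s divfK// gt_eqF// ltr_wpDl.
nra.
Qed.

Lemma c1all_comp_dot y (phi dphi : R -> R) : continuous phi -> continuous dphi ->
  (forall x : R, is_derive x (1 : R) phi (dphi x)) ->
  c1all (fun x => phi (dot y x)) (fun i x => dphi (dot y x) * y i 0).
Proof. by move=> c d D i; exact: (c1_comp (c1_dot i y) c d D). Qed.

Lemma cos_dot_measurable y : measurable_fun setT (fun x => cos (dot y x)).
Proof.
apply: continuous_Rn_measurable => x; apply: (@continuous_comp _ _ _ (dot y) cos).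
  exact: dot_continuous.
exact: continuous_cos.
Qed.

Lemma sin_dot_measurable y : measurable_fun setT (fun x => sin (dot y x)).
Proof.
apply: continuous_Rn_measurable => x; apply: (@continuous_comp _ _ _ (dot y) sin).
  exact: dot_continuous.
exact: continuous_sin.
Qed.

Lemma cos_dot_integrable y : integrableR (fun x => cos (dot y x)).
Proof.
apply: (@bounded_integrable _ 1); first exact: cos_dot_measurable.
by move=> x; rewrite ler_norml cos_geN1 cos_le1.
Qed.

Lemma sin_dot_integrable y : integrableR (fun x => sin (dot y x)).
Proof.
apply: (@bounded_integrable _ 1); first exact: sin_dot_measurable.
by move=> x; rewrite ler_norml sin_geN1 sin_le1.
Qed.

Lemma integrable_bddM f g : integrableR f -> measurable_fun setT g ->
  (forall x, `|g x| <= 1) -> integrableR (fun x => g x * f x).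
Proof.
move=> If mg g1; apply: integrableR_dom (integrable_norm If).
  by apply: measurable_funM => //; exact: integrableR_measurable If.
by move=> x; rewrite normrM ler_piMl.
Qed.

Lemma cosM_dot_integrable y z : integrableR (fun x => cos (dot y x) * dot z x).
Proof.
apply: integrable_bddM; [exact: dot_integrable|exact: cos_dot_measurable|].
by move=> x; rewrite ler_norml cos_geN1 cos_le1.
Qed.

Lemma sinM_dot_integrable y z : integrableR (fun x => sin (dot y x) * dot z x).
Proof.
apply: integrable_bddM; [exact: dot_integrable|exact: sin_dot_measurable|].
by move=> x; rewrite ler_norml sin_geN1 sin_le1.
Qed.

Lemma cos_dot_ibp y z : \int[mu]_x (cos (dot y x) * dot z x) =
  - dot (G *m z) y * \int[mu]_x sin (dot y x).
Proof.
have D := c1all_comp_dot y (@continuous_cos R) (fun r : R => continuousN (@continuous_sin R r))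
    (@is_derive_cos R).
have E x : \sum_i (G *m z) i 0 * (- sin (dot y x) * y i 0) = - dot (G *m z) y * sin (dot y x).
  by rewrite mulNr mulr_suml -sumrN; apply: eq_bigr => i _; ring.
rewrite -(gauss_ibp D (cos_dot_integrable y)).
- by under eq_Rintegral do rewrite E; rewrite RintegralZl//; exact: sin_dot_integrable.
- apply: eq_integrable (integrableRZ (- dot (G *m z) y) (sin_dot_integrable y)) => // x _.
  by rewrite /= E.
- exact: cosM_dot_integrable.
Qed.

Lemma sin_dot_ibp y z : \int[mu]_x (sin (dot y x) * dot z x) =
  dot (G *m z) y * \int[mu]_x cos (dot y x).
Proof.
have D := c1all_comp_dot y (@continuous_sin R) (@continuous_cos R) (@is_derive_sin R).
have E x : \sum_i (G *m z) i 0 * (cos (dot y x) * y i 0) = dot (G *m z) y * cos (dot y x).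
  by rewrite mulr_suml; apply: eq_bigr => i _; ring.
rewrite -(gauss_ibp D (sin_dot_integrable y)).
- by under eq_Rintegral do rewrite E; rewrite RintegralZl//; exact: cos_dot_integrable.
- apply: eq_integrable (integrableRZ (dot (G *m z) y) (cos_dot_integrable y)) => // x _.
  by rewrite /= E.
- exact: sinM_dot_integrable.
Qed.

(** The Taylor remainder of the cosine is at most 2 h^2 <y, x>^2, integrable by the second moment;
    integration by parts rewrites the derivative as a multiple of the function itself, giving the
    equation solved by [gauss_ode]. *)
Lemma char_derive_cos y (t : R) :
  is_derive t (1 : R) (fun t => \int[mu]_x cos (dot (t *: y) x))
    (- (t * dot (G *m y) y * \int[mu]_x cos (dot (t *: y) x))).
Proof.
apply: (@is_derive_sqr_bound _ _ _ _ (2 * dot (G *m y) y)) => h.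
have -> : t * dot (G *m y) y * \int[mu]_x cos (dot (t *: y) x) =
    \int[mu]_x (sin (dot (t *: y) x) * dot y x).
  by rewrite sin_dot_ibp dotZr.
rewrite mulrN opprK -RintegralZl//; last exact: sinM_dot_integrable.
have I1 : integrableR (fun x => cos (dot ((t + h) *: y) x) - cos (dot (t *: y) x)).
  by apply: integrableRB; exact: cos_dot_integrable.
have I2 : integrableR (fun x => h * (sin (dot (t *: y) x) * dot y x)).
  by apply: integrableRZ; exact: sinM_dot_integrable.
rewrite -RintegralB//; [|exact: cos_dot_integrable..].
rewrite -RintegralD//.
apply: le_trans (le_normr_Rintegral _ _) _ => //; first exact: integrableRD.
have I3 : integrableR (fun x => 2 * h ^+ 2 * dot y x ^+ 2).
  by apply: integrableRZ; exact: second_moment_bound.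
rewrite (_ : 2 * _ * _ = \int[mu]_x (2 * h ^+ 2 * dot y x ^+ 2)); last first.
  by rewrite RintegralZl ?second_moment//; [ring|exact: second_moment_bound].
apply: le_RintegralT => //; first by apply: integrable_norm; exact: integrableRD.
move=> x; have := cos_taylor (t * dot y x) (h * dot y x).
rewrite !dotZl [(t + h) * _]mulrDl; set a := sin _; set b := dot y x.
rewrite (_ : h * b * a = h * (a * b)); last by ring.
by rewrite exprMn -[2 * _ * _]mulrA.
Qed.

Lemma char_derive_sin y (t : R) :
  is_derive t (1 : R) (fun t => \int[mu]_x sin (dot (t *: y) x))
    (- (t * dot (G *m y) y * \int[mu]_x sin (dot (t *: y) x))).
Proof.
apply: (@is_derive_sqr_bound _ _ _ _ (2 * dot (G *m y) y)) => h.
have -> : - (t * dot (G *m y) y * \int[mu]_x sin (dot (t *: y) x)) =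
    \int[mu]_x (cos (dot (t *: y) x) * dot y x).
  by rewrite cos_dot_ibp dotZr; ring.
rewrite -RintegralZl//; last exact: cosM_dot_integrable.
have I1 : integrableR (fun x => sin (dot ((t + h) *: y) x) - sin (dot (t *: y) x)).
  by apply: integrableRB; exact: sin_dot_integrable.
have I2 : integrableR (fun x => h * (cos (dot (t *: y) x) * dot y x)).
  by apply: integrableRZ; exact: cosM_dot_integrable.
rewrite -RintegralB//; [|exact: sin_dot_integrable..].
rewrite -RintegralB//.
apply: le_trans (le_normr_Rintegral _ _) _ => //; first exact: integrableRB.
have I3 : integrableR (fun x => 2 * h ^+ 2 * dot y x ^+ 2).
  by apply: integrableRZ; exact: second_moment_bound.
rewrite (_ : 2 * _ * _ = \int[mu]_x (2 * h ^+ 2 * dot y x ^+ 2)); last first.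
  by rewrite RintegralZl ?second_moment//; [ring|exact: second_moment_bound].
apply: le_RintegralT => //; first by apply: integrable_norm; exact: integrableRB.
move=> x; have := sin_taylor (t * dot y x) (h * dot y x).
rewrite !dotZl [(t + h) * _]mulrDl; set b := dot y x.
rewrite (_ : h * b * cos (t * b) = h * (cos (t * b) * b)); last by ring.
by rewrite exprMn -[2 * _ * _]mulrA.
Qed.

Lemma char_cos y : \int[mu]_x cos (dot y x) = expR (- (2^-1 * dot (G *m y) y)).
Proof.
have := gauss_ode (char_derive_cos y); rewrite scale1r scale0r => ->.
under eq_Rintegral do rewrite dot0l cos0.
by rewrite Rintegral_cstT mul1r.
Qed.

Lemma char_sin y : \int[mu]_x sin (dot y x) = 0.
Proof.
have := gauss_ode (char_derive_sin y); rewrite scale1r scale0r => ->.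
under eq_Rintegral do rewrite dot0l sin0.
by rewrite Rintegral_cstT mul0r.
Qed.

Lemma sinM_dot y : \int[mu]_x (sin (dot y x) * dot y x) =
  dot (G *m y) y * expR (- (2^-1 * dot (G *m y) y)).
Proof. by rewrite sin_dot_ibp char_cos. Qed.

End gaussian.

Lemma dot_delta {R : realType} {n : nat} (M : 'M[R]_n) (i j : 'I_n) :
  dot (M *m delta_mx j 0) (delta_mx i 0) = M i j.
Proof.
rewrite -colE /dot (bigD1 i)//= !mxE !eqxx mulr1 big1 ?addr0// => k ki.
by rewrite [X in _ * X]mxE (negbTE ki) mulr0.
Qed.

(** * The Lyapunov equation *)

Section covariance_lyapunov.
Context {R : realType} {n : nat}.
Variables (S B : 'M[R]_n).
Hypothesis ST : S^T = S.
Local Notation G := (Q_infty (S *m S) B).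
Local Notation leb := (@lebesgue_measure R).
Local Notation D := (`[0%R, +oo[%classic : set R).
Implicit Types (x y : 'cV[R]_n) (s t : R).

Definition flow_cov s : 'M[R]_n :=
  expmx (s *: B) *m (S *m S) *m expmx (s *: B^T).

Lemma flow_cov_dot s x y : dot (flow_cov s *m x) y =
  dot (S *m (expmx (s *: B^T) *m x)) (S *m (expmx (s *: B^T) *m y)).
Proof.
by rewrite /flow_cov -!mulmxA dot_mulmxl expmx_tr dot_mulmxl ST.
Qed.

Lemma flow_cov_coord s i j : flow_cov s i j = dot (flow_cov s *m delta_mx j 0) (delta_mx i 0).
Proof. by rewrite dot_delta. Qed.

Lemma flow_cov_sym s : (flow_cov s)^T = flow_cov s.
Proof. by rewrite /flow_cov !trmx_mul !expmx_tr trmxK ST mulmxA. Qed.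

Lemma Q_infty_sym : G^T = G.
Proof.
apply/matrixP => i j; rewrite !mxE; apply: eq_Rintegral => s _.
have := congr1 (fun M : 'M[R]_n => M i j) (flow_cov_sym s).
by rewrite mxE => <-.
Qed.

Lemma mderiv_flow_cov s : mderiv flow_cov s (B *m flow_cov s + flow_cov s *m B^T).
Proof.
apply: mderiv_eq.
  apply: mderivM; last exact: mderiv_expmx.
  by apply: mderivM; [exact: mderiv_expmx|exact: mderiv_cst].
rewrite /flow_cov mulmx0 addr0 (_ : B^T *m expmx (s *: B^T) = expmx (s *: B^T) *m B^T).
  by rewrite !mulmxA.
by rewrite expmx_comm.
Qed.

Lemma is_derive_flow_dot s x :
  is_derive s (1 : R) (fun s => dot (flow_cov s *m x) x)
    (2 * dot (flow_cov s *m x) (B^T *m x)).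
Proof.
apply: is_derive_eq.
  apply: is_derive_dot; last exact: mderiv_cst.
  by apply: mderivM; [exact: mderiv_flow_cov|exact: mderiv_cst].
rewrite mulmx0 addr0 dot0r addr0; have := flow_cov_sym s.
set F := flow_cov s => FT; rewrite mulmxDl dotDl -mulmxA.
rewrite [X in X + _]dot_mulmxl -mulmxA [X in _ + X]dot_mulmxl FT dotC.
by rewrite [RHS]mulr_natl mulr2n.
Qed.

Lemma continuous_flow_dot x y : continuous (fun s => dot (flow_cov s *m x) y).
Proof.
move=> s; apply: differentiable_continuous; apply/derivable1_diffP.
have [] : is_derive s (1 : R) (fun s => dot (flow_cov s *m x) y)
  (dot ((B *m flow_cov s + flow_cov s *m B^T) *m x) y) => //.
apply: is_derive_eq.
  apply: is_derive_dot; last exact: mderiv_cst.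
  by apply: mderivM; [exact: mderiv_flow_cov|exact: mderiv_cst].
by rewrite mulmx0 addr0 dot0r addr0.
Qed.

Lemma flow_dot_measurable x y : measurable_fun setT (fun s => dot (flow_cov s *m x) y).
Proof. by apply: continuous_measurable_fun; exact: continuous_flow_dot. Qed.

Hypothesis posdef : forall x, x != 0 -> 0 < dot (G *m x) x.

(** Positivity of the diagonal of [G] excludes divergence there; the off-diagonal entries are
    dominated by the diagonal ones because the integrand is a Gram matrix. *)
Lemma flow_coord_integrable i j :
  leb.-integrable D (fun s => (flow_cov s i j)%:E).
Proof.
have mF k l : measurable_fun setT (fun s => flow_cov s k l).
  under eq_fun do rewrite flow_cov_coord.
  exact: flow_dot_measurable.
have diag_ge0 k s : 0 <= flow_cov s k k by rewrite flow_cov_coord flow_cov_dot dot_ge0.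
have diag k : leb.-integrable D (fun s => (flow_cov s k k)%:E).
  apply/integrableP; split; first by apply/measurable_EFinP; apply: measurable_funTS; exact: mF.
  under eq_integral do rewrite /= ger0_norm//.
  (* A divergent integral would be given the real value 0, contradicting the positivity of the
     diagonal entry. *)
  rewrite ltNge leye_eq; apply/negP => /eqP E.
  have : 0 < G k k.
    rewrite -dot_delta; apply: posdef; apply/eqP => /matrixP/(_ k 0); rewrite !mxE !eqxx/=.
    by move/eqP; rewrite oner_eq0.
  rewrite mxE /Rintegral.
  under eq_integral do rewrite -/(flow_cov _).
  by rewrite E ltxx.
apply: (@le_integrable _ _ _ leb D _ _ (fun s => (flow_cov s i i + flow_cov s j j)%:E)) => //.
- by apply/measurable_EFinP; apply: measurable_funTS; exact: mF.
- move=> s _; rewrite lee_fin [leRHS]ger0_norm ?addr_ge0//.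
  rewrite !flow_cov_coord !flow_cov_dot.
  set u := S *m _; set v := S *m (_ *m delta_mx i 0).
  have := dot_ge0 (u - v); have := dot_ge0 (u + v).
  rewrite !dotBl !dotBr !dotDl !dotDr (dotC v u) => H1 H2.
  have := dot_ge0 u; have := dot_ge0 v => *.
  by rewrite ler_norml; apply/andP; split; lra.
- by apply: (@eq_integrable _ _ _ leb D _ _ _ _ (integrableD _ (diag i) (diag j))).
Qed.

Lemma flow_dotE s x y : dot (flow_cov s *m x) y =
  \sum_i \sum_j (x j 0 * y i 0) * flow_cov s i j.
Proof.
apply: eq_bigr => i _; rewrite mxE mulr_suml; apply: eq_bigr => j _.
by ring.
Qed.

Lemma flow_dot_restrictE x y : (fun s => dot (flow_cov s *m x) y) \_ D =
  (fun s => \sum_i \sum_j (x j 0 * y i 0) * ((fun s => flow_cov s i j) \_ D) s).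
Proof.
apply/funext => s; rewrite patchE; case: ifPn => sD.
  rewrite flow_dotE; apply: eq_bigr => i _; apply: eq_bigr => j _.
  by rewrite patchE sD.
rewrite big1// => i _; rewrite big1// => j _.
by rewrite patchE (negbTE sD) mulr0.
Qed.

Lemma flow_coord_restrict_integrable i j :
  leb.-integrable setT (EFin \o ((fun s => flow_cov s i j) \_ D)).
Proof.
have H := flow_coord_integrable i j; rewrite -restrict_EFin.
have [+ _] := @integrable_mkcond _ _ _ leb D (fun s => (flow_cov s i j)%:E) (measurable_itv _).
exact.
Qed.

Lemma flow_dot_restrict_integrable x y :
  leb.-integrable setT (EFin \o ((fun s => dot (flow_cov s *m x) y) \_ D)).
Proof.
rewrite flow_dot_restrictE; apply: integrableR_sum => i.
apply: integrableR_sum => j; apply: integrableRZ.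
exact: flow_coord_restrict_integrable.
Qed.

Lemma flow_dot_integrable x y : leb.-integrable D (fun s => (dot (flow_cov s *m x) y)%:E).
Proof.
apply/integrable_mkcond => //; have := flow_dot_restrict_integrable x y.
by rewrite -restrict_EFin.
Qed.

Lemma flow_dot_integral x y : \int[leb]_(s in D) dot (flow_cov s *m x) y = dot (G *m x) y.
Proof.
rewrite Rintegral_mkcond flow_dot_restrictE RintegralR_sum => [|i]; last first.
  apply: integrableR_sum => j; apply: integrableRZ.
  exact: flow_coord_restrict_integrable.
apply: eq_bigr => i _; rewrite RintegralR_sum => [|j]; last first.
  by apply: integrableRZ; exact: flow_coord_restrict_integrable.
rewrite mxE mulr_suml; apply: eq_bigr => j _; rewrite RintegralZl//; last first.
  exact: flow_coord_restrict_integrable.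
rewrite -Rintegral_mkcond -/(flow_cov _).
have -> : \int[leb]_(x in D) flow_cov x i j = G i j.
  by rewrite mxE.
by ring.
Qed.

(** An unobservable [x] makes the integrand of <G x, x> vanish identically, against positive
    definiteness. *)
Lemma Q_infty_observable x : (forall s, S *m (expmx (s *: B^T) *m x) = 0) -> x = 0.
Proof.
move=> H; apply/eqP/negPn/negP => /posdef; rewrite -flow_dot_integral.
under eq_Rintegral do rewrite flow_cov_dot H dot0l.
by rewrite Rintegral_cst ?mul0r ?ltxx.
Qed.

Lemma flow_dot_cvg x y (T : nat -> R) : (forall k, k%:R <= T k) ->
  (fun k => \int[leb]_(s in `[0, T k]) dot (flow_cov s *m x) y) @ \oo --> dot (G *m x) y.
Proof.
move=> Tk; rewrite -flow_dot_integral.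
pose f s := dot (flow_cov s *m x) y.
have mf := flow_dot_measurable x y.
rewrite [X in _ --> X]Rintegral_mkcond; under eq_fun do rewrite Rintegral_mkcond.
have mI (I : set R) : measurable I -> measurable_fun setT (f \_ I).
  by move=> mD; apply/measurable_restrict => //; rewrite setTI; apply: measurable_funS mf.
have fD s : 0 <= s -> (f \_ D) s = f s.
  by move=> s0; rewrite patchE mem_set//= in_itv/= s0.
refine (proj2 (@Rintegral_cvg_dom _ _ _ leb (fun k => f \_ `[0, T k]) (f \_ D) (fun s => `|(f \_
    D) s|) _ _ _ _)).
- by move=> k; exact: mI.
- move=> s; case: (leP 0 s) => s0; last first.
    rewrite patchE memNset /= ?in_itv/= ?leNgt ?s0//.
    apply: cvg_near_cst; apply: nearW => k.
    by rewrite patchE memNset//= in_itv/= leNgt s0.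
  rewrite fD//; apply: cvg_near_cst; near=> k.
  rewrite patchE mem_set//= in_itv/= s0/= (le_trans _ (Tk k))//.
  by near: k; exact: nbhs_infty_ger.
- move=> k s; rewrite /= [in leLHS]patchE; case: ifPn; last by rewrite normr0.
  by rewrite inE /= in_itv/= => /andP[s0 _]; rewrite fD.
- by apply: integrableR_norm; exact: flow_dot_restrict_integrable.
Unshelve. all: by end_near.
Qed.

(** The fundamental theorem of calculus on [0, T_k]. The sequence is arbitrary so that convergence
    as time tends to infinity can be exploited along any chosen times. *)
Lemma lyapunov_limit x (T : nat -> R) : (forall k, k.+1%:R <= T k) ->
  (fun k => dot (flow_cov (T k) *m x) x) @ \oo -->
    dot (S *m x) (S *m x) + 2 * dot (G *m x) (B^T *m x).
Proof.
move=> Tk.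
have T0 k : 0 < T k by apply: lt_le_trans (Tk k).
have cF : continuous (fun s => 2 * dot (flow_cov s *m x) (B^T *m x)).
  move=> s; apply: (@continuousM _ _ (cst 2) (fun s => dot (flow_cov s *m x) (B^T *m x))).
    exact: cst_continuous.
  exact: continuous_flow_dot.
have E k : dot (flow_cov (T k) *m x) x = dot (S *m x) (S *m x) +
    2 * \int[leb]_(s in `[0, T k]) dot (flow_cov s *m x) (B^T *m x).
  have Hi : leb.-integrable `[0, T k] (EFin \o (fun s => dot (flow_cov s *m x) (B^T *m x))).
    apply: (@integrableS _ _ _ leb D) => //; last exact: flow_dot_integrable.
    by move=> s /=; rewrite !in_itv/= => /andP[->].
  rewrite -RintegralZl//.
  rewrite /Rintegral (@continuous_FTC2 _ _ (fun s => dot (flow_cov s *m x) x))//.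
  - have -> : dot (flow_cov 0 *m x) x = dot (S *m x) (S *m x).
      by rewrite flow_cov_dot expmx0 mul1mx.
    by rewrite -EFinB/= addrC subrK.
  - by apply: continuous_subspaceT; exact: cF.
  - split.
    + by move=> s _; have [] := is_derive_flow_dot s x.
    + by apply: cvg_at_right_filter; exact: continuous_flow_dot.
    + by apply: cvg_at_left_filter; exact: continuous_flow_dot.
  - by move=> s _; rewrite derive1E; have [_] := is_derive_flow_dot s x.
under eq_fun do rewrite E.
apply: cvgD; first exact: cvg_cst.
apply: cvgMr; apply: flow_dot_cvg => k.
by apply: le_trans (Tk k); rewrite ler_nat.
Qed.

(** The left-hand side is the limit at infinity of a nonnegative integrable function: a positive
    limit would make its integral diverge. *)
Lemma lyapunov_form x : dot (S *m x) (S *m x) + 2 * dot (G *m x) (B^T *m x) = 0.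
Proof.
set l := (X in X = 0).
have Hl := @lyapunov_limit x; rewrite -/l in Hl.
have l0 : 0 <= l.
  have H := Hl (fun k => k.+1%:R) (fun k => lexx _).
  rewrite -(cvg_lim _ H)//; apply: limr_ge; first by apply/cvg_ex; eexists; exact: H.
  by apply: nearW => k; rewrite flow_cov_dot dot_ge0.
apply/eqP; rewrite eq_le l0 andbT leNgt; apply/negP => lp.
(* Otherwise a sequence of times tending to infinity keeps the function below half of its limit. *)
have [T0 HT0] : exists k : nat, forall s, k.+1%:R <= s -> l / 2 <= dot (flow_cov s *m x) x.
  apply/not_existsP => H.
  have {}H k : exists s, k.+1%:R <= s /\ dot (flow_cov s *m x) x < l / 2.
    have /existsNP[s /not_implyP[ks /negP]] := H k.
    by rewrite -ltNge => lts; exists s.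
  pose T k := projT1 (cid (H k)).
  have HT := Hl T (fun k => (projT2 (cid (H k))).1).
  have : l <= l / 2.
    rewrite -{1}(cvg_lim _ HT)//; apply: limr_le; first by apply/cvg_ex; eexists; exact: HT.
    by apply: nearW => k; rewrite ltW// (projT2 (cid (H k))).2.
  lra.
have /integrableP[_] := flow_dot_integrable x x.
rewrite ltNge => /negP; apply.
under eq_integral do rewrite /= ger0_norm ?flow_cov_dot ?dot_ge0//.
have -> : (+oo = \int[leb]_(s in `[T0.+1%:R, +oo[) (l / 2)%:E)%E.
  rewrite integral_cst//= lebesgue_measure_itv/= ltry addye//.
  by rewrite gt0_muley// lte_fin divr_gt0.
apply: (@le_trans _ _ (\int[leb]_(s in `[T0.+1%:R, +oo[) (dot (flow_cov s *m x) x)%:E)%E).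
  apply: ge0_le_integral => //.
  - by move=> s _; rewrite lee_fin ltW// divr_gt0.
  - by apply/measurable_EFinP; apply: measurable_funTS; exact: flow_dot_measurable.
  - by move=> s /=; rewrite in_itv/= andbT lee_fin => /HT0.
under [X in (_ <= X)%E]eq_integral do rewrite -flow_cov_dot.
apply: ge0_subset_integral => //.
- by apply/measurable_EFinP; apply: measurable_funTS; exact: flow_dot_measurable.
- by move=> s _; rewrite lee_fin flow_cov_dot dot_ge0.
- by move=> s /=; rewrite !in_itv/= !andbT; apply: le_trans.
Qed.

(** Polarisation: a symmetric matrix whose quadratic form vanishes is zero. *)
Lemma Q_infty_lyapunov : B *m G + G *m B^T = - (S *m S).
Proof.
set M := B *m G + G *m B^T + S *m S.
have MT : M^T = M.
  by rewrite /M !linearD/= !trmx_mul trmxK Q_infty_sym ST [G *m _ + _]addrC.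
have M0 x : dot (M *m x) x = 0.
  rewrite !mulmxDl !dotDl -!mulmxA dot_mulmxl [X in _ + X]dot_mulmxl ST.
  rewrite [X in _ + X + _]dot_mulmxl Q_infty_sym.
  by have := lyapunov_form x; rewrite (dotC (B^T *m x)) => H; lra.
suff MM : M = 0 by apply/eqP; rewrite -subr_eq0 opprK -/M MM.
apply/matrixP => i j; rewrite -dot_delta mxE.
set u := delta_mx j 0; set v := delta_mx i 0.
have := M0 (u + v); rewrite mulmxDr dotDl !dotDr !M0 [dot (M *m v) u]dot_mulmxl MT [dot v _]dotC.
by move=> H; lra.
Qed.

End covariance_lyapunov.

(** * Squared modulus of complex numbers *)

Section complex_square.
Context {R : realType}.
Implicit Types (z w : R[i]) (a : R).

Definition sqn z : R := complex.Re z ^+ 2 + complex.Im z ^+ 2.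

Lemma ReD z w : complex.Re (z + w) = complex.Re z + complex.Re w.
Proof. by case: z w => a b []. Qed.

Lemma ImD z w : complex.Im (z + w) = complex.Im z + complex.Im w.
Proof. by case: z w => a b []. Qed.

Lemma ReN z : complex.Re (- z) = - complex.Re z.
Proof. by case: z. Qed.

Lemma ImN z : complex.Im (- z) = - complex.Im z.
Proof. by case: z. Qed.

Lemma ReM z w :
  complex.Re (z * w) = complex.Re z * complex.Re w - complex.Im z * complex.Im w.
Proof. by case: z w => a b []. Qed.

Lemma ImM z w :
  complex.Im (z * w) = complex.Re z * complex.Im w + complex.Im z * complex.Re w.
Proof. by case: z w => a b []. Qed.

Lemma complex_eq z w :
  complex.Re z = complex.Re w -> complex.Im z = complex.Im w -> z = w.
Proof. by case: z w => a b [c d] /= -> ->. Qed.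

Lemma Re_sum (I : Type) (r : seq I) (P : pred I) (F : I -> R[i]) :
  complex.Re (\sum_(i <- r | P i) F i) = \sum_(i <- r | P i) complex.Re (F i).
Proof. exact: (big_morph _ ReD). Qed.

Lemma Im_sum (I : Type) (r : seq I) (P : pred I) (F : I -> R[i]) :
  complex.Im (\sum_(i <- r | P i) F i) = \sum_(i <- r | P i) complex.Im (F i).
Proof. exact: (big_morph _ ImD). Qed.

Lemma normcE z : Normc.normc z = Num.sqrt (sqn z).
Proof. by case: z. Qed.

Lemma sqn_ge0 z : 0 <= sqn z.
Proof. by rewrite addr_ge0// sqr_ge0. Qed.

Lemma sqn0 : sqn 0 = 0.
Proof. by rewrite /sqn /= expr0n addr0. Qed.

Lemma sqnM z w : sqn (z * w) = sqn z * sqn w.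
Proof. by rewrite /sqn ReM ImM; ring. Qed.

Lemma sqnN z : sqn (- z) = sqn z.
Proof. by rewrite /sqn ReN ImN !sqrrN. Qed.

Lemma sqn_real a : sqn a%:C%C = a ^+ 2.
Proof. by rewrite /sqn /= expr0n addr0. Qed.

Lemma sqnB_sym z w : sqn (z - w) = sqn (w - z).
Proof. by rewrite -sqnN opprB. Qed.

Lemma sqn_le0 z : sqn z <= 0 -> z = 0.
Proof.
rewrite /sqn => H.
have := sqr_ge0 (complex.Re z); have := sqr_ge0 (complex.Im z) => H1 H2.
by apply: complex_eq => /=; apply/eqP; rewrite -sqrf_eq0; apply/eqP; lra.
Qed.

(** Young's inequality with a free weight; optimising the weight yields the triangle inequality in
    L^2. *)
Lemma sqnD_le a z w : 0 < a ->
  sqn (z + w) <= (1 + a) * sqn z + (1 + a^-1) * sqn w.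
Proof.
move=> a0; rewrite /sqn ReD ImD.
have key (x y : R) : (x + y) ^+ 2 <= (1 + a) * x ^+ 2 + (1 + a^-1) * y ^+ 2.
  rewrite -subr_ge0 (_ : _ - _ = a^-1 * (a * x - y) ^+ 2).
    by rewrite mulr_ge0 ?sqr_ge0// invr_ge0 ltW.
  by field; rewrite gt_eqF.
have := key (complex.Re z) (complex.Re w); have := key (complex.Im z) (complex.Im w).
by lra.
Qed.

Lemma sqnD_le2 z w : sqn (z + w) <= 2 * sqn z + 2 * sqn w.
Proof. by have := sqnD_le z w (@ltr01 R); rewrite invr1. Qed.

Lemma Re_le_sqn z : `|complex.Re z| <= Num.sqrt (sqn z).
Proof. by rewrite -sqrtr_sqr ler_sqrt ?sqn_ge0// lerDl sqr_ge0. Qed.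

Lemma Im_le_sqn z : `|complex.Im z| <= Num.sqrt (sqn z).
Proof. by rewrite -sqrtr_sqr ler_sqrt ?sqn_ge0// lerDr sqr_ge0. Qed.

End complex_square.

(** * The space L^2 *)

Section L2_theory.
Context {R : realType} {n : nat}.
Local Notation Rn := 'cV[R]_n.
Variable mu : probability Rn R.
Local Notation integrableR f := (mu.-integrable setT (EFin \o f)).
Implicit Types (f g : Rn -> R[i]).

Definition cmeasurable f := measurable_fun setT (fun x => complex.Re (f x)) /\
  measurable_fun setT (fun x => complex.Im (f x)).

Lemma cmeasurable_cst (c : R[i]) : cmeasurable (fun=> c).
Proof. by split; exact: measurable_cst. Qed.

Lemma cmeasurableD f g : cmeasurable f -> cmeasurable g ->
  cmeasurable (fun x => f x + g x).
Proof.
move=> [f1 f2] [g1 g2]; split.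
  by under eq_fun do rewrite ReD; exact: measurable_funD.
by under eq_fun do rewrite ImD; exact: measurable_funD.
Qed.

Lemma cmeasurableM f g : cmeasurable f -> cmeasurable g ->
  cmeasurable (fun x => f x * g x).
Proof.
move=> [f1 f2] [g1 g2]; split.
  by under eq_fun do rewrite ReM; apply: measurable_funB; apply: measurable_funM.
by under eq_fun do rewrite ImM; apply: measurable_funD; apply: measurable_funM.
Qed.

Lemma sqn_measurable f : cmeasurable f -> measurable_fun setT (fun x => sqn (f x)).
Proof. by move=> [f1 f2]; apply: measurable_funD; apply: measurable_funX. Qed.

Lemma L2normE f : L2norm mu f = ((\int[mu]_x (sqn (f x))%:E) `^ (2^-1))%E.
Proof.
rewrite /L2norm unlock; congr (_ `^ _)%E; apply: eq_integral => x _.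
rewrite normcE abse_EFin ger0_norm ?sqrtr_ge0// poweR_EFin.
by rewrite powR_mulrn ?sqrtr_ge0// sqr_sqrtr ?sqn_ge0.
Qed.

(** Real-valued; a divergent integral is replaced by 0, so comparisons with the extended norm
    require membership in [L2]. *)
Definition nrm f : R := Num.sqrt (\int[mu]_x sqn (f x)).

Lemma nrm_ge0 f : 0 <= nrm f. Proof. exact: sqrtr_ge0. Qed.

Lemma L2P f : L2 mu f <-> cmeasurable f /\ integrableR (fun x => sqn (f x)).
Proof.
split=> [[m1 m2 Lf]|[[m1 m2] If]].
  split=> //; apply/integrableP; split.
    by apply/measurable_EFinP; exact: sqn_measurable.
  under eq_integral do rewrite /= ger0_norm ?sqn_ge0//.
  move: Lf; rewrite L2normE; case: (\int[mu]_x _)%E => [r _| |_]; rewrite ?ltry ?ltNyr//.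
  by rewrite /= (_ : (2^-1 == 0 :> R) = false)// invr_eq0 pnatr_eq0.
split; [exact: m1|exact: m2|]; rewrite L2normE; have := integrable_fin_num measurableT If.
by rewrite /= => /fineK <-; rewrite poweR_EFin ltry.
Qed.

Lemma L2_cmeasurable f : L2 mu f -> cmeasurable f.
Proof. by move=> /L2P[]. Qed.

Lemma L2_integrable f : L2 mu f -> integrableR (fun x => sqn (f x)).
Proof. by move=> /L2P[]. Qed.

Lemma int_sqn_ge0 f : 0 <= \int[mu]_x sqn (f x).
Proof. by apply: Rintegral_ge0 => x _; exact: sqn_ge0. Qed.

Lemma nrm_sqr f : nrm f ^+ 2 = \int[mu]_x sqn (f x).
Proof. by rewrite sqr_sqrtr// int_sqn_ge0. Qed.

Lemma L2norm_nrm f : L2 mu f -> L2norm mu f = (nrm f)%:E.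
Proof.
move=> /L2_integrable If; rewrite L2normE EFin_RintegralT// poweR_EFin.
by rewrite powR12_sqrt// int_sqn_ge0.
Qed.

Lemma L2_dominated f (g : Rn -> R) : cmeasurable f ->
  (forall x, sqn (f x) <= g x) -> integrableR g -> L2 mu f.
Proof.
move=> mf fg Ig; apply/L2P; split=> //.
apply: (integrableR_dom _ _ Ig); first exact: sqn_measurable.
by move=> x; rewrite ger0_norm ?sqn_ge0.
Qed.

Lemma nrm_le_sqr f g (c : R) : L2 mu f -> L2 mu g ->
  (forall x, sqn (f x) <= c ^+ 2 * sqn (g x)) -> 0 <= c -> nrm f <= c * nrm g.
Proof.
move=> Lf Lg H c0; rewrite -(@ler_pXn2r _ 2)// ?nnegrE ?mulr_ge0 ?nrm_ge0//.
rewrite exprMn !nrm_sqr -RintegralZl//; last exact: L2_integrable.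
apply: le_RintegralT => //; first exact: L2_integrable.
by apply: integrableRZ; exact: L2_integrable.
Qed.

Lemma L2D f g : L2 mu f -> L2 mu g -> L2 mu (fun x => f x + g x).
Proof.
move=> Lf Lg.
apply: (@L2_dominated _ (fun x => 2 * sqn (f x) + 2 * sqn (g x))).
- by apply: cmeasurableD; exact: L2_cmeasurable.
- by move=> x; exact: sqnD_le2.
- by apply: integrableRD; apply: integrableRZ; exact: L2_integrable.
Qed.

Lemma L2_bddM f g (c : R) : cmeasurable f -> (forall x, sqn (f x) <= c) ->
  L2 mu g -> L2 mu (fun x => f x * g x).
Proof.
move=> mf fc Lg; apply: (@L2_dominated _ (fun x => c * sqn (g x))).
- by apply: cmeasurableM => //; exact: L2_cmeasurable.
- by move=> x; rewrite sqnM ler_wpM2r ?sqn_ge0.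
- by apply: integrableRZ; exact: L2_integrable.
Qed.

Lemma L2Z (c : R[i]) f : L2 mu f -> L2 mu (fun x => c * f x).
Proof. by apply: (@L2_bddM _ _ (sqn c)); first exact: cmeasurable_cst. Qed.

Lemma L2N f : L2 mu f -> L2 mu (fun x => - f x).
Proof. by move=> /(L2Z (-1)); under eq_fun do rewrite mulN1r. Qed.

Lemma L2B f g : L2 mu f -> L2 mu g -> L2 mu (fun x => f x - g x).
Proof. by move=> Lf Lg; apply: L2D => //; exact: L2N. Qed.

Lemma L2_bounded f (c : R) : cmeasurable f -> (forall x, sqn (f x) <= c) -> L2 mu f.
Proof.
by move=> mf fc; apply: (@L2_dominated _ (fun=> c)) => //; exact: cst_integrable.
Qed.

Lemma L2_cst (c : R[i]) : L2 mu (fun=> c).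
Proof. by apply: (@L2_bounded _ (sqn c)) => //; exact: cmeasurable_cst. Qed.

Lemma nrm_eq f g : f =1 g -> nrm f = nrm g.
Proof. by move=> /funext ->. Qed.

Lemma nrm0 : nrm (fun=> 0) = 0.
Proof.
rewrite /nrm; under eq_Rintegral do rewrite sqn0.
by rewrite Rintegral_cstT sqrtr0.
Qed.

Lemma nrmZ (c : R[i]) f : L2 mu f -> nrm (fun x => c * f x) = Num.sqrt (sqn c) * nrm f.
Proof.
move=> Lf; rewrite /nrm -sqrtrM ?sqn_ge0// -RintegralZl//; last exact: L2_integrable.
by congr Num.sqrt; apply: eq_Rintegral => x _; rewrite sqnM.
Qed.

Lemma nrmN f : nrm (fun x => - f x) = nrm f.
Proof. by rewrite /nrm; under eq_Rintegral do rewrite sqnN. Qed.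

Lemma nrmB_sym f g : nrm (fun x => f x - g x) = nrm (fun x => g x - f x).
Proof. by rewrite /nrm; under eq_Rintegral do rewrite sqnB_sym. Qed.

(** Minkowski from [sqnD_le] with weight B / A, where A and B exceed the two norms by e / 2; the
    slack prevents a division by zero. *)
Lemma nrmD f g : L2 mu f -> L2 mu g -> nrm (fun x => f x + g x) <= nrm f + nrm g.
Proof.
move=> Lf Lg; apply/ler_addgt0Pr => e e0.
have e2 : 0 < e / 2 by rewrite divr_gt0.
have e2' := ltW e2; pose A := nrm f + e / 2; pose B := nrm g + e / 2.
have A0 : 0 < A by rewrite /A ltr_wpDl ?nrm_ge0 ?divr_gt0 ?ltr0n.
have B0 : 0 < B by rewrite /B ltr_wpDl ?nrm_ge0 ?divr_gt0 ?ltr0n.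
have -> : nrm f + nrm g + e = A + B by rewrite /A /B; field.
have A1 := ltW A0; have B1 := ltW B0.
rewrite -(@ler_pXn2r _ 2)// ?nnegrE ?addr_ge0 ?nrm_ge0//.
have BA : 0 < B / A by rewrite divr_gt0.
have -> : (A + B) ^+ 2 = (1 + B / A) * A ^+ 2 + (1 + (B / A)^-1) * B ^+ 2.
  by field; rewrite !gt_eqF.
apply: (@le_trans _ _ ((1 + B / A) * nrm f ^+ 2 + (1 + (B / A)^-1) * nrm g ^+ 2)).
  have If := L2_integrable Lf; have Ig := L2_integrable Lg.
  rewrite !nrm_sqr -!RintegralZl// -RintegralD//; try exact: integrableRZ.
  apply: le_RintegralT; first by apply: L2_integrable; exact: L2D.
    by apply: integrableRD; exact: integrableRZ.
  by move=> x; exact: sqnD_le.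
have sA : nrm f ^+ 2 <= A ^+ 2.
  by rewrite ler_pXn2r ?nnegrE ?nrm_ge0// /A lerDl.
have sB : nrm g ^+ 2 <= B ^+ 2.
  by rewrite ler_pXn2r ?nnegrE ?nrm_ge0// /B lerDl.
apply: lerD; by rewrite ler_wpM2l// addr_ge0// ?invr_ge0 ltW//.
Qed.

Lemma nrm_tri f g h : L2 mu f -> L2 mu g -> L2 mu h ->
  nrm (fun x => f x - h x) <= nrm (fun x => f x - g x) + nrm (fun x => g x - h x).
Proof.
move=> Lf Lg Lh; apply: le_trans (nrmD (L2B Lf Lg) (L2B Lg Lh)).
by rewrite le_eqVlt; apply/orP; left; apply/eqP; apply: nrm_eq => x; rewrite addrA subrK.
Qed.

Lemma nrm_le_add f g : L2 mu f -> L2 mu g -> nrm f <= nrm g + nrm (fun x => f x - g x).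
Proof.
move=> Lf Lg; apply: le_trans (nrmD Lg (L2B Lf Lg)).
by rewrite le_eqVlt; apply/orP; left; apply/eqP; apply: nrm_eq => x; rewrite addrC subrK.
Qed.

Lemma nrm_ae f g : L2 mu f -> L2 mu g -> {ae mu, forall x, f x = g x} -> nrm f = nrm g.
Proof.
move=> Lf Lg fg; rewrite /nrm /Rintegral; congr (Num.sqrt (fine _)).
apply: ae_eq_integral => //.
- by apply/measurable_EFinP; exact: sqn_measurable (L2_cmeasurable Lf).
- by apply/measurable_EFinP; exact: sqn_measurable (L2_cmeasurable Lg).
- by apply: filterS fg => x /= -> _.
Qed.

Lemma nrm_eq0_ae f : L2 mu f -> nrm f = 0 -> {ae mu, forall x, f x = 0}.
Proof.
move=> Lf f0.
have mf : measurable_fun setT (fun x => (sqn (f x))%:E).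
  by apply/measurable_EFinP; exact: sqn_measurable (L2_cmeasurable Lf).
have H : (\int[mu]_x `|(sqn (f x))%:E| = 0)%E.
  under eq_integral do rewrite /= ger0_norm ?sqn_ge0//.
  by rewrite EFin_RintegralT; [rewrite -nrm_sqr f0 expr0n|exact: L2_integrable].
have /= := proj1 (ae_eq_integral_abs mu measurableT mf) H.
by apply: filterS => x /(_ I) [] E; apply: sqn_le0; rewrite E.
Qed.

Lemma sqrt_measurable : measurable_fun setT (@Num.sqrt R).
Proof. by apply: continuous_measurable_fun; exact: sqrt_continuous. Qed.

(** Nonnegativity of the integral of (|h| - m)^2, with m the integral of |h|. *)
Lemma L1_le_L2 (h : Rn -> R) : measurable_fun setT h ->
  integrableR (fun x => h x ^+ 2) ->
  integrableR h /\ \int[mu]_x `|h x| <= Num.sqrt (\int[mu]_x h x ^+ 2).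
Proof.
move=> mh I2.
have Ih : integrableR h.
  apply: (@integrableR_dom _ _ _ mu _ (fun x => 1 + h x ^+ 2)) => // [x|].
    rewrite -(real_normK (num_real (h x))); have := sqr_ge0 (`|h x| - 1).
    by move: (normr_ge0 (h x)); nra.
  by apply: integrableRD => //; exact: cst_integrable.
split=> //; set m := \int[mu]_x _.
have Ia : integrableR (fun x => `|h x|) by exact: integrableR_norm.
have m0 : 0 <= m by apply: Rintegral_ge0.
have : 0 <= \int[mu]_x (h x ^+ 2 + (m ^+ 2 + (- (2 * m)) * `|h x|)).
  apply: Rintegral_ge0 => x _; rewrite -(real_normK (num_real (h x))).
  by have := sqr_ge0 (`|h x| - m); nra.
have I3 : integrableR (fun x => (- (2 * m)) * `|h x|) by exact: integrableRZ.
have I4 : integrableR (fun x => m ^+ 2 + (- (2 * m)) * `|h x|).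
  by apply: integrableRD => //; exact: cst_integrable.
rewrite RintegralD// RintegralD//; last exact: cst_integrable.
rewrite Rintegral_cstT RintegralZl// -/m => H.
rewrite -[leLHS]ger0_norm// -sqrtr_sqr ler_sqrt; first by nra.
by apply: Rintegral_ge0 => x _; exact: sqr_ge0.
Qed.

Lemma L2_Re_integrable f : L2 mu f -> integrableR (fun x => complex.Re (f x)).
Proof.
move=> Lf; have [m1 m2] := L2_cmeasurable Lf; apply: (proj1 (L1_le_L2 _ _)) => //.
apply: (@integrableR_dom _ _ _ mu _ (fun x => sqn (f x))); last exact: L2_integrable.
  exact: measurable_funX.
by move=> x; rewrite ger0_norm ?sqr_ge0// lerDl sqr_ge0.
Qed.

Lemma L2_Im_integrable f : L2 mu f -> integrableR (fun x => complex.Im (f x)).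
Proof.
move=> Lf; have [m1 m2] := L2_cmeasurable Lf; apply: (proj1 (L1_le_L2 _ _)) => //.
apply: (@integrableR_dom _ _ _ mu _ (fun x => sqn (f x))); last exact: L2_integrable.
  exact: measurable_funX.
by move=> x; rewrite ger0_norm ?sqr_ge0// lerDr sqr_ge0.
Qed.

Lemma sqrt_sqn_integrable f : L2 mu f -> integrableR (fun x => Num.sqrt (sqn (f x))).
Proof.
move=> Lf; have mf := sqn_measurable (L2_cmeasurable Lf).
apply: (proj1 (L1_le_L2 _ _)).
  exact: (measurableT_comp sqrt_measurable mf).
by under eq_fun do rewrite sqr_sqrtr ?sqn_ge0//; exact: L2_integrable.
Qed.

Lemma int_sqrt_sqn_le f : L2 mu f -> \int[mu]_x Num.sqrt (sqn (f x)) <= nrm f.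
Proof.
move=> Lf; have mf := sqn_measurable (L2_cmeasurable Lf).
have := @L1_le_L2 (fun x => Num.sqrt (sqn (f x))); case.
- by exact: (measurableT_comp sqrt_measurable mf).
- by under eq_fun do rewrite sqr_sqrtr ?sqn_ge0//; exact: L2_integrable.
move=> _; under eq_Rintegral do rewrite ger0_norm ?sqrtr_ge0//.
by under [in leRHS]eq_Rintegral do rewrite sqr_sqrtr ?sqn_ge0//.
Qed.

End L2_theory.

(** * Completeness of L^2 *)

Section completeness.
Context {R : realType} {n : nat}.
Local Notation Rn := 'cV[R]_n.
Variable mu : probability Rn R.
Local Notation integrableR f := (mu.-integrable setT (EFin \o f)).
Local Notation nrm := (nrm mu).

Lemma sum_half_le (m : nat) : \sum_(0 <= k < m) (2^-1 ^+ k : R) <= 2.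
Proof.
suff -> : \sum_(0 <= k < m) (2^-1 ^+ k : R) = 2 - 2 * 2^-1 ^+ m.
  by rewrite gerBl mulr_ge0// exprn_ge0.
elim: m => [|m IH]; first by rewrite big_nil expr0 mulr1 subrr.
by rewrite big_nat_recr//= IH exprS; field.
Qed.

(** The sum of the absolute increments has integral at most 2, hence is finite almost everywhere,
    and the telescoping series converges there. *)
Lemma fast_cvg_ae (h : nat -> Rn -> R) : (forall k, integrableR (h k)) ->
  (forall k, \int[mu]_x `|h k.+1 x - h k x| <= 2^-1 ^+ k) ->
  {ae mu, forall x, cvgn (h ^~ x)}.
Proof.
move=> Ih Hh.
have Id k : integrableR (fun x => `|h k.+1 x - h k x|).
  by apply: integrableR_norm; exact: integrableRB.
pose D k x := (`|h k.+1 x - h k x|)%:E.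
have D0 k x : (0 <= D k x)%E by rewrite lee_fin.
have mD k : measurable_fun setT (D k).
  by apply/measurable_EFinP; exact: integrableR_measurable (Id k).
have mS : measurable_fun setT (fun x => \sum_(k <oo) D k x)%E.
  by apply: ge0_emeasurable_sum => k //.
have IS : mu.-integrable setT (fun x => \sum_(k <oo) D k x)%E.
  apply/integrableP; split=> //.
  under eq_integral do rewrite gee0_abs ?nneseries_ge0//.
  rewrite integral_nneseries//.
  apply: (@le_lt_trans _ _ 2%:E); last exact: ltry.
  apply: lime_le; first by apply: is_cvg_nneseries => k _ _; apply: integral_ge0.
  apply: nearW => m; rewrite (eq_bigr (fun k => (\int[mu]_x `|h k.+1 x - h k x|)%:E)).
    by rewrite sumEFin lee_fin; apply: le_trans (sum_half_le m); apply: ler_sum.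
  by move=> k _; rewrite -EFin_RintegralT.
have := integrable_ae measurableT IS.
apply: filterS => x /(_ I) Fx.
have H1 : cvgn [normed series (fun k => h k.+1 x - h k x)].
  apply: nondecreasing_is_cvgn.
    by apply/nondecreasing_seqP => m; rewrite /series/= [leRHS]big_nat_recr//= lerDl.
  exists (fine (\sum_(k <oo) D k x)%E) => _ [m _ <-].
  rewrite -lee_fin fineK// /series/= -sumEFin.
  by apply: nneseries_lim_ge.
have H2 := normed_cvg H1.
have -> : h ^~ x = (fun m => h 0 x + series (fun k => h k.+1 x - h k x) m).
  by apply/funext => m; rewrite /series/= telescope_sumr// addrC subrK.
by apply: is_cvgD H2; exact: is_cvg_cst.
Qed.

(** An upper limit, measurable without any convergence, and equal to the limit wherever that
    exists. *)
Definition seq_limit (h : nat -> Rn -> R) x : R :=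
  fine (limn_esup (fun k => (h k x)%:E)).

Lemma seq_limit_measurable h : (forall k, measurable_fun setT (h k)) ->
  measurable_fun setT (seq_limit h).
Proof.
move=> mh; apply: (measurableT_comp (fine_measurable measurableT)).
by apply: measurable_fun_limn_esup => k; apply/measurable_EFinP.
Qed.

Lemma seq_limit_cvg h x : cvgn (h ^~ x) -> h ^~ x @ \oo --> seq_limit h x.
Proof.
move=> /cvg_ex[l hl]; rewrite /seq_limit.
have H : (fun k => (h k x)%:E) @ \oo --> l%:E by apply: cvg_EFin => //; exact: nearW.
rewrite is_cvg_limn_esupE; last by apply/cvg_ex; exists l%:E.
by rewrite (cvg_lim _ H).
Qed.

Lemma fatou_bound_ae (f_ : nat -> Rn -> R) (f : Rn -> R) (K : \bar R) :
  (forall k, measurable_fun setT (f_ k)) -> (forall k x, 0 <= f_ k x) ->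
  measurable_fun setT f -> (forall x, 0 <= f x) ->
  {ae mu, forall x, f_ ^~ x @ \oo --> f x} ->
  (\forall k \near \oo, (\int[mu]_x (f_ k x)%:E <= K)%E) ->
  (\int[mu]_x (f x)%:E <= K)%E.
Proof.
move=> mf f0 mff ff0 ff fK.
have A1 k : measurable_fun setT (EFin \o f_ k) by exact/measurable_EFinP.
have := @fatou _ _ _ mu setT measurableT (fun k => EFin \o f_ k) A1 (fun k x _ => f0 k x).
move=> H; apply: (@le_trans _ _ (\int[mu]_x limn_einf (fun k => (EFin \o f_ k) x))%E); last first.
  apply: le_trans H _.
  rewrite limn_einf_lim; apply: lime_le; first exact: is_cvg_einfs.
  near=> k; apply: (@le_trans _ _ (\int[mu]_x (f_ k x)%:E)%E).
    by apply: ereal_inf_lbound; exists k => //=.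
  by near: k.
apply: ae_ge0_le_integral => //.
- by move=> x _; rewrite lee_fin.
- exact/measurable_EFinP.
- move=> x _; rewrite limn_einf_lim; apply: lime_ge; first exact: is_cvg_einfs.
  by apply: nearW => k; apply: le_ereal_inf_tmp => _ [m _ <-]; rewrite lee_fin.
- have -> : (fun x => limn_einf (fun k => (EFin \o f_ k) x)) =
      (fun x => - limn_esup (fun k => - (EFin \o f_ k) x))%E.
    apply/funext => x; have := limn_esupN (fun k => (EFin \o f_ k) x).
    by move=> E; rewrite -[LHS]oppeK -E.
  apply: measurableT_comp => //; apply: measurable_fun_limn_esup => k.
  exact: measurableT_comp.
apply: filterS ff => x fx _.
have cx : (fun k => (f_ k x)%:E) @ \oo --> (f x)%:E.
  by apply: cvg_EFin => //; exact: nearW.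
rewrite is_cvg_limn_einfE; first by rewrite (cvg_lim _ cx).
by apply/cvg_ex; exists (f x)%:E.
Unshelve. all: by end_near.
Qed.

(** Riesz-Fischer: a fast subsequence converges almost everywhere, and Fatou turns the Cauchy bounds
    into bounds on the distance to its limit. *)
Lemma L2_complete (F : nat -> Rn -> R[i]) : (forall k, L2 mu (F k)) ->
  (forall e, 0 < e -> exists N, forall k l, (N <= k)%N -> (N <= l)%N ->
    nrm (fun x => F k x - F l x) <= e) ->
  exists2 f, L2 mu f & forall e, 0 < e -> exists N, forall k, (N <= k)%N ->
    nrm (fun x => F k x - f x) <= e.
Proof.
move=> LF CF.
have h0 (j : nat) : 0 < 2^-1 ^+ j :> R by rewrite exprn_gt0.
pose N j := projT1 (cid (CF _ (h0 j))).
have HN j k l : (N j <= k)%N -> (N j <= l)%N -> nrm (fun x => F k x - F l x) <= 2^-1 ^+ j.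
  exact: (projT2 (cid (CF _ (h0 j)))).
(* The partial sum puts both m_j and m_(j+1) beyond N_j, so consecutive terms differ by at most
   2^-j, and the summand j makes the indices tend to infinity. *)
pose m j := (j + \sum_(i < j.+1) N i)%N.
have mN j : (N j <= m j)%N by rewrite /m big_ord_recr /= addnA leq_addl.
have mN1 j : (N j <= m j.+1)%N.
  rewrite /m big_ord_recr /= big_ord_recr /=; apply: leq_trans (leq_addl _ _).
  by rewrite -addnA addnCA leq_addr.
have mj j : (j <= m j)%N by rewrite leq_addr.
have step j : nrm (fun x => F (m j.+1) x - F (m j) x) <= 2^-1 ^+ j by exact: HN.
have mF k : cmeasurable (F k) by exact: L2_cmeasurable (LF k).
have cRe : {ae mu, forall x, cvgn (fun j => complex.Re (F (m j) x))}.
  apply: fast_cvg_ae => [k|k]; first exact: L2_Re_integrable.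
  apply: le_trans (step k); apply: le_trans (int_sqrt_sqn_le (L2B (LF _) (LF _))).
  apply: le_RintegralT; last by move=> x; rewrite -ReN -ReD Re_le_sqn.
    by apply: integrableR_norm; apply: integrableRB; exact: L2_Re_integrable.
  by apply: sqrt_sqn_integrable; exact: L2B.
have cIm : {ae mu, forall x, cvgn (fun j => complex.Im (F (m j) x))}.
  apply: fast_cvg_ae => [k|k]; first exact: L2_Im_integrable.
  apply: le_trans (step k); apply: le_trans (int_sqrt_sqn_le (L2B (LF _) (LF _))).
  apply: le_RintegralT; last by move=> x; rewrite -ImN -ImD Im_le_sqn.
    by apply: integrableR_norm; apply: integrableRB; exact: L2_Im_integrable.
  by apply: sqrt_sqn_integrable; exact: L2B.
pose f x : R[i] := (seq_limit (fun j x => complex.Re (F (m j) x)) x +i*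
  seq_limit (fun j x => complex.Im (F (m j) x)) x)%C.
have mf : cmeasurable f.
  by split; apply: seq_limit_measurable => k; have [] := mF (m k).
have key e : 0 < e -> exists N, forall k, (N <= k)%N ->
    (\int[mu]_x (sqn (F k x - f x))%:E <= (e ^+ 2)%:E)%E.
  move=> e0; have [N0 HN0] := CF e e0; exists N0 => k Nk.
  have mBk g : cmeasurable g -> measurable_fun setT (fun x => sqn (F k x - g x)).
    move=> mg; apply: sqn_measurable; apply: cmeasurableD => //.
    by under eq_fun do rewrite -mulN1r; apply: cmeasurableM => //; exact: cmeasurable_cst.
  apply: (@fatou_bound_ae (fun j x => sqn (F k x - F (m j) x))) => //.
  - by move=> j; exact: mBk.
  - by move=> j x; exact: sqn_ge0.
  - exact: mBk.
  - by move=> x; exact: sqn_ge0.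
  - apply: filterS2 cRe cIm => x H1 H2.
    have c1 := @seq_limit_cvg (fun j x => complex.Re (F (m j) x)) x H1.
    have c2 := @seq_limit_cvg (fun j x => complex.Im (F (m j) x)) x H2.
    rewrite /sqn; apply: cvgD; rewrite expr2; under eq_fun do rewrite expr2.
      by apply: cvgM; rewrite ReD ReN; under eq_fun do rewrite ReD ReN;
        apply: cvgB => //; exact: cvg_cst.
    by apply: cvgM; rewrite ImD ImN; under eq_fun do rewrite ImD ImN;
        apply: cvgB => //; exact: cvg_cst.
  - near=> j.
    have Lj := L2B (LF k) (LF (m j)).
    rewrite EFin_RintegralT; last exact: L2_integrable.
    rewrite lee_fin -nrm_sqr ler_pXn2r ?nnegrE ?nrm_ge0 ?(ltW e0)//.
    apply: HN0 => //; apply: leq_trans (mj j).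
    by near: j; exact: nbhs_infty_ge.
have LB k : (\int[mu]_x (sqn (F k x - f x))%:E < +oo)%E -> L2 mu (fun x => F k x - f x).
  move=> H; have mB : cmeasurable (fun x => F k x - f x).
    apply: cmeasurableD => //.
    by under eq_fun do rewrite -mulN1r; apply: cmeasurableM => //; exact: cmeasurable_cst.
  apply/L2P; split=> //; apply/integrableP; split.
    by apply/measurable_EFinP; exact: sqn_measurable.
  by under eq_integral do rewrite /= ger0_norm ?sqn_ge0//.
exists f.
  have [N1 H1] := key 1 ltr01.
  have L1 := LB N1 (le_lt_trans (H1 N1 (leqnn _)) (ltry _)).
  rewrite (_ : f = (fun x => F N1 x - (F N1 x - f x))); first exact: L2B.
  by apply/funext => x; rewrite opprB addrC subrK.
move=> e e0; have [N1 H1] := key e e0; exists N1 => k Nk.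
have L1 := LB k (le_lt_trans (H1 k Nk) (ltry _)).
have := H1 k Nk; rewrite EFin_RintegralT; last exact: L2_integrable.
by rewrite lee_fin -nrm_sqr ler_pXn2r ?nnegrE ?nrm_ge0 ?(ltW e0).
Unshelve. all: by end_near.
Qed.

End completeness.

(** * Local boundedness of the semigroup *)

Section semigroup_bound.
Context {R : realType} {n : nat}.
Local Notation Rn := 'cV[R]_n.
Variable mu : probability Rn R.
Variable T : R -> (Rn -> R[i]) -> (Rn -> R[i]).
Hypothesis CT : C0_semigroup mu T.
Local Notation nrm := (nrm mu).
Local Notation L2 := (L2 mu).
Implicit Types (f g : Rn -> R[i]) (s t : R).

Lemma sg_L2 t f : 0 <= t -> L2 f -> L2 (T t f).
Proof. by move=> t0 Lf; exact: (semigroup_L2 CT t0 Lf). Qed.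

Lemma sg_bound t : 0 <= t -> exists2 M : R, 0 <= M & forall f, L2 f -> nrm (T t f) <= M * nrm f.
Proof.
move=> t0; have [M HM] := semigroup_bounded CT t0; exists `|M| => // f Lf.
have := HM f Lf; rewrite !L2norm_nrm//; last exact: sg_L2.
rewrite -EFinM lee_fin => /le_trans; apply.
by rewrite ler_wpM2r ?nrm_ge0// ler_norm.
Qed.

Lemma nrm_sgD t (a : R[i]) f g : 0 <= t -> L2 f -> L2 g ->
  nrm (T t (fun x => a * f x + g x)) = nrm (fun x => a * T t f x + T t g x).
Proof.
move=> t0 Lf Lg; apply: nrm_ae; last exact: (semigroup_linear CT).
  by apply: sg_L2 => //; apply: L2D => //; exact: L2Z.
by apply: L2D; [apply: L2Z|]; exact: sg_L2.
Qed.

Lemma nrm_sgB t f g : 0 <= t -> L2 f -> L2 g ->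
  nrm (fun x => T t f x - T t g x) = nrm (T t (fun x => f x - g x)).
Proof.
move=> t0 Lf Lg.
rewrite (@nrm_eq _ _ _ _ (fun x => -1 * T t g x + T t f x)); last by move=> x; rewrite mulN1r addrC.
rewrite -nrm_sgD//; congr (nrm (T t _)); apply/funext => x.
by rewrite mulN1r addrC.
Qed.

Lemma nrm_sg_comp s t f g : 0 <= s -> 0 <= t -> L2 f -> L2 g ->
  nrm (fun x => T (s + t) f x - g x) = nrm (fun x => T s (T t f) x - g x).
Proof.
move=> s0 t0 Lf Lg; apply: nrm_ae.
- by apply: L2B => //; apply: sg_L2 => //; exact: addr_ge0.
- by apply: L2B => //; apply: sg_L2 => //; exact: sg_L2.
- by apply: filterS (semigroupD CT s0 t0 Lf) => x ->.
Qed.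

Lemma nrm_sg0 f g : L2 f -> L2 g ->
  nrm (fun x => T 0 f x - g x) = nrm (fun x => f x - g x).
Proof.
move=> Lf Lg; apply: nrm_ae.
- by apply: L2B => //; apply: sg_L2.
- exact: L2B.
- by apply: filterS (semigroup0 CT Lf) => x ->.
Qed.

Lemma sg_continuous f (e : R) : L2 f -> 0 < e -> exists2 d : R, 0 < d &
  forall t, 0 <= t -> t < d -> nrm (fun x => T t f x - f x) <= e.
Proof.
move=> Lf e0.
have H := semigroup_continuous CT Lf.
have : \forall t \near 0^'+, (L2norm mu (fun x => T t f x - f x)%R < e%:E)%E.
  apply: (H [set y | (y < e%:E)%E]); exists e => //= y; rewrite /= sub0r normrN => ye.
  by rewrite lte_fin (le_lt_trans _ ye)// ler_norm.
rewrite near_withinE => -[d /= d0 Hd]; exists d => // t t0 td.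
have [->|tn0] := eqVneq t 0.
  rewrite nrm_sg0// (@nrm_eq _ _ _ _ (fun=> 0)); last by move=> x; rewrite subrr.
  by rewrite nrm0 ltW.
have t1 : 0 < t by rewrite lt_def tn0.
have := Hd t; rewrite /= sub0r normrN ger0_norm// => /(_ td t1).
by rewrite L2norm_nrm ?lte_fin; [exact: ltW|apply: L2B => //; exact: sg_L2].
Qed.

(** A supremum over the unit ball, meaningful for nonnegative times, where the set is nonempty and
    bounded. *)
Definition opnorm t := sup [set nrm (T t f) | f in [set f | L2 f /\ nrm f <= 1]].

Lemma opnorm_has_sup t : 0 <= t ->
  has_sup [set nrm (T t f) | f in [set f | L2 f /\ nrm f <= 1]].
Proof.
move=> t0; split.
  exists (nrm (T t (fun=> 0))), (fun=> 0) => //; split; first exact: L2_cst.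
  by rewrite nrm0.
have [M M0 HM] := sg_bound t0; exists M => _ [f [Lf f1] <-].
by apply: le_trans (HM f Lf) _; rewrite ler_piMr.
Qed.

Lemma nrm_sgZ t (a : R) f : 0 <= t -> 0 <= a -> L2 f ->
  nrm (T t (fun x => a%:C%C * f x)) = a * nrm (T t f).
Proof.
move=> t0 a0 Lf.
have L0 : L2 (fun=> 0) := L2_cst _ _.
have Z : nrm (T t (fun=> 0)) = 0.
  have [M M0 HM] := sg_bound t0; apply/eqP; rewrite eq_le nrm_ge0 andbT.
  by apply: le_trans (HM _ L0) _; rewrite nrm0 mulr0.
have Z1 := nrm_eq0_ae (sg_L2 t0 L0) Z.
transitivity (nrm (fun x => a%:C%C * T t f x)).
  transitivity (nrm (T t (fun x => a%:C%C * f x + 0))).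
    by congr (nrm (T t _)); apply/funext => x; rewrite addr0.
  rewrite nrm_sgD//; apply: nrm_ae.
  - by apply: L2D; [apply: L2Z|]; exact: sg_L2.
  - by apply: L2Z; exact: sg_L2.
  - by apply: filterS Z1 => x ->; rewrite addr0.
rewrite nrmZ; last exact: sg_L2.
by rewrite sqn_real sqrtr_sqr ger0_norm.
Qed.

Lemma opnorm_le t f : 0 <= t -> L2 f -> nrm (T t f) <= opnorm t * nrm f.
Proof.
move=> t0 Lf; have [f0|f0] := eqVneq (nrm f) 0.
  have [M M0 HM] := sg_bound t0; rewrite f0 mulr0.
  by apply: le_trans (HM f Lf) _; rewrite f0 mulr0.
have fp : 0 < nrm f by rewrite lt_def f0 nrm_ge0.
rewrite -ler_pdivrMr// mulrC -nrm_sgZ// ?invr_ge0 ?nrm_ge0//.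
apply: ub_le_sup; first by case: (opnorm_has_sup t0).
exists (fun x => ((nrm f)^-1)%:C%C * f x) => //; split; first exact: L2Z.
by rewrite nrmZ// sqn_real sqrtr_sqr ger0_norm ?invr_ge0 ?nrm_ge0// mulVf.
Qed.

Lemma opnorm_adherent t c : 0 <= t -> c < opnorm t ->
  exists f, [/\ L2 f, nrm f <= 1 & c < nrm (T t f)].
Proof.
move=> t0 ct.
have [|_ [f [Lf f1] <-]] := @sup_adherent _ _ (opnorm t - c) _ (opnorm_has_sup t0).
  by rewrite subr_gt0.
by rewrite opprB addrC subrK => H; exists f.
Qed.

(* Either [x + c y] or [x - c y] works, since their images differ by [2 c T y]. *)
Lemma hump_step t (c : R) x y : 0 <= t -> 0 <= c -> L2 x -> L2 y ->
  exists z, [/\ L2 z, nrm (fun u => z u - x u) <= c * nrm y &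
    c * nrm (T t y) <= nrm (T t z)].
Proof.
move=> t0 c0 Lx Ly; have Lcy : L2 (fun u => c%:C%C * y u) by exact: L2Z.
have Lp := L2D Lx Lcy; have Lm := L2B Lx Lcy.
have Ec : nrm (fun u => c%:C%C * y u) = c * nrm y.
  by rewrite nrmZ// sqn_real sqrtr_sqr ger0_norm.
have [H|H] := lerP (c * nrm (T t y)) (nrm (T t (fun u => x u + c%:C%C * y u))).
  exists (fun u => x u + c%:C%C * y u); split => //.
  by under eq_fun do rewrite addrC addKr; rewrite Ec.
exists (fun u => x u - c%:C%C * y u); split => //.
  by under eq_fun do rewrite addrC addKr; rewrite nrmN Ec.
rewrite leNgt; apply/negP => H2.
have : nrm (T t (fun u => (2 * c)%:C%C * y u)) = 2 * c * nrm (T t y).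
  by rewrite nrm_sgZ// mulr_ge0.
have -> : (fun u => (2 * c)%:C%C * y u) = (fun u => (x u + c%:C%C * y u) - (x u - c%:C%C * y u)).
  apply/funext => u; apply: complex_eq; rewrite !(ReD, ReN, ImD, ImN, ReM, ImM) /=; ring.
rewrite -nrm_sgB// => E.
have := nrmD (sg_L2 t0 Lp) (L2N (sg_L2 t0 Lm)); rewrite nrmN E => H3.
lra.
Qed.

Lemma geometric_small (q e : R) : 0 <= q -> q < 1 -> 0 < e -> exists k, q ^+ k <= e.
Proof.
move=> q0 q1 e0.
have H : (fun k => q ^+ k) @ \oo --> 0 by apply: cvg_expr; rewrite ger0_norm.
have /cvgr0Pnorm_le/(_ e e0)[N _ HN] := H.
by exists N; have := HN N (leqnn N); rewrite /= ger0_norm// exprn_ge0.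
Qed.

Lemma hump_arith (a p o : R) : p * (2 / 3 * o) <= a + o * (2^-1 * p) -> p * o <= a * 6.
Proof. by lra. Qed.

(* Sokal's gliding hump. *)
Lemma hump_sequence (s : nat -> R) : (forall k, 0 <= s k) ->
  (forall k, 4 ^+ k < opnorm (s k)) ->
  exists2 x, L2 x & forall k, (4 / 3) ^+ k / 6 <= nrm (T (s k) x).
Proof.
move=> s0 Hs.
have op0 k : 0 < opnorm (s k) by apply: le_lt_trans (Hs k); exact: exprn_ge0.
have /choice[y Hy] k : exists f, [/\ L2 f, nrm f <= 1 & 2 / 3 * opnorm (s k) < nrm (T (s k) f)].
  by apply: opnorm_adherent => //; have := op0 k; lra.
(* Perturbations of size 3^-k leave a tail of size at most 3^-k / 2 after step k. The step gains 2/3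
   of 3^-k times the operator norm and the tail spoils at most 1/2 of it, so 1/6 survives, against
   operator norms beyond 4^k. *)
pose q : R := 3^-1.
have q0 k : 0 < q ^+ k by rewrite exprn_gt0// invr_gt0.
have step k (x : {f | L2 f}) : exists z : {f | L2 f},
    nrm (fun u => sval z u - sval x u) <= q ^+ k /\
    q ^+ k * nrm (T (s k) (y k)) <= nrm (T (s k) (sval z)).
  have [Ly y1 _] := Hy k.
  have [z [Lz z1 z2]] := hump_step (s0 k) (ltW (q0 k)) (svalP x) Ly.
  by exists (exist _ z Lz); split => //=; apply: le_trans z1 _; rewrite ler_piMr// ltW.
pose X := nat_rect (fun=> {f | L2 f}) (exist _ _ (L2_cst mu 0))
  (fun k x => projT1 (cid (step k x))).
have X1 k : nrm (fun u => sval (X k.+1) u - sval (X k) u) <= q ^+ k.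
  by have [] := projT2 (cid (step k (X k))).
have X2 k : q ^+ k * nrm (T (s k) (y k)) <= nrm (T (s k) (sval (X k.+1))).
  by have [] := projT2 (cid (step k (X k))).
have LX k : L2 (sval (X k)) := svalP (X k).
have X3 k m : nrm (fun u => sval (X (k.+1 + m)%N) u - sval (X k.+1) u) <=
    2^-1 * q ^+ k - 2^-1 * q ^+ (k + m).
  elim: m => [|m IH].
    rewrite !addn0 subrr (@nrm_eq _ _ _ _ (fun=> 0)) ?nrm0// => u.
    by rewrite subrr.
  rewrite addnS; apply: le_trans (nrm_tri (LX _) (LX (k.+1 + m)%N) (LX _)) _.
  have H := X1 (k.+1 + m)%N; apply: le_trans (lerD H IH) _.
  rewrite addnS addSn !exprS; move: (q ^+ k) (q ^+ (k + m)) => a b.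
  by rewrite le_eqVlt; apply/orP; left; apply/eqP; rewrite /q; field.
have X4 k l : (k < l)%N -> nrm (fun u => sval (X l) u - sval (X k.+1) u) <= 2^-1 * q ^+ k.
  move=> /subnKC <-; apply: le_trans (X3 k _) _.
  by have := q0 (k + (l - k.+1))%N; lra.
have [x Lx Hx] : exists2 x, L2 x & forall e, 0 < e -> exists N, forall k, (N <= k)%N ->
    nrm (fun u => sval (X k) u - x u) <= e.
  apply: L2_complete => // e e0.
  have [||N HN] := @geometric_small q e _ _ e0; rewrite /q ?invr_ge0//.
    by rewrite invf_lt1// ltr1n.
  exists N.+1 => k l Nk Nl; apply: le_trans (nrm_tri (LX _) (LX N.+1) (LX _)) _.
  rewrite [X in _ + X]nrmB_sym; apply: le_trans (lerD (X4 _ _ Nk) (X4 _ _ Nl)) _.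
  by rewrite -mulrDl (_ : 2^-1 + 2^-1 = 1 :> R) ?mul1r//; field.
exists x => // k.
have X5 : nrm (fun u => sval (X k.+1) u - x u) <= 2^-1 * q ^+ k.
  apply/ler_addgt0Pr => e e0; have [N HN] := Hx e e0.
  apply: le_trans (nrm_tri (LX _) (LX (k.+1 + N)%N) Lx) _.
  apply: lerD; last by apply: HN; rewrite leq_addl.
  by rewrite nrmB_sym; apply: X4; rewrite ltnS leq_addr.
have [Ly y1 Hyk] := Hy k.
have H1 := nrm_le_add (sg_L2 (s0 k) (LX k.+1)) (sg_L2 (s0 k) Lx).
rewrite nrm_sgB// in H1.
have H2 := opnorm_le (s0 k) (L2B (LX k.+1) Lx).
have H3 : opnorm (s k) * nrm (fun u => sval (X k.+1) u - x u) <= opnorm (s k) * (2^-1 * q ^+ k).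
  by rewrite ler_pM2l.
have H4 : q ^+ k * (2 / 3 * opnorm (s k)) <= q ^+ k * nrm (T (s k) (y k)).
  by rewrite ler_pM2l// ltW.
have H5 : q ^+ k * 4 ^+ k <= q ^+ k * opnorm (s k) by rewrite ler_pM2l// ltW.
have -> : (4 / 3) ^+ k = q ^+ k * 4 ^+ k by rewrite -exprMn mulrC.
have H7 := le_trans (X2 k) (le_trans H1 (lerD (lexx _) (le_trans H2 H3))).
have {H7}H8 := le_trans H4 H7.
by rewrite ler_pdivrMr//; apply: le_trans H5 _; exact: hump_arith H8.
Qed.

(** Otherwise there are times tending to 0 with operator norms beyond 4^k; the hump vector then has
    unbounded images along them, contradicting strong continuity at 0. *)
Lemma sg_bounded_near0 : exists2 d : R, 0 < d & exists2 M : R, 1 <= M &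
  forall s f, 0 <= s -> s <= d -> L2 f -> nrm (T s f) <= M * nrm f.
Proof.
apply: contrapT => H.
have /choice[s Hs] k : exists s : R, [/\ 0 <= s, s <= k.+1%:R^-1 & 4 ^+ k < opnorm s].
  apply: contrapT => Hk; apply: H; exists k.+1%:R^-1; first by rewrite invr_gt0.
  exists (4 ^+ k); first by rewrite exprn_ege1// ler1n.
  move=> s f s0 sk Lf; apply: le_trans (opnorm_le s0 Lf) _.
  rewrite ler_wpM2r ?nrm_ge0// leNgt; apply/negP => sk4; apply: Hk; exists s.
  by split.
have s0 k : 0 <= s k by have [] := Hs k.
have [|x Lx Hx] := hump_sequence s0; first by move=> k; have [] := Hs k.
have [d d0 Hd] := sg_continuous Lx ltr01.
have [K HK] : exists K, (4 / 3 : R) ^+ K / 6 > nrm x + 1.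
  have p0 : 0 < 6 * (nrm x + 1) + 1 by have := nrm_ge0 mu x; lra.
  have c0 : 0 <= 3 / 4 :> R by lra.
  have c1 : 3 / 4 < 1 :> R by lra.
  have p1 : 0 < (6 * (nrm x + 1) + 1)^-1 by rewrite invr_gt0.
  have [K HK] := geometric_small c0 c1 p1.
  exists K; rewrite ltr_pdivlMr// mulrC.
  apply: (@lt_le_trans _ _ (6 * (nrm x + 1) + 1)); first by rewrite ltrDl.
  have q0 : 0 < (3 / 4 : R) ^+ K by apply: exprn_gt0; lra.
  by rewrite -[leLHS]invrK -[leRHS]invrK -exprVn invf_div lef_pV2 ?posrE.
have [k [Kk kd]] : exists k, (K <= k)%N /\ k.+1%:R^-1 < d.
  have H2 : (fun k => k.+1%:R^-1 : R) @ \oo --> 0 by exact: cvg_harmonic.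
  have /cvgr0Pnorm_lt/(_ d d0)[M _ HM] := H2.
  exists (maxn K M); split; first exact: leq_maxl.
  by have := HM (maxn K M) (leq_maxr _ _); rewrite /= ger0_norm.
have [_ sk _] := Hs k.
have H1 := Hd _ (s0 k) (le_lt_trans sk kd).
have H2 := nrm_le_add (sg_L2 (s0 k) Lx) Lx.
have H3 := Hx k.
have H4 : (4 / 3 : R) ^+ K <= (4 / 3) ^+ k by rewrite ler_weXn2l//; lra.
have := le_trans H2 (lerD (lexx _) H1); move: H3 H4 HK.
by move: (nrm _) ((4 / 3) ^+ _) ((4 / 3) ^+ _) (nrm _) => a b c e; clear -a b c e; lra.
Qed.

(** An interval of length t is covered by finitely many steps of length [d], and the bounds
    multiply. *)
Lemma sg_bounded t : exists2 M : R, 1 <= M &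
  forall s f, 0 <= s -> s <= t -> L2 f -> nrm (T s f) <= M * nrm f.
Proof.
have [d d0 [M M1 HM]] := sg_bounded_near0.
have M0 : 0 <= M by exact: le_trans M1.
have key (k : nat) s f : 0 <= s -> s <= k.+1%:R * d -> L2 f -> nrm (T s f) <= M ^+ k.+1 * nrm f.
  elim: k s f => [|k IH] s f s0 sk Lf; first by rewrite expr1; apply: HM => //; rewrite mul1r in sk.
  have [sd|ds] := lerP s d.
    apply: le_trans (HM _ _ s0 sd Lf) _; rewrite ler_wpM2r ?nrm_ge0//.
    by rewrite exprS ler_peMr// exprn_ege1.
  have sd0 : 0 <= s - d by rewrite subr_ge0 ltW.
  have := nrm_sg_comp (ltW d0) sd0 Lf (L2_cst mu 0).
  rewrite addrCA subrr addr0.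
  rewrite (@nrm_eq _ _ _ _ (T s f)) => [|x]; last by rewrite subr0.
  rewrite [RHS](@nrm_eq _ _ _ _ (T d (T (s - d) f))) => [->|x]; last by rewrite subr0.
  apply: le_trans (HM _ _ (ltW d0) (lexx _) (sg_L2 sd0 Lf)) _.
  rewrite exprS -mulrA ler_wpM2l//; apply: IH => //.
  by rewrite lerBlDr (le_trans sk)// [X in X * d]mulrSr mulrDl mul1r.
pose k := Num.Def.truncn (t / d).
exists (M ^+ k.+1); first exact: exprn_ege1.
move=> s f s0 st; apply: key => //.
rewrite (le_trans st)// -ler_pdivrMr// ltW//.
by apply: truncnS_gt.
Qed.

End semigroup_bound.

(** * Density of trigonometric polynomials *)

Section trigonometric_polynomials.
Context {R : realType} {n : nat}.
Local Notation Rn := 'cV[R]_n.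
Implicit Types (s : seq (R[i] * Rn)) (x y : Rn).

Definition wave y x : R[i] := (cos (dot y x) +i* sin (dot y x))%C.

Definition trigpoly s x : R[i] := \sum_(p <- s) p.1 * wave p.2 x.

Lemma waveD y z x : wave (y + z) x = wave y x * wave z x.
Proof.
apply: complex_eq; rewrite ?ReM ?ImM /= dotDl.
  by rewrite cosD.
by rewrite sinD addrC mulrC [X in _ + X]mulrC addrC [sin _ * _]mulrC mulrC.
Qed.

Lemma sqn_wave y x : sqn (wave y x) = 1.
Proof. by rewrite /sqn /= cos2Dsin2. Qed.

Lemma wave_cmeasurable y : cmeasurable (wave y).
Proof. by split; [exact: cos_dot_measurable|exact: sin_dot_measurable]. Qed.

Lemma trigpoly_nil x : trigpoly [::] x = 0.
Proof. by rewrite /trigpoly big_nil. Qed.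

Lemma trigpoly_cons p s x : trigpoly (p :: s) x = p.1 * wave p.2 x + trigpoly s x.
Proof. by rewrite /trigpoly big_cons. Qed.

Lemma trigpoly_cat s1 s2 x : trigpoly (s1 ++ s2) x = trigpoly s1 x + trigpoly s2 x.
Proof. by rewrite /trigpoly big_cat. Qed.

Definition trig_mul s1 s2 := [seq (p.1 * q.1, p.2 + q.2) | p <- s1, q <- s2].

Lemma trigpoly_mul s1 s2 x : trigpoly (trig_mul s1 s2) x = trigpoly s1 x * trigpoly s2 x.
Proof.
rewrite /trigpoly /trig_mul big_allpairs_dep/= mulr_suml; apply: eq_bigr => p _.
rewrite mulr_sumr; apply: eq_bigr => q _.
by rewrite waveD mulrACA.
Qed.

Definition trig_scale (c : R[i]) s := [seq (c * p.1, p.2) | p <- s].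

Lemma trigpoly_scale c s x : trigpoly (trig_scale c s) x = c * trigpoly s x.
Proof.
rewrite /trigpoly big_map mulr_sumr; apply: eq_bigr => p _.
by rewrite mulrA.
Qed.

Lemma trigpoly_cmeasurable s : cmeasurable (trigpoly s).
Proof.
elim: s => [|p s IH].
  rewrite (_ : trigpoly [::] = fun=> 0); first exact: cmeasurable_cst.
  by apply/funext => x; rewrite trigpoly_nil.
rewrite (_ : trigpoly (p :: s) = fun x => p.1 * wave p.2 x + trigpoly s x); last first.
  by apply/funext => x; rewrite trigpoly_cons.
apply: cmeasurableD => //.
by apply: cmeasurableM; [exact: cmeasurable_cst|exact: wave_cmeasurable].
Qed.

Lemma trigpoly_bounded s : exists c : R, forall x, sqn (trigpoly s x) <= c.
Proof.
elim: s => [|p s [c IH]].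
  by exists 0 => x; rewrite trigpoly_nil sqn0.
exists (2 * sqn p.1 + 2 * c) => x; rewrite trigpoly_cons.
apply: le_trans (sqnD_le2 _ _) _; rewrite sqnM sqn_wave mulr1 lerD2l.
by rewrite ler_wpM2l.
Qed.

Lemma sin_trigpoly y (b : R) : exists s, forall x, (sin (dot y x + b))%:C%C = trigpoly s x.
Proof.
exists [:: ((sin b / 2 -i* (cos b / 2))%C, y); ((sin b / 2 +i* (cos b / 2))%C, - y)] => x.
rewrite !trigpoly_cons trigpoly_nil addr0 sinD.
apply: complex_eq; rewrite ?(ReD, ReM, ImD, ImM) /= dotNl cosN sinN; by field.
Qed.

End trigonometric_polynomials.

Section density_of_trigonometric_polynomials.
Context {R : realType} {n : nat}.
Local Notation Rn := 'cV[R]_n.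
Variable mu : probability Rn R.
Local Notation nrm := (nrm mu).
Local Notation L2 := (L2 mu).
Local Notation integrableR f := (mu.-integrable setT (EFin \o f)).
Implicit Types (f : Rn -> R[i]) (g : Rn -> R) (A : set Rn).

Lemma trigpoly_L2 s : L2 (trigpoly s).
Proof.
by have [c Hc] := trigpoly_bounded s; apply: L2_bounded Hc; exact: trigpoly_cmeasurable.
Qed.

Definition trig_approx f := L2 f /\
  forall e, 0 < e -> exists s, nrm (fun x => f x - trigpoly s x) <= e.

Lemma trig_approx_closed f : L2 f ->
  (forall e, 0 < e -> exists2 f', trig_approx f' & nrm (fun x => f x - f' x) <= e) ->
  trig_approx f.
Proof.
move=> Lf H; split=> // e e0.
have e2 : 0 < e / 2 by rewrite divr_gt0.
have [f' [Lf' Hf'] ff'] := H _ e2; have [s Hs] := Hf' _ e2; exists s.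
apply: le_trans (nrm_tri Lf Lf' (trigpoly_L2 s)) _.
by rewrite [leRHS]splitr lerD.
Qed.

Lemma trig_approx_trigpoly s : trig_approx (trigpoly s).
Proof.
split=> [|e e0]; first exact: trigpoly_L2.
by exists s; rewrite (@nrm_eq _ _ _ _ (fun=> 0)) ?nrm0 ?ltW// => x; rewrite subrr.
Qed.

Lemma trig_approxD f1 f2 : trig_approx f1 -> trig_approx f2 ->
  trig_approx (fun x => f1 x + f2 x).
Proof.
move=> [L1 H1] [L2 H2]; split=> [|e e0]; first exact: L2D.
have e2 : 0 < e / 2 by rewrite divr_gt0.
have [s1 Hs1] := H1 _ e2; have [s2 Hs2] := H2 _ e2; exists (s1 ++ s2).
rewrite [leRHS]splitr; apply: le_trans (lerD Hs1 Hs2).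
apply: le_trans (nrmD (L2B L1 (trigpoly_L2 s1)) (L2B L2 (trigpoly_L2 s2))).
rewrite le_eqVlt; apply/orP; left; apply/eqP; apply: nrm_eq => x.
by rewrite trigpoly_cat opprD addrACA.
Qed.

Lemma trig_approxZ (c : R[i]) f : trig_approx f -> trig_approx (fun x => c * f x).
Proof.
move=> [Lf Hf]; split=> [|e e0]; first exact: L2Z.
have c1 : 0 < Num.sqrt (sqn c) + 1 by rewrite ltr_wpDl ?sqrtr_ge0.
have [s Hs] := Hf _ (divr_gt0 e0 c1); exists (trig_scale c s).
rewrite (@nrm_eq _ _ _ _ (fun x => c * (f x - trigpoly s x))) => [|x]; last first.
  by rewrite trigpoly_scale mulrBr.
rewrite nrmZ; last by apply: L2B => //; exact: trigpoly_L2.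
apply: (@le_trans _ _ (Num.sqrt (sqn c) * (e / (Num.sqrt (sqn c) + 1)))).
  by rewrite ler_wpM2l ?sqrtr_ge0.
by rewrite mulrCA ler_piMr ?ltW// ltr_pdivrMr// mul1r ltrDl.
Qed.

(* Bounded multipliers of the closure of the trigonometric polynomials: they
   form an algebra stable under bounded pointwise limits. *)
Definition multiplier g := [/\ measurable_fun setT g, exists c : R, forall x, `|g x| <= c &
  forall s, trig_approx (fun x => (g x)%:C%C * trigpoly s x)].

Lemma cmeasurable_real g : measurable_fun setT g -> cmeasurable (fun x => (g x)%:C%C).
Proof. by split => //; exact: measurable_cst. Qed.

Lemma bounded_sqn g (c : R) : (forall x, `|g x| <= c) -> forall x, sqn (g x)%:C%C <= c ^+ 2.
Proof.
move=> gc x; rewrite sqn_real -(real_normK (num_real (g x))).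
by rewrite ler_pXn2r ?nnegrE// (le_trans _ (gc x)).
Qed.

Lemma multiplier_trigpoly g s : (forall x, (g x)%:C%C = trigpoly s x) -> multiplier g.
Proof.
move=> gs; split.
- have [m _] := trigpoly_cmeasurable s; apply: eq_measurable_fun m => x _.
  by rewrite -gs.
- have [c Hc] := trigpoly_bounded s; exists (Num.sqrt c) => x.
  have := Hc x; rewrite -gs sqn_real => H; rewrite -sqrtr_sqr ler_sqrt//.
  by apply: le_trans H; exact: sqr_ge0.
- move=> s'; rewrite (_ : (fun x => _) = trigpoly (trig_mul s s')).
    exact: trig_approx_trigpoly.
  by apply/funext => x; rewrite trigpoly_mul gs.
Qed.

Lemma multiplier_cst (a : R) : multiplier (fun=> a).
Proof.
apply: (@multiplier_trigpoly _ [:: (a%:C%C, 0)]) => x.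
rewrite trigpoly_cons trigpoly_nil addr0.
by apply: complex_eq; rewrite ?(ReM, ImM) /= dot0l cos0 sin0; ring.
Qed.

Lemma multiplierD g1 g2 : multiplier g1 -> multiplier g2 -> multiplier (fun x => g1 x + g2 x).
Proof.
move=> [m1 [c1 b1] H1] [m2 [c2 b2] H2]; split.
- exact: measurable_funD.
- by exists (c1 + c2) => x; apply: le_trans (ler_normD _ _) _; exact: lerD.
- move=> s; have := trig_approxD (H1 s) (H2 s).
  by congr trig_approx; apply/funext => x; rewrite -mulrDl -rmorphD.
Qed.

Lemma multiplierM g1 g2 : multiplier g1 -> multiplier g2 -> multiplier (fun x => g1 x * g2 x).
Proof.
move=> [m1 [c1 b1] H1] [m2 [c2 b2] H2]; split.
- exact: measurable_funM.
- by exists (c1 * c2) => x; rewrite normrM; apply: ler_pM.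
- move=> s; have [L2s H2s] := H2 s.
  have E : (fun x => (g1 x * g2 x)%:C%C * trigpoly s x) =
      (fun x => (g1 x)%:C%C * ((g2 x)%:C%C * trigpoly s x)).
    by apply/funext => x; rewrite rmorphM mulrA.
  have Lg1 f : L2 f -> L2 (fun x => (g1 x)%:C%C * f x).
    by apply: L2_bddM; [exact: cmeasurable_real|exact: bounded_sqn b1].
  have c0 : 0 <= c1 by apply: le_trans (b1 0).
  have c1p : 0 < c1 + 1 by rewrite ltr_wpDl.
  rewrite E; apply: trig_approx_closed; first exact: Lg1.
  move=> e e0; have [s' Hs'] := H2s (e / (c1 + 1)) (divr_gt0 e0 c1p).
  exists (fun x => (g1 x)%:C%C * trigpoly s' x); first exact: H1.
  have LB := L2B L2s (trigpoly_L2 s').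
  rewrite (@nrm_eq _ _ _ _ (fun x => (g1 x)%:C%C * ((g2 x)%:C%C * trigpoly s x - trigpoly s'
      x))); last first.
    by move=> x; rewrite mulrBr.
  apply: (@le_trans _ _ (c1 * nrm (fun x => (g2 x)%:C%C * trigpoly s x - trigpoly s' x))).
    apply: nrm_le_sqr => //; first exact: Lg1.
    by move=> x; rewrite sqnM ler_wpM2r ?sqn_ge0// (bounded_sqn b1).
  apply: (@le_trans _ _ (c1 * (e / (c1 + 1)))); first by rewrite ler_wpM2l.
  by rewrite mulrCA ler_piMr ?ltW// ltr_pdivrMr// mul1r ltrDl.
Qed.

Lemma multiplierZ (a : R) g : multiplier g -> multiplier (fun x => a * g x).
Proof. by move=> H; apply: multiplierM => //; exact: multiplier_cst. Qed.

Lemma nrm_dominated_cvg (f_ : nat -> Rn -> R[i]) f (h : Rn -> R) (e : R) :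
  (forall k, L2 (f_ k)) -> L2 f ->
  (forall x, (fun k => sqn (f_ k x - f x)) @ \oo --> 0) ->
  (forall k x, sqn (f_ k x - f x) <= h x) -> integrableR h -> 0 < e ->
  exists k, nrm (fun x => f_ k x - f x) <= e.
Proof.
move=> Lf_ Lf H1 H2 Ih e0.
have [|||//|_ H] := @Rintegral_cvg_dom _ _ _ mu (fun k x => sqn (f_ k x - f x)) (fun=> 0) h.
- by move=> k; apply: sqn_measurable; apply: L2_cmeasurable; exact: L2B.
- exact: H1.
- by move=> k x; rewrite ger0_norm ?sqn_ge0.
move: H; rewrite Rintegral_cstT => /cvgr0Pnorm_le/(_ _ (exprn_gt0 2 e0))[N _ HN].
exists N; have := HN N (leqnn N); rewrite /= ger0_norm ?int_sqn_ge0// -nrm_sqr.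
by rewrite ler_pXn2r ?nnegrE ?nrm_ge0 ?(ltW e0).
Qed.

Lemma sqr_cvg0 (u : nat -> R) (a : R) : u @ \oo --> a ->
  (fun k => (u k - a) ^+ 2) @ \oo --> 0.
Proof.
move=> ua; have H : (fun k => u k - a) @ \oo --> 0.
  by rewrite -(subrr a); apply: cvgB => //; exact: cvg_cst.
by rewrite -(mulr0 0); under eq_fun do rewrite expr2; exact: cvgM.
Qed.

(** Dominated convergence in L^2, with (2 c)^2 times the squared modulus of the trigonometric
    polynomial as majorant. *)
Lemma multiplier_lim (g_ : nat -> Rn -> R) g (c : R) : (forall k, multiplier (g_ k)) ->
  (forall k x, `|g_ k x| <= c) -> (forall x, g_ ^~ x @ \oo --> g x) -> multiplier g.
Proof.
move=> H b l.
have mg : measurable_fun setT g.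
  apply: (@measurable_fun_cvg _ _ _ _ g_) => [k|x _]; last exact: l.
  by have [] := H k.
have bg x : `|g x| <= c.
  have lx : (fun k => `|g_ k x|) @ \oo --> `|g x| by apply: cvg_norm; exact: l.
  rewrite -(cvg_lim _ lx)//; apply: limr_le; first by apply/cvg_ex; eexists; exact: lx.
  by apply: nearW => k; exact: b.
split => //; first by exists c.
move=> s.
have Lg (h : Rn -> R) (mh : measurable_fun setT h) (bh : forall x : Rn, `|h x| <= c) : L2 (fun x
    => (h x)%:C%C * trigpoly s x).
  by apply: L2_bddM; [exact: cmeasurable_real|exact: bounded_sqn bh|exact: trigpoly_L2].
have mk k : measurable_fun setT (g_ k) by have [] := H k.
apply: trig_approx_closed; first exact: Lg.
move=> e e0.
have E k x : sqn ((g_ k x)%:C%C * trigpoly s x - (g x)%:C%C * trigpoly s x) =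
    (g_ k x - g x) ^+ 2 * sqn (trigpoly s x).
  by rewrite -mulrBl sqnM -rmorphB sqn_real.
have [||||||k Hk] := @nrm_dominated_cvg (fun k x => (g_ k x)%:C%C * trigpoly s x)
    (fun x => (g x)%:C%C * trigpoly s x) (fun x => (2 * c) ^+ 2 * sqn (trigpoly s x)) e.
- by move=> k; exact: Lg.
- exact: Lg.
- move=> x; under eq_fun do rewrite E; rewrite -(mul0r (sqn (trigpoly s x))).
  apply: cvgM; last exact: cvg_cst.
  exact: sqr_cvg0.
- move=> k x; rewrite E ler_wpM2r ?sqn_ge0// -(real_normK (num_real (_ - _))).
  have c0 : 0 <= 2 * c by rewrite mulr_ge0// (le_trans _ (bg 0)).
  rewrite ler_pXn2r ?nnegrE//.
  by apply: le_trans (ler_normB _ _) _; rewrite mulrDl mul1r lerD.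
- by apply: integrableRZ; apply: L2_integrable; exact: trigpoly_L2.
- by [].
exists (fun x => (g_ k x)%:C%C * trigpoly s x); first by have [_ _] := H k; apply.
by rewrite nrmB_sym.
Qed.

(* The iterates of [a |-> (3 a - a^3) / 2] converge to the sign on [-1, 1]. *)
Definition sign_step (a : R) := (3 * a - a ^+ 3) / 2.

(** The identity 1 - f(b) = (1 - b)(1 - b/2 - b^2/2), with f the step: as the iterates stay above
    [a], each one contracts the distance to 1 by at least 1 - a/2. *)
Lemma sign_step_pos (a : R) (k : nat) : 0 < a -> a <= 1 ->
  [/\ a <= iter k sign_step a, iter k sign_step a <= 1 &
    1 - iter k sign_step a <= (1 - a / 2) ^+ k].
Proof.
move=> a0 a1; elim: k => [|k [H1 H2 H3]]; first by rewrite /= expr0; split => //; lra.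
rewrite iterS; set b := iter k _ _ in H1 H2 H3 *.
have E : 1 - sign_step b = (1 - b) * (1 - b / 2 - b ^+ 2 / 2).
  by rewrite /sign_step; field.
split.
- rewrite /sign_step; nra.
- rewrite -subr_ge0 E mulr_ge0//; first by lra.
  nra.
- rewrite E [leRHS]exprSr; apply: ler_pM => //; first by lra.
    by nra.
  by nra.
Qed.

Lemma sign_stepN (a : R) k : iter k sign_step (- a) = - iter k sign_step a.
Proof. by elim: k => //= k ->; rewrite /sign_step; field. Qed.

Lemma sign_step0 k : iter k sign_step 0 = 0.
Proof. by elim: k => //= k ->; rewrite /sign_step expr0n /=; field. Qed.

Lemma sign_step_cvg_pos (a : R) : 0 < a -> a <= 1 ->
  (fun k => iter k sign_step a) @ \oo --> (1 : R).
Proof.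
move=> a0 a1; have q0 : 0 <= 1 - a / 2 by lra.
have H : (fun k => (1 - a / 2) ^+ k) @ \oo --> 0.
  by apply: cvg_expr; rewrite ger0_norm//; lra.
apply/cvgrPdist_le => e e0; have /cvgr0Pnorm_le/(_ e e0) := H.
apply: filterS => k; rewrite ger0_norm ?exprn_ge0// => He.
have [_ H2 H3] := sign_step_pos k a0 a1.
by rewrite ger0_norm ?subr_ge0//; exact: le_trans H3 He.
Qed.

Lemma sign_step_cvg (a : R) : `|a| <= 1 ->
  (fun k => iter k sign_step a) @ \oo --> Num.sg a.
Proof.
move=> a1; have [a0|a0|->] := ltgtP a 0.
- rewrite ltr0_sg// -(opprK a); under eq_fun do rewrite sign_stepN.
  apply: cvgN; apply: sign_step_cvg_pos; first by rewrite oppr_gt0.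
  by move: a1; rewrite ltr0_norm.
- by rewrite gtr0_sg//; apply: sign_step_cvg_pos => //; rewrite gtr0_norm in a1.
- by rewrite sgr0; under eq_fun do rewrite sign_step0; exact: cvg_cst.
Qed.

Lemma sign_step_le1 (a : R) k : `|a| <= 1 -> `|iter k sign_step a| <= 1.
Proof.
move=> a1; have [a0|a0|->] := ltgtP a 0.
- rewrite -(opprK a) sign_stepN normrN.
  have [|| H1 H2 _] := @sign_step_pos (- a) k; first by rewrite oppr_gt0.
    by move: a1; rewrite ltr0_norm.
  by rewrite ger0_norm//; apply: le_trans H1; rewrite oppr_ge0 ltW.
- have [|| H1 H2 _] := @sign_step_pos a k => //; first by rewrite gtr0_norm in a1.
  by rewrite ger0_norm//; apply: le_trans H1; rewrite ltW.
- by rewrite sign_step0 normr0.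
Qed.

(** Rescaling [g] into [-1, 1] preserves its sign, and each iterate is a polynomial in a
    multiplier. *)
Lemma multiplier_sign g : multiplier g -> multiplier (fun x => Num.sg (g x)).
Proof.
move=> Mg; have [mg [c bg] _] := Mg.
have c0 : 0 <= c by apply: le_trans (bg 0).
have c1 : 0 < c + 1 by rewrite ltr_wpDl.
have b1 x : `|(c + 1)^-1 * g x| <= 1.
  rewrite normrM ger0_norm ?invr_ge0 ?(ltW c1)// ler_pdivrMl// mulr1.
  by rewrite (le_trans (bg x))// lerDl.
apply: (@multiplier_lim (fun k x => iter k sign_step ((c + 1)^-1 * g x)) _ 1).
- elim=> [|k IH]; first exact: multiplierZ.
  rewrite (_ : (fun x => _) = fun x => 3 / 2 * iter k sign_step ((c + 1)^-1 * g x) +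
    (- 2^-1) * (iter k sign_step ((c + 1)^-1 * g x) * (iter k sign_step ((c + 1)^-1 * g x) *
      iter k sign_step ((c + 1)^-1 * g x)))).
    by apply: multiplierD; apply: multiplierZ => //; do 2 apply: multiplierM => //.
  by apply/funext => x; rewrite iterS /sign_step; field.
- by move=> k x; exact: sign_step_le1.
- move=> x; have := sign_step_cvg (b1 x).
  by rewrite sgrM gtr0_sg ?invr_gt0// mul1r.
Qed.

Lemma multiplier_pos g : multiplier g -> multiplier (fun x => (0 < g x)%R%:R).
Proof.
move=> /multiplier_sign H.
rewrite (_ : (fun x => _) = fun x => 2^-1 * (Num.sg (g x) * Num.sg (g x) + Num.sg (g x))).
  by apply: multiplierZ; apply: multiplierD => //; exact: multiplierM.
apply/funext => x; have [g0|g0|->] := ltgtP (g x) 0.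
- by rewrite ltr0_sg// mulrNN mulr1 subrr mulr0.
- by rewrite gtr0_sg//=; field.
- by rewrite sgr0 mulr0 addr0 mulr0.
Qed.

Definition multiplier_set A := multiplier (\1_A : Rn -> R).

Lemma multiplier_setC A : multiplier_set A -> multiplier_set (~` A).
Proof.
move=> H; rewrite /multiplier_set (_ : \1_(~` A) = fun x => 1 + (-1) * \1_A x).
  by apply: multiplierD; [exact: multiplier_cst|exact: multiplierZ].
by apply/funext => x; rewrite !indicE in_setC; case: (x \in A); rewrite /= ?mulr1 ?mulr0 ?subrr
    ?addr0.
Qed.

Lemma multiplier_set0 : multiplier_set set0.
Proof. by rewrite /multiplier_set indic0; exact: multiplier_cst. Qed.

Lemma multiplier_setI A1 A2 : multiplier_set A1 -> multiplier_set A2 -> multiplier_set (A1 `&` A2).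
Proof. by move=> H1 H2; rewrite /multiplier_set indicI; exact: multiplierM. Qed.

Lemma multiplier_bigcup (F : nat -> set Rn) : (forall k, multiplier_set (F k)) ->
  multiplier_set (\bigcup_k F k).
Proof.
move=> H.
pose U k := [set x | exists2 i, (i < k)%N & F i x].
have H2 k : multiplier_set (U k).
  elim: k => [|k IH].
    rewrite (_ : U 0 = set0); first exact: multiplier_set0.
    by apply/seteqP; split => x // [].
  rewrite (_ : U k.+1 = ~` (~` U k `&` ~` F k)).
    by apply/multiplier_setC/multiplier_setI; exact: multiplier_setC.
  rewrite setCI !setCK; apply/seteqP; split => x.
    move=> [i +]; rewrite ltnS leq_eqVlt => /orP[/eqP ->|ik] Fi; [by right|by left; exists i].
  by move=> [[i ik Fi]|Fk]; [exists i => //; exact: ltnW|exists k].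
apply: (@multiplier_lim (fun k => \1_(U k)) _ 1) => //.
- by move=> k x; rewrite indicE; case: (_ \in _); rewrite ?normr1 ?normr0.
- move=> x; have [[k _ Fk]|Nx] := pselect ((\bigcup_k F k) x).
    rewrite [X in _ --> X]indicE mem_set; last by exists k.
    apply: cvg_near_cst; near=> m; rewrite indicE mem_set//; exists k => //.
    by near: m; exact: nbhs_infty_gt.
  rewrite [X in _ --> X]indicE memNset//.
  apply: cvg_near_cst; apply: nearW => m; rewrite indicE memNset//.
  by move=> [i _ Fi]; apply: Nx; exists i.
Unshelve. all: by end_near.
Qed.

(** For fixed [x], the sine of (x_i - a) / (k+1) has the sign of x_i - a once the argument is
    smaller than pi in modulus. Periodic functions thus detect half-spaces in the limit. *)
Lemma multiplier_halfspace (i : 'I_n) (a : R) : multiplier_set [set x | a < x i 0].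
Proof.
pose y := delta_mx i 0 : Rn.
have Ey x : dot y x = x i 0.
  rewrite /dot (bigD1 i)//= mxE !eqxx mul1r big1 ?addr0// => k ki.
  by rewrite mxE (negbTE ki) mul0r.
apply: (@multiplier_lim (fun k x => (0 < sin (dot (k.+1%:R^-1 *: y) x + - (k.+1%:R^-1 *
    a)))%R%:R) _ 1).
- move=> k; apply: multiplier_pos.
  have [s Hs] := sin_trigpoly (k.+1%:R^-1 *: y) (- (k.+1%:R^-1 * a)).
  exact: multiplier_trigpoly Hs.
- by move=> k x; case: (_ < _)%R; rewrite ?normr1 ?normr0.
- move=> x; set b := x i 0 - a.
  have E k : dot (k.+1%:R^-1 *: y) x + - (k.+1%:R^-1 * a) = k.+1%:R^-1 * b.
    by rewrite dotZl Ey /b mulrBr.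
  have H : (fun k => k.+1%:R^-1 * b) @ \oo --> 0.
    by rewrite -(mul0r b); apply: cvgM; [exact: cvg_harmonic|exact: cvg_cst].
  have /cvgr0Pnorm_lt/(_ pi (pi_gt0 R)) := H.
  move=> Hpi; apply: cvg_near_cst; apply: filterS Hpi => k.
  rewrite E indicE; have k0 : 0 < k.+1%:R^-1 :> R by rewrite invr_gt0.
  have [ax|xa] := ltP a (x i 0).
    rewrite mem_set//= => Hk; have b0 : 0 < k.+1%:R^-1 * b by rewrite mulr_gt0// subr_gt0.
    by rewrite gtr0_norm// in Hk; rewrite sin_gt0_pi// b0 Hk.
  rewrite memNset /=; last by apply/negP; rewrite -leNgt.
  have b0 : k.+1%:R^-1 * b <= 0 by rewrite mulr_ge0_le0 ?(ltW k0)// subr_le0.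
  rewrite ler0_norm// => Hk; have : 0 <= sin (- (k.+1%:R^-1 * b)).
    by apply: sin_ge0_pi; rewrite oppr_ge0 b0 ltW.
  by rewrite sinN oppr_ge0 ltNge => ->.
Qed.

(** Sets whose indicators are multipliers form a sigma-algebra. It contains the half-spaces, hence,
    for each coordinate, the preimages of all Borel sets, and these generate. *)
Lemma multiplier_measurable A : measurable A -> multiplier_set A.
Proof.
have SA : sigma_algebra setT multiplier_set.
  split; [exact: multiplier_set0|by move=> B HB; rewrite setTD; exact: multiplier_setC|].
  by move=> F HF; exact: multiplier_bigcup.
move: A; apply: smallest_sub => //.
rewrite -bigcup_seq/= => _ [i _] [Y mY <-]; rewrite setTI.
have {mY} : (@RGenOInfty.G R).-sigma.-measurable Y.
  by rewrite -RGenOInfty.measurableE; exact: mY.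
move: Y; apply: smallest_sub.
  split.
  - by rewrite preimage_set0; exact: multiplier_set0.
  - by move=> Y HY; rewrite setTD preimage_setC; exact: multiplier_setC.
  - by move=> F HF; rewrite preimage_bigcup; exact: multiplier_bigcup.
move=> _ [a ->]; have := multiplier_halfspace i a.
by congr multiplier_set; apply/seteqP; split => x /=; rewrite in_itv/= andbT.
Qed.

(** The sum counts the integers below [y], that is, it rounds [y] up as long as [y] is at most
    [k]. *)
Lemma count_below (y : R) (k : nat) : 0 <= y ->
  [/\ k%:R <= y -> \sum_(j < k) (j%:R < y)%R%:R = k%:R :> R,
      y <= k%:R -> y <= \sum_(j < k) (j%:R < y)%R%:R &
      \sum_(j < k) (j%:R < y)%R%:R <= y + 1].
Proof.
move=> y0; elim: k => [|k [H1 H2 H3]].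
  by rewrite big_ord0; split => //; lra.
rewrite big_ord_recr /=; have [ky|yk] := ltP k%:R y.
  by rewrite (H1 (ltW ky)) natr1; split => //; rewrite -natr1 lerD2r ltW.
rewrite addr0; split => //; first by rewrite -natr1; lra.
by move=> _; exact: H2.
Qed.

(** After translation by [c], rounding up to multiples of 1/(k+1) writes [g], up to 1/(k+1), as a
    finite sum of indicators of level sets. *)
Lemma multiplier_bounded g (c : R) : measurable_fun setT g ->
  (forall x, `|g x| <= c) -> multiplier g.
Proof.
move=> mg bg.
have c0 : 0 <= c by apply: le_trans (bg 0).
pose y k x := k.+1%:R * (g x + c).
pose N k := (Num.Def.truncn (k.+1%:R * (2 * c))).+1.
have y0 k x : 0 <= y k x.
  by rewrite mulr_ge0//; have := bg x; rewrite ler_norml; lra.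
have yN k x : y k x <= (N k)%:R.
  apply: ltW; apply: le_lt_trans (truncnS_gt _).
  by rewrite ler_wpM2l//; have := bg x; rewrite ler_norml; lra.
pose G k x := k.+1%:R^-1 * \sum_(j < N k) (j%:R < y k x)%R%:R + - c.
have Gd k x : `|G k x - g x| <= k.+1%:R^-1.
  have [_ /(_ (yN k x)) H2 H3] := count_below (N k) (y0 k x).
  have k0 : 0 < k.+1%:R :> R by [].
  have -> : G k x - g x = k.+1%:R^-1 * (\sum_(j < N k) (j%:R < y k x)%R%:R - y k x).
    by rewrite /G /y; field; rewrite addrC natr1 pnatr_eq0.
  rewrite normrM gtr0_norm ?invr_gt0// ler_piMr ?invr_ge0//.
  by rewrite ler_norml; lra.
apply: (@multiplier_lim G _ (c + 1)).
- move=> k; apply: multiplierD; last exact: multiplier_cst.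
  apply: multiplierZ.
  elim: (N k) => [|m IH]; first by under eq_fun do rewrite big_ord0; exact: multiplier_cst.
  under eq_fun do rewrite big_ord_recr/=; apply: multiplierD => //.
  rewrite (_ : (fun x => _) = \1_(y k @^-1` `]m%:R, +oo[)).
    apply: multiplier_measurable; rewrite -[X in measurable X]setTI.
    have my : measurable_fun setT (y k).
      by apply: measurable_funM => //; exact: measurable_funD.
    exact: my.
  apply/funext => x; rewrite indicE; have [yx|yx] := ltP m%:R (y k x).
    by rewrite mem_set//= in_itv/= yx.
  by rewrite memNset//= in_itv/= andbT; apply/negP; rewrite -leNgt.
- move=> k x; have := Gd k x => H; rewrite -(subrK (g x) (G k x)).
  apply: le_trans (ler_normD _ _) _; rewrite addrC lerD//.
  by apply: le_trans H _; rewrite invf_le1// ler1n.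
- move=> x; apply/cvgrPdist_le => e e0.
  have /cvgr0Pnorm_le/(_ e e0) := @cvg_harmonic R.
  apply: filterS => k; rewrite /= ger0_norm// => He.
  by rewrite distrC; exact: le_trans (Gd k x) He.
Qed.

(** Truncations of [g] are bounded multipliers; applied to the constant 1, a trigonometric
    polynomial, they approximate [g] itself. *)
Lemma trig_approx_real g : measurable_fun setT g -> integrableR (fun x => g x ^+ 2) ->
  trig_approx (fun x => (g x)%:C%C).
Proof.
move=> mg Ig.
pose h k x := Num.max (- k%:R) (Num.min (g x) k%:R) : R.
have mh k : measurable_fun setT (h k).
  by apply: measurable_maxr => //; apply: measurable_minr.
have hk k x : `|h k x| <= k%:R.
  have k0 : (0 : R) <= k%:R by [].
  by rewrite /h ler_norml le_max lexx /= ge_max ge_min lexx orbT andbT; lra.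
have hg k x : (h k x - g x) ^+ 2 <= g x ^+ 2.
  have k0 : (0 : R) <= k%:R by [].
  rewrite /h; case: (leP (g x) k%:R) => H; case: (leP (- k%:R) _) => H2; nra.
have Lg : L2 (fun x => (g x)%:C%C).
  apply: L2_dominated Ig; first exact: cmeasurable_real.
  by move=> x; rewrite sqn_real.
have Lh k : L2 (fun x => (h k x)%:C%C).
  by apply: L2_bounded; [exact: cmeasurable_real|exact: bounded_sqn (hk k)].
apply: trig_approx_closed => // e e0.
have [||||//||k Hk] := @nrm_dominated_cvg (fun k x => (h k x)%:C%C) (fun x => (g x)%:C%C)
  (fun x => g x ^+ 2) e => //.
- move=> x; apply: cvg_near_cst; near=> k; rewrite -rmorphB sqn_real.
  have gk : `|g x| <= k%:R by near: k; exact: nbhs_infty_ger.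
  move: gk; rewrite ler_norml => /andP[g1 g2].
  by rewrite /h (min_idPl g2) (max_idPr g1) subrr expr0n.
- by move=> k x; rewrite -rmorphB sqn_real.
exists (fun x => (h k x)%:C%C); last by rewrite nrmB_sym.
have [_ _ /(_ [:: (1, 0)])] := multiplier_bounded (mh k) (hk k).
congr trig_approx; apply/funext => x.
rewrite trigpoly_cons trigpoly_nil addr0 mul1r.
by apply: complex_eq; rewrite ?(ReM, ImM) /= dot0l cos0 sin0; ring.
Unshelve. all: by end_near.
Qed.

Lemma trigpoly_dense f (e : R) : L2 f -> 0 < e ->
  exists s, nrm (fun x => f x - trigpoly s x) <= e.
Proof.
move=> Lf e0; have [mR mI] := L2_cmeasurable Lf; have If := L2_integrable Lf.
have HR : trig_approx (fun x => (complex.Re (f x))%:C%C).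
  apply: trig_approx_real => //; apply: (integrableR_dom _ _ If).
    exact: measurable_funX.
  by move=> x; rewrite ger0_norm ?sqr_ge0// lerDl sqr_ge0.
have HI : trig_approx (fun x => (complex.Im (f x))%:C%C).
  apply: trig_approx_real => //; apply: (integrableR_dom _ _ If).
    exact: measurable_funX.
  by move=> x; rewrite ger0_norm ?sqr_ge0// lerDr sqr_ge0.
have := trig_approxD HR (trig_approxZ 'i%C HI).
rewrite (_ : (fun x => _) = f) => [[_]|]; first exact.
by apply/funext => x; apply: complex_eq; rewrite ?(ReD, ImD, ReM, ImM) /=; ring.
Qed.

End density_of_trigonometric_polynomials.

(** * The semigroup on waves *)

Section distributions.
Context {R : realType} {n : nat}.
Local Notation Rn := 'cV[R]_n.
Local Notation leb := (@lebesgue_Rn R n).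
Implicit Types (f g phi : Rn -> R[i]) (i j : 'I_n) (x y : Rn).

Definition ccontinuous f :=
  continuous (fun x => complex.Re (f x)) /\ continuous (fun x => complex.Im (f x)).

Definition cbounded_supp f :=
  bounded_supp (fun x => complex.Re (f x)) /\ bounded_supp (fun x => complex.Im (f x)).

Definition cc1 i f df := c1 i (fun x => complex.Re (f x)) (fun x => complex.Re (df x)) /\
  c1 i (fun x => complex.Im (f x)) (fun x => complex.Im (df x)).

Lemma ccontinuousM f g : ccontinuous f -> ccontinuous g -> ccontinuous (fun x => f x * g x).
Proof.
move=> [f1 f2] [g1 g2]; split.
  under eq_fun do rewrite ReM; move=> x.
  exact: (continuousB (continuousM (f1 x) (g1 x)) (continuousM (f2 x) (g2 x))).
under eq_fun do rewrite ImM; move=> x.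
exact: (continuousD (continuousM (f1 x) (g2 x)) (continuousM (f2 x) (g1 x))).
Qed.

Lemma ccontinuous_cst (c : R[i]) : ccontinuous (fun=> c).
Proof. by split; exact: cst_continuous. Qed.

Lemma ccontinuousD f g : ccontinuous f -> ccontinuous g -> ccontinuous (fun x => f x + g x).
Proof.
move=> [f1 f2] [g1 g2]; split.
  by under eq_fun do rewrite ReD; move=> x; exact: (continuousD (f1 x) (g1 x)).
by under eq_fun do rewrite ImD; move=> x; exact: (continuousD (f2 x) (g2 x)).
Qed.

Lemma ccontinuous_real (h : Rn -> R) : continuous h -> ccontinuous (fun x => (h x)%:C%C).
Proof. by split => //; exact: cst_continuous. Qed.

Lemma ccontinuous_wave y : ccontinuous (wave y).
Proof.
split=> x.
  by apply: (@continuous_comp _ _ _ (dot y) cos); [exact: dot_continuous|exact: continuous_cos].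
by apply: (@continuous_comp _ _ _ (dot y) sin); [exact: dot_continuous|exact: continuous_sin].
Qed.

Lemma ccontinuous_trigpoly s : ccontinuous (@trigpoly R n s).
Proof.
elim: s => [|p s IH].
  rewrite (_ : trigpoly [::] = fun=> 0); first exact: ccontinuous_cst.
  by apply/funext => x; rewrite trigpoly_nil.
rewrite (_ : trigpoly (p :: s) = fun x => p.1 * wave p.2 x + trigpoly s x); last first.
  by apply/funext => x; rewrite trigpoly_cons.
apply: ccontinuousD => //.
by apply: ccontinuousM; [exact: ccontinuous_cst|exact: ccontinuous_wave].
Qed.

Lemma cbounded_suppMr f g : cbounded_supp g -> cbounded_supp (fun x => f x * g x).
Proof.
move=> [[M1 g1] [M2 g2]].
have H x : ~ cube (Num.max M1 M2) x -> g x = 0.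
  move=> xM; apply: complex_eq; [rewrite g1//|rewrite g2//] => xN; apply: xM => i.
    by rewrite le_max xN.
  by rewrite le_max xN orbT.
by split; exists (Num.max M1 M2) => x /H ->; rewrite mulr0.
Qed.

Lemma cc1_cbounded_supp i f df : cc1 i f df -> cbounded_supp f -> cbounded_supp df.
Proof.
by move=> [H1 H2] [b1 b2]; split; [exact: bounded_supp_deriv H1 b1|exact: bounded_supp_deriv H2 b2].
Qed.

Lemma cc1_ccontinuous i f df : cc1 i f df -> ccontinuous f /\ ccontinuous df.
Proof. by move=> [[c1 c2 _] [c3 c4 _]]. Qed.

Lemma cc1_pderiv i f df : cc1 i f df -> pderiv i f = df.
Proof.
move=> [[_ _ H1] [_ _ H2]]; apply/funext => x; rewrite /pderiv.
have [_ ->] := H1 x; have [_ ->] := H2 x.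
by case: (df x).
Qed.

Lemma c1_ext i (h dh dh' : Rn -> R) : c1 i h dh -> (forall x, dh x = dh' x) -> c1 i h dh'.
Proof. by move=> H /funext <-. Qed.

Lemma cc1M i f df g dg : cc1 i f df -> cc1 i g dg ->
  cc1 i (fun x => f x * g x) (fun x => f x * dg x + df x * g x).
Proof.
move=> [f1 f2] [g1 g2]; split.
  rewrite (_ : (fun x => complex.Re (f x * g x)) = fun x =>
     complex.Re (f x) * complex.Re (g x) + -1 * (complex.Im (f x) * complex.Im (g x))).
    apply: c1_ext (c1D (c1M f1 g1) (c1Z (-1) (c1M f2 g2))) _ => x.
    by rewrite !ReD !ReM; ring.
  by apply/funext => x; rewrite ReM mulN1r.
under eq_fun do rewrite ImM.
apply: c1_ext (c1D (c1M f1 g2) (c1M f2 g1)) _ => x.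
by rewrite !ImD !ImM; ring.
Qed.

Lemma cc1_real i (h dh : Rn -> R) : c1 i h dh -> cc1 i (fun x => (h x)%:C%C) (fun x => (dh x)%:C%C).
Proof. by split => //; exact: c1_cst. Qed.

Lemma cc1_wave i y : cc1 i (wave y) (fun x => ('i * (y i 0)%:C)%C * wave y x).
Proof.
split.
- apply: c1_ext (c1_comp (c1_dot i y) (@continuous_cos R) _ (@is_derive_cos R)) _.
    by move=> r; exact: (continuousN (@continuous_sin R r)).
  by move=> x; rewrite !ReM /=; ring.
- apply: c1_ext (c1_comp (c1_dot i y) (@continuous_sin R) (@continuous_cos R) (@is_derive_sin R)) _.
  by move=> x; rewrite !ImM /=; ring.
Qed.

Lemma integrable_ccontinuous f phi : ccontinuous f -> ccontinuous phi -> cbounded_supp phi ->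
  leb.-integrable setT (EFin \o (fun x => complex.Re (f x * phi x))) /\
  leb.-integrable setT (EFin \o (fun x => complex.Im (f x * phi x))).
Proof.
move=> cf cphi sphi; have [c1 c2] := ccontinuousM cf cphi.
have [s1 s2] := cbounded_suppMr f sphi.
by split; exact: bounded_supp_integrable.
Qed.

Lemma of_funD f g phi : ccontinuous f -> ccontinuous g -> ccontinuous phi -> cbounded_supp phi ->
  of_fun (fun x => f x + g x) phi = of_fun f phi + of_fun g phi.
Proof.
move=> cf cg cphi sphi.
have [If1 If2] := integrable_ccontinuous cf cphi sphi.
have [Ig1 Ig2] := integrable_ccontinuous cg cphi sphi.
apply: complex_eq; rewrite ?(ReD, ImD) /of_fun /= -RintegralD//; apply: eq_Rintegral => x _.
  by rewrite mulrDl ReD.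
by rewrite mulrDl ImD.
Qed.

Lemma of_funZ (c : R[i]) f phi : ccontinuous f -> ccontinuous phi -> cbounded_supp phi ->
  of_fun (fun x => c * f x) phi = c * of_fun f phi.
Proof.
move=> cf cphi sphi.
have [If1 If2] := integrable_ccontinuous cf cphi sphi.
apply: complex_eq; rewrite ?(ReM, ImM) /of_fun /= -!RintegralZl//.
  rewrite -RintegralB//; [|exact: integrableRZ|exact: integrableRZ].
  by apply: eq_Rintegral => x _; rewrite -mulrA ReM.
rewrite -RintegralD//; [|exact: integrableRZ|exact: integrableRZ].
by apply: eq_Rintegral => x _; rewrite -mulrA ImM.
Qed.

Lemma of_fun0 phi : of_fun (fun=> 0) phi = 0.
Proof.
by apply: complex_eq; rewrite /of_fun /=; under eq_Rintegral do rewrite mul0r /=;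
  rewrite /Rintegral integral0.
Qed.

Lemma of_fun_sum (I : finType) (F : I -> Rn -> R[i]) phi :
  (forall k, ccontinuous (F k)) -> ccontinuous phi -> cbounded_supp phi ->
  of_fun (fun x => \sum_k F k x) phi = \sum_k of_fun (F k) phi.
Proof.
move=> cF cphi sphi.
suff [] : ccontinuous (fun x => \sum_(k <- index_enum I) F k x) /\
  of_fun (fun x => \sum_(k <- index_enum I) F k x) phi = \sum_(k <- index_enum I) of_fun (F k)
      phi by [].
elim: (index_enum I) => [|k r [IH1 IH2]].
  under eq_fun do rewrite big_nil; rewrite big_nil of_fun0; split => //.
  exact: ccontinuous_cst.
under eq_fun do rewrite big_cons; rewrite big_cons; split; first exact: ccontinuousD.
by rewrite of_funD// IH2.
Qed.

(** The product with a compactly supported test function has a derivative of zero Lebesgue integral,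
    real and imaginary parts separately. *)
Lemma of_fun_ibp i f df phi dphi : cc1 i f df -> cc1 i phi dphi -> cbounded_supp phi ->
  of_fun f dphi = - of_fun df phi.
Proof.
move=> Hf Hphi sphi; have [D1 D2] := cc1M Hf Hphi.
have [b1 b2] := cbounded_suppMr f sphi.
have [cf cdf] := cc1_ccontinuous Hf; have [cphi cdphi] := cc1_ccontinuous Hphi.
have sdphi := cc1_cbounded_supp Hphi sphi.
have [I1 I2] := integrable_ccontinuous cf cdphi sdphi.
have [I3 I4] := integrable_ccontinuous cdf cphi sphi.
have E1 := integral_deriv_Rn D1 b1; have E2 := integral_deriv_Rn D2 b2.
apply: complex_eq; rewrite ?(ReN, ImN) /of_fun /=; apply/eqP; rewrite -addr_eq0 -RintegralD//.
  by rewrite /Rintegral; under eq_integral do rewrite -ReD; rewrite E1.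
by rewrite /Rintegral; under eq_integral do rewrite -ImD; rewrite E2.
Qed.

Lemma smooth_cc1 phi i s : smooth_on setT phi ->
  cc1 i (pderivs s phi) (pderivs (i :: s) phi).
Proof.
move=> Hphi; split; split.
- by move=> x; have [] := Hphi s x I.
- by move=> x; have [] := Hphi (i :: s) x I.
- by move=> x; have [_ _ /(_ i)[D _]] := Hphi s x I; split.
- by move=> x; have [] := Hphi s x I.
- by move=> x; have [] := Hphi (i :: s) x I.
- by move=> x; have [_ _ /(_ i)[_ D]] := Hphi s x I; split.
Qed.

Lemma test_fun_cbounded_supp phi : test_fun setT phi -> cbounded_supp phi.
Proof.
move=> [_ [K [cK _ sK]]].
have [M [_ HM]] := compact_bounded cK.
have H x : ~ cube (M + 1) x -> phi x = 0.
  move=> xM; apply: sK => Kx; apply: xM => i.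
  apply: le_trans (coord_le_norm x i) _.
  by apply: HM => //; rewrite ltrDl.
by split; exists (M + 1) => x /H ->.
Qed.

(** All derivatives fall on the test function in the distributional definition and are moved back to
    the wave, where they become multiplications. In the drift term the derivative of x_j phi is
    taken as a whole, which respects the order x_j d_i. *)
Lemma OU_wave (Q B : 'M[R]_n) y :
  eq_distr setT (OU_operator Q B (of_fun (wave y)))
    (of_fun (fun x => ((- (2^-1 * dot (Q *m y) y)) +i* dot (B *m x) y)%C * wave y x)).
Proof.
move=> phi Tphi; have [Sphi _] := Tphi; have sphi := test_fun_cbounded_supp Tphi.
have H0 i := smooth_cc1 i [::] Sphi; have H1 i j := smooth_cc1 i [:: j] Sphi.
rewrite /= in H0 H1.
have [cphi _] : ccontinuous phi /\ True.
  by have [] := Sphi [::] 0 I; split=> //; split=> x; have [] := Sphi [::] x I.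
have W := fun i => cc1_wave i y.
have cw := ccontinuous_wave y.
have D2 i j : ddiff i (ddiff j (of_fun (wave y))) phi = - (y i 0 * y j 0)%:C%C * of_fun (wave y)
    phi.
  rewrite /ddiff opprK (of_fun_ibp (W j) (H1 j i)); last exact: cc1_cbounded_supp (H0 i) sphi.
  have [_ cdw] := cc1_ccontinuous (W j); have [_ cdphi] := cc1_ccontinuous (H0 i).
  have sdphi := cc1_cbounded_supp (H0 i) sphi.
  rewrite of_funZ// (of_fun_ibp (W i) (H0 i))// of_funZ// mulrN opprK mulrA.
  by congr (_ * _); apply: complex_eq; rewrite ?(ReM, ImM, ReN, ImN) /=; ring.
have D1 i j : dmul (fun x => (x j 0)%:C%C) (ddiff i (of_fun (wave y))) phi =
    ('i * (y i 0)%:C)%C * of_fun (fun x => (x j 0)%:C%C * wave y x) phi.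
  have Hx : cc1 i (fun x => (x j 0)%:C%C * phi x)
      (fun x => (x j 0)%:C%C * pderiv i phi x + ((i == j)%:R)%:C%C * phi x).
    by apply: cc1M => //; apply: cc1_real; exact: c1_coord.
  rewrite /dmul /ddiff (cc1_pderiv Hx) (of_fun_ibp (W i) Hx) ?opprK; last exact: cbounded_suppMr.
  have [cx _] := cc1_ccontinuous Hx.
  rewrite of_funZ//; last exact: cbounded_suppMr.
  congr (_ * _); rewrite /of_fun; congr (_ +i* _)%C; apply: eq_Rintegral => x _.
    by congr complex.Re; rewrite mulrCA mulrA.
  by congr complex.Im; rewrite mulrCA mulrA.
have cx j : ccontinuous (fun x => (x j 0)%:C%C * wave y x).
  by apply: ccontinuousM => //; apply: ccontinuous_real; exact: coord_continuous.
have cZ (c : R[i]) f : ccontinuous f -> ccontinuous (fun x => c * f x).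
  by move=> cf; apply: ccontinuousM => //; exact: ccontinuous_cst.
have cF i j : ccontinuous (fun x => ((B i j)%:C * ('i * (y i 0)%:C))%C * ((x j 0)%:C%C * wave y x)).
  by apply: cZ; exact: cx.
have csum (I : finType) (F : I -> Rn -> R[i]) : (forall k, ccontinuous (F k)) ->
    ccontinuous (fun x => \sum_k F k x).
  move=> H; elim: (index_enum I) => [|k r IH].
    by under eq_fun do rewrite big_nil; exact: ccontinuous_cst.
  by under eq_fun do rewrite big_cons; exact: ccontinuousD.
rewrite (_ : (fun x => _) = fun x => (- (2^-1 * dot (Q *m y) y))%:C%C * wave y x +
    \sum_i \sum_j ((B i j)%:C * ('i * (y i 0)%:C))%C * ((x j 0)%:C%C * wave y x)); last first.
  apply/funext => x.
  have -> : \sum_i \sum_j ((B i j)%:C * ('i * (y i 0)%:C))%C * ((x j 0)%:C%C * wave y x) =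
      ('i * (dot (B *m x) y)%:C)%C * wave y x.
    rewrite /dot rmorph_sum mulr_sumr mulr_suml; apply: eq_bigr => i _.
    rewrite mxE mulr_suml rmorph_sum mulr_sumr mulr_suml; apply: eq_bigr => j _.
    rewrite mulrA; congr (_ * _).
    by apply: complex_eq; rewrite ?(ReM, ImM) /=; ring.
  rewrite -mulrDl; congr (_ * _).
  by apply: complex_eq; rewrite ?(ReD, ImD, ReM, ImM) /=; ring.
rewrite of_funD//; [|exact: cZ|by apply: (csum) => i; apply: csum => j; exact: cF].
rewrite of_funZ// of_fun_sum//; last by move=> i; apply: csum => j; exact: cF.
rewrite /OU_operator; congr (_ + _).
  under eq_bigr => i _ do under eq_bigr => j _ do rewrite D2.
  have -> : \sum_i \sum_j (Q i j)%:C%C * (- (y i 0 * y j 0)%:C%C * of_fun (wave y) phi) =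
      (- dot (Q *m y) y)%:C%C * of_fun (wave y) phi.
    rewrite /dot -sumrN rmorph_sum mulr_suml; apply: eq_bigr => i _.
    rewrite mxE mulr_suml -sumrN rmorph_sum mulr_suml; apply: eq_bigr => j _.
    by rewrite mulrA; congr (_ * _); apply: complex_eq; rewrite ?(ReM, ImM, ReN, ImN) /=; ring.
  rewrite mulrA; congr (_ * _).
  have -> : 2^-1 = (2^-1)%:C%C :> R[i] by rewrite fmorphV rmorph_nat.
  by apply: complex_eq; rewrite ?(ReM, ImM) /=; ring.
apply: eq_bigr => i _; rewrite of_fun_sum//; apply: eq_bigr => j _.
by rewrite D1 of_funZ// mulrA.
Qed.

End distributions.

(** * Norms of waves and of their differences *)

Section gaussian_waves.
Context {R : realType} {n : nat}.
Local Notation Rn := 'cV[R]_n.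
Variables (G : 'M[R]_n) (mu : probability Rn R).
Hypothesis GT : G^T = G.
Hypothesis density : forall A, measurable A ->
  mu A = (\int[@lebesgue_Rn R n]_(x in A) (gauss_density G x)%:E)%E.
Local Notation nrm := (nrm mu).
Local Notation L2 := (L2 mu).
Local Notation integrableR f := (mu.-integrable setT (EFin \o f)).
Implicit Types (x y w : Rn).

Lemma wave_L2 y : L2 (wave y).
Proof.
by apply: (@L2_bounded _ _ mu _ 1) => [|x]; [exact: wave_cmeasurable|rewrite sqn_wave].
Qed.

Lemma nrm_wave y : nrm (wave y) = 1.
Proof.
rewrite /nrm; under eq_Rintegral do rewrite sqn_wave.
by rewrite Rintegral_cstT sqrtr1.
Qed.

Lemma dot_wave_L2 w y : L2 (fun x => ('i * (dot w x)%:C)%C * wave y x).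
Proof.
apply: (@L2_dominated _ _ mu _ (fun x => dot w x ^+ 2)).
- apply: cmeasurableM; last exact: wave_cmeasurable.
  apply: cmeasurableM; first exact: cmeasurable_cst.
  by apply: cmeasurable_real; exact: dot_measurable.
- by move=> x; rewrite !sqnM sqn_wave mulr1 sqn_real /sqn /= expr0n expr1n add0r mul1r.
- exact: (second_moment_bound GT density).
Qed.

Lemma nrm_dot_wave w y : nrm (fun x => ('i * (dot w x)%:C)%C * wave y x) = Num.sqrt (dot (G *m
    w) w).
Proof.
rewrite /nrm -(second_moment GT density); congr Num.sqrt; apply: eq_Rintegral => x _.
by rewrite !sqnM sqn_wave mulr1 sqn_real /sqn /= expr0n expr1n add0r mul1r.
Qed.

(** Both bounds only use exp (- q/2) >= 1 - q/2. The expressions are the squared L^2 errors of the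
    approximations of order 0 and 1 of a wave, with q = <G d, d>. *)
Lemma expR_bounds (q : R) : 0 <= q -> 2 - 2 * expR (- (2^-1 * q)) <= q /\
  2 - 2 * expR (- (2^-1 * q)) + (- 2 * (q * expR (- (2^-1 * q))) + q) <= q ^+ 2.
Proof.
move=> q0; have := expR_ge1Dx (- (2^-1 * q)); move: (expR _) => a Ha.
by split; nra.
Qed.

Lemma nrm_wave_diff y d : nrm (fun x => wave (y + d) x - wave y x) <= Num.sqrt (dot (G *m d) d).
Proof.
have q0 := gauss_psd GT density d.
rewrite /nrm ler_sqrt//.
have E x : sqn (wave (y + d) x - wave y x) = 2 + (- 2) * cos (dot d x).
  rewrite waveD -[X in _ - X]mulr1 -mulrBr sqnM sqn_wave mul1r.
  by rewrite /sqn ReD ImD ReN ImN /= subr0; have := cos2Dsin2 (dot d x); lra.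
under eq_Rintegral do rewrite E.
have Ic := cos_dot_integrable mu d.
rewrite RintegralD//; [|exact: cst_integrable|exact: integrableRZ].
rewrite Rintegral_cstT RintegralZl// (char_cos GT density) mulNr.
exact: (proj1 (expR_bounds q0)).
Qed.

(** The squared error is a combination of Gaussian integrals known in closed form, so the quadratic
    remainder needs no fourth moment. *)
Lemma nrm_wave_taylor y d :
  nrm (fun x => wave (y + d) x - wave y x - ('i * (dot d x)%:C)%C * wave y x) <= dot (G *m d) d.
Proof.
have q0 := gauss_psd GT density d.
rewrite -[leRHS]ger0_norm// -sqrtr_sqr /nrm ler_sqrt ?sqr_ge0//.
have E x : sqn (wave (y + d) x - wave y x - ('i * (dot d x)%:C)%C * wave y x) =
    2 + (- 2) * cos (dot d x) + (- 2 * (sin (dot d x) * dot d x) + dot d x ^+ 2).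
  rewrite waveD (_ : _ - _ - _ = (wave d x - 1 - ('i * (dot d x)%:C)%C) * wave y x).
    rewrite sqnM sqn_wave mulr1.
    rewrite /sqn !(ReD, ImD, ReN, ImN, ReM, ImM) /=; have := cos2Dsin2 (dot d x).
    move: (cos (dot d x)) (sin (dot d x)) => a b H.
    transitivity (a ^+ 2 + b ^+ 2 + 1 - 2 * a + (- 2 * (b * dot d x) + dot d x ^+ 2)).
      by ring.
    by rewrite H; ring.
  by rewrite mulrBl mulrBl mul1r mulrC.
under eq_Rintegral do rewrite E.
have Ic := cos_dot_integrable mu d.
have Is := sinM_dot_integrable GT density d d.
have I2 := second_moment_bound GT density d.
have Z := @integrableRZ _ _ _ mu; have D := @integrableRD _ _ _ mu.
have C1 := cst_integrable mu.
rewrite RintegralD//; [|by apply: D => //; exact: Z|by apply: D => //; exact: Z].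
rewrite RintegralD//; try exact: Z.
rewrite [X in _ + X <= _]RintegralD//; try exact: Z.
rewrite Rintegral_cstT !RintegralZl// (char_cos GT density) (sinM_dot GT density) (second_moment
    GT density).
by have [_] := expR_bounds q0; rewrite [- 2 * expR _]mulNr.
Qed.

End gaussian_waves.

(** * One-variable estimates for increments *)

Section calculus.
Context {R : realType}.

Lemma small_of_derive (f : R -> R) (s l e : R) : is_derive s (1 : R) f l -> 0 < e ->
  exists2 d : R, 0 < d & forall h, 0 < h -> h < d -> `|f (s + h) - f s - h * l| <= e * h.
Proof.
move=> [fd <-] e0.
have H : (fun h => h^-1 *: ((f \o shift s) (h *: 1) - f s)) @ 0^' --> 'D_1 f s by exact: fd.
have /cvgrPdist_le/(_ e e0) := H.
rewrite near_withinE => -[d /= d0 Hd]; exists d => // h h0 hd.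
have := Hd h; rewrite /= sub0r normrN gtr0_norm// => /(_ hd (lt0r_neq0 h0)).
rewrite /GRing.scale/= mulr1 [h + s]addrC => H2.
have -> : f (s + h) - f s - h * 'D_1 f s = - h * ('D_1 f s - h^-1 * (f (s + h) - f s)).
  by field; exact: lt0r_neq0.
by rewrite normrM normrN (gtr0_norm h0) mulrC ler_wpM2r// ltW.
Qed.

Lemma continuous_of_derive (f : R -> R) (s l e : R) : is_derive s (1 : R) f l -> 0 < e ->
  exists2 d : R, 0 < d & forall h, `|h| < d -> `|f (s + h) - f s| <= e.
Proof.
move=> [fd _] e0.
have cf : {for s, continuous f} by apply: differentiable_continuous; apply/derivable1_diffP.
have /cvgrPdist_le/(_ e e0)/nbhs_ballP[d /= d0 Hd] := cf.
exists d => // h hd; rewrite distrC; apply: Hd.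
by rewrite /ball/= opprD addNKr normrN.
Qed.

(* Applied to [s |-> |T_{t-s} u(s) - T_t u(0)|], of which we only control the right
   derivative and the jumps from the left. *)
Lemma zero_of_small_increments (g : R -> R) (t : R) : 0 < t -> g 0 = 0 ->
  (forall s e, 0 <= s -> s < t -> 0 < e -> exists2 d : R, 0 < d &
     forall h, 0 < h -> h < d -> s + h <= t -> g (s + h) <= g s + e * h) ->
  (forall s e, 0 < s -> s <= t -> 0 < e -> exists2 d : R, 0 < d &
     forall h, 0 < h -> h < d -> h <= s -> g s <= g (s - h) + e) ->
  g t <= 0.
Proof.
move=> t0 g0 right left.
apply/ler_addgt0Pr => e' e'0; rewrite add0r.
pose e := e' / t.
have e0 : 0 < e by rewrite divr_gt0.
suff : g t <= e * t by rewrite /e divfK// gt_eqF.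
rewrite leNgt; apply/negP => bad.
(* The times at which the line of slope [e] is exceeded. At the infimum the jump condition from the
   left keeps [g] below the line, and the right increment condition then forbids crossing
   immediately afterwards. *)
pose A := [set s | 0 <= s <= t /\ e * s < g s].
have hA : has_inf A.
  by split; [exists t; split => //; rewrite lexx ltW|exists 0 => s [/andP[]]].
set s0 := inf A.
have s00 : 0 <= s0 by apply: lb_le_inf => [|s [/andP[]]]//; case: hA.
have s0t : s0 <= t by apply: ge_inf; [case: hA|split => //; rewrite lexx ltW].
have below s : 0 <= s -> s < s0 -> g s <= e * s.
  move=> s1 ss0; rewrite leNgt; apply/negP => H.
  have : s0 <= s by apply: ge_inf; [case: hA|split => //; rewrite s1 (le_trans (ltW ss0))].
  by rewrite leNgt ss0.
have gs0 : g s0 <= e * s0.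
  have [->|s0n] := eqVneq s0 0; first by rewrite g0 mulr0.
  have s0p : 0 < s0 by rewrite lt_def s0n.
  apply/ler_addgt0Pr => c c0.
  have [d d0 Hd] := left s0 c s0p s0t c0.
  pose h := Num.min (d / 2) s0.
  have h0 : 0 < h by rewrite lt_min s0p divr_gt0.
  have hd : h < d by rewrite gt_min; apply/orP; left; rewrite ltr_pdivrMr// mulr2n mulrDr mulr1
      ltrDl.
  have hs : h <= s0 by rewrite ge_min lexx orbT.
  apply: le_trans (Hd h h0 hd hs) _; rewrite lerD2r.
  apply: le_trans (below (s0 - h) _ _) _; rewrite ?subr_ge0// ?ltrBlDr ?ltrDl//.
  by rewrite ler_pM2l// gerBl ltW.
have s0lt : s0 < t.
  by rewrite lt_neqAle s0t andbT; apply/eqP => E; move: gs0; rewrite E leNgt bad.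
have [d d0 Hd] := right s0 e s00 s0lt e0.
have [s [/andP[s1 st] gs] sd] := inf_adherent d0 hA.
have s0s : s0 <= s by apply: ge_inf; [case: hA|split => //; rewrite s1 st].
move: s0s; rewrite le_eqVlt => /orP[/eqP E|s0s].
  by move: gs; rewrite -E ltNge gs0.
have := Hd (s - s0); rewrite subr_gt0 ltrBlDl addrCA subrr addr0 => /(_ s0s sd st).
rewrite leNgt => /negP; apply; apply: le_lt_trans gs.
by rewrite mulrBr addrCA -subr_ge0; lra.
Qed.

End calculus.

Lemma near0P (R : realType) (P : R -> Prop) :
  (exists2 d : R, 0 < d & forall h, 0 < h -> h < d -> P h) <-> \forall h \near 0^'+, P h.
Proof.
split=> [[d d0 Hd]|]; rewrite near_withinE.
  apply/nbhs_ballP; exists d => //= h; rewrite /ball/= sub0r normrN => hd h0.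
  by apply: Hd => //; rewrite gtr0_norm in hd.
move=> /nbhs_ballP[d /= d0 Hd]; exists d => // h h0 hd; apply: Hd => //=.
by rewrite /ball/= sub0r normrN gtr0_norm.
Qed.

Lemma quadratic_form_coord_le (R : realType) n (G : 'M[R]_n) (w : 'cV[R]_n) (c : R) :
  0 <= c -> (forall k, `|w k 0| <= c) ->
  dot (G *m w) w <= c ^+ 2 * \sum_i \sum_j `|G i j|.
Proof.
move=> c0 wc; rewrite /dot mulr_sumr; apply: ler_sum => i _.
rewrite mxE mulr_suml mulr_sumr; apply: ler_sum => j _.
apply: le_trans (ler_norm _) _; rewrite !normrM -mulrA [leLHS]mulrC ler_wpM2r// expr2.
exact: ler_pM.
Qed.

Lemma step_identity (R : realType) (a b c d k l : R[i]) :
  a - b * c = (a - b * d - k * (b * l)) - b * (c - d - k * l).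
Proof. by ring. Qed.

Lemma wave_difference (R : realType) (a b : R) (V W : R[i]) :
  a%:C%C * W - b%:C%C * V = a%:C%C * (W - V) + (a - b)%:C%C * V.
Proof. by apply: complex_eq; rewrite !(ReD, ImD, ReN, ImN, ReM, ImM) /=; ring. Qed.

Lemma norm_sub0 (R : realType) (a b c d e k : R) :
  c = 0 -> `|a * b - d * c - e| <= k -> `|a * b - e| <= k.
Proof. by move=> ->; rewrite mulr0 subr0. Qed.

Lemma combination_coord (R : realType) n (a b c : R) (u v x : 'cV[R]_n) k :
  (a *: (u - v) - (b * c) *: x) k 0 = a * (u k 0 - v k 0) - b * (c * x k 0).
Proof. by rewrite !mxE mulrA. Qed.

Lemma scale_quotient (R : realType) (h : R) (a b : R[i]) : h != 0 ->
  a - h%:C%C * b = h%:C%C * ((h^-1)%:C%C * a - b).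
Proof.
move=> h0; apply: complex_eq; rewrite !(ReD, ImD, ReN, ImN, ReM, ImM) /=.
  by field.
by field.
Qed.

(** * Identification of the semigroup on waves *)

Section semigroup_on_waves.
Context {R : realType} {n : nat}.
Local Notation Rn := 'cV[R]_n.
Variables (S B G : 'M[R]_n) (mu : probability Rn R).
Variable T : R -> (Rn -> R[i]) -> (Rn -> R[i]).
Hypotheses (ST : S^T = S) (GT : G^T = G).
Hypothesis lyap : B *m G + G *m B^T = - (S *m S).
Hypothesis density : forall A, measurable A ->
  mu A = (\int[@lebesgue_Rn R n]_(x in A) (gauss_density G x)%:E)%E.
Hypothesis gen : semigroup_generated_by mu (OU_operator (S *m S) B) T.
Local Notation nrm := (nrm mu).
Local Notation L2 := (L2 mu).
Local Notation CT := (proj1 gen).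
Implicit Types (x y eta : Rn) (s t h : R).

Definition orbit eta s : Rn := expmx (s *: B^T) *m eta.
Definition energy eta s : R := dot (G *m orbit eta s) (orbit eta s).
Definition damping eta s : R := expR (- (2^-1 * (energy eta 0 - energy eta s))).
Definition damped_wave eta s x : R[i] := (damping eta s)%:C%C * wave (orbit eta s) x.

Definition OU_symbol y x : R[i] := ((- (2^-1 * dot (S *m S *m y) y)) +i* dot (B *m x) y)%C.

Lemma damping_ge0 eta s : 0 <= damping eta s.
Proof. exact: expR_ge0. Qed.

Lemma damping_le1 eta s : 0 <= s -> damping eta s <= 1.
Proof.
move=> s0; rewrite /damping expR_le1 oppr_le0 mulr_ge0// subr_ge0.
exact: (energy_le ST lyap).
Qed.

Lemma is_derive_damping eta s : is_derive s (1 : R) (damping eta)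
  (damping eta s * (- (2^-1 * dot (S *m orbit eta s) (S *m orbit eta s)))).
Proof.
have H : is_derive s (1 : R) (fun s => - (2^-1 * (energy eta 0 - energy eta s)))
    (- (2^-1 * dot (S *m orbit eta s) (S *m orbit eta s))).
  have D := is_derive_energy ST lyap eta s.
  rewrite (_ : (fun s => _) = (fun s => - (2^-1 * energy eta 0) + 2^-1 * energy eta s)).
    apply: (is_derive_eq (is_deriveD (is_derive_cst0 _ _ _) (is_deriveZ (2^-1) D))).
    by rewrite add0r /GRing.scale/= mulrN.
  by apply/funext => r; ring.
exact: (is_derive_comp_R (is_derive_expR _) H).
Qed.

Lemma OU_symbolE y x : OU_symbol y x * wave y x =
  (- (2^-1 * dot (S *m y) (S *m y)))%:C%C * wave y x +
  ('i * (dot (B^T *m y) x)%:C)%C * wave y x.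
Proof.
rewrite -mulrDl; congr (_ * _); apply: complex_eq; rewrite ?(ReD, ImD, ReM, ImM) /=.
  by rewrite -mulmxA dot_mulmxl ST; ring.
by rewrite (dot_mulmxl B^T) trmxK dotC; ring.
Qed.

(** The symbol grows linearly in [x]; the Gaussian second moment keeps its product with the wave in
    L^2, which puts the wave in the domain of the generator. *)
Lemma OU_symbol_L2 y : L2 (fun x => OU_symbol y x * wave y x).
Proof.
under eq_fun do rewrite OU_symbolE.
apply: L2D; first by apply: L2Z; exact: wave_L2.
exact: (dot_wave_L2 GT density).
Qed.

Lemma damped_wave_L2 eta s : L2 (damped_wave eta s).
Proof. by apply: L2Z; exact: wave_L2. Qed.

Lemma generator_wave y (e : R) : 0 < e -> \forall h \near 0^'+,
  nrm (fun x => T h (wave y) x - wave y x - h%:C%C * (OU_symbol y x * wave y x)) <= e * h.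
Proof.
move=> e0; have Lw := wave_L2 mu y; have Ls := OU_symbol_L2 y.
have [_ _ H] : generator_graph mu T (wave y) (fun x => OU_symbol y x * wave y x).
  by apply: (proj2 (proj2 gen _ _)); split => //; exact: OU_wave.
have H1 : \forall h \near 0^'+, (L2norm mu (fun x => (h^-1)%:C%C * (T h (wave y) x - wave y x) -
    OU_symbol y x * wave y x)%R < e%:E)%E.
  apply: (H [set v | (v < e%:E)%E]); exists e => //= v; rewrite /= sub0r normrN => ve.
  by rewrite lte_fin (le_lt_trans _ ve)// ler_norm.
have H0 : \forall h \near 0^'+, (0 : R) < h by exact: nbhs_right_gt.
apply: filterS2 H0 H1 => h h0.
have LT : L2 (T h (wave y)) by apply: (sg_L2 CT) => //; exact: ltW.
have L1 : L2 (fun x => (h^-1)%:C%C * (T h (wave y) x - wave y x) - OU_symbol y x * wave y x).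
  by apply: L2B => //; apply: L2Z; exact: L2B.
rewrite L2norm_nrm// lte_fin => H2.
rewrite (@nrm_eq _ _ _ _ (fun x => h%:C%C * ((h^-1)%:C%C * (T h (wave y) x - wave y x) -
    OU_symbol y x * wave y x))) => [|x]; last first.
  by rewrite -scale_quotient// gt_eqF.
by rewrite nrmZ// sqn_real sqrtr_sqr gtr0_norm// mulrC ler_wpM2r// ltW.
Qed.

(** Differentiability in L^2. The remainder splits into the Taylor remainder of the wave, quadratic
    in the displacement of the frequency, the scalar remainder of the damping factor, and a linear
    form in [x] with small coefficients; each is given e / 3. *)
Lemma damped_wave_taylor eta s (e : R) : 0 <= s -> 0 < e -> \forall h \near 0^'+,
  nrm (fun x => damped_wave eta (s + h) x - damped_wave eta s x -
    h%:C%C * ((damping eta s)%:C%C * (OU_symbol (orbit eta s) x * wave (orbit eta s) x))) <= e * h.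
Proof.
move=> s0 e0.
pose y := orbit eta s; pose g := damping eta s; pose l := - (2^-1 * dot (S *m y) (S *m y)).
(* Converts a bound on the coordinates of a vector into one on its [G]-norm; adding 1 makes it
   positive. *)
pose K := Num.sqrt (\sum_i \sum_j `|G i j|) + 1.
have K0 : 0 < K by rewrite ltr_wpDl ?sqrtr_ge0.
have e3 : 0 < e / 3 by rewrite divr_gt0.
have eK : 0 < e / 3 / K by rewrite divr_gt0.
pose q h := dot (G *m (orbit eta (s + h) - y)) (orbit eta (s + h) - y).
have Dz : mderiv (orbit eta) s (B^T *m y) by exact: mderiv_orbit.
have N1 : \forall h \near 0^'+, `|q h| <= e / 3 * h.
  have Dy : mderiv (fun r => orbit eta r - y) s (B^T *m y).
    by apply: mderiv_eq; [apply: mderivD Dz (mderiv_cst _ _)|rewrite addr0].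
  have := is_derive_dot (mderiv_mulmxl G Dy) Dy.
  rewrite -/y subrr mulmx0 dot0r dot0l addr0 => D.
  have [d d0 Hd] := small_of_derive D e3; apply/near0P; exists d => // h h0 hd.
  by have := Hd h h0 hd; rewrite -/y subrr mulmx0 dot0l subr0 mulr0 subr0.
have N2 : \forall h \near 0^'+, `|damping eta (s + h) - g - h * (g * l)| <= e / 3 * h.
  by apply/near0P; exact: small_of_derive (is_derive_damping eta s) e3.
(* The first-order error of the frequency, weighted by the damping factor, in which the coefficient
   of the linear form is collected. *)
pose w h : Rn := damping eta (s + h) *: (orbit eta (s + h) - y) - (h * g) *: (B^T *m y).
have wE h k : w h k 0 =
    damping eta (s + h) * (orbit eta (s + h) k 0 - y k 0) - h * (g * (B^T *m y) k 0).
  exact: combination_coord.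
have N3 : \forall h \near 0^'+, forall k : 'I_n, `|w h k 0| <= e / 3 / K * h.
  apply: filter_forall => k.
  have D : is_derive s (1 : R) (fun r => damping eta r * (orbit eta r k 0 - y k 0)) (g * (B^T *m
      y) k 0).
    apply: (is_derive_eq (is_deriveM (is_derive_damping eta s) (is_deriveB (Dz k 0)
        (is_derive_cst0 _ _ _)))).
    by rewrite -[X in _ + X *: _]/(y k 0 - y k 0) subrr scale0r addr0 subr0.
  have [d d0 Hd] := small_of_derive D eK; apply/near0P; exists d => // h h0 hd.
  have E0 : orbit eta s k 0 - y k 0 = 0 by exact: subrr.
  by rewrite wE; exact: norm_sub0 E0 (Hd h h0 hd).
have H0 : \forall h \near 0^'+, (0 : R) < h by exact: nbhs_right_gt.
near=> h.
have h0 : 0 < h by near: h.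
have sh : 0 <= s + h by rewrite addr_ge0// ltW.
pose d := orbit eta (s + h) - y.
have Ed : orbit eta (s + h) = y + d by rewrite /d addrCA subrr addr0.
have Ew x : dot (w h) x = damping eta (s + h) * dot d x - h * (g * dot (B^T *m y) x).
  by rewrite dotBl !dotZl mulrA.
have E x : damped_wave eta (s + h) x - damped_wave eta s x -
    h%:C%C * (g%:C%C * (OU_symbol y x * wave y x)) =
  (damping eta (s + h))%:C%C * (wave (y + d) x - wave y x - ('i * (dot d x)%:C)%C * wave y x) +
  ((damping eta (s + h) - g - h * (g * l))%:C%C * wave y x + ('i * (dot (w h) x)%:C)%C * wave y x).
  rewrite OU_symbolE Ew /damped_wave Ed -/y -/g -/l.
  move: (wave (y + d) x) (wave y x) (damping eta (s + h)) (dot d x) (dot (B^T *m y) x) => W V a b c.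
  by apply: complex_eq; rewrite !(ReD, ImD, ReN, ImN, ReM, ImM) /=; ring.
rewrite (@nrm_eq _ _ _ _ _ E).
have L1 : L2 (fun x => wave (y + d) x - wave y x - ('i * (dot d x)%:C)%C * wave y x).
  by apply: L2B; [apply: L2B; exact: wave_L2|exact: (dot_wave_L2 GT density)].
have L2' : L2 (fun x => (damping eta (s + h) - g - h * (g * l))%:C%C * wave y x).
  by apply: L2Z; exact: wave_L2.
have L3 := dot_wave_L2 GT density (w h) y.
apply: le_trans (nrmD (L2Z _ L1) (L2D L2' L3)) _.
have -> : e * h = e / 3 * h + (e / 3 * h + e / 3 * h) by field.
apply: lerD.
  rewrite nrmZ// sqn_real sqrtr_sqr ger0_norm ?damping_ge0//.
  apply: (@le_trans _ _ (q h)).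
    rewrite -[leRHS]mul1r; apply: ler_pM; rewrite ?damping_ge0 ?nrm_ge0 ?damping_le1//.
    exact: (nrm_wave_taylor GT density).
  by apply: le_trans (ler_norm _) _; near: h.
apply: le_trans (nrmD L2' L3) _; apply: lerD.
  rewrite nrmZ ?nrm_wave ?mulr1; last exact: wave_L2.
  by rewrite sqn_real sqrtr_sqr; near: h.
rewrite (nrm_dot_wave GT density).
have Hw : forall k, `|w h k 0| <= e / 3 / K * h by near: h.
have c0 : 0 <= e / 3 / K * h by rewrite mulr_ge0// ltW.
apply: (@le_trans _ _ (e / 3 / K * h * Num.sqrt (\sum_i \sum_j `|G i j|))).
  rewrite -[e / 3 / K * h]ger0_norm// -sqrtr_sqr -sqrtrM ?sqr_ge0// ler_sqrt.
    exact: quadratic_form_coord_le.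
  by rewrite mulr_ge0 ?sqr_ge0//; do 2 (apply: sumr_ge0 => ? _).
apply: (@le_trans _ _ (e / 3 / K * h * K)); first by rewrite ler_wpM2l// lerDl.
by rewrite mulrAC divfK// gt_eqF.
Unshelve. all: by end_near.
Qed.

(** Along the candidate solution and along the semigroup the first-order terms coincide, so the two
    differ by o(h). *)
Lemma damped_wave_step eta s (e : R) : 0 <= s -> 0 < e -> \forall h \near 0^'+,
  nrm (fun x => damped_wave eta (s + h) x - T h (damped_wave eta s) x) <= e * h.
Proof.
move=> s0 e0; have e2 : 0 < e / 2 by rewrite divr_gt0.
have H0 : \forall h \near 0^'+, (0 : R) < h by exact: nbhs_right_gt.
apply: filterS3 H0 (damped_wave_taylor eta s0 e2) (generator_wave (orbit eta s) e2) => h h0 H1 H2.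
set y := orbit eta s in H1 H2 *; set g := damping eta s in H1 *.
have Lw := wave_L2 mu y; have h0' := ltW h0.
have LT := sg_L2 CT h0' Lw.
have g0 : 0 <= g by exact: damping_ge0.
have ET : nrm (fun x => damped_wave eta (s + h) x - T h (damped_wave eta s) x) =
    nrm (fun x => damped_wave eta (s + h) x - g%:C%C * T h (wave y) x).
  have L0 : L2 (fun=> 0) := L2_cst mu 0.
  have LZ := L2Z g%:C%C LT.
  apply: nrm_ae.
  - by apply: L2B; [exact: damped_wave_L2|apply: (sg_L2 CT) => //; exact: damped_wave_L2].
  - by apply: L2B => //; exact: damped_wave_L2.
  have Z := nrm_eq0_ae (sg_L2 CT h0' L0) _.
  have Z0 : nrm (T h (fun=> 0)) = 0.
    have [M M0 HM] := sg_bound CT h0'; apply/eqP; rewrite eq_le nrm_ge0 andbT.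
    by apply: le_trans (HM _ L0) _; rewrite nrm0 mulr0.
  have E : damped_wave eta s = (fun x => g%:C%C * wave y x + 0).
    by apply/funext => x; rewrite addr0.
  rewrite E; apply: filterS2 (Z Z0) (semigroup_linear CT g%:C%C h0' Lw L0) => x Zx ->.
  by rewrite Zx addr0.
rewrite ET (@nrm_eq _ _ _ _ (fun x => (damped_wave eta (s + h) x - damped_wave eta s x -
    h%:C%C * (g%:C%C * (OU_symbol y x * wave y x))) -
    g%:C%C * (T h (wave y) x - wave y x - h%:C%C * (OU_symbol y x * wave y x)))) => [|x]; last
        first.
  exact: step_identity.
have Ls := OU_symbol_L2 y.
have L1 : L2 (fun x => damped_wave eta (s + h) x - damped_wave eta s x -
    h%:C%C * (g%:C%C * (OU_symbol y x * wave y x))).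
  by apply: L2B; [apply: L2B; exact: damped_wave_L2|do 2 apply: L2Z].
have L2' : L2 (fun x => T h (wave y) x - wave y x - h%:C%C * (OU_symbol y x * wave y x)).
  by apply: L2B; [exact: L2B|exact: L2Z].
apply: le_trans (nrmD L1 (L2N (L2Z g%:C%C L2'))) _.
rewrite nrmN nrmZ// sqn_real sqrtr_sqr ger0_norm//.
have -> : e * h = e / 2 * h + e / 2 * h by field.
apply: lerD => //; apply: le_trans H2; rewrite ler_piMl ?nrm_ge0//.
exact: damping_le1.
Qed.

Lemma damped_wave_continuous eta s (e : R) : 0 <= s -> 0 < e -> exists2 d : R, 0 < d &
  forall h, `|h| < d -> 0 <= s + h ->
    nrm (fun x => damped_wave eta (s + h) x - damped_wave eta s x) <= e.
Proof.
move=> s0 e0; have e2 : 0 < e / 2 by rewrite divr_gt0.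
pose y := orbit eta s.
have Dz : mderiv (orbit eta) s (B^T *m y) by exact: mderiv_orbit.
have Dy : mderiv (fun r => orbit eta r - y) s (B^T *m y).
  by apply: mderiv_eq; [apply: mderivD Dz (mderiv_cst _ _)|rewrite addr0].
have [d1 d10 H1] := continuous_of_derive (is_derive_damping eta s) e2.
have [d2 d20 H2] := continuous_of_derive (is_derive_dot (mderiv_mulmxl G Dy) Dy) (exprn_gt0 2 e2).
exists (Num.min d1 d2); first by rewrite lt_min d10.
move=> h; rewrite lt_min => /andP[hd1 hd2] sh.
have {}H1 := H1 _ hd1; have {}H2 := H2 _ hd2.
rewrite -/y subrr mulmx0 dot0l subr0 in H2.
pose d := orbit eta (s + h) - y.
have Ed : orbit eta (s + h) = y + d by rewrite /d addrCA subrr addr0.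
rewrite (@nrm_eq _ _ _ _ (fun x => (damping eta (s + h))%:C%C * (wave (y + d) x - wave y x) +
    (damping eta (s + h) - damping eta s)%:C%C * wave y x)) => [|x]; last first.
  by rewrite /damped_wave Ed; exact: wave_difference.
have Lw := wave_L2 mu y.
have L1 : L2 (fun x => wave (y + d) x - wave y x) by apply: L2B => //; exact: wave_L2.
apply: le_trans (nrmD (L2Z _ L1) (L2Z _ Lw)) _.
rewrite [leRHS]splitr !nrmZ// !sqn_real !sqrtr_sqr nrm_wave mulr1; apply: lerD => //.
rewrite ger0_norm ?damping_ge0//.
apply: (@le_trans _ _ (nrm (fun x => wave (y + d) x - wave y x))).
  by rewrite ler_piMl ?nrm_ge0// damping_le1.
apply: le_trans (nrm_wave_diff GT density y d) _.
rewrite -[leRHS]ger0_norm ?(ltW e2)// -sqrtr_sqr ler_sqrt ?sqr_ge0//.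
exact: le_trans (ler_norm _) H2.
Qed.

(** Uniqueness by the comparison function s |-> |T_{t-s} u(s) - T_t u(0)|: its right increments are
    o(h) by the consistency of one step, amplified by at most the uniform bound [M]. *)
Lemma semigroup_wave eta t : 0 <= t ->
  nrm (fun x => T t (wave eta) x - damped_wave eta t x) = 0.
Proof.
move=> t0.
have U0 : damped_wave eta 0 = wave eta.
  apply/funext => x; rewrite /damped_wave /damping subrr mulr0 oppr0 expR0 mul1r.
  by rewrite /orbit expmx0 mul1mx.
have Lw := wave_L2 mu eta; have Lu := damped_wave_L2 eta.
have [->|tn0] := eqVneq t 0.
  rewrite U0 (nrm_sg0 CT)// (@nrm_eq _ _ _ _ (fun=> 0)) ?nrm0// => x.
  by rewrite subrr.
have tp : 0 < t by rewrite lt_def tn0.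
have [M M1 HM] := sg_bounded CT t.
have M0 : 0 < M by exact: lt_le_trans M1.
pose g s := nrm (fun x => T (t - s) (damped_wave eta s) x - T t (wave eta) x).
have LT s f : 0 <= s -> L2 f -> L2 (T s f) by exact: (sg_L2 CT).
have LTt := LT _ _ t0 Lw.
have gt0 : g t = nrm (fun x => T t (wave eta) x - damped_wave eta t x).
  by rewrite /g subrr (nrm_sg0 CT)// nrmB_sym.
rewrite -gt0; apply/eqP; rewrite eq_le nrm_ge0 andbT.
(* The semigroup law factors T_a out of the difference, at the cost of the factor [M]. *)
have step a b f k : 0 <= a -> 0 <= b -> a + b <= t -> L2 f -> L2 k ->
    nrm (fun x => T (a + b) f x - T a k x) <= M * nrm (fun x => T b f x - k x).
  move=> a0 b0 ab Lf Lk.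
  rewrite (nrm_sg_comp CT)//; last exact: LT.
  have Lb := LT _ _ b0 Lf.
  rewrite (nrm_sgB CT)//; apply: HM => //; last exact: L2B.
  by apply: le_trans ab; rewrite lerDl.
apply: zero_of_small_increments => //.
- by rewrite /g subr0 U0 (@nrm_eq _ _ _ _ (fun=> 0)) ?nrm0// => x; rewrite subrr.
- move=> s e s0 st e0.
  have eM : 0 < e / M by rewrite divr_gt0.
  have /near0P[d d0 Hd] := damped_wave_step eta s0 eM.
  exists d => // h h0 hd sht.
  have a0 : 0 <= t - (s + h) by rewrite subr_ge0.
  have ts : 0 <= t - s by rewrite subr_ge0 ltW.
  apply: le_trans (nrm_tri (LT _ _ a0 (Lu (s + h))) (LT _ _ ts (Lu s)) LTt) _.
  rewrite -/(g s) [leLHS]addrC lerD2l.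
  have E : t - s = (t - (s + h)) + h by ring.
  rewrite nrmB_sym E; apply: le_trans (step _ _ _ _ a0 (ltW h0) _ (Lu _) (Lu _)) _.
    by rewrite -E gerBl.
  rewrite nrmB_sym mulrC -ler_pdivlMr// mulrAC; exact: Hd.
- move=> s e s0 st e0.
  have eM : 0 < e / M / 2 by rewrite !divr_gt0.
  have eM2 : 0 < e / M / 2 / M by rewrite !divr_gt0.
  have [d1 d10 H1] := sg_continuous CT (Lu s) eM.
  have [d2 d20 H2] := damped_wave_continuous eta (ltW s0) eM2.
  exists (Num.min d1 d2); first by rewrite lt_min d10.
  move=> h h0; rewrite lt_min => /andP[hd1 hd2] hs.
  have ts : 0 <= t - s by rewrite subr_ge0.
  have tsh : 0 <= t - (s - h) by rewrite subr_ge0 (le_trans _ st)// gerBl ltW.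
  apply: le_trans (nrm_tri (LT _ _ ts (Lu s)) (LT _ _ tsh (Lu (s - h))) LTt) _.
  rewrite -/(g (s - h)) [leLHS]addrC lerD2l.
  have E : t - (s - h) = (t - s) + h by ring.
  have LTh := LT _ _ (ltW h0) (Lu (s - h)).
  rewrite nrmB_sym E; apply: le_trans (step _ _ _ _ ts (ltW h0) _ (Lu _) (Lu _)) _.
    by rewrite -E gerBl subr_ge0.
  rewrite mulrC -ler_pdivlMr//.
  apply: le_trans (nrm_tri LTh (LT _ _ (ltW h0) (Lu s)) (Lu s)) _.
  rewrite [leRHS]splitr; apply: lerD; last by apply: H1 => //; exact: ltW.
  rewrite (nrm_sgB CT) ?(ltW h0)//.
  have hle : h <= t by exact: le_trans hs st.
  apply: le_trans (HM _ _ (ltW h0) hle (L2B (Lu _) (Lu _))) _.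
  rewrite mulrC -ler_pdivlMr//; apply: H2; first by rewrite normrN gtr0_norm.
  by rewrite subr_ge0.
Qed.

End semigroup_on_waves.

(** * Estimates on trigonometric polynomials *)

Section positive_kernels.
Context {R : realType} {X : Type}.
Implicit Types (K : X -> X -> R) (s : seq (R * X)).

Definition quadratic_form K s : R := \sum_(p <- s) \sum_(q <- s) p.1 * q.1 * K p.2 q.2.

(** Positivity on finite families with real coefficients; complex coefficients are handled later by
    applying it to real and imaginary parts. *)
Definition psd_kernel K := forall s, 0 <= quadratic_form K s.

Lemma quadratic_formD K1 K2 s :
  quadratic_form (fun x y => K1 x y + K2 x y) s = quadratic_form K1 s + quadratic_form K2 s.
Proof.
rewrite /quadratic_form -big_split; apply: eq_bigr => p _; rewrite -big_split.
by apply: eq_bigr => q _; rewrite mulrDr.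
Qed.

Lemma quadratic_formZ (a : R) K s :
  quadratic_form (fun x y => a * K x y) s = a * quadratic_form K s.
Proof.
rewrite /quadratic_form mulr_sumr; apply: eq_bigr => p _; rewrite mulr_sumr.
by apply: eq_bigr => q _; rewrite mulrCA.
Qed.

Lemma eq_quadratic_form K1 K2 s : (forall x y, K1 x y = K2 x y) ->
  quadratic_form K1 s = quadratic_form K2 s.
Proof. by move=> E; apply: eq_bigr => p _; apply: eq_bigr => q _; rewrite E. Qed.

Lemma psd_kernel_scale K (f : X -> R) : psd_kernel K ->
  psd_kernel (fun x y => f x * f y * K x y).
Proof.
move=> H s; have := H [seq (p.1 * f p.2, p.2) | p <- s].
rewrite /quadratic_form big_map; congr (0 <= _); apply: eq_bigr => p _.
by rewrite big_map; apply: eq_bigr => q _ /=; ring.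
Qed.

Lemma psd_kernel_sum (I : finType) (K : I -> X -> X -> R) :
  (forall i, psd_kernel (K i)) -> psd_kernel (fun x y => \sum_i K i x y).
Proof.
move=> H s; rewrite (_ : quadratic_form _ _ = \sum_i quadratic_form (K i) s).
  by apply: sumr_ge0 => i _; exact: H.
rewrite /quadratic_form [RHS]exchange_big; apply: eq_bigr => p _ /=.
by rewrite [RHS]exchange_big; apply: eq_bigr => q _ /=; rewrite mulr_sumr.
Qed.

End positive_kernels.

Lemma is_derive_sum_seq (R : realType) (I : Type) (r : seq I) (f df : I -> R -> R) (s : R) :
  (forall i, is_derive s (1 : R) (f i) (df i s)) ->
  is_derive s (1 : R) (fun x => \sum_(i <- r) f i x) (\sum_(i <- r) df i s).
Proof.
move=> H; elim: r => [|i r IH].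
  rewrite big_nil; under eq_fun do rewrite big_nil; exact: is_derive_cst0.
rewrite big_cons; under eq_fun do rewrite big_cons; exact: is_deriveD.
Qed.

(** * Gram kernels of waves under the Gaussian measure *)

Section gaussian_kernels.
Context {R : realType} {n : nat}.
Local Notation Rn := 'cV[R]_n.
Variables (G : 'M[R]_n) (mu : probability Rn R).
Hypothesis GT : G^T = G.
Hypothesis density : forall A, measurable A ->
  mu A = (\int[@lebesgue_Rn R n]_(x in A) (gauss_density G x)%:E)%E.
Local Notation nrm := (nrm mu).
Implicit Types (x y : Rn).

(** The characteristic function at [y]. By [char_product] it is also the weight that turns the Gram
    kernel of waves into exp <G y, z>. *)
Definition half_gauss y : R := expR (- (2^-1 * dot (G *m y) y)).

Lemma char_product y z : expR (- (2^-1 * dot (G *m (y - z)) (y - z))) =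
  half_gauss y * half_gauss z * expR (dot (G *m y) z).
Proof.
rewrite /half_gauss -!expRD; congr expR.
rewrite mulmxBr !dotBl !dotBr [dot (G *m z) y]dot_mulmxl GT [dot z _]dotC.
by field.
Qed.

Lemma char_cos_product y z :
  \int[mu]_x (cos (dot y x) * cos (dot z x) + sin (dot y x) * sin (dot z x)) =
  half_gauss y * half_gauss z * expR (dot (G *m y) z).
Proof.
rewrite -char_product -(char_cos GT density); apply: eq_Rintegral => x _.
by rewrite dotBl cosB.
Qed.

Lemma sin_product y z :
  \int[mu]_x (sin (dot y x) * cos (dot z x) - cos (dot y x) * sin (dot z x)) = 0.
Proof.
rewrite -(char_sin GT density (y - z)); apply: eq_Rintegral => x _.
by rewrite dotBl sinB.
Qed.

Lemma trig_product_integrable y z (a b : R) :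
  mu.-integrable setT (EFin \o (fun x =>
    a * (cos (dot y x) * cos (dot z x) + sin (dot y x) * sin (dot z x)) +
    b * (sin (dot y x) * cos (dot z x) - cos (dot y x) * sin (dot z x)))).
Proof.
apply: integrableRD; apply: integrableRZ.
  by under eq_fun do rewrite -cosB -dotBl; exact: cos_dot_integrable.
by under eq_fun do rewrite -sinB -dotBl; exact: sin_dot_integrable.
Qed.

(* The Schur product with a kernel [exp <G f x, f y>], proved by writing the
   latter as a Gaussian integral of rank two kernels. *)
Lemma psd_kernel_mul_exp {X : Type} (K : X -> X -> R) (f : X -> Rn) : psd_kernel K ->
  psd_kernel (fun a b => K a b * expR (dot (G *m f a) (f b))).
Proof.
move=> HK s.
pose h p x := (half_gauss (f p.2))^-1 * p.1 * cos (dot (f p.2) x).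
pose k p x := (half_gauss (f p.2))^-1 * p.1 * sin (dot (f p.2) x).
have hg y : half_gauss y != 0 by rewrite gt_eqF// expR_gt0.
have I p q : mu.-integrable setT (EFin \o (fun x =>
    h p x * h q x * K p.2 q.2 + k p x * k q x * K p.2 q.2)).
  pose a := (half_gauss (f p.2))^-1 * p.1 * ((half_gauss (f q.2))^-1 * q.1) * K p.2 q.2.
  have := trig_product_integrable (f p.2) (f q.2) a 0.
  by apply: eq_integrable => // x _; rewrite /= /h /k /a; congr (_%:E); ring.
have E : quadratic_form (fun a b => K a b * expR (dot (G *m f a) (f b))) s =
    \int[mu]_x (\sum_(p <- s) \sum_(q <- s) (h p x * h q x * K p.2 q.2 + k p x * k q x * K p.2
        q.2)).
  rewrite RintegralR_sum; last by move=> p; exact: integrableR_sum.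
  apply: eq_bigr => p _; rewrite RintegralR_sum//; apply: eq_bigr => q _.
  rewrite (@eq_Rintegral _ _ _ _ _ (fun x => ((half_gauss (f p.2))^-1 * p.1 * ((half_gauss (f
      q.2))^-1 * q.1) * K p.2 q.2) *
    (cos (dot (f p.2) x) * cos (dot (f q.2) x) + sin (dot (f p.2) x) * sin (dot (f q.2) x)))).
    rewrite RintegralZl//; last first.
      have := trig_product_integrable (f p.2) (f q.2) 1 0.
      by apply: eq_integrable => // x _; rewrite /= mul1r mul0r addr0.
    by rewrite char_cos_product; field; rewrite !hg.
  by move=> x _; rewrite /h /k; ring.
rewrite E; apply: Rintegral_ge0 => x _.
under eq_bigr do rewrite big_split/=; rewrite big_split/=; apply: addr_ge0.
  have := HK [seq (h p x, p.2) | p <- s].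
  rewrite /quadratic_form big_map; congr (0 <= _); apply: eq_bigr => p _.
  by rewrite big_map.
have := HK [seq (k p x, p.2) | p <- s].
rewrite /quadratic_form big_map; congr (0 <= _); apply: eq_bigr => p _.
by rewrite big_map.
Qed.

(** Only the real part of the product of a coefficient with the conjugate of another survives: the
    remaining cross terms multiply the integral of a sine, which is zero. *)
Lemma nrm_sum_waves (I : Type) (r : seq I) (c : I -> R[i]) (y : I -> Rn) :
  nrm (fun x => \sum_(i <- r) c i * wave (y i) x) ^+ 2 =
  \sum_(i <- r) \sum_(j <- r) (complex.Re (c i) * complex.Re (c j) + complex.Im (c i) *
      complex.Im (c j)) *
    (half_gauss (y i) * half_gauss (y j) * expR (dot (G *m y i) (y j))).
Proof.
rewrite nrm_sqr.
pose F i j x := (complex.Re (c i) * complex.Re (c j) + complex.Im (c i) * complex.Im (c j)) *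
    (cos (dot (y i) x) * cos (dot (y j) x) + sin (dot (y i) x) * sin (dot (y j) x)) +
    (complex.Re (c i) * complex.Im (c j) - complex.Im (c i) * complex.Re (c j)) *
    (sin (dot (y i) x) * cos (dot (y j) x) - cos (dot (y i) x) * sin (dot (y j) x)).
have IF i j : mu.-integrable setT (EFin \o F i j) by exact: trig_product_integrable.
rewrite (@eq_Rintegral _ _ _ _ _ (fun x => \sum_(i <- r) \sum_(j <- r) F i j x)).
  rewrite RintegralR_sum; last by move=> i; apply: integrableR_sum => j; exact: IF.
  apply: eq_bigr => i _; rewrite (RintegralR_sum r (IF i)); apply: eq_bigr => j _.
  rewrite /F RintegralD//.
  - have I1 := trig_product_integrable (y i) (y j) 1 0.
    have I2 := trig_product_integrable (y i) (y j) 0 1.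
    rewrite !RintegralZl//.
    + by rewrite char_cos_product sin_product mulr0 addr0.
    + by apply: eq_integrable I2 => // x _; rewrite /= mul0r mul1r add0r.
    + by apply: eq_integrable I1 => // x _; rewrite /= mul0r mul1r addr0.
  - have := trig_product_integrable (y i) (y j) (complex.Re (c i) * complex.Re (c j) +
      complex.Im (c i) * complex.Im (c j)) 0.
    by apply: eq_integrable => // x _; rewrite /= mul0r addr0.
  - have := trig_product_integrable (y i) (y j) 0 (complex.Re (c i) * complex.Im (c j) -
      complex.Im (c i) * complex.Re (c j)).
    by apply: eq_integrable => // x _; rewrite /= mul0r add0r.
move=> x _; rewrite /sqn Re_sum Im_sum !expr2 !mulr_suml -big_split; apply: eq_bigr => i _.
rewrite !mulr_sumr -big_split; apply: eq_bigr => j _ /=.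
by rewrite !ReM !ImM /F /=; ring.
Qed.

End gaussian_kernels.

Lemma taylor_identity (R : realType) (a b c d : R) :
  a - c * b - (b - d * b) = a - b - (c - d) * b.
Proof. by ring. Qed.

Lemma derivative_identity (R : realType) (a b c : R) :
  - (a * b) - c * (- a) = - (a * (b - c)).
Proof. by ring. Qed.

Lemma difference_identity (R : realType) (a b : R) : a - b = 1 * 1 * a + -1 * (1 * 1 * b).
Proof. by ring. Qed.

Lemma le_of_eqs (R : realType) (a b c d : R) : a = c -> b = d -> c <= d -> a <= b.
Proof. by move=> -> ->. Qed.

Lemma le_of_sqr (R : realType) (a b : R) : 0 <= a -> 0 <= b -> a ^+ 2 <= b ^+ 2 -> a <= b.
Proof. by move=> a0 b0; rewrite ler_pXn2r ?nnegrE. Qed.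

Lemma smoothing_identity (R : realType) (m a b l k e f : R) :
  (m * (a + -1 * b) + -1 * (l * k)) * e + m * ((f - e - (a - b) * e) + e) =
  m * (1 * 1 * f) + -1 * (l * k * e).
Proof. by ring. Qed.

(** * Kernel inequalities along the flow *)

Section trigonometric_estimates.
Context {R : realType} {n : nat}.
Local Notation Rn := 'cV[R]_n.
Variables (S B G : 'M[R]_n) (mu : probability Rn R).
Hypotheses (ST : S^T = S) (GT : G^T = G).
Hypothesis lyap : B *m G + G *m B^T = - (S *m S).
Hypothesis density : forall A, measurable A ->
  mu A = (\int[@lebesgue_Rn R n]_(x in A) (gauss_density G x)%:E)%E.
Local Notation nrm := (nrm mu).
Implicit Types (eta : Rn) (s t : R).

Definition correlation t eta eta' : R :=
  dot (G *m orbit B eta t) (orbit B eta' t).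

Lemma is_derive_correlation t eta eta' : is_derive t (1 : R)
  (fun t => correlation t eta eta')
  (- dot (S *m orbit B eta t) (S *m orbit B eta' t)).
Proof.
apply: is_derive_eq.
  apply: is_derive_dot; last exact: mderiv_orbit.
  by apply: mderiv_mulmxl; exact: mderiv_orbit.
rewrite -[LHS]/(dot (G *m (B^T *m orbit B eta t)) (orbit B eta' t) +
  dot (G *m orbit B eta t) (B^T *m orbit B eta' t)).
move: (orbit B eta t) (orbit B eta' t) => x y.
rewrite [X in _ + X]dot_mulmxr trmxK -dotDl !mulmxA -mulmxDl [X in X *m _]addrC lyap.
by rewrite mulNmx dotNl -mulmxA -{1}ST -dot_mulmxr.
Qed.

Lemma is_derive_exp_correlation t eta eta' : is_derive t (1 : R)
  (fun t => expR (correlation t eta eta'))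
  (- (dot (S *m orbit B eta t) (S *m orbit B eta' t) * expR (correlation t eta eta'))).
Proof.
have := is_derive_comp_R (is_derive_expR _) (is_derive_correlation t eta eta').
by rewrite mulrN mulrC.
Qed.

(** A Gram kernel is a sum of rank one kernels over the coordinates, and multiplying by a rank one
    kernel only rescales the coefficients. *)
Lemma psd_kernel_gram {X : Type} (f : X -> Rn) (K : X -> X -> R) : psd_kernel K ->
  psd_kernel (fun a b => dot (f a) (f b) * K a b).
Proof.
move=> HK s; have := @psd_kernel_sum R X 'I_n (fun i a b => f a i 0 * f b i 0 * K a b).
move=> /(_ (fun i => psd_kernel_scale (fun a => f a i 0) HK)) => /(_ s).
congr (0 <= _); apply: eq_quadratic_form => a b.
by rewrite /dot mulr_suml.
Qed.

Lemma psd_exp_correlation t : psd_kernel (fun eta eta' => expR (correlation t eta eta')).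
Proof.
have H : psd_kernel (fun _ _ : Rn => 1 : R).
  move=> s; rewrite /quadratic_form (_ : \sum_(p <- s) _ = (\sum_(p <- s) p.1) ^+ 2) ?sqr_ge0//.
  rewrite expr2 mulr_suml; apply: eq_bigr => p _; rewrite mulr_sumr; apply: eq_bigr => q _.
  by rewrite mulr1.
move=> s; have := psd_kernel_mul_exp GT density (fun eta => orbit B eta t) H s.
by congr (0 <= _); apply: eq_quadratic_form => a b; rewrite mul1r.
Qed.

(** For fixed coefficients the quadratic form is a scalar function of time with nonpositive
    derivative. *)
Lemma psd_kernel_derive (K dK : R -> Rn -> Rn -> R) (a b : R) : a <= b ->
  (forall t x y, is_derive t (1 : R) (fun t => K t x y) (- dK t x y)) ->
  (forall t, a <= t <= b -> psd_kernel (dK t)) ->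
  psd_kernel (fun x y => K a x y - K b x y).
Proof.
move=> ab HK HdK s.
have -> : quadratic_form (fun x y => K a x y - K b x y) s =
    quadratic_form (K a) s - quadratic_form (K b) s.
  rewrite -[- _]mulN1r -quadratic_formZ -quadratic_formD.
  by apply: eq_quadratic_form => x y; rewrite mulN1r.
rewrite subr_ge0.
apply: (@ler_derive_le _ (fun t => quadratic_form (K t) s) (fun t => - quadratic_form (dK t) s))
    => //.
  move=> t _; rewrite -[- _]mulN1r -quadratic_formZ.
  apply: (@is_derive_sum_seq _ _ s (fun p t => \sum_(q <- s) p.1 * q.1 * K t p.2 q.2)
    (fun p t => \sum_(q <- s) p.1 * q.1 * (-1 * dK t p.2 q.2))) => p.
  apply: (@is_derive_sum_seq _ _ s (fun q t => p.1 * q.1 * K t p.2 q.2)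
    (fun q t => p.1 * q.1 * (-1 * dK t p.2 q.2))) => q.
  by have := is_deriveZ (p.1 * q.1) (HK t p.2 q.2); rewrite mulN1r.
by move=> t /HdK H; rewrite oppr_le0; exact: H.
Qed.

Lemma psd_exp_correlation_diff s t : s <= t ->
  psd_kernel (fun eta eta' => expR (correlation s eta eta') - expR (correlation t eta eta')).
Proof.
move=> st; apply: (@psd_kernel_derive (fun t x y => expR (correlation t x y))
  (fun t x y => dot (S *m orbit B x t) (S *m orbit B y t) * expR (correlation t x y))) => //.
  by move=> r x y; exact: is_derive_exp_correlation.
move=> r _; apply: psd_kernel_gram; exact: psd_exp_correlation.
Qed.

(* The derivative in [r] of the kernel [exp c_r - c_r exp c_t], [c_r] standing for the
   correlation at time [r], is [c_r' (exp c_r - exp c_t)] with [- c_r'] a Gram kernel. *)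
Lemma psd_exp_correlation_taylor t : 0 <= t ->
  psd_kernel (fun eta eta' => expR (correlation 0 eta eta') - expR (correlation t eta eta') -
    (correlation 0 eta eta' - correlation t eta eta') * expR (correlation t eta eta')).
Proof.
move=> t0 s.
have := @psd_kernel_derive (fun r x y => expR (correlation r x y) - correlation r x y * expR
    (correlation t x y))
  (fun r x y => dot (S *m orbit B x r) (S *m orbit B y r) *
    (expR (correlation r x y) - expR (correlation t x y))) 0 t t0.
move=> H; have := H _ _ s; rewrite (@eq_quadratic_form _ _ _ (fun eta eta' =>
    expR (correlation 0 eta eta') - expR (correlation t eta eta') -
    (correlation 0 eta eta' - correlation t eta eta') * expR (correlation t eta eta'))) => [|x
        y]; last exact: taylor_identity.
apply.
- move=> r x y.
  have D := is_deriveB (is_derive_exp_correlation r x y)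
    (is_deriveZ (expR (correlation t x y)) (is_derive_correlation r x y)).
  have := is_derive_eq D (_ : _ = - (dot (S *m orbit B x r) (S *m orbit B y r) *
    (expR (correlation r x y) - expR (correlation t x y)))).
  rewrite (_ : (fun _ => _) - (_ \*: _) = fun r => expR (correlation r x y) - correlation r x y
      * expR (correlation t x y)).
    by apply; exact: derivative_identity.
  by apply/funext => r'; rewrite /= /GRing.scale/= mulrC.
- by move=> r /andP[r0 rt]; apply: psd_kernel_gram; exact: psd_exp_correlation_diff.
Qed.

(** With weight 1 this is the image of the polynomial under the semigroup; with weight <xi, z(t)> it
    is its derivative along [xi], up to the factor i. *)
Definition weighted_waves (l : Rn -> R) (r : seq (R[i] * Rn)) t x : R[i] :=
  \sum_(p <- r) (p.1 * (l p.2 * damping B G p.2 t)%:C%C) * wave (orbit B p.2 t) x.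

(** The identity exp (- (p(0) - p(t)) / 2) exp (- p(t) / 2) = exp (- p(0) / 2) makes the
    coefficients of all the quadratic forms independent of time. *)
Lemma damping_half_gauss eta t :
  damping B G eta t * half_gauss G (orbit B eta t) = half_gauss G eta.
Proof.
rewrite /damping /half_gauss -expRD; congr expR.
have -> : energy B G eta 0 = dot (G *m eta) eta.
  by rewrite /energy /orbit expmx0 mul1mx.
by rewrite /energy; move: (dot _ _) (dot _ _) => a b; field.
Qed.

Lemma nrm_weighted_waves l r t : nrm (weighted_waves l r t) ^+ 2 =
  quadratic_form (fun x y => l x * l y * expR (correlation t x y))
    [seq (complex.Re p.1 * half_gauss G p.2, p.2) | p <- r] +
  quadratic_form (fun x y => l x * l y * expR (correlation t x y))
    [seq (complex.Im p.1 * half_gauss G p.2, p.2) | p <- r].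
Proof.
rewrite (nrm_sum_waves GT density r (fun p => p.1 * (l p.2 * damping B G p.2 t)%:C%C)
  (fun p => orbit B p.2 t)).
rewrite /quadratic_form !big_map -big_split; apply: eq_bigr => p _ /=.
rewrite !big_map -big_split; apply: eq_bigr => q _ /=.
rewrite -(damping_half_gauss p.2 t) -(damping_half_gauss q.2 t) /correlation !ReM !ImM /=.
move: (damping _ _ _ _) (damping _ _ _ _) (half_gauss _ _) (half_gauss _ _) (expR _) => a b c d e.
by ring.
Qed.

Lemma weighted_waves0 r : weighted_waves (fun=> 1) r 0 = trigpoly r.
Proof.
apply/funext => x; apply: eq_bigr => p _.
rewrite /damping subrr mulr0 oppr0 expR0 mulr1 mulr1.
by rewrite /orbit expmx0 mul1mx.
Qed.

Lemma trig_contraction r t : 0 <= t ->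
  nrm (weighted_waves (fun=> 1) r t) <= nrm (trigpoly r).
Proof.
move=> t0; have E := weighted_waves0 r.
apply: le_of_sqr; [exact: nrm_ge0|exact: nrm_ge0|rewrite -E].
have H w : quadratic_form (fun x y => 1 * 1 * expR (correlation t x y)) w <=
    quadratic_form (fun x y => 1 * 1 * expR (correlation 0 x y)) w.
  rewrite -subr_ge0 -[- _]mulN1r -quadratic_formZ -quadratic_formD.
  have := psd_exp_correlation_diff t0 w; congr (0 <= _); apply: eq_quadratic_form => x y.
  exact: difference_identity.
have E0 := nrm_weighted_waves (fun=> 1) r 0; have Et := nrm_weighted_waves (fun=> 1) r t.
exact: le_of_eqs Et E0 (lerD (H _) (H _)).
Qed.

Definition combination (w : seq (R * Rn)) : Rn := \sum_(p <- w) p.1 *: p.2.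

Lemma dot_sum_seq (I J : Type) (r : seq I) (r' : seq J) (F : I -> Rn) (F' : J -> Rn) :
  dot (\sum_(i <- r) F i) (\sum_(j <- r') F' j) = \sum_(i <- r) \sum_(j <- r') dot (F i) (F' j).
Proof.
have H y : dot (\sum_(i <- r) F i) y = \sum_(i <- r) dot (F i) y.
  by elim: r => [|i r IH]; rewrite ?big_nil ?dot0l// !big_cons dotDl IH.
rewrite H; apply: eq_bigr => i _; rewrite dotC.
by elim: r' => [|j r' IH]; rewrite ?big_nil ?dot0l// !big_cons dotDl IH dotC.
Qed.

Lemma orbit_combination w t : orbit B (combination w) t = \sum_(p <- w) p.1 *: orbit B p.2 t.
Proof.
rewrite /orbit /combination mulmx_sumr; apply: eq_bigr => p _.
by rewrite scalemxAr.
Qed.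

Lemma quadratic_form_correlation w t :
  quadratic_form (correlation t) w = energy B G (combination w) t.
Proof.
rewrite /energy orbit_combination mulmx_sumr dot_sum_seq.
apply: eq_bigr => p _; apply: eq_bigr => q _.
by rewrite -scalemxAr dotZl dotZr mulrA.
Qed.

Lemma quadratic_form_dot xi w t :
  quadratic_form (fun x y => dot xi (orbit B x t) * dot xi (orbit B y t)) w =
  dot xi (orbit B (combination w) t) ^+ 2.
Proof.
rewrite orbit_combination expr2.
have -> : dot xi (\sum_(p <- w) p.1 *: orbit B p.2 t) = \sum_(p <- w) p.1 * dot xi (orbit B p.2 t).
  by elim: w => [|p w IH]; rewrite ?big_nil ?dot0r// !big_cons dotDr dotZr IH.
rewrite mulr_suml; apply: eq_bigr => p _; rewrite mulr_sumr; apply: eq_bigr => q _.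
by ring.
Qed.

(** In terms of kernels, with c_r the correlation and l the weight: l l' e^{c_t} <= M^2 (c_0 - c_t)
    e^{c_t} by hypothesis and Schur product, then e^{c_t} (1 + c_0 - c_t) <= e^{c_0} by
    [psd_exp_correlation_taylor]. *)
Lemma trig_smoothing xi r t (M : R) : 0 <= t -> 0 <= M ->
  (forall eta, dot xi (orbit B eta t) ^+ 2 <= M ^+ 2 * (energy B G eta 0 - energy B G eta t)) ->
  nrm (weighted_waves (fun eta => dot xi (orbit B eta t)) r t) <= M * nrm (trigpoly r).
Proof.
move=> t0 M0 HM.
pose l x := dot xi (orbit B x t).
have H w : quadratic_form (fun x y => l x * l y * expR (correlation t x y)) w <=
    M ^+ 2 * quadratic_form (fun x y => 1 * 1 * expR (correlation 0 x y)) w.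
  (* By linearity of the orbit in the initial vector, the quadratic form of this kernel is the
     hypothesis evaluated at one combination of the frequencies. *)
  have D : psd_kernel (fun x y => M ^+ 2 * (correlation 0 x y + -1 * correlation t x y) + -1 *
      (l x * l y)).
    move=> w'; rewrite quadratic_formD quadratic_formZ quadratic_formD !quadratic_formZ.
    rewrite !quadratic_form_correlation quadratic_form_dot !mulN1r subr_ge0.
    exact: HM.
  have H1 := psd_kernel_mul_exp GT density (fun eta => orbit B eta t) D w.
  have H2 := psd_exp_correlation_taylor t0 w.
  have H3 := psd_exp_correlation t w.
  rewrite -subr_ge0 -[- _]mulN1r -quadratic_formZ -quadratic_formZ -quadratic_formD.
  have M2 : 0 <= M ^+ 2 by exact: sqr_ge0.
  have := addr_ge0 H1 (mulr_ge0 M2 (addr_ge0 H2 H3)).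
  rewrite -quadratic_formD -quadratic_formZ -quadratic_formD; congr (0 <= _).
  apply: eq_quadratic_form => x y; exact: smoothing_identity.
have E := weighted_waves0 r.
apply: le_of_sqr; [exact: nrm_ge0|exact: mulr_ge0 M0 (nrm_ge0 _ _)|rewrite -E].
have E0 := nrm_weighted_waves (fun=> 1) r 0; have Et := nrm_weighted_waves l r t.
have E1 := congr1 (fun a => M ^+ 2 * a) E0; rewrite /= mulrDr -exprMn in E1.
exact: le_of_eqs Et E1 (lerD (H _) (H _)).
Qed.

End trigonometric_estimates.

Lemma deriv_coefficient (R : realType) (a W : R[i]) (x y : R) :
  a * ('i * (x * y)%:C)%C * W = x%:C%C * (a * ('i * y%:C)%C * W).
Proof. by apply: complex_eq; rewrite !(ReM, ImM) /=; ring. Qed.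

(** * Multiplication by a linear form in Gaussian L^2 *)

Section gaussian_position.
Context {R : realType} {n : nat}.
Local Notation Rn := 'cV[R]_n.
Variables (G : 'M[R]_n) (mu : probability Rn R).
Hypothesis GT : G^T = G.
Hypothesis density : forall A, measurable A ->
  mu A = (\int[@lebesgue_Rn R n]_(x in A) (gauss_density G x)%:E)%E.
Local Notation nrm := (nrm mu).
Local Notation integrableR f := (mu.-integrable setT (EFin \o f)).
Implicit Types (x y : Rn).

(** The derivative <xi, grad>, without the factor 1/i of D_x. *)
Definition trig_deriv (xi : Rn) (r : seq (R[i] * Rn)) : seq (R[i] * Rn) :=
  [seq (p.1 * ('i * (dot xi p.2)%:C)%C, p.2) | p <- r].

Lemma trig_deriv_cons xi p r : trig_deriv xi (p :: r) =
  (p.1 * ('i * (dot xi p.2)%:C)%C, p.2) :: trig_deriv xi r.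
Proof. by []. Qed.

Lemma cc1_trigpoly i (r : seq (R[i] * Rn)) :
  cc1 i (trigpoly r) (trigpoly (trig_deriv (delta_mx i 0) r)).
Proof.
elim: r => [|p r IH].
  rewrite (_ : trigpoly _ = fun=> 0); last by apply/funext => x; rewrite trigpoly_nil.
  by split; exact: c1_cst.
have Ei : dot (delta_mx i 0) p.2 = p.2 i 0.
  rewrite /dot (bigD1 i)//= mxE !eqxx mul1r big1 ?addr0// => k ki.
  by rewrite mxE (negbTE ki) mul0r.
have [H1 H2] := IH.
have [H3 H4] : cc1 i (fun x => p.1 * wave p.2 x)
    (fun x => p.1 * (('i * (p.2 i 0)%:C)%C * wave p.2 x) + 0 * wave p.2 x).
  by apply: cc1M; [split; exact: c1_cst|exact: cc1_wave].
split.
  rewrite (_ : (fun x => complex.Re (trigpoly (p :: r) x)) =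
      fun x => complex.Re (p.1 * wave p.2 x) + complex.Re (trigpoly r x)).
    apply: c1_ext (c1D H3 H1) _ => x.
    by rewrite trig_deriv_cons trigpoly_cons [RHS]ReD Ei mul0r addr0 mulrA.
  by apply/funext => x; rewrite trigpoly_cons ReD.
rewrite (_ : (fun x => complex.Im (trigpoly (p :: r) x)) =
    fun x => complex.Im (p.1 * wave p.2 x) + complex.Im (trigpoly r x)).
  apply: c1_ext (c1D H4 H2) _ => x.
  by rewrite trig_deriv_cons trigpoly_cons [RHS]ImD Ei mul0r addr0 mulrA.
by apply/funext => x; rewrite trigpoly_cons ImD.
Qed.

Lemma trig_deriv_sum xi (r : seq (R[i] * Rn)) x :
  trigpoly (trig_deriv xi r) x = \sum_i (xi i 0)%:C%C * trigpoly (trig_deriv (delta_mx i 0) r) x.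
Proof.
have Ei (y : Rn) i : dot (delta_mx i 0) y = y i 0.
  rewrite /dot (bigD1 i)//= mxE !eqxx mul1r big1 ?addr0// => k ki.
  by rewrite mxE (negbTE ki) mul0r.
rewrite /trigpoly !big_map; under [RHS]eq_bigr do rewrite big_map mulr_sumr.
rewrite exchange_big; apply: eq_bigr => p _ /=.
have -> : dot xi p.2 = \sum_i xi i 0 * p.2 i 0 by [].
rewrite rmorph_sum !mulr_sumr !mulr_suml; apply: eq_bigr => i _.
by rewrite Ei; exact: deriv_coefficient.
Qed.

(** Integration by parts of <x0, x> |u|^2 in the direction G x0 expresses the left-hand side by
    |u|^2 and a cross term between <x0, x> u and the derivative of u. *)
Lemma nrm_position (x0 : Rn) (r : seq (R[i] * Rn)) :
  nrm (fun x => (dot x0 x)%:C%C * trigpoly r x) ^+ 2 <=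
  2 * dot (G *m x0) x0 * nrm (trigpoly r) ^+ 2 + 4 * nrm (trigpoly (trig_deriv (G *m x0) r)) ^+ 2.
Proof.
pose u := trigpoly r; pose D := trigpoly (trig_deriv (G *m x0) r).
pose du i := trigpoly (trig_deriv (delta_mx i 0) r).
have [c Hc] := trigpoly_bounded r; have [c' Hc'] := trigpoly_bounded (trig_deriv (G *m x0) r).
have c0 : 0 <= c by exact: le_trans (sqn_ge0 _) (Hc 0).
have c0' : 0 <= c' by exact: le_trans (sqn_ge0 _) (Hc' 0).
have [mu1 mu2] := trigpoly_cmeasurable r.
have [mD1 mD2] := trigpoly_cmeasurable (trig_deriv (G *m x0) r).
have md := dot_measurable x0.
have msq := sqn_measurable (trigpoly_cmeasurable r).
pose df i x := dot x0 x * (complex.Re (u x) * complex.Re (du i x) + complex.Re (du i x) *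
    complex.Re (u x) +
  (complex.Im (u x) * complex.Im (du i x) + complex.Im (du i x) * complex.Im (u x))) + x0 i 0 *
      sqn (u x).
have Hf : c1all (fun x => dot x0 x * sqn (u x)) df.
  move=> i; have [H1 H2] := cc1_trigpoly i r.
  apply: c1M; first exact: c1_dot.
  rewrite (_ : (fun x => sqn (u x)) = fun x => complex.Re (u x) * complex.Re (u x) + complex.Im
      (u x) * complex.Im (u x)).
    by apply: c1D; apply: c1M.
  by apply/funext => x; rewrite /sqn !expr2.
pose e x := complex.Re (u x) * complex.Re (D x) + complex.Im (u x) * complex.Im (D x).
have Esum x : \sum_i (G *m x0) i 0 * df i x = dot (G *m x0) x0 * sqn (u x) + 2 * (dot x0 x * e x).
  have ERe : complex.Re (D x) = \sum_i (G *m x0) i 0 * complex.Re (du i x).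
    rewrite [D x]trig_deriv_sum Re_sum; apply: eq_bigr => i _.
    by rewrite ReM /= mul0r subr0.
  have EIm : complex.Im (D x) = \sum_i (G *m x0) i 0 * complex.Im (du i x).
    rewrite [D x]trig_deriv_sum Im_sum; apply: eq_bigr => i _.
    by rewrite ImM /= mul0r addr0.
  have dE : dot (G *m x0) x0 = \sum_i (G *m x0) i 0 * x0 i 0 by [].
  rewrite /e ERe EIm dE mulr_suml !mulr_sumr -big_split !mulr_sumr -big_split.
  by apply: eq_bigr => i _; rewrite /df /=; ring.
have me : measurable_fun setT e.
  by apply: measurable_funD; apply: measurable_funM.
have e_le x : `|e x| <= c + c'.
  have h1 := Hc x; have h2 := Hc' x; rewrite /sqn -/u -/D in h1 h2; rewrite /e.
  move: (complex.Re (u x)) (complex.Im (u x)) (complex.Re (D x)) (complex.Im (D x)) h1 h2 => a b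
      a' b' h1 h2.
  have := sqr_ge0 (a - a'); have := sqr_ge0 (b - b').
  have := sqr_ge0 (a + a'); have := sqr_ge0 (b + b').
  have := sqr_ge0 a; have := sqr_ge0 b; have := sqr_ge0 a'; have := sqr_ge0 b'.
  by rewrite !sqrrB !sqrrD ler_norml => *; apply/andP; split; lra.
have I2 := second_moment_bound GT density x0.
have Isq : integrableR (fun x => sqn (u x)).
  apply: (@bounded_integrable _ _ mu _ c) => // x.
  by rewrite ger0_norm ?sqn_ge0.
have Ide : integrableR (fun x => dot x0 x * e x).
  apply: (@integrableR_dom _ _ _ mu _ (fun x => (c + c') * `|dot x0 x|)).
  - exact: measurable_funM.
  - by move=> x; rewrite normrM mulrC ler_wpM2r.
  - by apply: integrableRZ; apply: integrableR_norm; exact: (dot_integrable GT density).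
have Idd : integrableR (fun x => dot x0 x * sqn (u x) * dot x0 x).
  apply: (@integrableR_dom _ _ _ mu _ (fun x => c * dot x0 x ^+ 2)).
  - by apply: measurable_funM => //; exact: measurable_funM.
  - move=> x; rewrite mulrAC -expr2 ger0_norm.
      by rewrite mulrC ler_wpM2r ?sqr_ge0.
    by apply: mulr_ge0; [exact: sqr_ge0|exact: sqn_ge0].
  - exact: integrableRZ.
have IBP := gauss_ibp GT density Hf.
have {}IBP := IBP x0 _ _ Idd.
have E1 : nrm (fun x => (dot x0 x)%:C%C * trigpoly r x) ^+ 2 = \int[mu]_x (dot x0 x * sqn (u x)
    * dot x0 x).
  rewrite nrm_sqr; apply: eq_Rintegral => x _.
  by rewrite sqnM sqn_real -/u; ring.
have Iq : integrableR (fun x => dot (G *m x0) x0 * sqn (u x)) by exact: integrableRZ.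
have I2e : integrableR (fun x => 2 * (dot x0 x * e x)) by exact: integrableRZ.
have ID : integrableR (fun x => sqn (D x)).
  apply: (@bounded_integrable _ _ mu _ c'); first exact: sqn_measurable (trigpoly_cmeasurable _).
  by move=> x; rewrite ger0_norm ?sqn_ge0.
have E2 : \int[mu]_x (dot x0 x * sqn (u x) * dot x0 x) =
    dot (G *m x0) x0 * nrm u ^+ 2 + \int[mu]_x (2 * (dot x0 x * e x)).
  rewrite -IBP.
  - under eq_Rintegral do rewrite Esum.
    by rewrite RintegralD// RintegralZl// nrm_sqr.
  - apply: (@integrableR_dom _ _ _ mu _ (fun x => c * `|dot x0 x|)).
    + exact: measurable_funM.
    + by move=> x; rewrite normrM mulrC (ger0_norm (sqn_ge0 _)) ler_wpM2r.
    + by apply: integrableRZ; apply: integrableR_norm; exact: (dot_integrable GT density).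
  - by under eq_fun do rewrite Esum; exact: integrableRD.
(* Young's inequality splits the cross term so that half of the left-hand side is absorbed, whence
   the constants 2 and 4. *)
have E3 : \int[mu]_x (2 * (dot x0 x * e x)) <=
    2^-1 * \int[mu]_x (dot x0 x * sqn (u x) * dot x0 x) + 2 * nrm D ^+ 2.
  rewrite nrm_sqr -!RintegralZl// -RintegralD//; try exact: integrableRZ.
  apply: le_RintegralT => //; first by apply: integrableRD; exact: integrableRZ.
  move=> x; rewrite /e /sqn.
  move: (dot x0 x) (complex.Re (u x)) (complex.Im (u x)) (complex.Re (D x)) (complex.Im (D x))
      => d a b a' b'.
  have := sqr_ge0 (d * a - 2 * a'); have := sqr_ge0 (d * b - 2 * b'); nra.
rewrite E1; move: E2 E3; rewrite -/u -/D.
move: (\int[mu]_x _) (\int[mu]_x _) (nrm u ^+ 2) (nrm D ^+ 2) => a b a' b'; lra.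
Qed.

End gaussian_position.

Lemma combination_bound (R : realType) (S a b p q u v r : R) : 0 <= a -> 0 <= b ->
  `|p| <= S -> `|q| <= S -> `|u * r| <= a -> `|v * r| <= b ->
  `|(p * u - q * v) * r| <= (a + b) * S /\ `|(p * v + q * u) * r| <= (a + b) * S.
Proof.
move=> a0 b0 pS qS ua vb; rewrite !mulrDl mulNr -!mulrA; split.
  apply: le_trans (ler_normB _ _) _; rewrite !normrM; apply: lerD.
    by rewrite [leRHS]mulrC; apply: ler_pM; rewrite -?normrM.
  by rewrite [leRHS]mulrC; apply: ler_pM; rewrite -?normrM.
apply: le_trans (ler_normD _ _) _; rewrite !normrM addrC; apply: lerD.
  by rewrite [leRHS]mulrC; apply: ler_pM; rewrite -?normrM.
by rewrite [leRHS]mulrC; apply: ler_pM; rewrite -?normrM.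
Qed.

Lemma ReZ (R : realType) (a : R) (z : R[i]) : complex.Re (a%:C%C * z) = a * complex.Re z.
Proof. by rewrite ReM /= mul0r subr0. Qed.

Lemma ImZ (R : realType) (a : R) (z : R[i]) : complex.Im (a%:C%C * z) = a * complex.Im z.
Proof. by rewrite ImM /= mul0r addr0. Qed.

(** * Passage to the limit *)

Section pairing.
Context {R : realType} {n : nat}.
Local Notation Rn := 'cV[R]_n.
Variables (G : 'M[R]_n) (mu : probability Rn R).
Hypothesis GT : G^T = G.
Hypothesis density : forall A, measurable A ->
  mu A = (\int[@lebesgue_Rn R n]_(x in A) (gauss_density G x)%:E)%E.
Local Notation rho := (gauss_density G).
Local Notation nrm := (nrm mu).
Local Notation L2 := (L2 mu).
Local Notation integrableR f := (mu.-integrable setT (EFin \o f)).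
Implicit Types (f g psi : Rn -> R[i]) (x : Rn).

Definition admissible psi := ccontinuous psi /\ cbounded_supp psi.

Lemma rho_gt0 x : 0 < rho x.
Proof. exact: (gauss_density_gt0 density). Qed.

(** Distributions are paired with respect to Lebesgue measure and norms are Gaussian. On a bounded
    set the density is bounded away from 0, so the quotient is a bounded weight. *)
Lemma admissible_div (h : Rn -> R) : continuous h -> bounded_supp h ->
  exists2 c : R, 0 <= c & forall x, `|h x / rho x| <= c.
Proof.
move=> ch sh.
have cq : continuous (fun x => h x * (rho x)^-1).
  move=> x; apply: (@continuousM _ _ h (fun x => (rho x)^-1)); first exact: ch.
  apply: (@continuousV _ _ rho); first by rewrite gt_eqF// rho_gt0.
  exact: (gauss_density_continuous GT).
have [c Hc] := bounded_supp_bounded cq (bounded_suppMl _ sh).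
by exists `|c| => // x; apply: le_trans (Hc x) (ler_norm _).
Qed.

Definition pair_Re f psi x : R := complex.Re (f x * psi x) / rho x.
Definition pair_Im f psi x : R := complex.Im (f x * psi x) / rho x.

Lemma pair_bounds psi : admissible psi -> exists2 c : R, 0 <= c & forall f x,
  `|pair_Re f psi x| <= c * Num.sqrt (sqn (f x)) /\
  `|pair_Im f psi x| <= c * Num.sqrt (sqn (f x)).
Proof.
move=> [[c1 c2] [s1 s2]].
have [a a0 Ha] := admissible_div c1 s1; have [b b0 Hb] := admissible_div c2 s2.
exists (a + b) => [|f x]; first exact: addr_ge0.
have h1 := Re_le_sqn (f x); have h2 := Im_le_sqn (f x).
rewrite /pair_Re /pair_Im ReM ImM.
exact: combination_bound (Ha x) (Hb x).
Qed.

Lemma pair_measurable f psi : cmeasurable f -> admissible psi ->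
  measurable_fun setT (pair_Re f psi) /\ measurable_fun setT (pair_Im f psi).
Proof.
move=> mf [[c1 c2] _].
have mpsi : cmeasurable psi by split; exact: continuous_Rn_measurable.
have [m1 m2] := cmeasurableM mf mpsi.
have mr : measurable_fun setT (fun x => (rho x)^-1).
  apply: continuous_Rn_measurable => x; apply: (@continuousV _ _ rho).
    by rewrite gt_eqF// rho_gt0.
  exact: (gauss_density_continuous GT).
by split; apply: measurable_funM.
Qed.

Lemma pair_integrable f psi : L2 f -> admissible psi ->
  integrableR (pair_Re f psi) /\ integrableR (pair_Im f psi).
Proof.
move=> Lf apsi; have [m1 m2] := pair_measurable (L2_cmeasurable Lf) apsi.
have [c c0 Hc] := pair_bounds apsi.
have I := integrableRZ c (sqrt_sqn_integrable Lf).
by split; apply: (integrableR_dom _ _ I) => // x; have [] := Hc f x.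
Qed.

Lemma of_funE f psi : L2 f -> admissible psi ->
  of_fun f psi = (\int[mu]_x pair_Re f psi x +i* \int[mu]_x pair_Im f psi x)%C.
Proof.
move=> Lf apsi; have [I1 I2] := pair_integrable Lf apsi.
rewrite /of_fun /Rintegral (integral_gauss GT density I1) (integral_gauss GT density I2).
congr (fine _ +i* fine _)%C; apply: eq_integral => x _.
  by rewrite /pair_Re divfK// gt_eqF// rho_gt0.
by rewrite /pair_Im divfK// gt_eqF// rho_gt0.
Qed.

Lemma of_fun_bound psi : admissible psi -> exists2 c : R, 0 <= c & forall f, L2 f ->
  `|complex.Re (of_fun f psi)| <= c * nrm f /\ `|complex.Im (of_fun f psi)| <= c * nrm f.
Proof.
move=> apsi; have [c c0 Hc] := pair_bounds apsi; exists c => // f Lf.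
have [I1 I2] := pair_integrable Lf apsi.
have I := sqrt_sqn_integrable Lf.
have B : c * \int[mu]_x Num.sqrt (sqn (f x)) <= c * nrm f.
  by rewrite ler_wpM2l// int_sqrt_sqn_le.
rewrite of_funE//=; split; apply: le_trans B; rewrite -RintegralZl//.
  apply: le_trans (le_normr_Rintegral _ _) _ => //.
  apply: le_RintegralT; [exact: integrableR_norm|exact: integrableRZ|].
  by move=> x; have [] := Hc f x.
apply: le_trans (le_normr_Rintegral _ _) _ => //.
apply: le_RintegralT; [exact: integrableR_norm|exact: integrableRZ|].
by move=> x; have [] := Hc f x.
Qed.

Lemma of_fun_L2B f g psi : L2 f -> L2 g -> admissible psi ->
  of_fun f psi - of_fun g psi = of_fun (fun x => f x - g x) psi.
Proof.
move=> Lf Lg apsi; rewrite !of_funE//; last exact: L2B.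
have [I1 I2] := pair_integrable Lf apsi; have [I3 I4] := pair_integrable Lg apsi.
apply: complex_eq; rewrite !(ReD, ImD, ReN, ImN) /= -RintegralB//; apply: eq_Rintegral => x _.
  by rewrite /pair_Re mulrBl ReD ReN mulrBl.
by rewrite /pair_Im mulrBl ImD ImN mulrBl.
Qed.

Lemma of_fun_L2Z (c : R[i]) f psi : L2 f -> admissible psi ->
  of_fun (fun x => c * f x) psi = c * of_fun f psi.
Proof.
move=> Lf apsi; rewrite !of_funE//; last exact: L2Z.
have [I1 I2] := pair_integrable Lf apsi.
apply: complex_eq; rewrite !(ReM, ImM) /= -!RintegralZl//.
  rewrite -RintegralB//; [|exact: integrableRZ|exact: integrableRZ].
  by apply: eq_Rintegral => x _; rewrite /pair_Re /pair_Im -mulrA ReM; ring.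
rewrite -RintegralD//; [|exact: integrableRZ|exact: integrableRZ].
by apply: eq_Rintegral => x _; rewrite /pair_Re /pair_Im -mulrA ImM; ring.
Qed.

Lemma of_fun_sum_test f (xi : Rn) (psi : 'I_n -> Rn -> R[i]) : L2 f ->
  (forall j, admissible (psi j)) ->
  of_fun f (fun x => \sum_j (xi j 0)%:C%C * psi j x) = \sum_j (xi j 0)%:C%C * of_fun f (psi j).
Proof.
move=> Lf ap.
have cs : ccontinuous (fun x => \sum_j (xi j 0)%:C%C * psi j x) /\
    cbounded_supp (fun x => \sum_j (xi j 0)%:C%C * psi j x).
  elim: (index_enum 'I_n) => [|j r [IH1 IH2]].
    under eq_fun do rewrite big_nil; split; first exact: ccontinuous_cst.
    by split; exists 0.
  have [c1 b1] := ap j.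
  under eq_fun do rewrite big_cons; split.
    by apply: ccontinuousD => //; apply: ccontinuousM => //; exact: ccontinuous_cst.
  have [b2 b3] := cbounded_suppMr (fun=> (xi j 0)%:C%C) b1; have [b4 b5] := IH2.
  split; [under eq_fun do rewrite ReD|under eq_fun do rewrite ImD]; exact: bounded_suppD.
rewrite of_funE//.
have I j := pair_integrable Lf (ap j).
have R1 j : \int[mu]_x pair_Re f (psi j) x = complex.Re (of_fun f (psi j)) by rewrite of_funE.
have R2 j : \int[mu]_x pair_Im f (psi j) x = complex.Im (of_fun f (psi j)) by rewrite of_funE.
apply: complex_eq; [rewrite [RHS]Re_sum|rewrite [RHS]Im_sum].
  rewrite -[LHS]/(\int[mu]_x pair_Re f (fun x => \sum_j (xi j 0)%:C%C * psi j x) x).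
  rewrite (@eq_Rintegral _ _ _ _ _ (fun x => \sum_j xi j 0 * pair_Re f (psi j) x)).
    rewrite RintegralR_sum => [|j]; last by apply: integrableRZ; have [] := I j.
    apply: eq_bigr => j _; rewrite RintegralZl//; last by have [] := I j.
    by rewrite R1 [RHS]ReM mul0r subr0.
  move=> x _; rewrite /pair_Re mulr_sumr Re_sum mulr_suml; apply: eq_bigr => j _.
  by rewrite mulrCA ReZ mulrA.
rewrite -[LHS]/(\int[mu]_x pair_Im f (fun x => \sum_j (xi j 0)%:C%C * psi j x) x).
rewrite (@eq_Rintegral _ _ _ _ _ (fun x => \sum_j xi j 0 * pair_Im f (psi j) x)).
  rewrite RintegralR_sum => [|j]; last by apply: integrableRZ; have [] := I j.
  apply: eq_bigr => j _; rewrite RintegralZl//; last by have [] := I j.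
  by rewrite R2 [RHS]ImM mul0r addr0.
move=> x _; rewrite /pair_Im mulr_sumr Im_sum mulr_suml; apply: eq_bigr => j _.
by rewrite mulrCA ImZ mulrA.
Qed.

(** The distributional derivative is closed: the pairing with a fixed test function, or with its
    derivative, is continuous for the L^2 norm. *)
Lemma dir_D_limit (xi : Rn) f g (r : nat -> seq (R[i] * Rn)) : L2 f -> L2 g ->
  (forall e, 0 < e -> exists N, forall k, (N <= k)%N ->
    nrm (fun x => trigpoly (r k) x - f x) <= e) ->
  (forall e, 0 < e -> exists N, forall k, (N <= k)%N ->
    nrm (fun x => trigpoly (trig_deriv xi (r k)) x - g x) <= e) ->
  eq_distr setT (dir_D xi (of_fun f)) (of_fun (fun x => ('i^-1)%C * g x)).
Proof.
move=> Lf Lg Hf Hg phi Tphi; have [Sphi _] := Tphi.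
have sphi := test_fun_cbounded_supp Tphi.
have H1 j := smooth_cc1 j [::] Sphi; rewrite /= in H1.
have cphi : ccontinuous phi.
  by split=> x; have [] := Sphi [::] x I.
have aphi : admissible phi by [].
have adphi j : admissible (pderiv j phi).
  split; last exact: cc1_cbounded_supp (H1 j) sphi.
  by have [] := cc1_ccontinuous (H1 j).
pose Dphi x := \sum_j (xi j 0)%:C%C * pderiv j phi x.
have iV : ('i^-1)%C = - 'i%C :> R[i].
  by apply: complex_eq; rewrite /= ?expr0n ?expr1n ?add0r ?divr1 ?oppr0 ?mul0r.
have E h : L2 h -> of_fun h Dphi = \sum_j (xi j 0)%:C%C * of_fun h (pderiv j phi).
  by move=> Lh; exact: of_fun_sum_test.
have aD : admissible Dphi.
  split.
    rewrite /Dphi; elim: (index_enum 'I_n) => [|j r' IH].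
      by under eq_fun do rewrite big_nil; exact: ccontinuous_cst.
    under eq_fun do rewrite big_cons; apply: ccontinuousD => //.
    by apply: ccontinuousM; [exact: ccontinuous_cst|have [] := adphi j].
  rewrite /Dphi; elim: (index_enum 'I_n) => [|j r' IH].
    by under eq_fun do rewrite big_nil; split; exists 0.
  have [b2 b3] := cbounded_suppMr (fun=> (xi j 0)%:C%C) (proj2 (adphi j)).
  have [b4 b5] := IH; under eq_fun do rewrite big_cons.
  by split; [under eq_fun do rewrite ReD|under eq_fun do rewrite ImD]; exact: bounded_suppD.
(* The weak form of the claim. It holds exactly for the approximating polynomials, and the two
   pairings pass to the limit. *)
suff Z : of_fun f Dphi + of_fun g phi = 0.
  rewrite of_fun_L2Z// -[of_fun g phi](addKr (of_fun f Dphi)) Z addr0.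
  rewrite E// mulrN mulr_sumr -sumrN; apply: eq_bigr => j _.
  by rewrite /ddiff mulrN mulrN mulrCA.
have Zk k : of_fun (trigpoly (r k)) Dphi + of_fun (trigpoly (trig_deriv xi (r k))) phi = 0.
  rewrite E; last exact: trigpoly_L2.
  have -> : trigpoly (trig_deriv xi (r k)) = fun x => \sum_i (xi i 0)%:C%C * trigpoly
      (trig_deriv (delta_mx i 0) (r k)) x.
    by apply/funext => x; exact: trig_deriv_sum.
  have ct i := ccontinuous_trigpoly (trig_deriv (delta_mx i 0) (r k)) : ccontinuous _.
  rewrite of_fun_sum//; last first.
    by move=> i; apply: ccontinuousM => //; exact: ccontinuous_cst.
  rewrite -big_split big1// => j _ /=.
  rewrite of_funZ// (of_fun_ibp (cc1_trigpoly j (r k)) (H1 j))//.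
  by rewrite mulrN addNr.
have [c1 c10 Hc1] := of_fun_bound aD; have [c2 c20 Hc2] := of_fun_bound aphi.
have key e : 0 < e -> `|complex.Re (of_fun f Dphi + of_fun g phi)| <= e /\
    `|complex.Im (of_fun f Dphi + of_fun g phi)| <= e.
  move=> e0; have cc : 0 < c1 + c2 + 1 by rewrite ltr_wpDl ?addr_ge0.
  pose e' := e / (c1 + c2 + 1); have e'0 : 0 < e' by rewrite divr_gt0.
  have [N1 HN1] := Hf _ e'0; have [N2 HN2] := Hg _ e'0.
  have {HN1} h1 := HN1 _ (leq_maxl N1 N2); have {HN2} h2 := HN2 _ (leq_maxr N1 N2).
  set k := maxn N1 N2 in h1 h2; rewrite nrmB_sym in h1; rewrite nrmB_sym in h2.
  have Lk := trigpoly_L2 mu (r k); have Lk' := trigpoly_L2 mu (trig_deriv xi (r k)).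
  have -> : of_fun f Dphi + of_fun g phi =
      of_fun (fun x => f x - trigpoly (r k) x) Dphi +
      of_fun (fun x => g x - trigpoly (trig_deriv xi (r k)) x) phi.
    by rewrite -!of_fun_L2B// addrACA -opprD Zk subr0.
  have [a1 a2] := Hc1 _ (L2B Lf Lk); have [b1 b2] := Hc2 _ (L2B Lg Lk').
  have ee : c1 * e' + c2 * e' <= e.
    rewrite -mulrDl /e' mulrCA ler_piMr ?(ltW e0)// ler_pdivrMr// mul1r lerDl.
    by [].
  have B1 := ler_wpM2l c10 h1; have B2 := ler_wpM2l c20 h2.
  rewrite ReD ImD; split.
    apply: le_trans (ler_normD _ _) _; apply: le_trans ee.
    by apply: lerD; [exact: le_trans a1 B1|exact: le_trans b1 B2].
  apply: le_trans (ler_normD _ _) _; apply: le_trans ee.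
  by apply: lerD; [exact: le_trans a2 B1|exact: le_trans b2 B2].
have zero (a : R) : (forall e, 0 < e -> `|a| <= e) -> a = 0.
  move=> H; apply/eqP; rewrite -normr_le0; apply/ler_addgt0Pr => e e0.
  by rewrite add0r H.
by apply: complex_eq; apply: zero => e /key[].
Qed.

End pairing.

Lemma evolve_coefficient (R : realType) (c W : R[i]) (a l : R) :
  c * (1 * a)%:C%C * ('i * l%:C)%C * W = 'i%C * (c * (l * a)%:C%C * W).
Proof. by apply: complex_eq; rewrite !(ReM, ImM) /=; ring. Qed.

Lemma cons_identity (R : realType) (c u s e W : R[i]) (a : R) :
  c * u + s - (c * (1 * a)%:C%C * W + e) = c * (u - a%:C%C * W) + (s - e).
Proof. by rewrite mul1r mulrBr opprD addrACA mulrA. Qed.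

(** * Extension from trigonometric polynomials to L^2 *)

Section smoothing.
Context {R : realType} {n : nat}.
Local Notation Rn := 'cV[R]_n.
Variables (S B G : 'M[R]_n) (mu : probability Rn R).
Variable T : R -> (Rn -> R[i]) -> (Rn -> R[i]).
Hypotheses (ST : S^T = S) (GT : G^T = G).
Hypothesis lyap : B *m G + G *m B^T = - (S *m S).
Hypothesis density : forall A, measurable A ->
  mu A = (\int[@lebesgue_Rn R n]_(x in A) (gauss_density G x)%:E)%E.
Hypothesis gen : semigroup_generated_by mu (OU_operator (S *m S) B) T.
Local Notation nrm := (nrm mu).
Local Notation L2 := (L2 mu).
Local Notation CT := (proj1 gen).
Implicit Types (x : Rn) (t : R) (r : seq (R[i] * Rn)).

(** The factor 1 is the weight of [weighted_waves] for the undifferentiated solution. *)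
Definition evolve r t : seq (R[i] * Rn) :=
  [seq (p.1 * (1 * damping B G p.2 t)%:C%C, orbit B p.2 t) | p <- r].

Lemma trigpoly_evolve r t : trigpoly (evolve r t) = weighted_waves B G (fun=> 1) r t.
Proof. by apply/funext => x; rewrite /trigpoly big_map. Qed.

Lemma trig_deriv_evolve xi r t x : trigpoly (trig_deriv xi (evolve r t)) x =
  'i%C * weighted_waves B G (fun eta => dot xi (orbit B eta t)) r t x.
Proof.
rewrite /trigpoly !big_map /weighted_waves mulr_sumr; apply: eq_bigr => p _ /=.
exact: evolve_coefficient.
Qed.

Lemma evolve_cat r1 r2 t : evolve (r1 ++ r2) t = evolve r1 t ++ evolve r2 t.
Proof. exact: map_cat. Qed.

Lemma trig_deriv_cat xi r1 r2 : trig_deriv xi (r1 ++ r2) = trig_deriv xi r1 ++ trig_deriv xi r2.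
Proof. exact: map_cat. Qed.

Lemma evolve_scale c r t : evolve (trig_scale c r) t = trig_scale c (evolve r t).
Proof. by rewrite /evolve /trig_scale -!map_comp; apply: eq_map => p /=; rewrite mulrA. Qed.

Lemma trig_deriv_scale xi c r : trig_deriv xi (trig_scale c r) = trig_scale c (trig_deriv xi r).
Proof. by rewrite /trig_deriv /trig_scale -!map_comp; apply: eq_map => p /=; rewrite -mulrA. Qed.

Lemma semigroup_trigpoly r t : 0 <= t ->
  nrm (fun x => T t (trigpoly r) x - trigpoly (evolve r t) x) = 0.
Proof.
move=> t0; have LT f : L2 f -> L2 (T t f) by exact: (sg_L2 CT).
elim: r => [|p r IH].
  have L0 : L2 (fun=> 0) := L2_cst mu 0.
  have E0 : trigpoly [::] = (fun=> 0) :> (Rn -> R[i]).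
    by apply/funext => x; rewrite trigpoly_nil.
  rewrite E0 (@nrm_eq _ _ _ _ (T t (fun=> 0))) => [|x]; last by rewrite subr0.
  have [M M0 HM] := sg_bound CT t0; apply/eqP; rewrite eq_le nrm_ge0 andbT.
  by apply: le_trans (HM _ L0) _; rewrite nrm0 mulr0.
have Lw := wave_L2 mu p.2; have Lr := trigpoly_L2 mu r.
have Ld : L2 (damped_wave B G p.2 t) by exact: damped_wave_L2.
have E : trigpoly (p :: r) = (fun x => p.1 * wave p.2 x + trigpoly r x).
  by apply/funext => x; rewrite trigpoly_cons.
have LB1 := L2B (LT _ Lw) Ld; have LB2 := L2B (LT _ Lr) (trigpoly_L2 mu (evolve r t)).
have -> : nrm (fun x => T t (trigpoly (p :: r)) x - trigpoly (evolve (p :: r) t) x) =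
    nrm (fun x => p.1 * (T t (wave p.2) x - damped_wave B G p.2 t x) +
      (T t (trigpoly r) x - trigpoly (evolve r t) x)).
  rewrite E; apply: nrm_ae.
  - by apply: L2B; [apply: LT; apply: L2D => //; exact: L2Z|exact: trigpoly_L2].
  - by apply: L2D => //; exact: L2Z.
  apply: filterS (semigroup_linear CT p.1 t0 Lw Lr) => x ->.
  by rewrite [trigpoly (evolve (p :: r) t) x]trigpoly_cons /=; exact: cons_identity.
apply/eqP; rewrite eq_le nrm_ge0 andbT; apply: le_trans (nrmD (L2Z _ LB1) LB2) _.
by rewrite nrmZ// (semigroup_wave ST GT lyap density gen) // IH mulr0 addr0.
Qed.

Lemma approximation v : L2 v -> exists r : nat -> seq (R[i] * Rn),
  forall k, nrm (fun x => trigpoly (r k) x - v x) <= k.+1%:R^-1.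
Proof.
move=> Lv; have /choice[r Hr] (k : nat) : exists r, nrm (fun x => trigpoly r x - v x) <= k.+1%:R^-1.
  have k0 : 0 < k.+1%:R^-1 :> R by rewrite invr_gt0.
  by have [r Hr] := trigpoly_dense Lv k0; exists r; rewrite nrmB_sym.
by exists r.
Qed.

Lemma harmonic_small (c e : R) : 0 <= c -> 0 < e ->
  exists N, forall k, (N <= k)%N -> c * k.+1%:R^-1 <= e.
Proof.
move=> c0 e0; have H : (fun k => c * k.+1%:R^-1) @ \oo --> (0 : R).
  by rewrite -(mulr0 c); apply: cvgMr; exact: cvg_harmonic.
have /cvgr0Pnorm_le/(_ e e0)[N _ HN] := H; exists N => k Nk.
by apply: le_trans (HN k Nk); exact: ler_norm.
Qed.

Section fixed_time.
Variables (t : R) (t0 : 0 <= t) (v : Rn -> R[i]) (Lv : L2 v).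
Variables (r : nat -> seq (R[i] * Rn)).
Hypothesis rv : forall k, nrm (fun x => trigpoly (r k) x - v x) <= k.+1%:R^-1.

Lemma nrm_approx k : nrm (trigpoly (r k)) <= nrm v + k.+1%:R^-1.
Proof.
apply: le_trans (nrm_le_add (trigpoly_L2 mu (r k)) Lv) _.
by rewrite lerD2l.
Qed.

Lemma evolve_cvg : exists2 K : R, 0 <= K & forall k,
  nrm (fun x => trigpoly (evolve (r k) t) x - T t v x) <= K * k.+1%:R^-1.
Proof.
have [K K0 HK] := sg_bound CT t0; exists K => // k.
have Lk := trigpoly_L2 mu (r k); have Le := trigpoly_L2 mu (evolve (r k) t).
have LT f : L2 f -> L2 (T t f) by exact: (sg_L2 CT).
apply: le_trans (nrm_tri Le (LT _ Lk) (LT _ Lv)) _.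
rewrite nrmB_sym semigroup_trigpoly// add0r (nrm_sgB CT)//.
by apply: le_trans (HK _ (L2B Lk Lv)) _; rewrite ler_wpM2l.
Qed.

Lemma nrm_evolve_deriv xi (M : R) (w : seq (R[i] * Rn)) : 0 <= M ->
  (forall eta, dot xi (orbit B eta t) ^+ 2 <= M ^+ 2 * (energy B G eta 0 - energy B G eta t)) ->
  nrm (trigpoly (trig_deriv xi (evolve w t))) <= M * nrm (trigpoly w).
Proof.
move=> M0 HM; apply: le_trans (trig_smoothing ST GT lyap density w t0 M0 HM).
rewrite (@nrm_eq _ _ _ _ (fun x => 'i%C * weighted_waves B G (fun eta => dot xi (orbit B eta t))
    w t x)).
  rewrite nrmZ; last first.
    rewrite (_ : weighted_waves _ _ _ _ _ = trigpoly
        [seq (p.1 * (dot xi (orbit B p.2 t) * damping B G p.2 t)%:C%C, orbit B p.2 t) | p <- w]).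
      exact: trigpoly_L2.
    by apply/funext => x; rewrite /trigpoly big_map.
  by rewrite /sqn /= expr0n expr1n add0r sqrtr1 mul1r.
by move=> x; exact: trig_deriv_evolve.
Qed.

(** By linearity the estimate applies to differences of approximants, so their derivatives form a
    Cauchy sequence; closedness of the derivative identifies the limit, and the bound on norms
    passes to it. *)
Lemma derivative_estimate xi (M : R) : 0 <= M ->
  (forall eta, dot xi (orbit B eta t) ^+ 2 <= M ^+ 2 * (energy B G eta 0 - energy B G eta t)) ->
  (distr_L2norm mu (dir_D xi (of_fun (T t v))) <= (M * nrm v)%:E)%E.
Proof.
move=> M0 HM.
pose w k := trigpoly (trig_deriv xi (evolve (r k) t)).
have Lw k : L2 (w k) by exact: trigpoly_L2.
have wB k l : nrm (fun x => w k x - w l x) <= M * (k.+1%:R^-1 + l.+1%:R^-1).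
  (* The difference of two approximants written as a single polynomial. *)
  pose q := r k ++ trig_scale (-1) (r l).
  rewrite (@nrm_eq _ _ _ _ (trigpoly (trig_deriv xi (evolve q t)))); last first.
    move=> x; rewrite /q evolve_cat trig_deriv_cat trigpoly_cat.
    by rewrite evolve_scale trig_deriv_scale trigpoly_scale mulN1r.
  apply: le_trans (nrm_evolve_deriv q M0 HM) _; rewrite ler_wpM2l//.
  rewrite (@nrm_eq _ _ _ _ (fun x => trigpoly (r k) x - trigpoly (r l) x)); last first.
    by move=> x; rewrite /q trigpoly_cat trigpoly_scale mulN1r.
  apply: le_trans (nrm_tri (trigpoly_L2 mu (r k)) Lv (trigpoly_L2 mu (r l))) _.
  by apply: lerD => //; rewrite nrmB_sym.
have [g Lg Hg] : exists2 g, L2 g & forall e, 0 < e -> exists N, forall k, (N <= k)%N ->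
    nrm (fun x => w k x - g x) <= e.
  apply: L2_complete => // e e0.
  have [N HN] := harmonic_small (mulr_ge0 M0 (ler0n R 2)) e0; exists N => k l Nk Nl.
  apply: le_trans (wB k l) _; have := HN _ Nk; have := HN _ Nl; rewrite -!mulrA.
  by move: (k.+1%:R^-1) (l.+1%:R^-1) => a b; lra.
have gM : nrm g <= M * nrm v.
  apply/ler_addgt0Pr => e e0; have e2 : 0 < e / 2 by rewrite divr_gt0.
  have [N1 H1] := Hg _ e2; have [N2 H2] := harmonic_small M0 e2.
  have {}H1 := H1 _ (leq_maxl N1 N2); have {}H2 := H2 _ (leq_maxr N1 N2).
  set k := maxn N1 N2 in H1 H2; rewrite nrmB_sym in H1.
  apply: le_trans (nrm_le_add Lg (Lw k)) _.
  have H3 := nrm_evolve_deriv (r k) M0 HM.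
  have H4 := ler_wpM2l M0 (nrm_approx k); rewrite mulrDr in H4.
  have H5 := le_trans H3 H4.
  apply: le_trans (lerD H5 H1) _; rewrite -addrA lerD2l.
  by rewrite [leRHS]splitr lerD2r.
have [K K0 HK] := evolve_cvg.
have LTv : L2 (T t v) by exact: (sg_L2 CT).
have D := @dir_D_limit _ _ _ _ GT density xi _ _ (fun k => evolve (r k) t) LTv Lg _ Hg.
have iV : Num.sqrt (sqn ('i^-1)%C) = 1 :> R.
  have i0 : 'i%C != 0 :> R[i].
    by apply/eqP => /(congr1 (@complex.Im R)) /= /eqP; rewrite oner_eq0.
  have E : 'i%C * ('i^-1)%C = 1 :> R[i] by exact: mulfV.
  have si : sqn ('i%C : R[i]) = 1 by rewrite /sqn /= expr0n expr1n add0r.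
  have s1 : sqn (1 : R[i]) = 1 by rewrite /sqn /= expr0n expr1n addr0.
  by have := sqnM ('i%C : R[i]) ('i^-1)%C; rewrite E si s1 mul1r => <-; rewrite sqrtr1.
apply: (@le_trans _ _ (L2norm mu (fun x => (('i^-1)%C * g x)%R))).
  apply: ereal_inf_lbound; exists (fun x => ('i^-1)%C * g x) => //; split; first exact: L2Z.
  apply: D => e e0; have [N HN] := harmonic_small K0 e0; exists N => k Nk.
  exact: le_trans (HK k) (HN k Nk).
rewrite L2norm_nrm; last exact: L2Z.
by rewrite lee_fin nrmZ// iV mul1r.
Qed.

(** Multiplication by <x0, x> is unbounded on L^2. The weight is truncated first, which makes the
    passage from polynomials to [T t v] continuous, and Fatou removes the truncation. *)
Lemma position_estimate (x0 : Rn) (M : R) : 0 <= M ->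
  (forall eta, dot (G *m x0) (orbit B eta t) ^+ 2 <= M ^+ 2 * (energy B G eta 0 - energy B G eta
      t)) ->
  (L2norm mu (fun x => ((dot x0 x)%:C%C * T t v x)%R) <=
    (Num.sqrt (2 * dot (G *m x0) x0 + 4 * M ^+ 2) * nrm v)%:E)%E.
Proof.
move=> M0 HM; set N := Num.sqrt _.
have q0 := gauss_psd GT density x0.
have N0 : 0 <= N by exact: sqrtr_ge0.
have N2 : N ^+ 2 = 2 * dot (G *m x0) x0 + 4 * M ^+ 2.
  by rewrite sqr_sqrtr// addr_ge0// mulr_ge0// sqr_ge0.
have LTv : L2 (T t v) by exact: (sg_L2 CT).
have Hk k : nrm (fun x => (dot x0 x)%:C%C * trigpoly (evolve (r k) t) x) <= N * nrm (trigpoly (r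
    k)).
  apply: le_of_sqr; [exact: nrm_ge0|exact: mulr_ge0 N0 (nrm_ge0 _ _)|].
  apply: le_trans (nrm_position GT density x0 (evolve (r k) t)) _.
  rewrite exprMn N2 [leRHS]mulrDl; apply: lerD.
    rewrite ler_wpM2l ?mulr_ge0// ler_pXn2r ?nnegrE ?nrm_ge0// trigpoly_evolve.
    exact: (trig_contraction ST GT lyap density).
  rewrite -mulrA ler_wpM2l// -exprMn ler_pXn2r ?nnegrE ?nrm_ge0 ?mulr_ge0 ?nrm_ge0//.
  exact: nrm_evolve_deriv.
(* Truncating the modulus suffices, since only the size of the weight enters the norm. *)
pose h (m : nat) x : R := Num.min `|dot x0 x| m%:R.
have h0 m x : 0 <= h m x by rewrite le_min normr_ge0 ler0n.
have mh m : measurable_fun setT (h m).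
  apply: measurable_minr => //; apply: measurableT_comp => //; exact: dot_measurable.
have hm m x : `|h m x| <= m%:R by rewrite ger0_norm// ge_min lexx orbT.
have hd m x : (h m x) ^+ 2 <= dot x0 x ^+ 2.
  by rewrite -[leRHS](real_normK (num_real _)) ler_pXn2r ?nnegrE// ge_min lexx.
have Lh m f : L2 f -> L2 (fun x => (h m x)%:C%C * f x).
  by apply: L2_bddM; [exact: cmeasurable_real|exact: bounded_sqn (hm m)].
have Ldot k : L2 (fun x => (dot x0 x)%:C%C * trigpoly (evolve (r k) t) x).
  have [c Hc] := trigpoly_bounded (evolve (r k) t).
  apply: (@L2_dominated _ _ mu _ (fun x => c * dot x0 x ^+ 2)).
  - apply: cmeasurableM; last exact: trigpoly_cmeasurable.
    by apply: cmeasurable_real; exact: dot_measurable.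
  - by move=> x; rewrite sqnM sqn_real mulrC ler_wpM2r ?sqr_ge0.
  - by apply: integrableRZ; exact: (second_moment_bound GT density).
have [K K0 HK] := evolve_cvg.
have Hm m : nrm (fun x => (h m x)%:C%C * T t v x) <= N * nrm v.
  apply/ler_addgt0Pr => e e0.
  have c0 : 0 <= N + m%:R * K by rewrite addr_ge0// mulr_ge0.
  have [k0 Hk0] := harmonic_small c0 e0; have {}Hk0 := Hk0 _ (leqnn k0).
  pose u := trigpoly (evolve (r k0) t); have Lu : L2 u := trigpoly_L2 mu _.
  apply: le_trans (nrm_le_add (Lh m _ LTv) (Lh m _ Lu)) _.
  have B1 : nrm (fun x => (h m x)%:C%C * u x) <= N * nrm v + N * k0.+1%:R^-1.
    apply: (@le_trans _ _ (nrm (fun x => (dot x0 x)%:C%C * u x))).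
      rewrite -[leRHS]mul1r; apply: nrm_le_sqr => //; [exact: Lh|exact: Ldot|].
      by move=> x; rewrite expr1n mul1r !sqnM !sqn_real ler_wpM2r ?sqn_ge0.
    apply: le_trans (Hk k0) _; rewrite -mulrDr ler_wpM2l//; exact: nrm_approx.
  have B2 : nrm (fun x => (h m x)%:C%C * T t v x - (h m x)%:C%C * u x) <= m%:R * (K * k0.+1%:R^-1).
    rewrite (@nrm_eq _ _ _ _ (fun x => (h m x)%:C%C * (T t v x - u x))) => [|x]; last by rewrite
        mulrBr.
    apply: (@le_trans _ _ (m%:R * nrm (fun x => T t v x - u x))).
      apply: nrm_le_sqr => //; [by apply: Lh; exact: L2B|exact: L2B|].
      by move=> x; rewrite sqnM ler_wpM2r ?sqn_ge0// (bounded_sqn (hm m)).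
    by rewrite ler_wpM2l// nrmB_sym; exact: HK.
  apply: le_trans (lerD B1 B2) _; rewrite -addrA lerD2l.
  by rewrite (mulrA m%:R) -mulrDl.
have F : (\int[mu]_x (dot x0 x ^+ 2 * sqn (T t v x))%:E <= ((N * nrm v) ^+ 2)%:E)%E.
  have ms := sqn_measurable (L2_cmeasurable LTv).
  apply: (@fatou_bound _ _ _ mu (fun m x => h m x ^+ 2 * sqn (T t v x))).
  - by move=> m; apply: measurable_funM => //; exact: measurable_funX.
  - by move=> m x; rewrite mulr_ge0 ?sqr_ge0 ?sqn_ge0.
  - move=> x; apply: cvg_near_cst; near=> m.
    rewrite /h min_l ?real_normK ?num_real//.
    by near: m; exact: nbhs_infty_ger.
  - move=> m; under eq_integral do rewrite -sqn_real -sqnM.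
    rewrite EFin_RintegralT; last by apply: L2_integrable; exact: Lh.
    by rewrite lee_fin -nrm_sqr ler_pXn2r ?nnegrE ?mulr_ge0 ?nrm_ge0.
have LD : L2 (fun x => (dot x0 x)%:C%C * T t v x).
  have mD : cmeasurable (fun x => (dot x0 x)%:C%C * T t v x).
    apply: cmeasurableM; last exact: (L2_cmeasurable LTv).
    by apply: cmeasurable_real; exact: dot_measurable.
  apply/L2P; split=> //; apply: (@ge0_integrableR_bounded _ _ _ mu _ ((N * nrm v) ^+ 2)).
  - exact: sqn_measurable.
  - by move=> x; exact: sqn_ge0.
  - by under eq_integral do rewrite sqnM sqn_real.
rewrite L2norm_nrm// lee_fin; apply: le_of_sqr; [exact: nrm_ge0|exact: mulr_ge0 N0 (nrm_ge0 _ _)|].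
rewrite nrm_sqr -lee_fin -EFin_RintegralT; last exact: L2_integrable.
by under eq_integral do rewrite sqnM sqn_real.
Unshelve. all: by end_near.
Qed.

End fixed_time.
End smoothing.

(** * Uniform constants and time factors *)

Section smoothing_bounds.
Context {R : realType} {n : nat}.
Local Notation Rn := 'cV[R]_n.
Implicit Types (x xi : Rn) (t : R).

Lemma quadratic_form_le (A : 'M[R]_n) : exists2 K : R, 0 <= K &
  forall x, dot (A *m x) x <= K * dot x x.
Proof.
exists (n%:R * mxsum A); first by rewrite mulr_ge0 ?mxsum_ge0.
move=> x; apply: le_trans (ler_norm _) _; apply: le_trans (dot_le_norm _ _) _.
rewrite -mulrA ler_wpM2l//.
apply: (@le_trans _ _ (mxsum A * `|x| ^+ 2)).
  by rewrite expr2 mulrA ler_wpM2r// norm_mulmx_le.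
by rewrite ler_wpM2l ?mxsum_ge0// sqr_norm_le_dot.
Qed.

(** The two branches agree at t = 1, so the late bound covers t = 1 as well. *)
Definition time_factor (k : nat) t : R := if t <= 1 then t ^- k.*2.+1 else 1.

Lemma time_factor_ge1 k t : 0 < t -> 1 <= time_factor k t.
Proof.
move=> t0; rewrite /time_factor; case: ifPn => // t1.
by rewrite -invr1 lef_pV2 ?posrE ?exprn_gt0// exprn_ile1// ltW.
Qed.

Lemma time_factor_late k t : 1 <= t -> time_factor k t = 1.
Proof.
move=> t1; rewrite /time_factor; case: ifPn => // t1'.
have -> : t = 1 by apply/eqP; rewrite eq_le t1 t1'.
by rewrite expr1n invr1.
Qed.

Lemma sqrt_time_factor k t : 0 < t <= 1 ->
  Num.sqrt (time_factor k t) = t `^ (- ((2 * k + 1)%:R / 2)).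
Proof.
move=> /andP[t0 t1]; rewrite /time_factor t1.
suff <- : (t `^ (- ((2 * k + 1)%:R / 2))) ^+ 2 = t ^- k.*2.+1.
  by rewrite sqrtr_sqr ger0_norm ?powR_ge0.
rewrite -powR_mulrn ?powR_ge0// -powRrM mulNr divfK ?pnatr_eq0//.
by rewrite powRN powR_mulrn ?ltW// mul2n addn1.
Qed.

Variables (S B G : 'M[R]_n) (mu : probability Rn R).
Variable T : R -> (Rn -> R[i]) -> (Rn -> R[i]).
Hypotheses (ST : S^T = S) (GT : G^T = G).
Hypothesis lyap : B *m G + G *m B^T = - (S *m S).
Hypothesis density : forall A, measurable A ->
  mu A = (\int[@lebesgue_Rn R n]_(x in A) (gauss_density G x)%:E)%E.
Hypothesis gen : semigroup_generated_by mu (OU_operator (S *m S) B) T.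
Hypothesis obs : forall x : Rn, (forall s, S *m (expmx (s *: B^T) *m x) = 0) -> x = 0.
Local Notation nrm := (nrm mu).

(** The position estimate for [x] relies on the frequency estimate for G x; both are stated together
    so that a single constant serves the two. *)
Lemma smoothing_bounds (k0 : nat) : injective_up_to S B k0 ->
  exists2 C : R, 0 < C & forall k xi v t, (k <= k0)%N ->
  (xi^T <= freq_space S B k)%MS -> L2 mu v -> 0 < t ->
  (distr_L2norm mu (dir_D xi (of_fun (T t v))) <=
    (C * enorm xi * Num.sqrt (time_factor k t) * nrm v)%:E)%E /\
  forall x, G *m x = xi ->
  (L2norm mu (fun y => (dot x y)%:C%C * T t v y)%R <=
    (C * enorm x * Num.sqrt (time_factor k t) * nrm v)%:E)%E.
Proof.
move=> inj; have [c c0 Hc] := smoothing_le ST lyap obs inj.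
have [K1 K10 HK1] := quadratic_form_le G; have [K2 K20 HK2] := quadratic_form_le (G^T *m G).
(* The squared constant of [position_estimate] is 2 <G x, x> + 4 M^2, with M^2 proportional to |G
   x|^2 times the time factor. As the time factor is at least 1, it also absorbs the first term. *)
pose c' := 2 * K1 + 4 * c * K2.
have c'0 : 0 <= c' by rewrite addr_ge0 ?mulr_ge0// ltW.
exists (Num.sqrt c + Num.sqrt c').
  by rewrite ltr_pwDl ?sqrtr_ge0// sqrtr_gt0.
move=> k xi v t kk0 xik Lv t0; have [r Hr] := approximation Lv.
have f1 := time_factor_ge1 k t0; have f0 : 0 <= time_factor k t := le_trans ler01 f1.
pose M := Num.sqrt (c * dot xi xi * time_factor k t).
have M0 : 0 <= M := sqrtr_ge0 _.
have M2 : M ^+ 2 = c * dot xi xi * time_factor k t.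
  by rewrite sqr_sqrtr// !mulr_ge0 ?dot_ge0// ltW.
have HM eta : dot xi (orbit B eta t) ^+ 2 <= M ^+ 2 * (energy B G eta 0 - energy B G eta t).
  by rewrite M2; exact: (Hc _ _ eta _ kk0 xik t0).
split.
  apply: le_trans (derivative_estimate ST GT lyap density gen (ltW t0) Lv Hr M0 HM) _.
  rewrite lee_fin ler_wpM2r ?nrm_ge0// /M !sqrtrM ?mulr_ge0 ?dot_ge0 ?(ltW c0)//.
  rewrite ler_wpM2r ?sqrtr_ge0// ler_wpM2r ?sqrtr_ge0//.
  by rewrite lerDl sqrtr_ge0.
move=> x Gx; subst xi.
apply: le_trans (position_estimate ST GT lyap density gen (ltW t0) Lv Hr M0 HM) _.
rewrite lee_fin ler_wpM2r ?nrm_ge0//.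
apply: (@le_trans _ _ (Num.sqrt (c' * dot x x * time_factor k t))); last first.
  rewrite !sqrtrM ?mulr_ge0 ?dot_ge0//.
  rewrite ler_wpM2r ?sqrtr_ge0// ler_wpM2r ?sqrtr_ge0//.
  by rewrite lerDr sqrtr_ge0.
apply: ler_wsqrtr; rewrite M2.
have A1 := HK1 x; have A2 := HK2 x.
rewrite -mulmxA dot_mulmxl trmxK in A2.
rewrite /c' -[leRHS]mulrA [leRHS]mulrDl; apply: lerD.
  rewrite -mulrA ler_wpM2l//; apply: le_trans A1 _.
  by rewrite ler_wpM2l// ler_peMr// dot_ge0.
rewrite -!mulrA ler_wpM2l// ler_wpM2l ?(ltW c0)// mulrA.
by rewrite ler_wpM2r.
Qed.

End smoothing_bounds.

Theorem corollary3p2 (R : realType) (n : nat) (Q B S : 'M[R]_n)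
    (mu : probability 'cV[R]_n R)
    (T : R -> ('cV[R]_n -> R[i]) -> ('cV[R]_n -> R[i])) :
  (0 < n)%N ->
  psd Q ->
  is_psd_sqrt Q S ->
  hypoelliptic (OU_operator Q B) ->
  invariant_measure Q B mu ->
  (forall A : set 'cV[R]_n, measurable A ->
    mu A = (\int[@lebesgue_Rn R n]_(x in A)
              (gauss_density (Q_infty Q B) x)%:E)%E) ->
  semigroup_generated_by mu (OU_operator Q B) T ->
  [/\ forall xi0 : 'cV[R]_n, (freq_index S B xi0 <= kalman_index S B)%N,
      forall x0 : 'cV[R]_n, (space_index Q S B x0 <= kalman_index S B)%N &
  exists2 C : R, 0 < C &
    forall (x0 xi0 : 'cV[R]_n) (v0 : 'cV[R]_n -> R[i]), L2 mu v0 ->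
    [/\ forall t : R, 0 < t <= 1 ->
          (distr_L2norm mu (dir_D xi0 (of_fun (T t v0))) <=
           (C * enorm xi0 * t `^ (- ((2 * freq_index S B xi0 + 1)%:R / 2)))%:E
             * L2norm mu v0)%E,
        forall t : R, 0 < t <= 1 ->
          (L2norm mu (fun x => (dot x0 x)%:C%C * T t v0 x)%R <=
           (C * enorm x0 * t `^ (- ((2 * space_index Q S B x0 + 1)%:R / 2)))%:E
             * L2norm mu v0)%E,
        forall t : R, 1 <= t ->
          (distr_L2norm mu (dir_D xi0 (of_fun (T t v0))) <=
           (C * enorm xi0)%:E * L2norm mu v0)%E &
        forall t : R, 1 <= t ->
          (L2norm mu (fun x => (dot x0 x)%:C%C * T t v0 x)%R <=
           (C * enorm x0)%:E * L2norm mu v0)%E]].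
Proof.
move=> n0 _ [[ST _] <-] _ _ density gen {Q}.
have GT := Q_infty_sym B ST; have posdef := gauss_posdef GT density.
have uG := gauss_unitmx density.
have lyap := Q_infty_lyapunov ST posdef.
have obs := Q_infty_observable ST posdef.
have inj := kalman_indexP n0 ST obs.
have ffull := freq_space_full ST inj.
(* The frequency filtration exhausts R^n at the Kalman index, and the invertible matrix [G]
   transports this to the space filtration, so both searches for an index succeed. *)
have sfull : row_full (space_space (S *m S) S B (kalman_index S B)).
  have [_ H] := space_freq (kalman_index S B) ST uG GT lyap.
  rewrite -sub1mx; apply: submx_trans H; rewrite -[1%:M](mulmxV uG).
  by apply: submxMr; rewrite submx_full.
split=> [xi|x|].
- exact: (proj1 (freq_indexP xi n0 ffull)).
- exact: (proj1 (space_indexP x n0 sfull)).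
have [C C0 HC] := smoothing_bounds ST GT lyap density gen obs inj.
exists C => // x0 xi0 v0 Lv.
have [fk fin] := freq_indexP xi0 n0 ffull; have [sk sin] := space_indexP x0 n0 sfull.
(* [G] maps x0 into the frequency space of the same order, which converts the space index of x0 into
   an admissible frequency order. *)
have gin : ((Q_infty (S *m S) B *m x0)^T <= freq_space S B (space_index (S *m S) S B x0))%MS.
  have [H _] := space_freq (space_index (S *m S) S B x0) ST uG GT lyap.
  by rewrite trmx_mul GT; apply: submx_trans H; exact: submxMr.
rewrite L2norm_nrm//; split=> t Ht.
- have /andP[t0 _] := Ht; rewrite -sqrt_time_factor// -EFinM.
  exact: (proj1 (HC _ _ _ _ fk fin Lv t0)).
- have /andP[t0 _] := Ht; rewrite -sqrt_time_factor// -EFinM.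
  exact: (proj2 (HC _ _ _ _ sk gin Lv t0) x0 erefl).
- have [H _] := HC _ _ _ _ fk fin Lv (lt_le_trans ltr01 Ht).
  by move: H; rewrite time_factor_late// sqrtr1 mulr1.
- have [_ /(_ x0 erefl) H] := HC _ _ _ _ sk gin Lv (lt_le_trans ltr01 Ht).
  by move: H; rewrite time_factor_late// sqrtr1 mulr1.
Qed.
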